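(* Let $(Q,\tau)$ be a Dynkin $\imath$quiver, with $\mathbb I=Q_0$ and fixed set $\mathbb I_\tau$ of representatives of $\tau$-orbits. Let $\mathrm{Br}(W_\tau)=\langle t_i\mid i\in\mathbb I_\tau\rangle$ be the braid group of the restricted Weyl group $W_\tau$. Then there exists a group homomorphism $\mathrm{Br}(W_\tau)\to\mathrm{Aut}(\widetilde{\mathbf U}^\imath)$ with $t_i\mapsto \mathrm T_i$ for all $i\in\mathbb I_\tau$, and, for every parameter $\boldsymbol\varsigma=(\varsigma_i)_{i\in\mathbb I}\in(\mathbb Q(v)^\times)^{\mathbb I}$ with $\varsigma_i=\varsigma_{\tau i}$ for all $i$, there exists a group homomorphism $\mathrm{Br}(W_\tau)\to\mathrm{Aut}({}_{\mathbb F}\mathbf U^\imath)$ with $t_i\mapsto\mathrm T_i$ for all $i\in\mathbb I_\tau$, where ${}_{\mathbb F}\mathbf U^\imath=\mathbb F\otimes_{\mathbb Q(v)}\mathbf U^\imath_{\boldsymbol\varsigma}$.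
   Context: A Dynkin $\imath$quiver $(Q,\tau)$ is a quiver $Q$ whose underlying graph is a Dynkin diagram of type ADE, with a quiver automorphism $\tau$, $\tau^2=\mathrm{Id}$. Labelling and $\mathbb I_\tau$: if $\tau=\mathrm{Id}$, $\mathbb I_\tau=\mathbb I$. If $\tau\neq\mathrm{Id}$: type $A_{2r+1}$ has vertices $-r,\dots,r$, consecutive integers joined, $\tau(j)=-j$, $\mathbb I_\tau=\{0,1,\dots,r\}$; type $D_n$ has edges $1-2-\cdots-(n-2)$, $(n-2)-(n-1)$, $(n-2)-n$, $\tau$ swaps $n-1,n$, $\mathbb I_\tau=\{1,\dots,n-1\}$; type $E_6$ has edges $1-2,2-3,3-4,3-5,5-6$, $\tau$ swaps $1\leftrightarrow6$, $2\leftrightarrow5$ and fixes $3,4$, $\mathbb I_\tau=\{1,2,3,4\}$. $C=(c_{ij})$ is the Cartan matrix; $s_i(\alpha_j)=\alpha_j-c_{ij}\alpha_i$ on $\mathbb Z^{\mathbb I}=\bigoplus\mathbb Z\alpha_i$; $W=\langle s_i\rangle$. Restricted Weyl group: $W_\tau=\{w\in W\mid\tau w=w\tau\}$, a Coxeter group with simple reflections $\mathbf s_i$ ($i\in\mathbb I_\tau$), $\mathbf s_i=s_i$ if $\tau i=i$, $\mathbf s_i=s_is_{\tau i}$ if $\tau i\neq i$. $\mathrm{Br}(W_\tau)$ is generated by $t_i$ ($i\in\mathbb I_\tau$) with relations $t_it_jt_i\cdots=t_jt_it_j\cdots$ ($m_{ij}$ factors on each side, $m_{ij}$ the order of $\mathbf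 s_i\mathbf s_j$, $i\ne j$). $\widetilde{\mathbf U}$: $\mathbb Q(v)$-algebra generated by $E_i,F_i,\widetilde K_i^{\pm1},\widetilde K_i'^{\pm1}$ ($i\in\mathbb I$), all $\widetilde K_i,\widetilde K'_j$ commuting, $[E_i,F_j]=\delta_{ij}\frac{\widetilde K_i-\widetilde K_i'}{v-v^{-1}}$, $\widetilde K_iE_j=v^{c_{ij}}E_j\widetilde K_i$, $\widetilde K_iF_j=v^{-c_{ij}}F_j\widetilde K_i$, $\widetilde K_i'E_j=v^{-c_{ij}}E_j\widetilde K_i'$, $\widetilde K_i'F_j=v^{c_{ij}}F_j\widetilde K_i'$, and the quantum Serre relations for the $E_i$ and for the $F_i$ ($X_iX_j=X_jX_i$ if $c_{ij}=0$; $X_i^2X_j-(v+v^{-1})X_iX_jX_i+X_jX_i^2=0$ if $c_{ij}=-1$). $\mathbf U$: the same with $\widetilde K_i,\widetilde K_i'$ replaced by $K_i,K_i^{-1}$. Universal $\imath$quantum group $\widetilde{\mathbf U}^\imath\subset\widetilde{\mathbf U}$: subalgebra generated by $B_i=F_i+E_{\tau i}\widetilde K_i'$ and $\widetilde k_i^{\pm1}$, $\widetilde k_i=\widetilde K_i\widetilde K'_{\tau i}$ ($i\in\mathbb I$). $\imath$quantum group $\mathbf U^\imath=\mathbf U^\imath_{\boldsymbol\varsigma}\subset\mathbf U$: subalgebra generated by $B_i=F_i+\varsigma_iE_{\tau i}K_i^{-1}$ ($i\in\mathbb I$) and $k_j^{\pm1}$, $k_j=K_jK_{\tau j}^{-1}$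 ($j\in\mathbb I_\tau$). $\mathbf U^\imath_{\boldsymbol\varsigma}$ is the quotient of $\widetilde{\mathbf U}^\imath$ by the ideal generated by $\widetilde k_i-\varsigma_i$ ($\tau i=i$) and $\widetilde k_i\widetilde k_{\tau i}-\varsigma_i\varsigma_{\tau i}$ ($\tau i\ne i$), with $B_i\mapsto B_i$, $\widetilde k_j\mapsto\varsigma_jk_j$. Automorphisms $\mathrm T_i$ of $\widetilde{\mathbf U}^\imath$ ($i\in\mathbb I_\tau$; obtained in the paper from reflection functors on $\imath$Hall algebras): write $[x,y]_v=xy-vyx$, $\widetilde k_\alpha=\prod\widetilde k_i^{m_i}$ and $b_\alpha=\prod b_i^{m_i}$ for $\alpha=\sum m_i\alpha_i$, with $b_i=-v^2$ if $\tau i=i$ and $b_i=1$ if $\tau i\neq i$. $\mathrm T_i$ is the $\mathbb Q(v)$-algebra automorphism with $\mathrm T_i(\widetilde k_\alpha)=\frac{b_{\mathbf s_i\alpha}}{b_\alpha}\widetilde k_{\mathbf s_i\alpha}$ for $\alpha\in\mathbb Z^{\mathbb I}$, and on $B_j$: - if $\tau i=i$: $\mathrm T_i(B_j)=B_jB_i-vB_iB_j$ if $c_{ij}=-1$; $\mathrm T_i(B_i)=(-v^2\widetilde k_i)^{-1}B_i$; $\mathrm T_i(B_j)=B_j$ if $c_{ij}=0$; - if $\tau i\ne i$: $\mathrm T_i(B_j)=B_jB_i-vB_iB_j$ if $c_{ij}=-1,c_{\tau i,j}=0$; $=B_{\tau i}B_j-v^{-1}B_jB_{\tau i}$ if $c_{ij}=0,c_{\tau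 i,j}=-1$; $=-v^{-1}[[B_j,B_i]_v,B_{\tau i}]_v+B_j\widetilde k_i$ if $c_{ij}=c_{\tau i,j}=-1$; $=-\widetilde k_i^{-1}B_{\tau i}$ if $j=i$; $=-v^2\widetilde k_{\tau i}^{-1}B_i$ if $j=\tau i$; $=B_j$ otherwise. Distinguished parameter $\boldsymbol\varsigma_\diamond$: $\varsigma_{\diamond,i}=-v^{-2}$ if $\tau i=i$, $\varsigma_{\diamond,i}=1$ if $\tau i\neq i$. $\mathrm T_i$ on $\widetilde{\mathbf U}^\imath$ descends to an automorphism $\mathrm T_{\diamond,i}$ of $\mathbf U^\imath_{\boldsymbol\varsigma_\diamond}$. For general $\boldsymbol\varsigma$ put $a_i=\sqrt{\varsigma_{\diamond,i}/\varsigma_i}$ (with $a_i=a_{\tau i}$), $\mathbb F=\mathbb Q(v)(a_i\mid i\in\mathbb I)$, and let $\phi_{\mathbf u}:{}_{\mathbb F}\mathbf U^\imath_{\boldsymbol\varsigma_\diamond}\to{}_{\mathbb F}\mathbf U^\imath_{\boldsymbol\varsigma}$ be the $\mathbb F$-algebra isomorphism $B_i\mapsto a_iB_i$, $k_i\mapsto k_i$. On ${}_{\mathbb F}\mathbf U^\imath$, $\mathrm T_i:=\phi_{\mathbf u}\mathrm T_{\diamond,i}\phi_{\mathbf u}^{-1}$. *)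

(* Defs.v *)
From HB Require Import structures.
From mathcomp Require Import all_boot all_order all_algebra all_field.
From mathcomp Require Import boolp.

Set Implicit Arguments.
Unset Strict Implicit.
Unset Printing Implicit Defensive.

Import GRing.Theory.
Local Open Scope ring_scope.
Local Open Scope quotient_scope.

Definition is_alg_hom (K : pzRingType) (A B : algType K) (f : A -> B) :=
  [/\ linear f, f 1 = 1 & {morph f : x y / x * y}].

Section AlgIso.
Variables (K : pzRingType) (A B : algType K).

Record algIso := AlgIso {
  iso_fun :> A -> B;
  iso_inv : B -> A;
  iso_hom : is_alg_hom iso_fun;
  iso_funK : cancel iso_fun iso_inv;
  iso_invK : cancel iso_inv iso_fun
}.

Lemma algIso_eq (f g : algIso) : f =1 g -> f = g.
Proof.
case: f g => [f f' hf fK f'K] [g g' hg gK g'K] /= fg.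
have {}fg : f = g by apply/funext.
subst g; have : f' = g' by apply/funext => y; rewrite -{1}[y]g'K fK.
move=> f'g'; subst g'.
by congr AlgIso; apply: Prop_irrelevance.
Qed.

End AlgIso.

Definition algAut (K : pzRingType) (A : algType K) := algIso A A.

Section AlgAutGroup.
Variables (K : pzRingType) (A : algType K).
Implicit Types f g : algAut A.

Lemma alg_hom_id : is_alg_hom (@id A).
Proof. by []. Qed.

Lemma alg_hom_comp f g : is_alg_hom (f \o g).
Proof.
case: (iso_hom f) (iso_hom g) => [fl f1 fM] [gl g1 gM].
by split=> [k x y||x y]; rewrite /= ?gl ?g1 ?gM ?fl ?f1 ?fM.
Qed.

Lemma alg_hom_inv f : is_alg_hom (iso_inv f).
Proof.
case: (iso_hom f) => [fl f1 fM].
by split=> [k x y||x y]; apply: (can_inj (iso_funK f));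
  rewrite ?fl ?f1 ?fM !iso_invK.
Qed.

Definition aut_one : algAut A :=
  AlgIso alg_hom_id (fun _ => erefl) (fun _ => erefl).

Definition aut_mul f g : algAut A :=
  AlgIso (alg_hom_comp f g)
    (can_comp (iso_funK f) (iso_funK g)) (can_comp (iso_invK g) (iso_invK f)).

Definition aut_inv f : algAut A :=
  AlgIso (alg_hom_inv f) (iso_invK f) (iso_funK f).

Lemma aut_mulA : associative aut_mul.
Proof. by move=> f g h; apply: algIso_eq. Qed.

Lemma aut_mul1 : left_id aut_one aut_mul.
Proof. by move=> f; apply: algIso_eq. Qed.

Lemma aut_1mul : right_id aut_one aut_mul.
Proof. by move=> f; apply: algIso_eq. Qed.

Lemma aut_mulV : left_inverse aut_one aut_inv aut_mul.
Proof. by move=> f; apply: algIso_eq => x /=; rewrite iso_funK. Qed.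

Lemma aut_Vmul : right_inverse aut_one aut_inv aut_mul.
Proof. by move=> f; apply: algIso_eq => x /=; rewrite iso_invK. Qed.

HB.instance Definition _ := gen_eqMixin (algAut A).
HB.instance Definition _ := gen_choiceMixin (algAut A).
HB.instance Definition _ := isGroup.Build (algAut A)
  aut_mulA aut_mul1 aut_1mul aut_mulV aut_Vmul.

End AlgAutGroup.

Section GroupPresentation.
Variable X : Type.

Inductive gterm :=
| GOne
| GGen of X
| GMul of gterm & gterm
| GInv of gterm.

HB.instance Definition _ := gen_eqMixin gterm.
HB.instance Definition _ := gen_choiceMixin gterm.

Variable R : gterm -> gterm -> Prop.

(* The least congruence that contains R and the group axioms. *)
Inductive gcong : gterm -> gterm -> Prop :=
| gcong_rel s t : R s t -> gcong s t
| gcong_refl s : gcong s s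
| gcong_sym s t : gcong s t -> gcong t s
| gcong_trans s t u : gcong s t -> gcong t u -> gcong s u
| gcong_mul s s' t t' : gcong s s' -> gcong t t' -> gcong (GMul s t) (GMul s' t')
| gcong_inv s t : gcong s t -> gcong (GInv s) (GInv t)
| gcong_mulA s t u : gcong (GMul s (GMul t u)) (GMul (GMul s t) u)
| gcong_1mul s : gcong (GMul GOne s) s
| gcong_mul1 s : gcong (GMul s GOne) s
| gcong_Vmul s : gcong (GMul (GInv s) s) GOne
| gcong_mulV s : gcong (GMul s (GInv s)) GOne.

Definition gcongb s t := `[< gcong s t >].

Lemma gcongb_refl : reflexive gcongb.
Proof. by move=> s; apply/asboolP/gcong_refl. Qed.

Lemma gcongb_sym : symmetric gcongb.
Proof. by move=> s t; apply/asboolP/asboolP; apply: gcong_sym. Qed.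

Lemma gcongb_trans : transitive gcongb.
Proof.
by move=> t s u /asboolP st /asboolP tu; apply/asboolP/(gcong_trans st).
Qed.

Canonical gcong_equiv := EquivRel gcongb gcongb_refl gcongb_sym gcongb_trans.

(* The group <X | s = t for R s t>. *)
Definition presGroup := {eq_quot gcong_equiv}.

HB.instance Definition _ := Choice.on presGroup.

Definition pres_gen (x : X) : presGroup := \pi_presGroup (GGen x).

Lemma gpiP s t : \pi_presGroup s = \pi_presGroup t <-> gcong s t.
Proof. by split=> [/eqmodP/asboolP|st]; last apply/eqmodP/asboolP. Qed.

Definition pres_one : presGroup := \pi_presGroup GOne.
Definition pres_mul (x y : presGroup) : presGroup := \pi_presGroup (GMul (repr x) (repr y)).
Definition pres_inv (x : presGroup) : presGroup := \pi_presGroup (GInv (repr x)).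

Lemma gcong_repr s : gcong (repr (\pi_presGroup s)) s.
Proof. by apply/gpiP; rewrite reprK. Qed.

Lemma pres_mulE s t : pres_mul (\pi_presGroup s) (\pi_presGroup t) = \pi_presGroup (GMul s t).
Proof. by apply/gpiP/gcong_mul; apply: gcong_repr. Qed.

Lemma pres_invE s : pres_inv (\pi_presGroup s) = \pi_presGroup (GInv s).
Proof. by apply/gpiP/gcong_inv/gcong_repr. Qed.

Lemma pres_mulA : associative pres_mul.
Proof.
elim/quotW=> s; elim/quotW=> t; elim/quotW=> u.
rewrite (pres_mulE t u) (pres_mulE s t) !(pres_mulE s, pres_mulE _ u).
by apply/gpiP; apply: gcong_mulA.
Qed.

Lemma pres_1mul : left_id pres_one pres_mul.
Proof. by elim/quotW=> s; rewrite pres_mulE; apply/gpiP; apply: gcong_1mul. Qed.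

Lemma pres_mul1 : right_id pres_one pres_mul.
Proof. by elim/quotW=> s; rewrite pres_mulE; apply/gpiP; apply: gcong_mul1. Qed.

Lemma pres_Vmul : left_inverse pres_one pres_inv pres_mul.
Proof. by elim/quotW=> s; rewrite (pres_invE s) pres_mulE; apply/gpiP; apply: gcong_Vmul. Qed.

Lemma pres_mulV : right_inverse pres_one pres_inv pres_mul.
Proof. by elim/quotW=> s; rewrite (pres_invE s) pres_mulE; apply/gpiP; apply: gcong_mulV. Qed.

HB.instance Definition _ := isGroup.Build presGroup
  pres_mulA pres_1mul pres_mul1 pres_Vmul pres_mulV.

End GroupPresentation.

Declare Scope aterm_scope.
Delimit Scope aterm_scope with AT.

Section AlgebraPresentation.
Variables (K : comNzRingType) (X : Type).

Inductive aterm :=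
| AZero
| AOne
| AGen of X
| AAdd of aterm & aterm
| AMul of aterm & aterm
| AScale of K & aterm.

HB.instance Definition _ := gen_eqMixin aterm.
HB.instance Definition _ := gen_choiceMixin aterm.

Definition AOpp s := AScale (-1) s.

Section Congruence.
Variable R : aterm -> aterm -> Prop.

(* The least congruence that contains R and the axioms of unital associative
   K-algebras. *)
Inductive acong : aterm -> aterm -> Prop :=
| acong_rel s t : R s t -> acong s t
| acong_refl s : acong s s
| acong_sym s t : acong s t -> acong t s
| acong_trans s t u : acong s t -> acong t u -> acong s u
| acong_add s s' t t' : acong s s' -> acong t t' -> acong (AAdd s t) (AAdd s' t')
| acong_mul s s' t t' : acong s s' -> acong t t' -> acong (AMul s t) (AMul s' t')
| acong_scale k s t : acong s t -> acong (AScale k s) (AScale k t)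
| acong_addA s t u : acong (AAdd s (AAdd t u)) (AAdd (AAdd s t) u)
| acong_addC s t : acong (AAdd s t) (AAdd t s)
| acong_0add s : acong (AAdd AZero s) s
| acong_Nadd s : acong (AAdd (AOpp s) s) AZero
| acong_mulA s t u : acong (AMul s (AMul t u)) (AMul (AMul s t) u)
| acong_1mul s : acong (AMul AOne s) s
| acong_mul1 s : acong (AMul s AOne) s
| acong_mulDl s t u : acong (AMul (AAdd s t) u) (AAdd (AMul s u) (AMul t u))
| acong_mulDr s t u : acong (AMul s (AAdd t u)) (AAdd (AMul s t) (AMul s u))
| acong_scaleA k l s : acong (AScale k (AScale l s)) (AScale (k * l) s)
| acong_1scale s : acong (AScale 1 s) s
| acong_scaleDr k s t : acong (AScale k (AAdd s t)) (AAdd (AScale k s) (AScale k t))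
| acong_scaleDl s k l : acong (AScale (k + l) s) (AAdd (AScale k s) (AScale l s))
| acong_scaleAl k s t : acong (AScale k (AMul s t)) (AMul (AScale k s) t)
| acong_scaleAr k s t : acong (AScale k (AMul s t)) (AMul s (AScale k t)).

End Congruence.

Fixpoint aeval (A : algType K) (f : X -> A) (s : aterm) : A :=
  match s with
  | AZero => 0
  | AOne => 1
  | AGen x => f x
  | AAdd s t => aeval f s + aeval f t
  | AMul s t => aeval f s * aeval f t
  | AScale k s => k *: aeval f s
  end.

Lemma acong_aeval (R : aterm -> aterm -> Prop) (A : algType K) (f : X -> A) :
  (forall s t, R s t -> aeval f s = aeval f t) ->
  forall s t, acong R s t -> aeval f s = aeval f t.
Proof.
move=> fR s t; elim=> //=.
- by move=> ? ? ? _ -> _ ->.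
- by move=> ? ? ? ? _ -> _ ->.
- by move=> ? ? ? ? _ -> _ ->.
- by move=> ? ? ? _ ->.
- by move=> *; rewrite addrA.
- by move=> *; rewrite addrC.
- by move=> *; rewrite add0r.
- by move=> *; rewrite scaleN1r addNr.
- by move=> *; rewrite mulrA.
- by move=> *; rewrite mul1r.
- by move=> *; rewrite mulr1.
- by move=> *; rewrite mulrDl.
- by move=> *; rewrite mulrDr.
- by move=> *; rewrite scalerA.
- by move=> *; rewrite scale1r.
- by move=> *; rewrite scalerDr.
- by move=> *; rewrite scalerDl.
- by move=> *; rewrite scalerAl.
- by move=> *; rewrite scalerAr.
Qed.

(* MathComp's [algType] excludes the zero ring, so a presentation carries a
   proof that it does not collapse. *)
Record presentation := Presentation {
  pres_rel : aterm -> aterm -> Prop;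
  pres_nontrivial : ~ acong pres_rel AOne AZero
}.

Variable P : presentation.
Local Notation pcong := (acong (pres_rel P)).

Definition acongb s t := `[< pcong s t >].

Lemma acongb_refl : reflexive acongb.
Proof. by move=> s; apply/asboolP/acong_refl. Qed.

Lemma acongb_sym : symmetric acongb.
Proof. by move=> s t; apply/asboolP/asboolP; apply: acong_sym. Qed.

Lemma acongb_trans : transitive acongb.
Proof.
by move=> t s u /asboolP st /asboolP tu; apply/asboolP/(acong_trans st).
Qed.

Canonical acong_equiv := EquivRel acongb acongb_refl acongb_sym acongb_trans.

(* The K-algebra K<X | s = t for pres_rel P s t>. *)
Definition presAlg := {eq_quot acong_equiv}.

HB.instance Definition _ := Choice.on presAlg.

Definition alg_gen (x : X) : presAlg := \pi_presAlg (AGen x).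

Lemma apiP s t : \pi_presAlg s = \pi_presAlg t <-> pcong s t.
Proof. by split=> [/eqmodP/asboolP|st]; last apply/eqmodP/asboolP. Qed.

Definition pa_zero : presAlg := \pi_presAlg AZero.
Definition pa_one : presAlg := \pi_presAlg AOne.
Definition pa_add (x y : presAlg) : presAlg := \pi_presAlg (AAdd (repr x) (repr y)).
Definition pa_mul (x y : presAlg) : presAlg := \pi_presAlg (AMul (repr x) (repr y)).
Definition pa_scale (k : K) (x : presAlg) : presAlg := \pi_presAlg (AScale k (repr x)).
Definition pa_opp : presAlg -> presAlg := pa_scale (-1).

Lemma acong_repr s : pcong (repr (\pi_presAlg s)) s.
Proof. by apply/apiP; rewrite reprK. Qed.

Lemma pa_addE s t : pa_add (\pi_presAlg s) (\pi_presAlg t) = \pi_presAlg (AAdd s t).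
Proof. by apply/apiP/acong_add; apply: acong_repr. Qed.

Lemma pa_mulE s t : pa_mul (\pi_presAlg s) (\pi_presAlg t) = \pi_presAlg (AMul s t).
Proof. by apply/apiP/acong_mul; apply: acong_repr. Qed.

Lemma pa_scaleE k s : pa_scale k (\pi_presAlg s) = \pi_presAlg (AScale k s).
Proof. by apply/apiP/acong_scale/acong_repr. Qed.

Lemma pa_addA : associative pa_add.
Proof.
elim/quotW=> s; elim/quotW=> t; elim/quotW=> u.
rewrite (pa_addE t u) (pa_addE s t) !(pa_addE s, pa_addE _ u).
by apply/apiP; apply: acong_addA.
Qed.

Lemma pa_addC : commutative pa_add.
Proof.
by elim/quotW=> s; elim/quotW=> t; rewrite (pa_addE s t) (pa_addE t s); apply/apiP; apply: acong_addC.
Qed.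

Lemma pa_add0 : left_id pa_zero pa_add.
Proof. by elim/quotW=> s; rewrite pa_addE; apply/apiP; apply: acong_0add. Qed.

Lemma pa_addN : left_inverse pa_zero pa_opp pa_add.
Proof.
by elim/quotW=> s; rewrite /pa_opp (pa_scaleE _ s) pa_addE; apply/apiP; apply: acong_Nadd.
Qed.

HB.instance Definition _ :=
  GRing.isZmodule.Build presAlg pa_addA pa_addC pa_add0 pa_addN.

Lemma pa_mulA : associative pa_mul.
Proof.
elim/quotW=> s; elim/quotW=> t; elim/quotW=> u.
rewrite (pa_mulE t u) (pa_mulE s t) !(pa_mulE s, pa_mulE _ u).
by apply/apiP; apply: acong_mulA.
Qed.

Lemma pa_1mul : left_id pa_one pa_mul.
Proof. by elim/quotW=> s; rewrite pa_mulE; apply/apiP; apply: acong_1mul. Qed.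

Lemma pa_mul1 : right_id pa_one pa_mul.
Proof. by elim/quotW=> s; rewrite pa_mulE; apply/apiP; apply: acong_mul1. Qed.

Lemma pa_mulDl : left_distributive pa_mul +%R.
Proof.
elim/quotW=> s; elim/quotW=> t; elim/quotW=> u.
rewrite /GRing.add /= (pa_addE s t) (pa_mulE s u) (pa_mulE t u).
by rewrite (pa_mulE _ u) (pa_addE (AMul s u)); apply/apiP; apply: acong_mulDl.
Qed.

Lemma pa_mulDr : right_distributive pa_mul +%R.
Proof.
elim/quotW=> s; elim/quotW=> t; elim/quotW=> u.
rewrite /GRing.add /= (pa_addE t u) (pa_mulE s t) (pa_mulE s u).
by rewrite (pa_mulE s) (pa_addE (AMul s t)); apply/apiP; apply: acong_mulDr.
Qed.

Lemma pa_one_neq0 : pa_one != 0.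
Proof. by apply/eqP => /apiP; apply: pres_nontrivial. Qed.

HB.instance Definition _ := GRing.Zmodule_isNzRing.Build presAlg
  pa_mulA pa_1mul pa_mul1 pa_mulDl pa_mulDr pa_one_neq0.

Lemma pa_scaleA (k l : K) x : pa_scale k (pa_scale l x) = pa_scale (k * l) x.
Proof. by elim/quotW: x => s; rewrite (pa_scaleE l) !pa_scaleE; apply/apiP; apply: acong_scaleA. Qed.

Lemma pa_1scale : left_id 1 pa_scale.
Proof. by elim/quotW=> s; rewrite pa_scaleE; apply/apiP; apply: acong_1scale. Qed.

Lemma pa_scaleDr : right_distributive pa_scale +%R.
Proof.
move=> k; elim/quotW=> s; elim/quotW=> t.
rewrite /GRing.add /= (pa_addE s t) (pa_scaleE k s) (pa_scaleE k t).
by rewrite pa_scaleE (pa_addE (AScale k s)); apply/apiP; apply: acong_scaleDr.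
Qed.

Lemma pa_scaleDl x : {morph pa_scale^~ x : k l / k + l}.
Proof.
move=> k l; elim/quotW: x => s.
rewrite [RHS]/GRing.add /= (pa_scaleE k s) (pa_scaleE l s) pa_scaleE.
by rewrite (pa_addE (AScale k s)); apply/apiP; apply: acong_scaleDl.
Qed.

HB.instance Definition _ := GRing.Zmodule_isLmodule.Build K presAlg
  pa_scaleA pa_1scale pa_scaleDr pa_scaleDl.

Lemma pa_scaleAl (k : K) (x y : presAlg) : k *: (x * y) = (k *: x) * y.
Proof.
elim/quotW: x => s; elim/quotW: y => t.
rewrite /GRing.scale /GRing.mul /= (pa_mulE s t) (pa_scaleE k (AMul s t)).
by rewrite (pa_scaleE k s) (pa_mulE (AScale k s)); apply/apiP; apply: acong_scaleAl.
Qed.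

Lemma pa_scaleAr (k : K) (x y : presAlg) : k *: (x * y) = x * (k *: y).
Proof.
elim/quotW: x => s; elim/quotW: y => t.
rewrite /GRing.scale /GRing.mul /= (pa_mulE s t) (pa_scaleE k (AMul s t)).
by rewrite (pa_scaleE k t) (pa_mulE s (AScale k t)); apply/apiP; apply: acong_scaleAr.
Qed.

HB.instance Definition _ := GRing.Lmodule_isLalgebra.Build K presAlg pa_scaleAl.
HB.instance Definition _ := GRing.Lalgebra_isAlgebra.Build K presAlg pa_scaleAr.

End AlgebraPresentation.

Arguments AZero {K X}.
Arguments AOne {K X}.
Arguments AGen {K X} x.
Bind Scope aterm_scope with aterm.
Notation "0" := AZero : aterm_scope.
Notation "1" := AOne : aterm_scope.
Notation "s + t" := (AAdd s t) : aterm_scope.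
Notation "s - t" := (AAdd s (AOpp t)) : aterm_scope.
Notation "s * t" := (AMul s t) : aterm_scope.
Notation "k *: s" := (AScale k%R s) : aterm_scope.

Section Subalgebra.
Variables (K : pzRingType) (A : algType K) (S : A -> Prop).

Inductive in_subalg : A -> Prop :=
| subalg_gen x : S x -> in_subalg x
| subalg_1 : in_subalg 1
| subalg_add x y : in_subalg x -> in_subalg y -> in_subalg (x + y)
| subalg_mul x y : in_subalg x -> in_subalg y -> in_subalg (x * y)
| subalg_scale (k : K) x : in_subalg x -> in_subalg (k *: x).

Definition subalg_pred : {pred A} := fun x => `[< in_subalg x >].

Lemma subalg_subring_closed : subring_closed subalg_pred.
Proof.
split=> [|x y /asboolP Sx /asboolP Sy|x y /asboolP Sx /asboolP Sy].
- exact/asboolP/subalg_1.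
- by apply/asboolP/subalg_add; rewrite // -scaleN1r; apply: subalg_scale.
- exact/asboolP/subalg_mul.
Qed.

Lemma subalg_scaler_closed : GRing.scaler_closed subalg_pred.
Proof. by move=> k x /asboolP Sx; apply/asboolP/subalg_scale. Qed.

HB.instance Definition _ :=
  GRing.isSubringClosed.Build A subalg_pred subalg_subring_closed.
HB.instance Definition _ :=
  GRing.isScaleClosed.Build K A subalg_pred subalg_scaler_closed.

(* The subalgebra of A generated by S, as an algebra in its own right. *)
Record subalg := SubAlg { subalg_val :> A; subalg_valP : subalg_val \in subalg_pred }.

HB.instance Definition _ := [isSub for subalg_val].
HB.instance Definition _ := [Choice of subalg by <:].
HB.instance Definition _ := [SubChoice_isSubNzRing of subalg by <:].
HB.instance Definition _ := [SubZmodule_isSubLmodule of subalg by <:].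
HB.instance Definition _ := [SubNzRing_SubLmodule_isSubLalgebra of subalg by <:].
HB.instance Definition _ := [SubLalgebra_isSubAlgebra of subalg by <:].

Definition subalg_of_gen x (Sx : S x) : subalg :=
  SubAlg (introT (asboolP _) (subalg_gen Sx)).

End Subalgebra.

Section ExtensionOfScalars.
Import VectorInternalTheory.
Variables (K : fieldType) (F : fieldExtType K) (A : algType K).

Inductive ext_rel : aterm F A -> aterm F A -> Prop :=
| ext_1 : ext_rel (AGen 1) 1%AT
| ext_mul (x y : A) : ext_rel (AGen (x * y)) (AGen x * AGen y)%AT
| ext_add (x y : A) : ext_rel (AGen (x + y)) (AGen x + AGen y)%AT
| ext_scale (k : K) (x : A) : ext_rel (AGen (k *: x)) (k%:A *: AGen x)%AT.

Let d := dim F.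
Let r2v' : 'rV[K]_d -> F := @r2v K F.
Let mulF (a : F) (u : 'rV[K]_d) : 'rV[K]_d := v2r (a * r2v' u).
Let reg (a : F) : 'M[K]_d := lin1_mx (mulF a).

Let reg_act a u : u *m reg a = v2r (a * r2v' u).
Proof.
have lin : linear (mulF a).
  by move=> k x y; rewrite /mulF /r2v' !linearP mulrDr -scalerAr linearP.
pose M := GRing.isLinear.Build _ _ _ _ (mulF a) lin.
pose G : {linear 'rV[K]_d -> 'rV[K]_d} := HB.pack (mulF a) M.
exact: (mul_rV_lin1 G).
Qed.

Let reg_eq a (M : 'M[K]_d) : (forall u, u *m M = v2r (a * r2v' u)) -> reg a = M.
Proof. by move=> aM; apply/row_matrixP => i; rewrite !rowE reg_act aM. Qed.

Let regM a b : reg (a * b) = reg a *m reg b.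
Proof.
by apply: reg_eq => u; rewrite mulmxA !reg_act /r2v' v2rK mulrCA mulrA.
Qed.

Let regD a b : reg (a + b) = reg a + reg b.
Proof. by apply: reg_eq => u; rewrite mulmxDr !reg_act mulrDl linearD. Qed.

Let reg_scalar (k : K) : reg k%:A = k%:M.
Proof.
by apply: reg_eq => u; rewrite mul_mx_scalar -scalerAl mul1r linearZ /= /r2v' r2vK.
Qed.

Let regA (a : F) : 'M[A]_d := map_mx (in_alg A) (reg a).

Let in_algC (k : K) (x : A) : k%:A * x = x * k%:A.
Proof. by rewrite -scalerAl mul1r -scalerAr mulr1. Qed.

Let regA_scalar a x : regA a *m x%:M = x%:M *m regA a.
Proof.
apply/matrixP => i j; rewrite mul_scalar_mx !mxE (bigD1 j) //= big1.
  by rewrite !mxE eqxx addr0 in_algC.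
by move=> l lj; rewrite !mxE (negPf lj) mulr0n mulr0.
Qed.

Let regAC a b : regA a *m regA b = regA b *m regA a.
Proof. by rewrite -!map_mxM -!regM mulrC. Qed.

Fixpoint ext_model (s : aterm F A) : 'M[A]_d :=
  match s with
  | AZero => 0
  | AOne => 1%:M
  | AGen x => x%:M
  | AAdd s t => ext_model s + ext_model t
  | AMul s t => ext_model s *m ext_model t
  | AScale a s => regA a *m ext_model s
  end.

Let ext_modelC a s : regA a *m ext_model s = ext_model s *m regA a.
Proof.
elim: s => [||x|s IHs t IHt|s IHs t IHt|b s IHs] //=.
- by rewrite mulmx0 mul0mx.
- by rewrite mulmxDr mulmxDl IHs IHt.
- by rewrite mulmxA IHs -mulmxA IHt mulmxA.
- by rewrite mulmxA regAC -mulmxA IHs mulmxA.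
Qed.

Let regA_in_alg (k : K) : regA k%:A = k%:A%:M.
Proof. by rewrite /regA reg_scalar map_scalar_mx. Qed.

Let regA1 : regA 1 = 1%:M.
Proof. by have:= regA_in_alg 1; rewrite !scale1r. Qed.

Let regAM a b : regA (a * b) = regA a *m regA b.
Proof. by rewrite /regA regM map_mxM. Qed.

Let regAD a b : regA (a + b) = regA a + regA b.
Proof. by rewrite /regA regD map_mxD. Qed.

Lemma ext_model_cong s t : acong ext_rel s t -> ext_model s = ext_model t.
Proof.
elim=> //=.
- move=> {}s {}t [|x y|x y|k x] //=.
  + by rewrite scalar_mxM.
  + by rewrite raddfD.
  + by rewrite regA_in_alg -scalar_mxM -scalerAl mul1r.
- by move=> ? ? ? _ -> _ ->.
- by move=> ? ? ? ? _ -> _ ->.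
- by move=> ? ? ? ? _ -> _ ->.
- by move=> ? ? ? _ ->.
- by move=> *; rewrite addrA.
- by move=> *; rewrite addrC.
- by move=> *; rewrite add0r.
- move=> u; have:= regA_in_alg (-1); rewrite !scaleN1r => ->.
  by rewrite raddfN mulNmx mul1mx addNr.
- by move=> *; rewrite mulmxA.
- by move=> *; rewrite mul1mx.
- by move=> *; rewrite mulmx1.
- by move=> *; rewrite mulmxDl.
- by move=> *; rewrite mulmxDr.
- by move=> *; rewrite mulmxA regAM.
- by move=> *; rewrite regA1 mul1mx.
- by move=> *; rewrite mulmxDr.
- by move=> *; rewrite regAD mulmxDl.
- by move=> *; rewrite mulmxA.
- by move=> *; rewrite mulmxA ext_modelC mulmxA.
Qed.

Lemma ext_nontrivial : ~ acong ext_rel AOne AZero.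
Proof.
move=> /ext_model_cong /= /matrixP M10.
have d_gt0 : (0 < d)%N.
  rewrite lt0n; apply/eqP => d0; have /eqP[] := oner_neq0 F.
  rewrite -[1](@v2rK K F) -[0](@v2rK K F); congr r2v; apply/rowP => i.
  have d_gt0 : (0 < d)%N := leq_ltn_trans (leq0n i) (ltn_ord i).
  by rewrite d0 in d_gt0.
by have /eqP := M10 (Ordinal d_gt0) (Ordinal d_gt0); rewrite !mxE eqxx oner_eq0.
Qed.

(* The F-algebra F (x)_K A: its generators are the 1 (x) x, for x in A, and its
   relations say that x |-> 1 (x) x is a morphism of K-algebras. *)
Definition extScal := presAlg (Presentation ext_nontrivial).

Definition ext_in (x : A) : extScal := alg_gen (Presentation ext_nontrivial) x.

End ExtensionOfScalars.

(* Quivers with an involution; tau is a quiver automorphism, so it acts on the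
   arrows as well as on the vertices. *)
Record iquiver := IQuiver {
  vert : finType;
  arrow : finType;
  src : arrow -> vert;
  tgt : arrow -> vert;
  tau : vert -> vert;
  tau_arrow : arrow -> arrow;
  tauK : involutive tau;
  tau_arrowK : involutive tau_arrow;
  src_tau : forall h, src (tau_arrow h) = tau (src h);
  tgt_tau : forall h, tgt (tau_arrow h) = tau (tgt h)
}.
Arguments tau {i} _ : rename.

Record diagram := Diagram { nodes : seq int; edges : seq (int * int) }.

Definition joined (D : diagram) (a b : int) : bool :=
  ((a, b) \in edges D) || ((b, a) \in edges D).

Definition diagA (n : nat) := Diagram
  [seq k%:Z | k <- iota 1 n]
  [seq (k%:Z, k.+1%:Z) | k <- iota 1 n.-1].

(* A_{2r+1} with vertices -r, ..., r. *)
Definition diagA_sym (r : nat) := Diagram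
  [seq k%:Z - r%:Z | k <- iota 0 (2 * r).+1]
  [seq (k%:Z - r%:Z, k.+1%:Z - r%:Z) | k <- iota 0 (2 * r)].

Definition diagD (n : nat) := Diagram
  [seq k%:Z | k <- iota 1 n]
  (rcons [seq (k%:Z, k.+1%:Z) | k <- iota 1 (n - 2)%N] ((n - 2)%N%:Z, n%:Z)).

Definition diagE (n : nat) := Diagram
  [seq k%:Z | k <- iota 1 n]
  (take n.-1 [:: (1, 2); (2, 3); (3, 4); (3, 5); (5, 6); (6, 7); (7, 8)]).

Inductive is_ADE : diagram -> Prop :=
| ADE_A n : (1 <= n)%N -> is_ADE (diagA n)
| ADE_D n : (4 <= n)%N -> is_ADE (diagD n)
| ADE_E n : (6 <= n <= 8)%N -> is_ADE (diagE n).

Section Quiver.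
Variable P : iquiver.
Local Notation I := (vert P).

Definition nb_arrows (i j : I) : nat :=
  #|[set h : arrow P | ((src h == i) && (tgt h == j))
                    || ((src h == j) && (tgt h == i))]|.

(* lab identifies the underlying graph of the quiver with the diagram D. *)
Definition labelling (D : diagram) (lab : I -> int) :=
  [/\ injective lab,
      forall a : int, a \in nodes D <-> exists i, lab i = a
    & forall i j : I, nb_arrows i j = joined D (lab i) (lab j)].

Definition dynkin := exists D lab, is_ADE D /\ labelling D lab.

(* The set I_tau of representatives of the tau-orbits.  The four cases exhaust
   the Dynkin iquivers, since tau preserves the orientation: a nontrivial
   involution of A_{2r} would reverse the middle arrow. *)
Inductive orbit_reps : {set I} -> Prop :=
| reps_id : (forall i : I, tau i = i) -> orbit_reps [set: I]
| reps_A r lab :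
    (1 <= r)%N -> labelling (diagA_sym r) lab ->
    (forall i : I, lab (tau i) = - lab i) ->
    orbit_reps [set i | (0 <= lab i)%R]
| reps_D n lab :
    (4 <= n)%N -> labelling (diagD n) lab ->
    (forall i : I, lab (tau i) =
       if lab i == n%:Z then n%:Z - 1
       else if lab i == n%:Z - 1 then n%:Z else lab i) ->
    orbit_reps [set i | (lab i <= n%:Z - 1)%R]
| reps_E6 lab :
    labelling (diagE 6) lab ->
    (forall i : I, lab (tau i) =
       if lab i \in [:: 1; 6] then 7 - lab i
       else if lab i \in [:: 2; 5] then 7 - lab i else lab i) ->
    orbit_reps [set i | (lab i <= 4)%R].

Definition cartan (i j : I) : int := if i == j then 2 else - (nb_arrows i j)%:Z.

Definition lattice := {ffun I -> int}.

Definition refl (i : I) (a : lattice) : lattice :=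
  [ffun k => if k == i then a i - \sum_j cartan i j * a j else a k].

Definition brefl (i : I) : lattice -> lattice :=
  if tau i == i then refl i else refl i \o refl (tau i).

Definition has_order (T : Type) (m : nat) (f : T -> T) :=
  [/\ (0 < m)%N, iter m f =1 id
    & forall k, (0 < k < m)%N -> ~ iter k f =1 id].

Section Braid.
Variable It : {set I}.
Local Notation S := {i : I | i \in It}.

(* s t s ... with m factors *)
Fixpoint alternate (s t : gterm S) (m : nat) : gterm S :=
  if m is m'.+1 then GMul s (alternate t s m') else GOne S.

Inductive braid_rel : gterm S -> gterm S -> Prop :=
| BraidRel (i j : S) (m : nat) :
    i != j -> has_order m (brefl (val i) \o brefl (val j)) ->
    braid_rel (alternate (GGen i) (GGen j) m) (alternate (GGen j) (GGen i) m).

(* The braid group of the restricted Weyl group W_tau; the order of s_i s_j in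
   W_tau is its order as a map of the root lattice. *)
Definition Br := presGroup braid_rel.

Definition braid_gen (i : S) : Br := pres_gen braid_rel i.

End Braid.
End Quiver.

Arguments cartan {P} i j.
Arguments brefl {P} i a.
Arguments braid_gen {P It} i.

Definition Qv := {fraction {poly rat}}.
Definition qv : Qv := tofrac 'X.

Section QuantumGroupRelations.
Variable P : iquiver.
Local Notation I := (vert P).

Definition serre X (s t : aterm Qv X) : aterm Qv X :=
  (s * s * t - (qv + qv^-1) *: (s * t * s) + t * s * s)%AT.

(* The relations of U~ between E_i, F_i, K_i^{+-1}, K'_i^{+-1}; those of U are
   obtained by taking K' := K^-1. *)
Variables (X : Type) (E F K KV K' KV' : I -> aterm Qv X).

Inductive qg_rel : aterm Qv X -> aterm Qv X -> Prop :=
| qg_KKV i : qg_rel (K i * KV i)%AT 1%AT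
| qg_KVK i : qg_rel (KV i * K i)%AT 1%AT
| qg_K'KV' i : qg_rel (K' i * KV' i)%AT 1%AT
| qg_KV'K' i : qg_rel (KV' i * K' i)%AT 1%AT
| qg_KK i j : qg_rel (K i * K j)%AT (K j * K i)%AT
| qg_KK' i j : qg_rel (K i * K' j)%AT (K' j * K i)%AT
| qg_K'K' i j : qg_rel (K' i * K' j)%AT (K' j * K' i)%AT
| qg_EF i j :
    qg_rel (E i * F j - F j * E i)%AT
           ((if i == j then (qv - qv^-1)^-1 else 0) *: (K i - K' i))%AT
| qg_KE i j : qg_rel (K i * E j)%AT (qv ^ cartan i j *: (E j * K i))%AT
| qg_KF i j : qg_rel (K i * F j)%AT (qv ^ (- cartan i j) *: (F j * K i))%AT
| qg_K'E i j : qg_rel (K' i * E j)%AT (qv ^ (- cartan i j) *: (E j * K' i))%AT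
| qg_K'F i j : qg_rel (K' i * F j)%AT (qv ^ cartan i j *: (F j * K' i))%AT
| qg_EE0 i j : cartan i j = 0 -> qg_rel (E i * E j)%AT (E j * E i)%AT
| qg_EE1 i j : cartan i j = -1 -> qg_rel (serre (E i) (E j)) 0%AT
| qg_FF0 i j : cartan i j = 0 -> qg_rel (F i * F j)%AT (F j * F i)%AT
| qg_FF1 i j : cartan i j = -1 -> qg_rel (serre (F i) (F j)) 0%AT.

Lemma qg_nontrivial (f : X -> Qv^o) :
  (forall i, aeval f (E i) = 0) -> (forall i, aeval f (F i) = 0) ->
  (forall i, aeval f (K i) = 1) -> (forall i, aeval f (KV i) = 1) ->
  (forall i, aeval f (K' i) = 1) -> (forall i, aeval f (KV' i) = 1) ->
  ~ acong qg_rel 1%AT 0%AT.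
Proof.
move=> fE fF fK fKV fK' fKV' /(acong_aeval (f := f)) /=.
suff H : forall s t, qg_rel s t -> aeval f s = aeval f t.
  by move=> /(_ H)/eqP; rewrite oner_eq0.
by move=> s t [] * /=;
  rewrite ?(fE, fF, fK, fKV, fK', fKV') ?(scaleN1r, mulr1, mulr0, mul0r, scaler0, addr0, oppr0, subrr).
Qed.

End QuantumGroupRelations.

Section QuantumGroups.
(* The prefixes Ut, Uti, U, Ui stand for U~, U~^i, U, U^i; a suffix V marks an
   inverse. *)
Variable P : iquiver.
Local Notation I := (vert P).

Inductive Ut_gen :=
| gE of I | gF of I | gK of I | gKV of I | gK' of I | gKV' of I.

Definition Ut_rel := qg_rel
  (fun i => AGen (gE i)) (fun i => AGen (gF i))
  (fun i => AGen (gK i)) (fun i => AGen (gKV i))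
  (fun i => AGen (gK' i)) (fun i => AGen (gKV' i)).

Lemma Ut_nontrivial : ~ acong Ut_rel 1%AT 0%AT.
Proof.
by apply: (@qg_nontrivial _ _ _ _ _ _ _ _
  (fun x => match x with gE _ | gF _ => 0 | _ => 1 end)).
Qed.

Definition Ut_pres := Presentation Ut_nontrivial.

Definition Ut := presAlg Ut_pres.

Definition Ut_gen_in (x : Ut_gen) : Ut := alg_gen Ut_pres x.

Definition Ut_B (i : I) : Ut :=
  Ut_gen_in (gF i) + Ut_gen_in (gE (tau i)) * Ut_gen_in (gK' i).
Definition Ut_k (i : I) : Ut := Ut_gen_in (gK i) * Ut_gen_in (gK' (tau i)).
Definition Ut_kV (i : I) : Ut := Ut_gen_in (gKV i) * Ut_gen_in (gKV' (tau i)).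

Inductive Uti_gens : Ut -> Prop :=
| Uti_gens_B i : Uti_gens (Ut_B i)
| Uti_gens_k i : Uti_gens (Ut_k i)
| Uti_gens_kV i : Uti_gens (Ut_kV i).

Definition Uti := subalg Uti_gens.

Definition Uti_B (i : I) : Uti := subalg_of_gen (Uti_gens_B i).
Definition Uti_k (i : I) : Uti := subalg_of_gen (Uti_gens_k i).
Definition Uti_kV (i : I) : Uti := subalg_of_gen (Uti_gens_kV i).

Inductive U_gen := hE of I | hF of I | hK of I | hKV of I.

Definition U_rel := qg_rel
  (fun i => AGen (hE i)) (fun i => AGen (hF i))
  (fun i => AGen (hK i)) (fun i => AGen (hKV i))
  (fun i => AGen (hKV i)) (fun i => AGen (hK i)).

Lemma U_nontrivial : ~ acong U_rel 1%AT 0%AT.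
Proof.
by apply: (@qg_nontrivial _ _ _ _ _ _ _ _
  (fun x => match x with hE _ | hF _ => 0 | _ => 1 end)).
Qed.

Definition U_pres := Presentation U_nontrivial.

Definition U := presAlg U_pres.

Definition U_gen_in (x : U_gen) : U := alg_gen U_pres x.

Section Varsigma.
Variable vs : I -> Qv.

Definition U_B (i : I) : U :=
  U_gen_in (hF i) + vs i *: (U_gen_in (hE (tau i)) * U_gen_in (hKV i)).
Definition U_k (i : I) : U := U_gen_in (hK i) * U_gen_in (hKV (tau i)).
Definition U_kV (i : I) : U := U_gen_in (hKV i) * U_gen_in (hK (tau i)).

(* The generators k_j with j outside I_tau are redundant: k_{tau j} = k_j^-1. *)
Inductive Ui_gens : U -> Prop :=
| Ui_gens_B i : Ui_gens (U_B i)
| Ui_gens_k i : Ui_gens (U_k i)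
| Ui_gens_kV i : Ui_gens (U_kV i).

Definition Ui := subalg Ui_gens.

Definition Ui_B (i : I) : Ui := subalg_of_gen (Ui_gens_B i).
Definition Ui_k (i : I) : Ui := subalg_of_gen (Ui_gens_k i).

(* The quotient map U~^i -> U^i, by its values on generators. *)
Definition is_quotient_map (q : Uti -> Ui) :=
  [/\ is_alg_hom q, forall i, q (Uti_B i) = Ui_B i
    & forall i, q (Uti_k i) = vs i *: Ui_k i].

End Varsigma.

Definition Uti_k_exp (i : I) (m : int) : Uti :=
  match m with Posz n => Uti_k i ^+ n | Negz n => Uti_kV i ^+ n.+1 end.

Definition Uti_k_lattice (a : lattice P) : Uti := \prod_i Uti_k_exp i (a i).

Definition b_lattice (a : lattice P) : Qv :=
  \prod_i (if tau i == i then - qv ^+ 2 else 1) ^ a i.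

Definition vcomm (x y : Uti) : Uti := x * y - qv *: (y * x).

(* T_i(B_j) *)
Definition T_B (i j : I) : Uti :=
  let c := cartan i j in
  let c' := cartan (tau i) j in
  if tau i == i then
    if j == i then (- qv ^+ 2)^-1 *: (Uti_kV i * Uti_B i)
    else if c == -1 then Uti_B j * Uti_B i - qv *: (Uti_B i * Uti_B j)
    else Uti_B j
  else
    if j == i then - (Uti_kV i * Uti_B (tau i))
    else if j == tau i then - qv ^+ 2 *: (Uti_kV (tau i) * Uti_B i)
    else if (c == -1) && (c' == 0) then Uti_B j * Uti_B i - qv *: (Uti_B i * Uti_B j)
    else if (c == 0) && (c' == -1) then
      Uti_B (tau i) * Uti_B j - qv^-1 *: (Uti_B j * Uti_B (tau i))
    else if (c == -1) && (c' == -1) then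
      - qv^-1 *: vcomm (vcomm (Uti_B j) (Uti_B i)) (Uti_B (tau i)) + Uti_B j * Uti_k i
    else Uti_B j.

(* f is the automorphism T_i of U~^i: it is determined by its values on the
   generators. *)
Definition is_T (i : I) (f : algAut Uti) :=
  (forall a, f (Uti_k_lattice a) =
     (b_lattice (brefl i a) / b_lattice a) *: Uti_k_lattice (brefl i a)) /\
  (forall j, f (Uti_B j) = T_B i j).

Definition vs_diamond (i : I) : Qv := if tau i == i then - qv ^- 2 else 1.

(* g is the automorphism of U^i_{vs_diamond} to which T_i descends. *)
Definition is_T_diamond (i : I) (g : algAut (Ui vs_diamond)) :=
  exists (f : algAut Uti) (q : Uti -> Ui vs_diamond),
    [/\ is_T i f, is_quotient_map q & forall x, g (q x) = q (f x)].

Section Rescaling.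
Variables (vs : I -> Qv) (F : fieldExtType Qv) (a : I -> F).

Definition is_phi_u (phi : algIso (extScal F (Ui vs_diamond)) (extScal F (Ui vs))) :=
  (forall i, phi (ext_in F (Ui_B vs_diamond i)) = a i *: ext_in F (Ui_B vs i)) /\
  (forall i, phi (ext_in F (Ui_k vs_diamond i)) = ext_in F (Ui_k vs i)).

(* h = phi_u T_{diamond,i} phi_u^-1, where T_{diamond,i} is extended F-linearly. *)
Definition is_T_param (i : I) (h : algAut (extScal F (Ui vs))) :=
  exists (g : algAut (Ui vs_diamond)) (gF : algAut (extScal F (Ui vs_diamond)))
         (phi : algIso (extScal F (Ui vs_diamond)) (extScal F (Ui vs))),
    [/\ is_T_diamond i g,
        forall x, gF (ext_in F x) = ext_in F (g x),
        is_phi_u phi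
      & forall y, h y = phi (gF (iso_inv phi y))].

End Rescaling.
End QuantumGroups.

(* Main.v *)
Require Import Defs.
From HB Require Import structures.
From Stdlib Require Import ZArith.
From mathcomp Require Import all_boot all_order all_algebra all_field.
From mathcomp Require Import boolp ssrZ zify ring.

Set Implicit Arguments.
Unset Strict Implicit.
Unset Printing Implicit Defensive.

Import Order.TTheory GRing.Theory Num.Theory.
Local Open Scope ring_scope.

(** The algebra U~^i has a presentation: its generators b_i = B_i, k_i and
    k_i^-1 satisfy the relations collected in [iota_data], namely the weights of
    the b_j under the torus, commutation for non-adjacent vertices, a commutator
    [b_i, b_(tau i)] in the torus when tau i <> i, and Serre relations with a
    correction term q k_i b_j when tau i = i; and every other relation follows
    from these ([Uti_data], [Uti_lift]).  The theorem is then a computation with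
    generators.

    Presentation.  The relations hold by a computation in the quantum group
    ([qg_iota]).  That they suffice is seen on a module.  Let N be the algebra
    with the same generators and the homogeneous relations, in which the
    parameters s_i are 0.  The quantum group acts on N like on a Verma module:
    F_i is left multiplication by b_i, the K's act through weights and k's, and
    E_i is the skew derivation with [E_i, F_j] as prescribed ([verma_qg]).  As E_i
    lowers the degree, B_i acts as b_i plus terms of lower degree.  Hence if a
    combination of words in the generators acts by 0, its top component vanishes
    in N; the relations of N hold in the algebra of the iota relations up to
    lower degree, so the combination can be replaced by one of lower degree, and
    by induction it is 0 ([verma_faithful]).

    Existence of T_i.  By the presentation it is enough that the elements T_i(b_j),
    T_i(k_j) satisfy the relations again ([T_iota]).  A relation involves at most
    two orbits besides that of i.  As the Dynkin graph has no cycle ([no_cycle]),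
    few configurations occur, and in each of them the relation is an identity
    between polynomials in a few letters, which follows from the given relations
    by completing these up to a bounded degree; the tactic [NC.nc] does it.
    Bijectivity comes from the anti-involution sigma that fixes the b_j and sends
    k_j to k_(tau j): sigma T_i sigma is inverse to T_i ([T_sT], [T_aut]).

    Braid relations.  Products of two restricted reflections have order 2, 3 or 4
    on the root lattice.  On the torus T_i acts by the reflection and a scalar
    that is a coboundary, so the relations there come from the root lattice.  On
    the b_j: orthogonal orbits are clear ([orth_braid]); for order 3, T_i T_j
    carries the orbit of i to that of j ([same_kind_shift]), which gives the
    relation on these two orbits, and on the remaining vertices iterated
    commutators reassociate ([same_kind_braid]); for order 4, with c fixed and
    adjacent to i, T_c T_i T_c exchanges b_i and b_(tau i) up to scalars and
    T_i T_c T_i fixes b_c ([mixed_braid]).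

    Parameters.  The algebra with distinguished parameters is presented in the
    same way, with additional relations that give a scalar value to k_i if
    tau i = i and to k_i k_(tau i) in general; T_i preserves these
    ([diamond_T_data]).  For other parameters one conjugates by the isomorphism
    that rescales the b_i ([rescale_iso]). *)

(** * Consequences of relations in noncommutative algebras *)

(** A verified completion procedure: from equations between noncommutative
    polynomials over Z[q, q^-1] it derives rewriting rules, adds S-polynomials up
    to a given degree, and reduces the goal to normal form.  Only soundness is
    proved; that the goals do reduce to 0 is found by computation. *)
Module NC.

Notation Z1 := (Zpos xH).
Notation Zm1 := (Zneg xH).

(** A polynomial is a list of terms c q^e w, with c and e integers, in decreasing
    order for the degree-lexicographic order on w and then for e. *)
Definition word := seq nat.
Definition poly := seq (word * Z * Z).
Definition rule := (word * poly)%type.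

Fixpoint lex (u w : word) : comparison :=
  match u, w with
  | [::], [::] => Eq
  | [::], _ => Lt
  | _, [::] => Gt
  | a :: u', b :: w' =>
      match Nat.compare a b with Eq => lex u' w' | c => c end
  end.

Definition wcmp (u w : word) : comparison :=
  match Nat.compare (size u) (size w) with Eq => lex u w | c => c end.

Definition mcmp (m n : word * Z) : comparison :=
  match wcmp m.1 n.1 with Eq => Z.compare m.2 n.2 | c => c end.

Fixpoint padd (p : poly) : poly -> poly :=
  fix padd_p (r : poly) : poly :=
    match p, r with
    | [::], _ => r
    | _, [::] => p
    | (m, c) :: p', (n, d) :: r' =>
        match mcmp m n with
        | Gt => (m, c) :: padd p' r
        | Lt => (n, d) :: padd_p r'
        | Eq => if Z.eqb (Z.add c d) Z0 then padd p' r' else (m, (Z.add c d)) :: padd p' r'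
        end
    end.

(** c q^e u p w. *)
Definition pshift (c e : Z) (u w : word) (p : poly) : poly :=
  map (fun t : word * Z * Z =>
    (u ++ t.1.1 ++ w, Z.add e t.1.2, Z.mul c t.2)) p.

Definition popp := pshift Zm1 Z0 [::] [::].

Definition pmul (p r : poly) : poly :=
  foldr (fun t acc => padd (pshift t.2 t.1.2 t.1.1 [::] r) acc) [::] p.

Fixpoint strip (l w : word) : option word :=
  match l, w with
  | [::], _ => Some w
  | a :: l', b :: w' => if Nat.eqb a b then strip l' w' else None
  | _, _ => None
  end.

Fixpoint head_rule (rs : seq rule) (w : word) : option (poly * word) :=
  match rs with
  | [::] => None
  | (l, p) :: rs' =>
      match strip l w with Some s => Some (p, s) | None => head_rule rs' w end
  end.

Fixpoint find_rule (rs : seq rule) (pre w : word) : option (word * poly * word) :=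
  match head_rule rs w with
  | Some (p, s) => Some (rev pre, p, s)
  | None => match w with [::] => None | a :: w' => find_rule rs (a :: pre) w' end
  end.

Definition nf_step (rs : seq rule) (st : poly * poly) : poly * poly :=
  match st.1 with
  | [::] => st
  | (w, e, c) :: t =>
      match find_rule rs [::] w with
      | None => (t, (w, e, c) :: st.2)
      | Some (u, p, s) => (padd (pshift c e u s p) t, st.2)
      end
  end.

(** At most 2^n steps; doubling keeps the fuel a small numeral. *)
Fixpoint nf_run (rs : seq rule) (n : nat) (st : poly * poly) : poly * poly :=
  match n with
  | 0 => nf_step rs st
  | n'.+1 => let st' := nf_run rs n' st in
             match st'.1 with [::] => st' | _ => nf_run rs n' st' end
  end.

Definition nf (rs : seq rule) (p : poly) : poly :=
  let st := nf_run rs 20 (p, [::]) in catrev st.2 st.1.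

Definition two : poly := [:: ([::], Z1, Z1); ([::], Zm1, Z1)].

Fixpoint div2_aux (n : nat) (p acc : poly) : poly :=
  match n, p with
  | n'.+1, (w, e, c) :: _ =>
      let m := [:: (w, Z.add e Zm1, c)] in
      div2_aux n' (padd p (popp (pmul two m))) (padd acc m)
  | _, _ => acc
  end.

(** The completion of Serre relations produces leading coefficients divisible by
    q + q^-1, which is invertible in the ground field.  The division is exact or
    else p is returned, as the product is compared with p. *)
Definition div2 (p : poly) : poly :=
  let m := div2_aux (2 * size p) p [::] in
  if padd p (popp (pmul two m)) is [::] then m else p.

(** The leading coefficient is a unit +-q^e, so that the leading word can be
    rewritten. *)
Definition unit_lead (p : poly) : bool :=
  match p with
  | (w, _, c) :: p' =>
      Z.eqb (Z.mul c c) Z1 && (if p' is (w', _, _) :: _ then (if wcmp w w' is Eq then false else true) else true)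
  | [::] => false
  end.

Definition orient (p : poly) : seq rule :=
  let p1 := if unit_lead p then p else div2 p in
  let p2 := if unit_lead p1 then p1 else div2 p1 in
  match p2 with
  | (w, e, c) :: p' =>
      if unit_lead p2 then [:: (w, pshift (Z.opp c) (Z.opp e) [::] [::] p')] else [::]
  | [::] => [::]
  end.

(** The S-polynomials of two rules, for overlaps u = a b, w = b c with a, b and c
    nonempty; pre is the part a, reversed. *)
Fixpoint spolys (d : nat) (pre u : word) (pu : poly) (w : word) (pw : poly) : seq poly :=
  match u with
  | [::] => [::]
  | a :: u' =>
      let rest := spolys d (a :: pre) u' pu w pw in
      match pre, strip u w with
      | _ :: _, Some (c0 :: c) =>
          if Nat.leb (size pre + size w) d then
            padd (pshift Z1 Z0 [::] (c0 :: c) pu) (popp (pshift Z1 Z0 (rev pre) [::] pw)) :: rest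
          else rest
      | _, _ => rest
      end
  end.

Definition add_rule (rs : seq rule) (p : poly) : seq rule :=
  match p with [::] => rs | _ =>
  match nf rs p with
  | [::] => rs
  | p' => orient p' ++ rs
  end end.

(** Torus letters are the smallest; the rules that move them are used for reduction
    but are not overlapped, which keeps the completion small. *)
Definition core (t : nat) (rs : seq rule) : seq rule :=
  filter (fun r : rule => all (fun a => Nat.leb t a) r.1) rs.

Definition sat_pass (t d : nat) (rs : seq rule) : seq rule :=
  let cs := core t rs in
  foldl (fun acc (r : rule) =>
    foldl (fun acc (r' : rule) =>
      foldl add_rule acc (spolys d [::] r.1 r.2 r'.1 r'.2)) acc cs) rs cs.

(** New rules may overlap again within the same degree, hence the repetition. *)
Fixpoint sat_deg (n t d : nat) (rs : seq rule) : seq rule :=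
  match n with
  | 0 => rs
  | n'.+1 => let rs' := sat_pass t d rs in
             if Nat.eqb (size rs') (size rs) then rs' else sat_deg n' t d rs'
  end.

Fixpoint saturate (d0 n t : nat) (rs : seq rule) : seq rule :=
  match n with
  | 0 => rs
  | n'.+1 => saturate d0.+1 n' t (sat_deg 3 t d0 rs)
  end.

Inductive sexp :=
| SQ | SQI | S0 | S1 | SAdd of sexp & sexp | SMul of sexp & sexp | SOpp of sexp
| SPow of sexp & nat | SNeg of nat.

Inductive nexp :=
| EVar of nat | E0 | E1 | EAdd of nexp & nexp | EMul of nexp & nexp
| EOpp of nexp | EScale of sexp & nexp | EPow of nexp & nat.

Fixpoint ppow (p : poly) (n : nat) : poly :=
  match n with 0 => [:: ([::], Z0, Z1)] | n'.+1 => pmul p (ppow p n') end.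

Fixpoint ps (s : sexp) : poly :=
  match s with
  | SQ => [:: ([::], Z1, Z1)]
  | SQI => [:: ([::], Zm1, Z1)]
  | S0 => [::]
  | S1 => [:: ([::], Z0, Z1)]
  | SAdd a b => padd (ps a) (ps b)
  | SMul a b => pmul (ps a) (ps b)
  | SOpp a => popp (ps a)
  | SPow a n => ppow (ps a) n
  | SNeg n => [:: ([::], Z.opp (Z.of_nat n), Z1)]
  end.

Fixpoint pe (x : nexp) : poly :=
  match x with
  | EVar n => [:: ([:: n], Z0, Z1)]
  | E0 => [::]
  | E1 => [:: ([::], Z0, Z1)]
  | EAdd a b => padd (pe a) (pe b)
  | EMul a b => pmul (pe a) (pe b)
  | EOpp a => popp (pe a)
  | EScale s a => pmul (ps s) (pe a)
  | EPow a n => ppow (pe a) n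
  end.

Definition pdiff (h : nexp * nexp) : poly := padd (pe h.1) (popp (pe h.2)).

Definition init_rules (hs : seq (nexp * nexp)) : seq rule :=
  foldl (fun rs h => add_rule rs (pdiff h)) [::] hs.

Definition check (t d : nat) (hs : seq (nexp * nexp)) (g : nexp * nexp) : bool :=
  if nf (saturate 3 (d - 2) t (init_rules hs)) (pdiff g) is [::] then true else false.

Section Soundness.
Variables (K : fieldType) (A : algType K) (q : K) (rho : seq A).
Hypotheses (q0 : q != 0) (q2 : q + q^-1 != 0).

Definition zK (c : Z) : K := (int_of_Z c)%:~R.
Definition qz (e : Z) : K := q ^ int_of_Z e.

Lemma zKD c d : zK (Z.add c d) = zK c + zK d.
Proof. by rewrite /zK -intrD; congr (_%:~R); exact: (raddfD int_of_Z c d). Qed.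
Lemma zKM c d : zK (Z.mul c d) = zK c * zK d.
Proof. by rewrite /zK -intrM; congr (_%:~R); exact: (rmorphM int_of_Z c d). Qed.
Lemma zK1 : zK Z1 = 1. Proof. by []. Qed.
Lemma zKN1 : zK Zm1 = -1. Proof. by []. Qed.
Lemma zKN c : zK (Z.opp c) = - zK c.
Proof. by rewrite /zK -mulrNz; congr (_%:~R); exact: (raddfN int_of_Z c). Qed.
Lemma qzD e f : qz (Z.add e f) = qz e * qz f.
Proof. by rewrite /qz -expfzDr //; congr (_ ^ _); exact: (raddfD int_of_Z e f). Qed.
Lemma qzN e : qz (Z.opp e) = (qz e)^-1.
Proof. by rewrite /qz invr_expz; congr (_ ^ _); exact: (raddfN int_of_Z e). Qed.
Lemma qz_neq0 e : qz e != 0. Proof. exact: expfz_neq0. Qed.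

Fixpoint dw (w : word) : A := if w is a :: w' then nth 0 rho a * dw w' else 1.
Definition dt (t : word * Z * Z) : A := (zK t.2 * qz t.1.2) *: dw t.1.1.
Fixpoint dp (p : poly) : A := if p is t :: p' then dt t + dp p' else 0.

Lemma dw_cat u w : dw (u ++ w) = dw u * dw w.
Proof. by elim: u => [|a u IH] /=; rewrite ?mul1r // IH mulrA. Qed.

Lemma compareP a b : reflect (a = b) (if Nat.compare a b is Eq then true else false).
Proof.
by apply: (iffP idP) => [|->]; [case: PeanoNat.Nat.compare_spec | rewrite PeanoNat.Nat.compare_refl].
Qed.

Lemma lexP u w : lex u w = Eq -> u = w.
Proof.
elim: u w => [|a u IH] [|b w] //=.
case E: (Nat.compare a b) => // /IH ->; congr (_ :: _).
by apply/compareP; rewrite E.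
Qed.

Lemma wcmpP u w : wcmp u w = Eq -> u = w.
Proof. by rewrite /wcmp; case: (Nat.compare _ _) => //; apply: lexP. Qed.

Lemma mcmpP m n : mcmp m n = Eq -> m = n.
Proof.
case: m n => [u e] [w f]; rewrite /mcmp /=; case E: (wcmp u w) => //.
by move=> /Z.compare_eq_iff ->; rewrite (wcmpP E).
Qed.

Lemma dp_padd p r : dp (padd p r) = dp p + dp r.
Proof.
elim: p r => [|[m c] p IHp] r; first by case: r => [|? ?] /=; rewrite ?add0r.
elim: r => [|[n d] r IHr]; first by rewrite /= addr0.
rewrite [padd _ _]/=; case E: (mcmp m n) => /=; last 2 first.
- by rewrite IHr /= addrCA.
- by rewrite IHp /= addrA.
rewrite -(mcmpP E) {2}/dt /=.
have -> : dt (m, c) + dp p + ((zK d * qz m.2) *: dw m.1 + dp r)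
  = (zK (Z.add c d) * qz m.2) *: dw m.1 + (dp p + dp r).
  by rewrite zKD mulrDl scalerDl addrACA.
case: Z.eqb_spec => [->|_] /=; rewrite IHp //.
by rewrite mul0r scale0r add0r.
Qed.

Lemma dp_pshift c e u w p :
  dp (pshift c e u w p) = (zK c * qz e) *: (dw u * dp p * dw w).
Proof.
elim: p => [|[[m f] d] p IH] /=; first by rewrite mulr0 mul0r scaler0.
rewrite IH mulrDr mulrDl scalerDr; congr (_ + _).
rewrite /dt /= !dw_cat zKM qzD -!scalerAr -scalerAl scalerA mulrACA mulrA.
by rewrite !mulrA.
Qed.

Lemma dp_popp p : dp (popp p) = - dp p.
Proof. by rewrite dp_pshift /= mul1r mulr1 zKN1 mulr1 scaleN1r. Qed.

Lemma dp_pmul p r : dp (pmul p r) = dp p * dp r.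
Proof.
elim: p => [|t p IH] /=; first by rewrite mul0r.
by rewrite dp_padd IH dp_pshift /= mulr1 mulrDl -scalerAl.
Qed.

Lemma dp_psub p r : dp (padd p (popp r)) = dp p - dp r.
Proof. by rewrite dp_padd dp_popp. Qed.

Definition valid (rs : seq rule) := forall r, r \in rs -> dw r.1 = dp r.2.

Lemma valid_nil : valid [::]. Proof. by []. Qed.

Lemma valid_cons r rs : dw r.1 = dp r.2 -> valid rs -> valid (r :: rs).
Proof. by move=> hr hrs x; rewrite inE => /predU1P [->|/hrs]. Qed.

Lemma stripP l w s : strip l w = Some s -> w = l ++ s.
Proof.
elim: l w => [|a l IH] [|b w] //=; try by move=> [->].
by case: PeanoNat.Nat.eqb_spec => // -> /IH ->.
Qed.

Lemma head_ruleP rs w p s : valid rs -> head_rule rs w = Some (p, s) ->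
  dw w = dp p * dw s.
Proof.
elim: rs => [|[l r] rs IH] //= hv.
case E: (strip l w) => [s'|].
  move=> [<- <-]; rewrite (stripP E) dw_cat; congr (_ * _).
  by apply: (hv (l, r)); rewrite mem_head.
by apply: IH => x hx; apply: hv; rewrite inE hx orbT.
Qed.

Lemma find_ruleP rs pre w u p s : valid rs ->
  find_rule rs pre w = Some (u, p, s) -> dw (rev pre ++ w) = dw u * dp p * dw s.
Proof.
move=> hv; elim: w pre => [|a w IH] pre /=.
  case E: (head_rule _ _) => [[p' s']|] // [<- <- <-].
  by rewrite dw_cat (head_ruleP hv E) mulrA.
case E: (head_rule _ _) => [[p' s']|].
  by move=> [<- <- <-]; rewrite dw_cat (head_ruleP hv E) mulrA.
by move/IH; rewrite rev_cons cat_rcons.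
Qed.

(** The sum of the two components, reduced and unreduced, is what a step of
    reduction preserves. *)
Definition dst (st : poly * poly) := dp st.1 + dp st.2.

Lemma nf_stepP rs st : valid rs -> dst (nf_step rs st) = dst st.
Proof.
move=> hv; case: st => [[|[[w e] c] t] o] //; rewrite /nf_step /=.
case E: (find_rule _ _ _) => [[[u p] s]|]; rewrite /dst /=.
  by rewrite dp_padd dp_pshift -(find_ruleP hv E).
by rewrite addrCA addrA.
Qed.

Lemma nf_runP rs n st : valid rs -> dst (nf_run rs n st) = dst st.
Proof.
move=> hv; elim: n st => [|n IH] st /=; first exact: nf_stepP.
by case: (nf_run rs n st).1 (IH st) => [|? ?] // <-; rewrite IH.
Qed.

Lemma dp_catrev p r : dp (catrev p r) = dp p + dp r.
Proof. by elim: p r => [|t p IH] r /=; rewrite ?add0r // IH /= addrCA addrA. Qed.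

Lemma nfP rs p : valid rs -> dp (nf rs p) = dp p.
Proof.
move=> hv; rewrite /nf; move: 20%N => n.
by have := nf_runP n (p, [::]) hv; rewrite /dst addr0 dp_catrev addrC.
Qed.

Lemma dp_two : dp two = (q + q^-1)%:A.
Proof.
rewrite /two /= /dt /= addr0 !zK1 !mul1r -scalerDl; congr ((_ + _) *: _).
Qed.

Lemma div2P p : dp p = 0 -> dp (div2 p) = 0.
Proof.
move=> p0; rewrite /div2; set m := div2_aux _ _ _.
case E: (padd _ _) => [|? ?] //.
have:= congr1 dp E; rewrite dp_psub p0 dp_pmul dp_two sub0r /= -scalerAl mul1r.
move/eqP; rewrite oppr_eq0 scaler_eq0 (negPf q2) /=; by move/eqP.
Qed.

Lemma orientP p : dp p = 0 -> valid (orient p).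
Proof.
move=> p0; rewrite /orient.
set p1 := if unit_lead p then _ else _.
have p10 : dp p1 = 0 by rewrite /p1; case: ifP => // _; apply: div2P.
set p2 := if unit_lead p1 then _ else _.
have : dp p2 = 0 by rewrite /p2; case: ifP => // _; apply: div2P.
case: {p1 p10} p2 => [|[[w e] c] p'] //= p20; case: ifP => // /andP [/Z.eqb_eq cc _].
apply: valid_cons => //=; rewrite dp_pshift /= mul1r mulr1 zKN qzN.
have cK : zK c * zK c = 1 by rewrite -zKM cc.
have /eqP := p20; rewrite addr_eq0 => /eqP h.
have -> : dp p' = - dt (w, e, c) by rewrite h opprK.
rewrite /dt /= scalerN scalerA !mulNr scaleNr opprK mulrACA cK mul1r.
by rewrite mulVf ?qz_neq0 // scale1r.
Qed.

Lemma valid_cat r s : valid r -> valid s -> valid (r ++ s).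
Proof. by move=> hr hs x; rewrite mem_cat => /orP [/hr|/hs]. Qed.

Lemma add_ruleP rs p : valid rs -> dp p = 0 -> valid (add_rule rs p).
Proof.
case: p => [//|t p] hv p0; rewrite /add_rule; case E: (nf _ _) => [|t' p'] //.
apply: valid_cat => //; apply: orientP.
by rewrite -E nfP.
Qed.

Lemma spolysP d pre u pu w pw p : dw (rev pre ++ u) = dp pu -> dw w = dp pw ->
  p \in spolys d pre u pu w pw -> dp p = 0.
Proof.
move=> hu hw; elim: u pre hu => [|a u IH] pre hu //=.
have hrest : p \in spolys d (a :: pre) u pu w pw -> dp p = 0.
  by apply: IH; rewrite rev_cons cat_rcons.
case: pre hu hrest => [|a0 pre] hu hrest //.
case E: (match w with [::] => _ | _ => _ end) => [[|c0 c]|] //.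
case: ifP => // _; rewrite inE => /predU1P [->|]; last exact: hrest.
have Ew : w = (a :: u) ++ (c0 :: c) by apply: stripP.
rewrite dp_psub !dp_pshift [dw [::]]/= !mul1r !mulr1 -hu -hw Ew -!dw_cat.
by rewrite -!catA subrr.
Qed.

Lemma foldl_inv (T : eqType) (S : Type) (I : S -> Prop) (f : S -> T -> S) (s : seq T) x :
  I x -> (forall y t, t \in s -> I y -> I (f y t)) -> I (foldl f x s).
Proof.
elim: s x => [|t s IH] x //= hx hf; apply: IH; first by apply: hf; rewrite ?mem_head.
by move=> y u hu; apply: hf; rewrite inE hu orbT.
Qed.

Lemma sat_passP t d rs : valid rs -> valid (sat_pass t d rs).
Proof.
move=> hv; have hc : valid (core t rs).
  by move=> r; rewrite mem_filter => /andP [_ /hv].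
rewrite /sat_pass; apply: foldl_inv => // y r hr hy.
apply: foldl_inv => // {hy}y r' hr' hy; apply: foldl_inv => // {hy}y p hp hy.
apply: add_ruleP => //; apply: (spolysP (pre := [::]) _ _ hp); exact: hc.
Qed.

Lemma sat_degP n t d rs : valid rs -> valid (sat_deg n t d rs).
Proof.
elim: n rs => [|n IH] rs hv //=.
by case: ifP => _; [|apply: IH]; apply: sat_passP.
Qed.

Lemma saturateP d0 n t rs : valid rs -> valid (saturate d0 n t rs).
Proof.
elim: n d0 rs => [|n IH] d0 rs hv //.
by change (valid (saturate d0.+1 n t (sat_deg 3 t d0 rs))); apply/IH/sat_degP.
Qed.

Fixpoint ds (s : sexp) : K :=
  match s with
  | SQ => q | SQI => q^-1 | S0 => 0 | S1 => 1
  | SAdd a b => ds a + ds b | SMul a b => ds a * ds b | SOpp a => - ds a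
  | SPow a n => ds a ^+ n
  | SNeg n => q ^- n
  end.

Fixpoint de (x : nexp) : A :=
  match x with
  | EVar n => nth 0 rho n | E0 => 0 | E1 => 1
  | EAdd a b => de a + de b | EMul a b => de a * de b | EOpp a => - de a
  | EScale s a => ds s *: de a | EPow a n => de a ^+ n
  end.

Lemma dp_ppow p n : dp (ppow p n) = dp p ^+ n.
Proof.
elim: n => [|n IH]; rewrite [ppow _ _]/=; last by rewrite dp_pmul IH exprS.
by rewrite /= /dt /= addr0 mul1r scale1r.
Qed.

Lemma dp_ps s : dp (ps s) = (ds s)%:A.
Proof.
elim: s => [||||a IHa b IHb|a IHa b IHb|a IHa|a IHa n|n] //=;
  rewrite ?dp_padd ?dp_pmul ?dp_popp ?dp_ppow ?IHa ?IHb.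
- by rewrite /dt /= addr0 mul1r.
- by rewrite /dt /= addr0 mul1r.
- by rewrite scale0r.
- by rewrite /dt /= addr0 mul1r.
- by rewrite scalerDl.
- by rewrite -scalerAl mul1r scalerA.
- by rewrite scaleNr.
- elim: n => [|n IH]; first by rewrite scale1r.
  by rewrite !exprS IH -scalerAl mul1r scalerA.
- by rewrite /dt /= addr0 mul1r qzN /qz; congr (_^-1 *: _); exact: (congr1 (exprz q) (Z_of_intK (Posz n))).
Qed.

Lemma dp_pe x : dp (pe x) = de x.
Proof.
elim: x => [n|||a IHa b IHb|a IHa b IHb|a IHa|s a IHa|a IHa n] //=;
  rewrite ?dp_padd ?dp_pmul ?dp_popp ?dp_ppow ?dp_ps ?IHa ?IHb //.
- by rewrite /dt /= addr0 mulr1 mul1r scale1r.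
- by rewrite /dt /= addr0 mul1r scale1r.
- by rewrite -scalerAl mul1r.
Qed.

Fixpoint holds (hs : seq (nexp * nexp)) : Prop :=
  if hs is h :: hs' then de h.1 = de h.2 /\ holds hs' else True.

(** Every rule ever produced holds in A, so reduction to normal form does not
    change the value of a polynomial. *)
Lemma checkP t d hs g : holds hs -> check t d hs g -> de g.1 = de g.2.
Proof.
move=> hh; rewrite /check.
have dpd h : dp (pdiff h) = de h.1 - de h.2 by rewrite dp_psub !dp_pe.
have hv : valid (init_rules hs).
  rewrite /init_rules; move: valid_nil; move: [::] => rs0.
  elim: hs hh rs0 => [|h hs IH] //= [h1 hh] rs0 hv0; apply: IH => //.
  by apply: add_ruleP => //; rewrite dpd h1 subrr.
have := nfP (pdiff g) (@saturateP 3%N (d - 2)%N t _ hv).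
case: (nf _ _) => [|? ?] // /esym; rewrite dpd => /eqP.
by rewrite subr_eq0 => /eqP.
Qed.

End Soundness.

Ltac index x l :=
  match l with
  | x :: _ => constr:(0%N)
  | _ :: ?l' => let n := index x l' in constr:(n.+1)
  end.

Ltac rs q s :=
  lazymatch s with
  | 0 => constr:(S0)
  | 1 => constr:(S1)
  | ?a + ?b => let x := rs q a in let y := rs q b in constr:(SAdd x y)
  | ?a * ?b => let x := rs q a in let y := rs q b in constr:(SMul x y)
  | - ?a => let x := rs q a in constr:(SOpp x)
  | ?a ^+ ?n => let x := rs q a in constr:(SPow x n)
  | q ^ ?n =>
      let m := eval vm_compute in n in
      lazymatch m with
      | Posz ?k => constr:(SPow SQ k)
      | Negz ?k => constr:(SNeg k.+1)
      end
  | (q ^+ ?n)^-1 => constr:(SNeg n)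
  | q^-1 => constr:(SQI)
  | q => constr:(SQ)
  end.

Ltac re q env x :=
  lazymatch x with
  | 0 => constr:(E0)
  | 1 => constr:(E1)
  | ?a + ?b => let x := re q env a in let y := re q env b in constr:(EAdd x y)
  | ?a * ?b => let x := re q env a in let y := re q env b in constr:(EMul x y)
  | - ?a => let x := re q env a in constr:(EOpp x)
  | ?s *: ?a => let x := rs q s in let y := re q env a in constr:(EScale x y)
  | ?a ^+ ?n => let x := re q env a in constr:(EPow x n)
  | _ => let n := index x env in constr:(EVar n)
  end.

Ltac req q env e :=
  lazymatch e with
  | ?a = ?b => let x := re q env a in let y := re q env b in constr:((x, y))
  end.

Ltac rhs q env hs :=
  lazymatch hs with
  | (?hs', ?h) =>
      let T := type of h in
      let x := req q env T in let l := rhs q env hs' in constr:(x :: l)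
  | tt => constr:(@nil (nexp * nexp))
  | ?h => let T := type of h in let x := req q env T in constr:([:: x])
  end.

Ltac prove_holds hs :=
  lazymatch hs with
  | (?hs', ?h) => split; [exact h | prove_holds hs']
  | tt => exact I
  | ?h => split; [exact h | exact I]
  end.

(** [nc t d q hq0 hq2 env hs] proves an equation from the equations hs by
    completing these to degree d.  The order of env is the order of the letters,
    and its first t letters are the torus letters. *)
Ltac nc t d q hq0 hq2 env hs :=
  let g := lazymatch goal with |- ?g => constr:(g) end in
  let ge := req q env g in
  let l := rhs q env hs in
  refine (@checkP _ _ q env hq0 hq2 t d l ge _ _);
  [ prove_holds hs | vm_compute; reflexivity ].

End NC.

(** * Dynkin quivers with involution *)

Section QuiverFacts.
Variable P : iquiver.
Local Notation I := (vert P).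
Implicit Types i j k : I.

Lemma nb_arrowsC i j : nb_arrows i j = nb_arrows j i.
Proof. by apply: eq_card => h; rewrite !inE orbC. Qed.

Lemma nb_arrows_tau i j : nb_arrows (tau i) (tau j) = nb_arrows i j.
Proof.
rewrite /nb_arrows -[RHS](card_imset _ (inv_inj (@tau_arrowK P))).
apply: eq_card => h; apply/idP/imsetP => [|[g hg ->]].
  rewrite inE => hh; exists (tau_arrow h); last by rewrite tau_arrowK.
  by rewrite inE !src_tau !tgt_tau !(inv_eq (@tauK P)).
by rewrite inE in hg; rewrite inE !src_tau !tgt_tau !(inj_eq (inv_inj (@tauK P))).
Qed.

Lemma cartanC i j : cartan i j = cartan j i.
Proof. by rewrite /cartan eq_sym nb_arrowsC. Qed.

Lemma cartan_tau i j : cartan (tau i) (tau j) = cartan i j.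
Proof. by rewrite /cartan (inj_eq (inv_inj (@tauK P))) nb_arrows_tau. Qed.

Lemma ctauL i j : cartan (tau i) j = cartan i (tau j).
Proof. by rewrite -{1}[j]tauK cartan_tau. Qed.

Lemma cartan_ii i : cartan i i = 2.
Proof. by rewrite /cartan eqxx. Qed.

Definition adj i j := cartan i j == -1.

Lemma adjC i j : adj i j = adj j i. Proof. by rewrite /adj cartanC. Qed.

Lemma adj_neq i j : adj i j -> i != j.
Proof. by apply: contraTneq => ->; rewrite /adj cartan_ii. Qed.

Section Labelled.
Variables (D : diagram) (lab : I -> int) (labD : labelling D lab).

Lemma cartan_lab i j : i != j -> cartan i j = - (joined D (lab i) (lab j))%:Z.
Proof. by case: labD => _ _ hD; rewrite /cartan => /negPf ->; rewrite hD. Qed.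

Lemma cartan_cases i j : [\/ i = j, cartan i j = 0 | cartan i j = -1].
Proof.
have [->|ij] := eqVneq i j; first exact: Or31.
by rewrite (cartan_lab ij); case: joined; [apply: Or33 | apply: Or32].
Qed.

Lemma adj_joined i j : adj i j -> joined D (lab i) (lab j).
Proof.
by move=> a; move: (a); rewrite /adj (cartan_lab (adj_neq a)); case: joined.
Qed.

End Labelled.

(** In the labellings of type ADE each node has at most one smaller neighbour, its
    parent: the diagram is a rooted forest. *)
Definition parental D (f : int -> int) :=
  all (fun e : int * int => (e.1 < e.2)%R && (e.1 == f e.2)) (edges D).

Lemma ADE_parental D : is_ADE D -> exists f, parental D f.
Proof.
case=> n hn.
- exists (fun a => a - 1); apply/allP => e /mapP [k _ ->] /=; lia.
- exists (fun a => if a == n%:Z then a - 2 else a - 1); apply/allP => e.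
  rewrite /= mem_rcons inE => /predU1P [->|/mapP [k]] /=; first by rewrite eqxx; lia.
  by rewrite mem_iota => hk -> /=; case: (k.+1%:Z =P n) => e1; lia.
- exists (fun a => if a == 5 then 3 else a - 1); apply/allP => e /mem_take.
  by rewrite !inE; do 6?[case/orP]; move=> /eqP ->.
Qed.

(** The vertex of largest label on a cycle would have two smaller neighbours, but
    it has only one parent. *)
Lemma no_cycle (s : seq I) : dynkin P -> (2 < size s)%N -> uniq s -> ~~ cycle adj s.
Proof.
case=> D [lab [/ADE_parental [f hf] labD]] s2 us; apply/negP => cs.
have parent i j : adj i j -> (lab j < lab i)%R -> lab j = f (lab i).
  move=> /(adj_joined labD) /orP [] h lt; have := allP hf _ h; rewrite /=.
    by case/andP=> h1 _; have := lt_trans h1 lt; rewrite ltxx.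
  by case/andP=> _ /eqP.
have [x0 hx0] : exists x0, x0 \in s by case: s s2 {us cs} => // a s; exists a; rewrite mem_head.
case: (arg_maxP (fun x => lab x) hx0) => x hx hmax.
have /rot_to [n t hrot] : x \in s by [].
have ut : uniq (x :: t) by rewrite -hrot rot_uniq.
have ct : cycle adj (x :: t) by rewrite -hrot rot_cycle.
have st : (1 < size t)%N by have := size_rot n s; rewrite hrot /= => E; rewrite -E in s2.
have ht y : y \in t -> lab y < lab x.
  move=> yt; rewrite lt_neqAle; apply/andP; split.
    case: labD => hinj _ _; rewrite (inj_eq hinj); apply: contraTneq yt => ->.
    by have /andP [] := ut.
  have ys : y \in s by rewrite -(mem_rot n) hrot inE yt orbT.
  exact: hmax.
case: t ut ct st ht {hrot} => [|y t] //= /andP [_ /andP [yt _]].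
rewrite rcons_path => /andP [xy /andP [_ zx]] st ht.
have hz : last y t \in y :: t by rewrite mem_last.
have e : lab y = lab (last y t).
  rewrite (parent x y) ?ht ?mem_head //.
  by rewrite (parent x (last y t)) ?ht // adjC.
case: labD => hinj _ _; move/hinj: e => e.
by case: t yt st e {hz zx ht} => // w t yt _ /= e; rewrite e mem_last in yt.
Qed.

Section OrbitReps.
Hypothesis P_dynkin : dynkin P.
Variables (It : {set I}) (It_reps : orbit_reps It).

Lemma not_adj_tau i : cartan i (tau i) != -1.
Proof.
apply/negP => a; have ai := adj_neq a.
case: It_reps => [h|r lab _ L h|n lab hn L h|lab L h].
- by rewrite h eqxx in ai.
- have := adj_joined L a; rewrite h /joined => /orP [] /mapP [k _ [] /=]; lia.
- have := adj_joined L a; have := h i; case: L => hinj _ _.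
  case: eqP => [e1 e2|e1]; last case: eqP => [e2 e3|e2].
  + rewrite /joined e1 e2 /= !mem_rcons !inE !xpair_eqE.
    case/orP => /orP []; try lia; move=> /mapP [k]; rewrite mem_iota => hk []; lia.
  + rewrite /joined e2 e3 /= !mem_rcons !inE !xpair_eqE.
    case/orP => /orP []; try lia; move=> /mapP [k]; rewrite mem_iota => hk []; lia.
  + by move/hinj => e; rewrite e eqxx in ai.
- have := adj_joined L a; have := h i; case: (L) => hinj _ _.
  rewrite !inE; case: eqP => [-> ->|_] //=; case: eqP => [-> ->|_] //=.
  case: eqP => [-> ->|_] //=; case: eqP => [-> ->|_] //=.
  by move/hinj => e; rewrite e eqxx in ai.
Qed.

Lemma It_tau i : i \in It -> tau i \in It -> tau i = i.
Proof.
case: It_reps => [h|r lab _ L h|n lab hn L h|lab L h]; rewrite ?inE.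
- by move=> _ _; apply: h.
- rewrite h => h1 h2; case: L => hinj _ _; apply: hinj; rewrite h; lia.
- rewrite h => h1; case: eqP; first by lia.
  move=> _; case: eqP; first by lia.
  by move=> e1 _; case: L => hinj _ _; apply: hinj; rewrite h; do 2 (case: eqP; first by lia).
- rewrite h !inE => h1; case: eqP => [->|e1] //=; case: eqP => [e|e2] //=; first by rewrite e in h1.
  case: eqP => [->|e3] //=; case: eqP => [e|e4] //=; first by rewrite e in h1.
  move=> _; case: L => hinj _ _; apply: hinj; rewrite h !inE.
  by do 4 case: eqP => //.
Qed.

(** Representatives are chosen on one side of the symmetry axis, so that for free
    orbits an edge between two orbits joins the chosen representatives. *)
Lemma It_not_adj i j : i \in It -> j \in It -> tau i != i -> tau j != j -> cartan i (tau j) != -1.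
Proof.
move=> hi hj ti tj; apply/negP => a.
case: It_reps hi hj => [h|r lab _ L h|n lab hn L h|lab L h]; rewrite ?inE => hi hj.
- by rewrite h eqxx in ti.
- have := adj_joined L a; rewrite h /joined.
  have hl k : tau k != k -> lab k != 0.
    apply: contra_neq => e; case: L => hinj _ _; apply: hinj; rewrite h; lia.
  by have := hl _ ti; have := hl _ tj; move=> ? ? /orP [] /mapP [k _ [] /=]; lia.
- have hl k : (lab k <= n%:Z - 1)%R -> tau k != k -> lab k = n%:Z - 1.
    move=> hk; apply: contra_neqP; case: L => hinj _ _ e; apply: hinj; rewrite h.
    case: eqP; first by lia.
    by move=> _; case: eqP.
  have e : i = j by case: L => hinj _ _; apply: hinj; rewrite (hl i) // (hl j).
  by move: a; rewrite e (negPf (not_adj_tau j)).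
- have hl k : (lab k <= 4)%R -> tau k != k -> lab k \in [:: 1; 2].
    move=> hk; apply: contraNT; rewrite !inE => e; apply/eqP; case: L => hinj _ _; apply: hinj.
    rewrite h !inE.
    by move: e hk; case: (lab k =P 1); case: (lab k =P 2); case: (lab k =P 5); case: (lab k =P 6) => /= *; lia.
  have := adj_joined L a; rewrite h.
  by have := hl _ hi ti; have := hl _ hj tj; rewrite !inE; case/orP => /eqP ->; case/orP => /eqP ->.
Qed.

End OrbitReps.
End QuiverFacts.

(** * Identities between few letters *)

(** The computations behind the relations between the T_i(b_j), freed from the
    quiver.  Letters stand for the b_j; z, zx, zy, ... for the coefficients of the
    corrected Serre relations, which are central; ki, kp, kx, ... for the torus
    elements k_j / (q - q^-1), which makes all coefficients lie in Z[q, q^-1]. *)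
Section LocalIdentities.
Variables (K : fieldType) (A : algType K) (q : K).
Hypotheses (q0 : q != 0) (q2 : q + q^-1 != 0).
Local Notation serre x y := (x * x * y - (q + q^-1) *: (x * y * x) + y * x * x).
Local Notation br x y := (x * y - q *: (y * x)).

(** x is a neighbour of i, and [br x i] is T_i(b_x) unless x is adjacent to tau i and
    tau i <> i; y is a second neighbour, and m is a neighbour of x that is not
    adjacent to i. *)
Section Fixed.
Variables (i x z zx : A).
Hypotheses (zi : z * i = i * z) (zX : z * x = x * z)
  (zxi : zx * i = i * zx) (zxx : zx * x = x * zx) (zzx : z * zx = zx * z).
Hypotheses (Six : serre i x = q *: (z * x)) (Sxi : serre x i = q *: (zx * i)).

Lemma fixed_serre_nbr_self : serre (br x i) i = q *: (- q ^+ 2 *: (zx * z) * i).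
Proof. NC.nc 2%N 5%N q q0 q2 [:: z; zx; i; x] (zi, zX, zxi, zxx, zzx, Six, Sxi). Qed.

Lemma fixed_serre_self_nbr : serre i (br x i) = q *: (z * br x i).
Proof. NC.nc 2%N 5%N q q0 q2 [:: z; zx; i; x] (zi, zX, zxi, zxx, zzx, Six, Sxi). Qed.

Lemma fixed_nbr_inv V : V * z = 1 -> V * i = i * V -> V * x = x * V ->
  - q ^- 2 *: (V * i) * br x i - q *: (br x i * (- q ^- 2 *: (V * i))) = x.
Proof.
move=> zV Vi Vx.
NC.nc 3%N 4%N q q0 q2 [:: V; z; zx; i; x] (zi, zX, zxi, zxx, zzx, zV, Vi, Vx, Six, Sxi).
Qed.

Section Nbr2.
Variables (y zy : A).
Hypotheses (zY : z * y = y * z) (zxy : zx * y = y * zx) (zyi : zy * i = i * zy)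
  (zyx : zy * x = x * zy) (zyy : zy * y = y * zy) (zzy : z * zy = zy * z)
  (zxzy : zx * zy = zy * zx).
Hypotheses (Siy : serre i y = q *: (z * y)) (Syi : serre y i = q *: (zy * i)).

Lemma fixed_nbrs_comm : x * y = y * x -> br x i * br y i = br y i * br x i.
Proof.
move=> xy.
NC.nc 3%N 5%N q q0 q2 [:: z; zx; zy; x; i; y] (zi, zX, zxi, zxx, zzx, zY, zxy, zyi, zyx, zyy, zzy, zxzy, xy, Six, Sxi, Siy, Syi).
Qed.
End Nbr2.

Section Far.
Variables (m zm : A).
Hypotheses (zM : z * m = m * z) (zxm : zx * m = m * zx) (zmi : zm * i = i * zm)
  (zmx : zm * x = x * zm) (zmm : zm * m = m * zm) (zzm : z * zm = zm * z)
  (zxzm : zx * zm = zm * zx).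
Hypotheses (Sxm : serre x m = q *: (zx * m)) (Smx : serre m x = q *: (zm * x)).
Hypothesis im : i * m = m * i.

Lemma fixed_serre_nbr_far : serre (br x i) m = q *: (- q ^+ 2 *: (zx * z) * m).
Proof.
NC.nc 3%N 6%N q q0 q2 [:: z; zx; zm; i; x; m] (zi, zX, zxi, zxx, zzx, zM, zxm, zmi, zmx, zmm, zzm, zxzm, im, Six, Sxi, Sxm, Smx).
Qed.

Lemma fixed_serre_far_nbr : serre m (br x i) = q *: (zm * br x i).
Proof.
NC.nc 3%N 6%N q q0 q2 [:: z; zx; zm; i; x; m] (zi, zX, zxi, zxx, zzx, zM, zxm, zmi, zmx, zmm, zzm, zxzm, im, Six, Sxi, Sxm, Smx).
Qed.
End Far.
End Fixed.

(** x and y are exchanged by tau, with common neighbour i. *)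
Section FixedPair.
Variables (i x y z kx ky : A).
Hypotheses (zi : z * i = i * z) (zX : z * x = x * z) (zY : z * y = y * z)
  (kxi : kx * i = i * kx) (kyi : ky * i = i * ky)
  (kxx : kx * x = q ^- 2 *: (x * kx)) (kxy : kx * y = q ^+ 2 *: (y * kx))
  (kyx : ky * x = q ^+ 2 *: (x * ky)) (kyy : ky * y = q ^- 2 *: (y * ky))
  (kxky : kx * ky = ky * kx) (zkx : z * kx = kx * z) (zky : z * ky = ky * z).
Hypotheses (Six : serre i x = q *: (z * x)) (Sxi : serre x i = 0)
   (Siy : serre i y = q *: (z * y)) (Syi : serre y i = 0).
Hypothesis xy : x * y - y * x = ky - kx.

Lemma fixed_nbrs_pair : br x i * br y i - br y i * br x i = - q ^+ 2 *: (ky * z) - (- q ^+ 2 *: (kx * z)).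
Proof.
NC.nc 3%N 5%N q q0 q2 [:: z; kx; ky; x; i; y] (zi, zX, zY, kxi, kyi, kxx, kxy, kyx, kyy, kxky, zkx, zky, xy, Six, Sxi, Siy, Syi).
Qed.
End FixedPair.

Lemma serre_qcomm (i x : A) : serre i x = 0 -> i * br x i = q *: (br x i * i).
Proof. move=> Six. NC.nc 0%N 3%N q q0 q2 [:: x; i] Six. Qed.

(** i and p are exchanged by tau; x is adjacent to i only, y to p only, c is fixed
    and adjacent to both, and l is a neighbour of one of c, i and p. *)
Section Free.
Variables (i p ki kp : A).
Hypotheses (kii : ki * i = q ^- 2 *: (i * ki)) (kip : ki * p = q ^+ 2 *: (p * ki))
  (kpi : kp * i = q ^+ 2 *: (i * kp)) (kpp : kp * p = q ^- 2 *: (p * kp))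
  (kikp : ki * kp = kp * ki) (ip : i * p - p * i = kp - ki).

Section N1.
Variable x : A.
Hypotheses (kix : ki * x = q *: (x * ki)) (kpx : kp * x = q^-1 *: (x * kp)) (xp : x * p = p * x)
  (Six : serre i x = 0) (Sxi : serre x i = 0).

Lemma free_leg_bracket : br x i * p - p * br x i = (q - q^-1) *: (ki * x).
Proof.
NC.nc 2%N 3%N q q0 q2 [:: ki; kp; x; i; p] (kii, kip, kpi, kpp, kikp, ip, kix, kpx, xp).
Qed.

Section N1V.
Variable Vi : A.
Hypotheses (Vii : Vi * i = q ^+ 2 *: (i * Vi)) (Vip : Vi * p = q ^- 2 *: (p * Vi))
  (Vix : Vi * x = q^-1 *: (x * Vi)) (Viki : Vi * ki = ki * Vi) (Vikp : Vi * kp = kp * Vi).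

Lemma free_serre_self_leg : serre (Vi * p) (br x i) = 0.
Proof.
NC.nc 3%N 5%N q q0 q2 [:: Vi; ki; kp; x; i; p] (kii, kip, kpi, kpp, kikp, ip, kix, kpx, xp, Vii, Vip, Vix, Viki, Vikp, Six, Sxi).
Qed.

Lemma free_serre_leg_self : serre (br x i) (Vi * p) = 0.
Proof.
NC.nc 3%N 5%N q q0 q2 [:: Vi; ki; kp; x; i; p] (kii, kip, kpi, kpp, kikp, ip, kix, kpx, xp, Vii, Vip, Vix, Viki, Vikp, Six, Sxi).
Qed.
End N1V.

Section N12x.
Variable y : A.
Hypotheses (kiy : ki * y = q^-1 *: (y * ki)) (kpy : kp * y = q *: (y * kp)) (yi : y * i = i * y)
  (Spy : serre p y = 0) (Syp : serre y p = 0).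

Lemma free_legs_comm : x * y = y * x -> br x i * br y p = br y p * br x i.
Proof.
move=> xy.
NC.nc 2%N 5%N q q0 q2 [:: ki; kp; x; i; p; y] (kii, kip, kpi, kpp, kikp, ip, kix, kpx, xp, kiy, kpy, yi, xy, Six, Sxi, Spy, Syp).
Qed.

Lemma free_legs_pair (kx ky : A) : kx * x = q ^- 2 *: (x * kx) -> kx * y = q ^+ 2 *: (y * kx) ->
  ky * x = q ^+ 2 *: (x * ky) -> ky * y = q ^- 2 *: (y * ky) ->
  kx * i = q *: (i * kx) -> kx * p = q^-1 *: (p * kx) ->
  ky * i = q^-1 *: (i * ky) -> ky * p = q *: (p * ky) ->
  kx * ky = ky * kx -> kx * ki = ki * kx -> kx * kp = kp * kx -> ky * ki = ki * ky -> ky * kp = kp * ky ->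
  x * y - y * x = ky - kx ->
  br x i * (p * y - q^-1 *: (y * p)) - (p * y - q^-1 *: (y * p)) * br x i =
  (q - q^-1) *: (ky * kp) - (q - q^-1) *: (kx * ki).
Proof.
move=> h1 h2 h3 h4 h5 h6 h7 h8 h9 h10 h11 h12 h13 xy.
NC.nc 4%N 5%N q q0 q2 [:: ki; kp; kx; ky; x; i; p; y] (kii, kip, kpi, kpp, kikp, ip, kix, kpx, xp, kiy, kpy, yi, h1, h2, h3, h4, h5, h6, h7, h8, h9, h10, h11, h12, h13, xy, Six, Sxi, Spy, Syp).
Qed.
End N12x.
End N1.

Section N12.
Variables (c zc : A).
Hypotheses (kic : ki * c = c * ki) (kpc : kp * c = c * kp)
  (zci : zc * i = i * zc) (zcp : zc * p = p * zc) (zcc : zc * c = c * zc)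
  (zcki : zc * ki = ki * zc) (zckp : zc * kp = kp * zc)
  (Sic : serre i c = 0) (Sci : serre c i = q *: (zc * i))
  (Spc : serre p c = 0) (Scp : serre c p = q *: (zc * p)).
Local Notation Phi := (- q^-1 *: br (br c i) p + (q - q^-1) *: (c * ki)).

Lemma free_center_sym : Phi = - q^-1 *: br (br c p) i + (q - q^-1) *: (c * kp).
Proof.
NC.nc 3%N 3%N q q0 q2 [:: zc; ki; kp; i; c; p] (kii, kip, kpi, kpp, kikp, ip, kic, kpc).
Qed.

Lemma free_serre_self_center : serre p Phi = 0.
Proof.
NC.nc 3%N 6%N q q0 q2 [:: zc; ki; kp; i; c; p] (kii, kip, kpi, kpp, kikp, ip, kic, kpc, zci, zcp, zcc, zcki, zckp, Sic, Sci, Spc, Scp).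
Qed.

Lemma free_serre_center_self : serre Phi p = q *: ((q - q^-1) ^+ 2 *: (zc * ki * kp) * p).
Proof.
NC.nc 3%N 7%N q q0 q2 [:: zc; ki; kp; i; c; p] (kii, kip, kpi, kpp, kikp, ip, kic, kpc, zci, zcp, zcc, zcki, zckp, Sic, Sci, Spc, Scp).
Qed.

Lemma free_leg_center_comm x : ki * x = q *: (x * ki) -> kp * x = q^-1 *: (x * kp) -> zc * x = x * zc ->
   x * p = p * x -> x * c = c * x -> serre i x = 0 -> serre x i = 0 -> br x i * Phi = Phi * br x i.
Proof.
move=> kix kpx zcx xp xc Six Sxi.
NC.nc 3%N 6%N q q0 q2 [:: zc; ki; kp; x; i; c; p] (kii, kip, kpi, kpp, kikp, ip, kic, kpc, zci, zcp, zcc, zcki, zckp, kix, kpx, zcx, xp, xc, Six, Sxi, Sic, Sci, Spc, Scp).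
Qed.

Lemma free_center_inv : - q^-1 *: br i (p * Phi - q *: (Phi * p)) + (q - q^-1) *: (ki * Phi) =
  (q - q^-1) ^+ 2 *: (ki * kp * c).
Proof.
NC.nc 3%N 6%N q q0 q2 [:: zc; ki; kp; i; c; p] (kii, kip, kpi, kpp, kikp, ip, kic, kpc, zci, zcp, zcc, zcki, zckp, Sic, Sci, Spc, Scp).
Qed.

Lemma mixed_tau_center : br p Phi = q^-1 * (q - q^-1) *: (ki * (c * p - q *: (p * c))).
Proof.
NC.nc 3%N 5%N q q0 q2 [:: zc; ki; kp; i; c; p] (kii, kip, kpi, kpp, kikp, ip, kic, kpc, zci, zcp, zcc, zcki, zckp, Sic, Sci, Spc, Scp).
Qed.

Local Notation sPhi := (- q^-1 *: (p * (i * c - q *: (c * i)) - q *: ((i * c - q *: (c * i)) * p)) + (q - q^-1) *: (kp * c)).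

Lemma mixed_sigma_center V : V * zc = 1 -> zc * V = 1 -> V * i = i * V -> V * p = p * V -> V * c = c * V -> V * ki = ki * V -> V * kp = kp * V ->
  - q^-1 *: br (br (- q ^- 2 *: (V * c)) (br i c)) (br p c)
     + (q - q^-1) *: (- q ^- 2 *: (V * c) * (- q ^+ 2 *: (ki * zc))) = sPhi.
Proof.
move=> zV Vz Vi Vp Vc Vki Vkp.
NC.nc 4%N 7%N q q0 q2 [:: V; zc; ki; kp; i; c; p] (kii, kip, kpi, kpp, kikp, ip, kic, kpc, zci, zcp, zcc, zcki, zckp, zV, Vz, Vi, Vp, Vc, Vki, Vkp, Sic, Sci, Spc, Scp).
Qed.

Lemma mixed_leg_far l : zc * l = l * zc -> l * c = c * l -> l * p = p * l -> ki * l = q *: (l * ki) -> kp * l = q^-1 *: (l * kp) ->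
   serre i l = 0 -> serre l i = 0 ->
  br (br l i) (c * p - q *: (p * c)) = br (br l (br i c)) p.
Proof.
move=> zl lc lp kil kpl Sil Sli.
NC.nc 3%N 5%N q q0 q2 [:: zc; ki; kp; l; i; c; p] (kii, kip, kpi, kpp, kikp, ip, kic, kpc, zci, zcp, zcc, zcki, zckp, zl, lc, lp, kil, kpl, Sil, Sli, Sic, Sci, Spc, Scp).
Qed.

Lemma mixed_tau_leg_far l : zc * l = l * zc -> l * c = c * l -> l * i = i * l -> kp * l = q *: (l * kp) -> ki * l = q^-1 *: (l * ki) ->
   serre p l = 0 -> serre l p = 0 ->
  (c * i - q *: (i * c)) * (p * l - q^-1 *: (l * p)) - q^-1 *: ((p * l - q^-1 *: (l * p)) * (c * i - q *: (i * c)))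
  = i * (br p c * l - q^-1 *: (l * br p c)) - q^-1 *: ((br p c * l - q^-1 *: (l * br p c)) * i).
Proof.
move=> zl lc lp kil kpl Sil Sli.
NC.nc 3%N 5%N q q0 q2 [:: zc; ki; kp; l; i; c; p] (kii, kip, kpi, kpp, kikp, ip, kic, kpc, zci, zcp, zcc, zcki, zckp, zl, lc, lp, kil, kpl, Sil, Sli, Sic, Sci, Spc, Scp).
Qed.

Lemma same_kind_center j j' kj kj' : kj * j = q ^- 2 *: (j * kj) -> kj * j' = q ^+ 2 *: (j' * kj) ->
   kj' * j = q ^+ 2 *: (j * kj') -> kj' * j' = q ^- 2 *: (j' * kj') ->
   kj * i = q *: (i * kj) -> kj * p = q^-1 *: (p * kj) -> kj' * i = q^-1 *: (i * kj') -> kj' * p = q *: (p * kj') ->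
   ki * j = q *: (j * ki) -> ki * j' = q^-1 *: (j' * ki) -> kp * j = q^-1 *: (j * kp) -> kp * j' = q *: (j' * kp) ->
   kj * c = c * kj -> kj' * c = c * kj' ->
   kj * ki = ki * kj -> kj' * ki = ki * kj' -> kj * kp = kp * kj -> kj' * kp = kp * kj' -> kj * kj' = kj' * kj ->
   j * j' - j' * j = kj' - kj -> j * c = c * j -> j' * c = c * j' -> j' * i = i * j' -> j * p = p * j ->
   - q^-1 *: br (br Phi j) j' + (q - q^-1) *: (Phi * kj) =
   - q^-1 *: br (br c (br i j)) (j' * p - q^-1 *: (p * j')) + (q - q^-1) ^+ 2 *: (c * (ki * kj)).
Proof.
move=> h1 h2 h3 h4 h5 h6 h7 h8 h9 h10 h11 h12 h13 h14 h15 h16 h17 h18 h19 h20 h21 h22 h23 h24.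
NC.nc 4%N 3%N q q0 q2 [:: ki; kp; kj; kj'; j; i; c; p; j'] (kii, kip, kpi, kpp, kikp, ip, kic, kpc, h1, h2, h3, h4, h5, h6, h7, h8, h9, h10, h11, h12, h13, h14, h15, h16, h17, h18, h19, h20, h21, h22, h23, h24).
Qed.

Section N12far.
Variables (l zl : A).
Hypotheses (li : l * i = i * l) (lp : l * p = p * l) (kil : ki * l = l * ki) (kpl : kp * l = l * kp)
  (zcl : zc * l = l * zc) (zll : zl * l = l * zl) (zlc : zl * c = c * zl) (zli : zl * i = i * zl)
  (zlp : zl * p = p * zl) (zlki : zl * ki = ki * zl) (zlkp : zl * kp = kp * zl) (zlzc : zl * zc = zc * zl)
  (Scl : serre c l = q *: (zc * l)) (Slc : serre l c = q *: (zl * c)).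

Lemma free_serre_center_far : serre Phi l = q *: ((q - q^-1) ^+ 2 *: (zc * ki * kp) * l).
Proof.
NC.nc 4%N 7%N q q0 q2 [:: zc; zl; ki; kp; l; i; c; p] (kii, kip, kpi, kpp, kikp, ip, kic, kpc, zci, zcp, zcc, zcki, zckp, li, lp, kil, kpl, zcl, zll, zlc, zli, zlp, zlki, zlkp, zlzc, Scl, Slc, Sic, Sci, Spc, Scp).
Qed.

Lemma free_serre_far_center : serre l Phi = q *: (zl * Phi).
Proof.
NC.nc 4%N 5%N q q0 q2 [:: zc; zl; ki; kp; l; i; c; p] (kii, kip, kpi, kpp, kikp, ip, kic, kpc, zci, zcp, zcc, zcki, zckp, li, lp, kil, kpl, zcl, zll, zlc, zli, zlp, zlki, zlkp, zlzc, Scl, Slc, Sic, Sci, Spc, Scp).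
Qed.

Lemma mixed_far_center : br (br l c) sPhi = br (br l Phi) c.
Proof.
NC.nc 4%N 6%N q q0 q2 [:: zc; zl; ki; kp; l; i; c; p] (kii, kip, kpi, kpp, kikp, ip, kic, kpc, zci, zcp, zcc, zcki, zckp, li, lp, kil, kpl, zcl, zll, zlc, zli, zlp, zlki, zlkp, zlzc, Scl, Slc, Sic, Sci, Spc, Scp).
Qed.
End N12far.
End N12.
End Free.

Lemma nested_qcomm (l i j : A) : l * j = j * l -> br (br l i) j = br l (br i j).
Proof. move=> lj. NC.nc 0%N 2%N q q0 q2 [:: l; i; j] lj. Qed.

Lemma nested_qcomm_inv (l p j : A) : l * j = j * l ->
  j * (p * l - q^-1 *: (l * p)) - q^-1 *: ((p * l - q^-1 *: (l * p)) * j) =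
  (j * p - q^-1 *: (p * j)) * l - q^-1 *: (l * (j * p - q^-1 *: (p * j))).
Proof. move=> lj. NC.nc 0%N 2%N q q0 q2 [:: l; p; j] lj. Qed.

End LocalIdentities.

(** * The relations and the formulas for the braid operators *)

Notation Serre q x y := (x * x * y - (q + q^-1) *: (x * y * x) + y * x * x).
Notation qcomm q x y := (x * y - q *: (y * x)).

(** The relations of U~^i are the case red = false, s = 1; those of U^i with
    parameters s are the case red = true.  The degenerate case s = 0 is the algebra
    on which the quantum group acts. *)
Record iota_data (P : iquiver) (L : fieldType) (q : L) (red : bool) (s : vert P -> L)
    (A : algType L) (b k kV : vert P -> A) : Prop := IotaData {
  io_kkV : forall i, k i * kV i = 1;
  io_kVk : forall i, kV i * k i = 1;
  io_kk : forall i j, k i * k j = k j * k i;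
  io_kb : forall i j, k i * b j = q ^ (cartan (tau i) j - cartan i j) *: (b j * k i);
  io_comm : forall i j, cartan i j = 0 -> j != tau i -> b i * b j = b j * b i;
  io_pair : forall i, tau i != i ->
    b i * b (tau i) - b (tau i) * b i = (s i / (q - q^-1)) *: (k (tau i) - k i);
  io_serre : forall i j, cartan i j = -1 ->
    Serre q (b i) (b j) = (if tau i == i then q * s i else 0) *: (k i * b j);
  io_red : red -> forall i, k i * k (tau i) = 1;
  io_red_fixed : red -> forall i, tau i = i -> k i = 1
}.

Definition good_iquiver P := dynkin P /\ forall i : vert P, cartan i (tau i) != -1.

Section Iota.
Variables (P : iquiver) (Pg : good_iquiver P).
Local Notation I := (vert P).
Implicit Types i j l x y : I.

Lemma cartanP i j : [\/ i = j, cartan i j = 0 | cartan i j = -1].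
Proof. by case: Pg => [[D [lab [_ L]]] _]; apply: cartan_cases L i j. Qed.

Lemma cartan_taui i : tau i != i -> cartan i (tau i) = 0.
Proof.
move=> ti; case: (cartanP i (tau i)) => // e; first by rewrite -e eqxx in ti.
by case: Pg => _ /(_ i); rewrite e.
Qed.

Lemma adj_neq' i j : cartan i j = -1 -> i != j.
Proof. by move=> e; apply: adj_neq; rewrite /adj e. Qed.

Lemma cartan0_neq i j : cartan i j = 0 -> i != j.
Proof. by apply: contra_eq_neq => ->; rewrite cartan_ii. Qed.

Lemma adj_tauE i j : adj (tau i) (tau j) = adj i j.
Proof. by rewrite /adj cartan_tau. Qed.

Lemma no_triangle i j l : cartan i j = -1 -> cartan i l = -1 -> cartan j l = -1 -> False.
Proof.
case: Pg => Pd _ ij il jl; have := no_cycle (s := [:: i; j; l]) Pd isT.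
rewrite /= !inE !negb_or (adj_neq' ij) (adj_neq' il) (adj_neq' jl) /= /adj ij jl.
by rewrite cartanC il => /(_ isT).
Qed.

(** Otherwise i - x - tau i - tau x is a square. *)
Lemma common_nbr_fixed i x : tau i != i -> cartan i x = -1 -> cartan i (tau x) = -1 -> tau x = x.
Proof.
move=> ti ix itx; apply/eqP; apply: contraT => tx.
case: Pg => Pd _; have := no_cycle (s := [:: i; x; tau i; tau x]) Pd isT.
have h : cartan (tau i) x = -1 by rewrite ctauL.
rewrite /= !inE !negb_or (adj_neq' ix) (adj_neq' itx) eq_sym ti eq_sym (adj_neq' h) /= eq_sym tx.
rewrite (inj_eq (inv_inj (@tauK P))) (adj_neq' ix) /=.
rewrite adj_tauE /adj (cartanC x) (cartanC (tau x)) h ix itx => /(_ isT).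
by [].
Qed.

(** Otherwise i - x - l - tau i - tau x - tau l is a hexagon. *)
Lemma no_hexagon i x l : tau i != i -> cartan i x = -1 -> cartan i (tau x) = 0 ->
  cartan i l = 0 -> cartan i (tau l) = -1 -> cartan x l = -1 -> False.
Proof.
move=> ti ix itx il itl xl.
have h : cartan (tau i) l = -1 by rewrite ctauL.
have h1 : cartan (tau i) x = 0 by rewrite ctauL.
have xtx : x != tau x by apply: contra_eqN itx => /eqP <-; rewrite ix.
have ltl : l != tau l by apply: contra_eqN il => /eqP ->; rewrite itl.
have xtl : x != tau l.
  by case: Pg => _ /(_ x); apply: contraNneq => e; rewrite e tauK -e xl.
have xti : x != tau i by apply: contra_eqN h1 => /eqP ->; rewrite cartan_ii.
have lti : l != tau i by rewrite eq_sym adj_neq'.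
have inj := inj_eq (inv_inj (@tauK P)).
case: Pg => Pd _; have := no_cycle (s := [:: i; x; l; tau i; tau x; tau l]) Pd isT.
rewrite /= !inE !negb_or (adj_neq' ix) (cartan0_neq il) (eq_sym i) ti (cartan0_neq itx) (adj_neq' itl).
rewrite (adj_neq' xl) xti xtx xtl lti ltl !inj (adj_neq' ix) (adj_neq' xl) (cartan0_neq il).
rewrite -[l == tau x]inj tauK eq_sym xtl /= !adj_tauE /adj ix xl (cartanC l) h (cartanC (tau l)) itl.
by move/(_ isT).
Qed.

Section Data.
Variables (L : fieldType) (q : L).
Hypotheses (q0 : q != 0) (q2 : q + q^-1 != 0) (q1 : q - q^-1 != 0).
Variables (A : algType L) (b k kV : I -> A).
Hypothesis h : iota_data q false (fun _ => 1) b k kV.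

(** With this normalization the commutator of b_i and b_(tau i) is a difference of
    two kap's, with no denominator. *)
Definition kap i := (q - q^-1)^-1 *: k i.
(** The coefficient of the corrected Serre relation, zero at free orbits; it is
    central in both cases. *)
Definition zz i := if tau i == i then k i else 0.

Lemma kE i : k i = (q - q^-1) *: kap i.
Proof. by rewrite scalerA mulfV // scale1r. Qed.

Lemma kap_b i j : kap i * b j = q ^ (cartan i (tau j) - cartan i j) *: (b j * kap i).
Proof. by rewrite -ctauL -scalerAl (io_kb h) scalerA mulrC -scalerA scalerAr. Qed.

Lemma k_b i j : k i * b j = q ^ (cartan i (tau j) - cartan i j) *: (b j * k i).
Proof. by rewrite -ctauL (io_kb h). Qed.

Lemma kapC i j : kap i * kap j = kap j * kap i.
Proof. by rewrite /kap -!scalerAl -!scalerAr (io_kk h). Qed.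

Lemma kV_k i j : kV i * k j = k j * kV i.
Proof.
rewrite -[LHS]mulr1 -(io_kkV h i) mulrA -(mulrA _ (k j)) (io_kk h) mulrA.
by rewrite (io_kVk h) mul1r.
Qed.

Lemma kV_kV i j : kV i * kV j = kV j * kV i.
Proof.
rewrite -[LHS]mulr1 -(io_kkV h i) mulrA -(mulrA _ (kV j)) kV_k mulrA.
by rewrite (io_kVk h) mul1r.
Qed.

Lemma kV_kap i j : kV i * kap j = kap j * kV i.
Proof. by rewrite /kap -!scalerAl -!scalerAr kV_k. Qed.

Lemma kV_b i j : kV i * b j = q ^ (cartan i j - cartan i (tau j)) *: (b j * kV i).
Proof.
have := congr1 (fun t : A => kV i * t * kV i) (k_b i j).
rewrite /= mulrA (io_kVk h) mul1r -scalerAr -scalerAl -!mulrA (io_kkV h) mulr1 => ->.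
by rewrite scalerA -expfzDr // addrA subrK subrr scale1r.
Qed.

Lemma pairE i : tau i != i -> b i * b (tau i) - b (tau i) * b i = kap (tau i) - kap i.
Proof. by move=> ti; rewrite (io_pair h) // mul1r scalerBr. Qed.

Lemma serreE i j : cartan i j = -1 -> Serre q (b i) (b j) = q *: (zz i * b j).
Proof.
move=> ij; rewrite (io_serre h) // mulr1 /zz; case: ifP => _ //.
by rewrite mul0r scale0r scaler0.
Qed.

Lemma serre0 i j : tau i != i -> cartan i j = -1 -> Serre q (b i) (b j) = 0.
Proof. by move=> /negPf ti ij; rewrite serreE // /zz ti mul0r scaler0. Qed.

Lemma zz_b i j : zz i * b j = b j * zz i.
Proof.
rewrite /zz; case: eqP => [ti|_]; last by rewrite mulr0 mul0r.
by rewrite k_b -ctauL ti subrr scale1r.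
Qed.

Lemma zz_k i j : zz i * k j = k j * zz i.
Proof. by rewrite /zz; case: ifP => _; rewrite ?mulr0 ?mul0r // (io_kk h). Qed.

Lemma zz_kap i j : zz i * kap j = kap j * zz i.
Proof. by rewrite /kap -scalerAl -scalerAr zz_k. Qed.

Lemma zz_zz i j : zz i * zz j = zz j * zz i.
Proof. by rewrite {2 3}/zz; case: ifP => _; rewrite ?mulr0 ?mul0r // zz_k. Qed.

Definition TB i j : A :=
  let c := cartan i j in
  let c' := cartan (tau i) j in
  if tau i == i then
    if j == i then - q ^- 2 *: (kV i * b i)
    else if c == -1 then qcomm q (b j) (b i)
    else b j
  else
    if j == i then - (kV i * b (tau i))
    else if j == tau i then - q ^+ 2 *: (kV (tau i) * b i)
    else if (c == -1) && (c' == 0) then qcomm q (b j) (b i)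
    else if (c == 0) && (c' == -1) then
      b (tau i) * b j - q^-1 *: (b j * b (tau i))
    else if (c == -1) && (c' == -1) then
      - q^-1 *: qcomm q (qcomm q (b j) (b i)) (b (tau i)) + b j * k i
    else b j.

Definition TK i j : A :=
  let c := cartan i j in
  let c' := cartan (tau i) j in
  if tau i == i then
    if j == i then q ^- 4 *: kV i
    else if c == -1 then - q ^+ 2 *: (k j * k i)
    else k j
  else
    if j == i then kV i
    else if j == tau i then kV (tau i)
    else if (c == -1) && (c' == 0) then k j * k i
    else if (c == 0) && (c' == -1) then k j * k (tau i)
    else if (c == -1) && (c' == -1) then k j * (k i * k (tau i))
    else k j.

Definition TKV i j : A :=
  let c := cartan i j in
  let c' := cartan (tau i) j in
  if tau i == i then
    if j == i then q ^+ 4 *: k i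
    else if c == -1 then - q ^- 2 *: (kV j * kV i)
    else kV j
  else
    if j == i then k i
    else if j == tau i then k (tau i)
    else if (c == -1) && (c' == 0) then kV j * kV i
    else if (c == 0) && (c' == -1) then kV j * kV (tau i)
    else if (c == -1) && (c' == -1) then kV j * (kV i * kV (tau i))
    else kV j.

(** The cases in the definition of T_i(b_j), with the impossible ones removed: in
    PosFree12 the vertex j is fixed because the graph has no square. *)
Variant position i j : Prop :=
| PosSelf of j = i
| PosTau of j = tau i & tau i != i
| PosFixed of tau i = i & j != i & cartan i j = -1
| PosFree1 of tau i != i & j != i & j != tau i & cartan i j = -1 & cartan i (tau j) = 0
| PosFree2 of tau i != i & j != i & j != tau i & cartan i j = 0 & cartan i (tau j) = -1
| PosFree12 of tau i != i & j != i & j != tau i & cartan i j = -1 & cartan i (tau j) = -1 & tau j = j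
| PosFar of j != i & j != tau i & cartan i j = 0 & cartan i (tau j) = 0.

Lemma positionP i j : position i j.
Proof.
have [->|ji] := eqVneq j i; first exact: PosSelf.
have [jti|jti] := eqVneq j (tau i).
  by apply: PosTau => //; rewrite -jti.
have c1 : cartan i j = 0 \/ cartan i j = -1.
  by case: (cartanP i j) => e; [rewrite e eqxx in ji|left|right].
have [ti|ti] := eqVneq (tau i) i.
  have e : cartan i (tau j) = cartan i j by rewrite -ctauL ti.
  by case: c1 => c1; [apply: PosFar => //; rewrite e | apply: PosFixed].
have c2 : cartan i (tau j) = 0 \/ cartan i (tau j) = -1.
  by case: (cartanP i (tau j)) => e; [rewrite e tauK eqxx in jti|left|right].
case: c1 c2 => c1 [] c2; [exact: PosFar|exact: PosFree2|exact: PosFree1|].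
by apply: PosFree12 => //; apply: common_nbr_fixed c2.
Qed.

Lemma posFixedE i j : tau i = i -> j != i -> cartan i j = -1 ->
  (TB i j = qcomm q (b j) (b i)) * (TK i j = - q ^+ 2 *: (k j * k i)) *
  (TKV i j = - q ^- 2 *: (kV j * kV i)).
Proof. by move=> ti /negPf ji c; rewrite /TB /TK /TKV ti eqxx ji c. Qed.

Lemma posSelfFixedE i : tau i = i ->
  (TB i i = - q ^- 2 *: (kV i * b i)) * (TK i i = q ^- 4 *: kV i) * (TKV i i = q ^+ 4 *: k i).
Proof. by move=> ti; rewrite /TB /TK /TKV ti !eqxx. Qed.

Lemma posSelfE i : tau i != i ->
  (TB i i = - (kV i * b (tau i))) * (TK i i = kV i) * (TKV i i = k i).
Proof. by move=> /negPf ti; rewrite /TB /TK /TKV ti !eqxx. Qed.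

Lemma posTauE i : tau i != i ->
  (TB i (tau i) = - q ^+ 2 *: (kV (tau i) * b i)) * (TK i (tau i) = kV (tau i)) * (TKV i (tau i) = k (tau i)).
Proof. by move=> /negPf ti; rewrite /TB /TK /TKV ti !eqxx. Qed.

Lemma posFree1E i j : tau i != i -> j != i -> j != tau i -> cartan i j = -1 -> cartan i (tau j) = 0 ->
  (TB i j = qcomm q (b j) (b i)) * (TK i j = k j * k i) * (TKV i j = kV j * kV i).
Proof. by move=> /negPf ti /negPf ji /negPf jti c c'; rewrite /TB /TK /TKV ti ji jti ctauL c c'. Qed.

Lemma posFree2E i j : tau i != i -> j != i -> j != tau i -> cartan i j = 0 -> cartan i (tau j) = -1 ->
  (TB i j = b (tau i) * b j - q^-1 *: (b j * b (tau i))) * (TK i j = k j * k (tau i)) * (TKV i j = kV j * kV (tau i)).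
Proof. by move=> /negPf ti /negPf ji /negPf jti c c'; rewrite /TB /TK /TKV ti ji jti ctauL c c'. Qed.

Lemma posFree12E i j : tau i != i -> j != i -> j != tau i -> cartan i j = -1 -> cartan i (tau j) = -1 ->
  (TB i j = - q^-1 *: qcomm q (qcomm q (b j) (b i)) (b (tau i)) + (q - q^-1) *: (b j * kap i)) *
  (TK i j = k j * (k i * k (tau i))) * (TKV i j = kV j * (kV i * kV (tau i))).
Proof.
move=> /negPf ti /negPf ji /negPf jti c c'; rewrite /TB /TK /TKV ti ji jti ctauL c c'.
by rewrite /= [(q - q^-1) *: _]scalerAr -kE.
Qed.

Lemma posFarE i j : j != i -> j != tau i -> cartan i j = 0 -> cartan i (tau j) = 0 ->
  (TB i j = b j) * (TK i j = k j) * (TKV i j = kV j).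
Proof.
by move=> /negPf ji /negPf jti c c'; rewrite /TB /TK /TKV ji jti ctauL c c'; case: ifP.
Qed.

End Data.
End Iota.

(** Names for TB and kap in sections where these abbreviate TB and kap at fixed
    arguments. *)
Notation TBof := TB.
Notation kapof := kap.

(** * The torus and the weights of the images *)

Section TIota.
Variables (P : iquiver) (Pg : good_iquiver P).
Local Notation I := (vert P).
Variables (L : fieldType) (q : L).
Hypotheses (q0 : q != 0) (q2 : q + q^-1 != 0) (q1 : q - q^-1 != 0).
Variables (A : algType L) (b k kV : I -> A).
Hypothesis h : iota_data q false (fun _ => 1) b k kV.
Local Notation TB := (TB q b k kV).
Local Notation TK := (TK q k kV).
Local Notation TKV := (TKV q k kV).
Local Notation Br x y := (qcomm q x y).
Implicit Types i j l m : I.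

Lemma TKK i j : (TK i j * TKV i j = 1) /\ (TKV i j * TK i j = 1).
Proof.
have nck l m : k l * kV l * (k m * kV m) = 1 by rewrite !(io_kkV h) mulr1.
have V l := io_kkV h l; have V' l := io_kVk h l.
have C l m := kV_k h l m; have C' l m := io_kk h l m.
have P2 l m : k l * k m * (kV l * kV m) = 1.
  by rewrite -mulrA (mulrA (k m)) -C -!mulrA V mulr1 V.
have P2' l m : kV l * kV m * (k l * k m) = 1.
  by rewrite -mulrA (mulrA (kV m)) C -!mulrA V' mulr1 V'.
case: (positionP Pg i j) => [->|-> ti|ti ji c|ti ji jt c c'|ti ji jt c c'|ti ji jt c c' _|ji jt c c'].
- have [ti|ti] := eqVneq (tau i) i; last by rewrite !(posSelfE q b k kV ti).
  rewrite !(posSelfFixedE q b k kV ti).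
  by rewrite -!scalerAl -!scalerAr !scalerA mulVf ?mulfV ?expf_neq0 // !scale1r.
- by rewrite !(posTauE q b k kV ti).
- rewrite !(posFixedE q b k kV ti ji c) -!scalerAl -!scalerAr !scalerA !mulrNN.
  by rewrite mulVf ?mulfV ?expf_neq0 // !scale1r P2 P2'.
- by rewrite !(posFree1E q b k kV ti ji jt c c') P2 P2'.
- by rewrite !(posFree2E q b k kV ti ji jt c c') P2 P2'.
- rewrite !(posFree12E q1 b k kV ti ji jt c c').
  have Ct : kV j * (k i * k (tau i)) = k i * k (tau i) * kV j.
    by rewrite mulrA C -mulrA C mulrA.
  have Ct' : kV i * kV (tau i) * k j = k j * (kV i * kV (tau i)).
    by rewrite -mulrA C mulrA C mulrA.
  rewrite -[k j * _ * _]mulrA (mulrA (k i * _)) -Ct -(mulrA (kV j)) P2 mulr1 V; split=> //.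
  by rewrite -mulrA (mulrA _ (k j)) Ct' -(mulrA (k j)) P2' mulr1 V'.
- by rewrite !(posFarE q b k kV ji jt c c').
Qed.

(** All that is needed about the subalgebra generated by the k's: being toral is
    preserved by products and holds for the inverses. *)
Definition toral (t : A) := forall y : A, (forall m, k m * y = y * k m) -> t * y = y * t.

Lemma toral_k i : toral (k i). Proof. by move=> y. Qed.
Lemma toral_kV i : toral (kV i).
Proof.
move=> y hy; rewrite -[LHS]mulr1 -(io_kkV h i) mulrA -(mulrA _ y) -hy mulrA.
by rewrite (io_kVk h) mul1r.
Qed.
Lemma toralM s t : toral s -> toral t -> toral (s * t).
Proof. by move=> hs ht y hy; rewrite -mulrA ht // mulrA hs // mulrA. Qed.
Lemma toralZ c s : toral s -> toral (c *: s).
Proof. by move=> hs y hy; rewrite -scalerAl hs // scalerAr. Qed.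

Lemma TK_toral i j : toral (TK i j).
Proof.
by case: (positionP Pg i j) => [->|-> ti|ti ji c|ti ji jt c c'|ti ji jt c c'|ti ji jt c c' _|ji jt c c'];
  [have [ti|ti] := eqVneq (tau i) i; [rewrite (posSelfFixedE q b k kV ti)|rewrite (posSelfE q b k kV ti)]
  |rewrite (posTauE q b k kV ti)|rewrite (posFixedE q b k kV ti ji c)|rewrite (posFree1E q b k kV ti ji jt c c')
  |rewrite (posFree2E q b k kV ti ji jt c c')|rewrite (posFree12E q1 b k kV ti ji jt c c')
  |rewrite (posFarE q b k kV ji jt c c')];
  repeat (apply: toralZ || apply: toralM || apply: toral_k || apply: toral_kV).
Qed.

Lemma TK_comm i j l : TK i j * TK i l = TK i l * TK i j.
Proof.
by apply: TK_toral => m; apply/esym; apply: TK_toral => m'; apply: (io_kk h).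
Qed.

Definition weighted (x : A) (w : I -> int) := forall m, k m * x = q ^ w m *: (x * k m).
(** The weight of b_l: conjugation by k_m multiplies it by q ^ chi l m. *)
Definition chi l m : int := cartan m (tau l) - cartan m l.

Lemma weighted_b l : weighted (b l) (chi l).
Proof. by move=> m; rewrite (k_b h). Qed.

Lemma weighted_eq x w w' : weighted x w -> (forall m, w m = w' m) -> weighted x w'.
Proof. by move=> hx e m; rewrite hx e. Qed.

Lemma weightedM x y w w' : weighted x w -> weighted y w' -> weighted (x * y) (fun m => w m + w' m).
Proof.
by move=> hx hy m; rewrite mulrA hx -scalerAl -(mulrA x (k m)) hy -scalerAr scalerA mulrA expfzDr.
Qed.

Lemma weightedD x y w : weighted x w -> weighted y w -> weighted (x + y) w.
Proof. by move=> hx hy m; rewrite mulrDr hx hy mulrDl scalerDr. Qed.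

Lemma weightedZ c x w : weighted x w -> weighted (c *: x) w.
Proof. by move=> hx m; rewrite -scalerAr hx -scalerAl !scalerA mulrC. Qed.

Lemma weightedN x w : weighted x w -> weighted (- x) w.
Proof. by rewrite -scaleN1r; apply: weightedZ. Qed.

Lemma weighted_toral t : toral t -> weighted t (fun=> 0).
Proof. by move=> ht m; rewrite expr0z scale1r ht // => m'; apply: (io_kk h). Qed.

Lemma weightedBr x y w w' : weighted x w -> weighted y w' ->
  weighted (Br x y) (fun m => w m + w' m).
Proof.
move=> hx hy; apply: weightedD; first exact: weightedM.
apply/weightedN/weightedZ; apply: weighted_eq (weightedM hy hx) _ => m; exact: addrC.
Qed.

Lemma chi_tau l m : chi (tau l) m = - chi l m.
Proof. by rewrite /chi tauK opprB. Qed.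

Lemma chi_taur l m : chi l (tau m) = - chi l m.
Proof. by rewrite /chi !ctauL tauK opprB. Qed.

Lemma weighted_TB i l : weighted (TB i l) (fun m => chi l m + chi l i * chi i m).
Proof.
have b_i := @weighted_b i; have b_l := @weighted_b l.
have b_t : weighted (b (tau i)) (fun m => - chi i m).
  by apply: weighted_eq (@weighted_b _) _ => m; rewrite chi_tau.
have ci0 : tau i = i -> forall m, chi i m = 0 by move=> ti m; rewrite /chi ti subrr.
case: (positionP Pg i l) => [->|-> ti|ti ji c|ti ji jt c c'|ti ji jt c c'|ti ji jt c c' _|ji jt c c'].
- have [ti|ti] := eqVneq (tau i) i.
    rewrite (posSelfFixedE q b k kV ti); apply: weightedZ.
    apply: weighted_eq (weightedM (weighted_toral (@toral_kV i)) b_i) _ => m /=.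
    by rewrite !ci0 // mulr0 addr0.
  rewrite (posSelfE q b k kV ti); apply: weightedN.
  apply: weighted_eq (weightedM (weighted_toral (@toral_kV i)) b_t) _ => m /=.
  by rewrite [chi i i]/chi cartan_ii (cartan_taui Pg ti); lia.
- rewrite (posTauE q b k kV ti); apply: weightedZ.
  apply: weighted_eq (weightedM (weighted_toral (@toral_kV _)) b_i) _ => m /=.
  by rewrite !chi_tau [chi i i]/chi cartan_ii (cartan_taui Pg ti); lia.
- rewrite (posFixedE q b k kV ti ji c); apply: weighted_eq (weightedBr b_l b_i) _ => m.
  by rewrite ci0 // mulr0.
- rewrite (posFree1E q b k kV ti ji jt c c'); apply: weighted_eq (weightedBr b_l b_i) _ => m.
  by rewrite [chi l i]/chi c c'; lia.
- have e m : chi l m + chi l i * chi i m = chi l m - chi i m.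
    by rewrite [chi l i]/chi c c'; lia.
  rewrite (posFree2E q b k kV ti ji jt c c'); apply: weightedD.
    by apply: weighted_eq (weightedM b_t b_l) _ => m; rewrite e; lia.
  apply/weightedN/weightedZ; apply: weighted_eq (weightedM b_l b_t) _ => m.
  by rewrite e; lia.
- have e m : chi l m + chi l i * chi i m = chi l m.
    by rewrite [chi l i]/chi c c'; lia.
  rewrite (posFree12E q1 b k kV ti ji jt c c'); apply: weightedD; apply: weightedZ.
    by apply: weighted_eq (weightedBr (weightedBr b_l b_i) b_t) _ => m; rewrite e; lia.
  apply: weighted_eq (weightedM b_l (weighted_toral (toralZ _ (@toral_k i)))) _ => m /=.
  by rewrite e addr0.
- rewrite (posFarE q b k kV ji jt c c').
  by apply: weighted_eq b_l _ => m; rewrite [chi l i]/chi c c'; lia.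
Qed.

Lemma weighted_kV x w i : weighted x w -> kV i * x = q ^ (- w i) *: (x * kV i).
Proof.
move=> hx; have := congr1 (fun t : A => kV i * t * kV i) (hx i).
rewrite /= mulrA (io_kVk h) mul1r -scalerAr -scalerAl -!mulrA (io_kkV h) mulr1 => ->.
by rewrite scalerA -expfzDr // addNr expr0z scale1r.
Qed.

Lemma TK_weighted i j x w : weighted x w -> (forall m, w (tau m) = - w m) ->
  TK i j * x = q ^ (w j + chi j i * w i) *: (x * TK i j).
Proof.
move=> hx hw; have w0 : tau i = i -> w i = 0 by move=> ti; have := hw i; rewrite ti; lia.
have hV m := weighted_kV m hx.
have kk m n : k m * k n * x = q ^ (w m + w n) *: (x * (k m * k n)).
  by rewrite -mulrA hx -scalerAr (mulrA (k m)) hx -scalerAl scalerA -mulrA -expfzDr // addrC.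
case: (positionP Pg i j) => [->|-> ti|ti ji c|ti ji jt c c'|ti ji jt c c'|ti ji jt c c' _|ji jt c c'].
- have [ti|ti] := eqVneq (tau i) i.
    by rewrite (posSelfFixedE q b k kV ti) -scalerAl hV w0 // oppr0 mulr0 addr0 expr0z !scale1r scalerAr.
  rewrite (posSelfE q b k kV ti) hV /chi cartan_ii (cartan_taui Pg ti); congr (q ^ _ *: _); lia.
- rewrite (posTauE q b k kV ti) hV !chi_tau /chi cartan_ii (cartan_taui Pg ti) hw; congr (q ^ _ *: _); lia.
- rewrite (posFixedE q b k kV ti ji c) -scalerAl kk scalerA -scalerAr scalerA mulrC.
  by rewrite w0 // mulr0.
- rewrite (posFree1E q b k kV ti ji jt c c') kk /chi c c'; congr (q ^ _ *: _); lia.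
- rewrite (posFree2E q b k kV ti ji jt c c') kk /chi c c' hw; congr (q ^ _ *: _); lia.
- rewrite (posFree12E q1 b k kV ti ji jt c c') -mulrA kk -scalerAr !mulrA hx -!scalerAl scalerA.
  by rewrite -!mulrA -expfzDr // /chi c c' hw; congr (q ^ _ *: _); lia.
- rewrite (posFarE q b k kV ji jt c c') hx /chi c c'; congr (q ^ _ *: _); lia.
Qed.

(** T_i(b_l) has the weight of b_l plus a multiple of that of b_i, by the formula of
    the restricted reflection, and T_i(k_j) changes in the dual way. *)
Lemma T_kb i j l : TK i j * TB i l = q ^ (cartan (tau j) l - cartan j l) *: (TB i l * TK i j).
Proof.
rewrite (TK_weighted i j (weighted_TB i l)); last first.
  by move=> m; rewrite !chi_taur; lia.
congr (q ^ _ *: _); rewrite ctauL -/(chi l j).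
have e1 : chi i j = chi j i by rewrite /chi -ctauL (cartanC (tau j)) (cartanC j).
have e2 : chi i i = if tau i == i then 0 else -2.
  by rewrite /chi cartan_ii; case: eqP => [->|/eqP /(cartan_taui Pg) ->]; rewrite ?cartan_ii.
have e3 : tau i = i -> chi j i = 0 by move=> ti; rewrite -e1 /chi ti subrr.
by rewrite e1 e2; case: eqP => [/e3 ->|_]; lia.
Qed.

End TIota.

(** * The images at a fixed vertex *)

Section TIota.
Variables (P : iquiver) (Pg : good_iquiver P).
Local Notation I := (vert P).
Variables (L : fieldType) (q : L).
Hypotheses (q0 : q != 0) (q2 : q + q^-1 != 0) (q1 : q - q^-1 != 0).
Variables (A : algType L) (b k kV : I -> A).
Hypothesis h : iota_data q false (fun _ => 1) b k kV.
Local Notation kap := (kap q k).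
Local Notation zz := (zz k).
Local Notation TB := (TB q b k kV).
Local Notation TK := (TK q k kV).
Local Notation Br x y := (qcomm q x y).
Local Notation Serre x y := (Serre q x y).
Implicit Types i j l x y : I.

Lemma nbE i x (m n : int) : cartan i x = m -> cartan i (tau x) = n ->
  (cartan i x = m) * (cartan x i = m) * (cartan i (tau x) = n) * (cartan x (tau i) = n).
Proof.
move=> e1 e2; have e3 : cartan x (tau i) = n by rewrite -ctauL cartanC.
by rewrite (cartanC x i) e1 e2 e3. Qed.

Lemma pairNbE i : tau i != i -> (cartan i i = 2) * (cartan i (tau i) = 0).
Proof. by move=> ti; rewrite cartan_ii (cartan_taui Pg ti). Qed.

(* Closes the hypotheses on torus letters of the local identities, once the Cartan
   entries in E are known. *)
Ltac torus E := by rewrite ?(kap_b h) ?(kV_b q0 h) ?ctauL ?tauK ?E ?subrr ?expr0z ?scale1r.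
Ltac loc E := first
  [ exact: (kapC h) | exact: (zz_b h) | exact: (zz_kap h) | exact: (zz_zz h)
  | exact: (kV_kap h) | exact: esym (zz_b h _ _) | torus E ].

Lemma far_comm i l : l != i -> l != tau i -> cartan i l = 0 -> cartan i (tau l) = 0 ->
  (b i * b l = b l * b i) * (b (tau i) * b l = b l * b (tau i)) *
  (k i * b l = b l * k i) * (kV i * b l = b l * kV i) * (kV (tau i) * b l = b l * kV (tau i)) *
  (kap i * b l = b l * kap i) * (kap (tau i) * b l = b l * kap (tau i)) * (k (tau i) * b l = b l * k (tau i)).
Proof.
move=> li lti c c'.
have c2 : cartan (tau i) l = 0 by rewrite ctauL.
have n2 : l != tau (tau i) by rewrite tauK.
rewrite (io_comm h c lti) (io_comm h c2 n2).
by rewrite !(k_b h) !(kV_b q0 h) !(kap_b h) !ctauL tauK c c' !subrr !expr0z !scale1r.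
Qed.

Lemma Br_comm (s t u : A) : s * u = u * s -> t * u = u * t -> Br s t * u = u * Br s t.
Proof.
move=> su tu; rewrite mulrBl mulrBr -scalerAl -scalerAr -!mulrA tu su !mulrA.
by rewrite su tu.
Qed.

Lemma comm_far i j l : l != i -> l != tau i -> cartan i l = 0 -> cartan i (tau l) = 0 ->
  cartan j l = 0 -> l != tau j -> TB i j * TB i l = TB i l * TB i j.
Proof.
move=> li lti c c' jl ltj; rewrite (posFarE q b k kV li lti c c').
have F := far_comm li lti c c'; have jl' := io_comm h jl ltj.
have linC (c1 c2 : L) (s t u : A) : s * u = u * s -> t * u = u * t ->
    (c1 *: s + c2 *: t) * u = u * (c1 *: s + c2 *: t).
  by move=> su tu; rewrite mulrDl mulrDr -!scalerAl -!scalerAr su tu.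
case: (positionP Pg i j) => [->|-> ti|ti ji e|ti ji jt e e'|ti ji jt e e'|ti ji jt e e' _|ji jt e e'].
- have [ti|ti] := eqVneq (tau i) i.
    by rewrite (posSelfFixedE q b k kV ti) -scalerAl -scalerAr -mulrA F mulrA F mulrA.
  by rewrite (posSelfE q b k kV ti) mulNr mulrN -mulrA F mulrA F mulrA.
- by rewrite (posTauE q b k kV ti) -scalerAl -scalerAr -mulrA F mulrA F mulrA.
- by rewrite (posFixedE q b k kV ti ji e) Br_comm // F.
- by rewrite (posFree1E q b k kV ti ji jt e e') Br_comm // F.
- rewrite (posFree2E q b k kV ti ji jt e e') mulrBl mulrBr -scalerAl -scalerAr -!mulrA jl' F !mulrA.
  by rewrite F jl'.
- rewrite (posFree12E q1 b k kV ti ji jt e e').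
  have e1 : Br (Br (b j) (b i)) (b (tau i)) * b l = b l * Br (Br (b j) (b i)) (b (tau i)).
    by apply: Br_comm; [apply: Br_comm => // | ]; rewrite F.
  have e2 : b j * kap i * b l = b l * (b j * kap i) by rewrite -mulrA F mulrA jl' mulrA.
  exact: linC.
- by rewrite (posFarE q b k kV ji jt e e').
Qed.

Lemma comm_nbrs i x y : cartan i x = -1 -> cartan i y = -1 -> cartan x y = 0 -> y != tau x ->
  Br (b x) (b i) * Br (b y) (b i) = Br (b y) (b i) * Br (b x) (b i).
Proof.
move=> ix iy xy yx; have [xi yi] : cartan x i = -1 /\ cartan y i = -1 by rewrite !(cartanC _ i).
apply: (@fixed_nbrs_comm L A q q0 q2 _ _ (zz i) (zz x) _ _ _ _ _ _ _ _ (zz y));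
  try exact: (zz_b h); try exact: (zz_zz h); try by rewrite (serreE h) ?xi ?yi.
exact: (io_comm h).
Qed.

Section NbrFar.
Variables i x l : I.
Hypotheses (ix : cartan i x = -1) (xl : cartan x l = -1) (il : cartan i l = 0) (lti : l != tau i).
Let xi : cartan x i = -1. Proof. by rewrite cartanC. Qed.
Let lx : cartan l x = -1. Proof. by rewrite cartanC. Qed.

Lemma serre_nbr_far : Serre (Br (b x) (b i)) (b l) = q *: (- q ^+ 2 *: (zz x * zz i) * b l).
Proof.
apply: (@fixed_serre_nbr_far L A q q0 q2 _ _ (zz i) (zz x) _ _ _ _ _ _ _ _ (zz l));
  try exact: (zz_b h); try exact: (zz_zz h); try by rewrite (serreE h) ?xi ?lx.
exact: (io_comm h).
Qed.

Lemma serre_far_nbr : Serre (b l) (Br (b x) (b i)) = q *: (zz l * Br (b x) (b i)).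
Proof.
apply: (@fixed_serre_far_nbr L A q q0 q2 _ _ (zz i) (zz x) _ _ _ _ _ _ _ _ (zz l));
  try exact: (zz_b h); try exact: (zz_zz h); try by rewrite (serreE h) ?xi ?lx.
exact: (io_comm h).
Qed.
End NbrFar.

Lemma SerreZ (c d : L) (u w : A) : Serre (c *: u) (d *: w) = (c ^+ 2 * d) *: Serre u w.
Proof.
rewrite scalerDr scalerBr -!scalerAl -!scalerAr -!scalerAl !scalerA.
by congr (_ *: _ - _ *: _ + _ *: _); rewrite expr2; ring.
Qed.

Section FixedI.
Variable i : I.
Hypothesis ti : tau i = i.

Lemma fixedNbE x : cartan i x = -1 -> (cartan i x = -1) * (cartan x i = -1) * (cartan i (tau x) = -1) * (cartan x (tau i) = -1).
Proof. by move=> c; apply: nbE => //; rewrite -ctauL ti. Qed.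

Lemma zzi : zz i = k i. Proof. by rewrite /zz ti eqxx. Qed.

Lemma pair_fixed x : tau x != x -> cartan i x = -1 ->
  TB i x * TB i (tau x) - TB i (tau x) * TB i x = (1 / (q - q^-1)) *: (TK i (tau x) - TK i x).
Proof.
move=> tx ix; have ex := fixedNbE ix.
have xi : x != i by rewrite eq_sym (adj_neq' ix).
have txi : tau x != i by rewrite -(inj_eq (inv_inj (@tauK P))) tauK ti.
have itx : cartan i (tau x) = -1 by rewrite ex.
rewrite !(posFixedE q b k kV ti xi ix) !(posFixedE q b k kV ti txi itx).
have ttx := pairNbE tx; have ttx' : tau (tau x) != tau x by rewrite tauK eq_sym.
have etx := fixedNbE itx.
rewrite (@fixed_nbrs_pair L A q q0 q2 (b i) (b x) (b (tau x)) (zz i) (kap x) (kap (tau x)));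
  try solve [loc (ti, ex, ttx)]; try by rewrite ?(serreE h) ?(serre0 h) ?ex ?etx.
- by rewrite zzi mul1r /kap -!scalerAl !scalerBr !scalerA ![_ * (q - _)^-1]mulrC.
- by rewrite (serre0 h tx) ?ex.
- by rewrite (serre0 h ttx') ?etx.
- exact: (pairE h).
Qed.

Lemma serre_self_fixed x : cartan i x = -1 ->
  Serre (TB i i) (TB i x) = q *: (TK i i * TB i x).
Proof.
move=> ix; have ex := fixedNbE ix; have xi : x != i by rewrite eq_sym (adj_neq' ix).
rewrite !(posSelfFixedE q b k kV ti) !(posFixedE q b k kV ti xi ix).
have kVi l : kV i * b l = b l * kV i by rewrite (kV_b q0 h) -ctauL ti subrr expr0z scale1r.
have e := @fixed_serre_self_nbr L A q q0 q2 (b i) (b x) (zz i) (zz x) (zz_b h _ _) (zz_b h _ _) (zz_b h _ _) (zz_b h _ _)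
  (zz_zz h _ _) (serreE h ix) (serreE h (ex.1.1.2 : cartan x i = -1)).
have -> : - q ^- 2 *: (kV i * b i) = kV i * (- q ^- 2 *: b i) by rewrite scalerAr.
have V2 : kV i * Br (b x) (b i) = Br (b x) (b i) * kV i.
  by apply/esym/Br_comm; rewrite kVi.
move: e V2; move: (Br _ _) => y e V2.
have -> : Serre (kV i * (- q ^- 2 *: b i)) y = (q ^- 2) ^+ 2 *: (kV i * kV i * Serre (b i) y).
  have := kVi i; move: (kV i) (b i) V2 => V u V2 Vu.
  NC.nc 1%N 3%N q q0 q2 [:: V; u; y] (V2, Vu).
rewrite e zzi -!scalerAr -!mulrA (mulrA (kV i) (k i)) (io_kVk h) mul1r -scalerAl scalerA scalerA.
by rewrite -exprVn -exprM mulrC exprVn.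
Qed.

Lemma serre_nbr_self x : cartan i x = -1 ->
  Serre (TB i x) (TB i i) = q *: (- q ^+ 2 *: (zz x * zz i) * TB i i).
Proof.
move=> ix; have ex := fixedNbE ix; have xi : x != i by rewrite eq_sym (adj_neq' ix).
rewrite !(posSelfFixedE q b k kV ti) !(posFixedE q b k kV ti xi ix).
have kVi l : kV i * b l = b l * kV i by rewrite (kV_b q0 h) -ctauL ti subrr expr0z scale1r.
have e := @fixed_serre_nbr_self L A q q0 q2 (b i) (b x) (zz i) (zz x) (zz_b h _ _) (zz_b h _ _) (zz_b h _ _) (zz_b h _ _)
  (zz_zz h _ _) (serreE h ix) (serreE h (ex.1.1.2 : cartan x i = -1)).
have V2 : kV i * Br (b x) (b i) = Br (b x) (b i) * kV i.
  by apply/esym/Br_comm; rewrite kVi.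
have Vz : zz x * kV i = kV i * zz x.
  by apply/esym; apply: (toral_kV h) => m; rewrite (zz_k h).
have Vz' : zz i * kV i = kV i * zz i.
  by apply/esym; apply: (toral_kV h) => m; rewrite (zz_k h).
move: e V2; move: (Br _ _) => y e V2.
have -> : Serre y (- q ^- 2 *: (kV i * b i)) = - q ^- 2 *: (kV i * Serre y (b i)).
  move: (kV i) (b i) V2 => V u V2.
  NC.nc 1%N 3%N q q0 q2 [:: V; u; y] (V2).
rewrite e; move: (kV i) (b i) (zz i) (zz x) Vz Vz' => V u z zx Vz Vz'.
NC.nc 0%N 3%N q q0 q2 [:: V; zx; z; u] (Vz, Vz').
Qed.

End FixedI.
End TIota.

(** * The images at a free orbit *)

Section TFree.
Variables (P : iquiver) (Pg : good_iquiver P).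
Local Notation I := (vert P).
Variables (L : fieldType) (q : L).
Hypotheses (q0 : q != 0) (q2 : q + q^-1 != 0) (q1 : q - q^-1 != 0).
Variables (A : algType L) (b k kV : I -> A).
Hypothesis h : iota_data q false (fun _ => 1) b k kV.
Local Notation kap := (kap q k).
Local Notation zz := (zz k).
Local Notation TB := (TB q b k kV).
Local Notation TK := (TK q k kV).
Local Notation Br x y := (qcomm q x y).
Local Notation Serre x y := (Serre q x y).
Implicit Types i j l x y : I.

Ltac torus E := by rewrite ?(kap_b h) ?(kV_b q0 h) ?ctauL ?tauK ?E ?subrr ?expr0z ?scale1r.
Ltac loc E := first
  [ exact: (kapC h) | exact: (zz_b h) | exact: (zz_kap h) | exact: (zz_zz h)
  | exact: (kV_kap h) | exact: esym (zz_b h _ _) | torus E ].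

Lemma kkE i j : k i * k j = (q - q^-1) ^+ 2 *: (kap i * kap j).
Proof. by rewrite (kE q1 k i) (kE q1 k j) -scalerAl -scalerAr scalerA. Qed.

Section FreeI.
Variable i : I.
Hypothesis ti : tau i != i.
Local Notation p := (tau i).
Let Ei := pairNbE Pg ti.

Lemma tti : tau p != p. Proof. by rewrite tauK eq_sym. Qed.

Lemma pair_i : b i * b p - b p * b i = kap p - kap i.
Proof. exact: (pairE h). Qed.

(** T_i on a neighbour of tau i is, up to a scalar, the formula of T_(tau i); this
    halves the number of cases. *)
Lemma free2Br y : b p * b y - q^-1 *: (b y * b p) = - q^-1 *: Br (b y) (b p).
Proof. by rewrite scalerBr scalerA mulNr mulVf // scaleN1r opprK scaleNr addrC. Qed.

Section OneLeg.
Variable x : I.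
Hypotheses (c : cartan i x = -1) (c' : cartan i (tau x) = 0).
Let ex := nbE c c'.

Lemma leg_neq : [/\ x != i, x != p & tau x != x].
Proof.
split.
- by rewrite eq_sym (adj_neq' c).
- by apply: contra_eqN c' => /eqP ->; rewrite tauK cartan_ii.
- by apply: contra_eqN c' => /eqP ->; rewrite c.
Qed.

Lemma leg_comm : b x * b p = b p * b x.
Proof. by apply/esym/(io_comm h); [rewrite ctauL|case: leg_neq; rewrite tauK]. Qed.

Lemma leg_serre : Serre (b i) (b x) = 0. Proof. exact: (serre0 h). Qed.
Lemma leg_serre' : Serre (b x) (b i) = 0.
Proof. by case: leg_neq => _ _ tx; rewrite (serre0 h) ?ex. Qed.

Lemma comm_tau_leg : kV p * b i * Br (b x) (b i) = Br (b x) (b i) * (kV p * b i).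
Proof.
have e := serre_qcomm q0 q2 leg_serre.
have V1 : kV p * b x = q *: (b x * kV p) by torus (Ei, ex).
have V2 : kV p * b i = q ^- 2 *: (b i * kV p) by torus (Ei, ex).
move: (kV p) V1 V2 e => V V1 V2 e.
NC.nc 1%N 3%N q q0 q2 [:: V; b x; b i] (V1, V2, e).
Qed.

Lemma serre_self_leg : Serre (kV i * b p) (Br (b x) (b i)) = 0.
Proof.
apply: (@free_serre_self_leg L A q q0 q2 (b i) (b p) (kap i) (kap p));
  try exact: leg_comm; try exact: leg_serre; try exact: leg_serre'; try exact: pair_i;
  loc (Ei, ex).
Qed.

Lemma serre_leg_self : Serre (Br (b x) (b i)) (kV i * b p) = 0.
Proof.
apply: (@free_serre_leg_self L A q q0 q2 (b i) (b p) (kap i) (kap p));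
  try exact: leg_comm; try exact: leg_serre; try exact: leg_serre'; try exact: pair_i;
  loc (Ei, ex).
Qed.

Lemma leg_inv : Br (b x) (b i) * b p - b p * Br (b x) (b i) = (q - q^-1) *: (kap i * b x).
Proof.
apply: (@free_leg_bracket L A q q0 q2 (b i) (b p) (kap i) (kap p));
  try exact: leg_comm; try exact: leg_serre; try exact: leg_serre'; try exact: pair_i;
  loc (Ei, ex).
Qed.

End OneLeg.

Lemma comm_legs x y : cartan i x = -1 -> cartan i (tau x) = 0 ->
  cartan p y = -1 -> cartan p (tau y) = 0 -> cartan x y = 0 -> y != tau x ->
  Br (b x) (b i) * Br (b y) (b p) = Br (b y) (b p) * Br (b x) (b i).
Proof.
move=> c c' d d' xy yx; have ex := nbE c c'; rewrite !ctauL tauK in d d'.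
have ey := nbE d' d; have yi : cartan y i = 0 by rewrite ey.
have [yni ynp ty] : [/\ y != i, y != p & tau y != y].
  split; first by apply: contra_eqN d' => /eqP ->; rewrite cartan_ii.
    by apply: contra_eqN d => /eqP ->; rewrite tauK cartan_ii.
  by apply: contra_eqN d' => /eqP e; rewrite -e d.
have py : cartan p y = -1 by rewrite ctauL.
have yp : cartan y p = -1 by rewrite ey.
case: (leg_neq c c') => _ _ tx.
apply: (@free_legs_comm L A q q0 q2 (b i) (b p) (kap i) (kap p));
  try exact: leg_comm; try exact: leg_serre; try exact: leg_serre'; try exact: pair_i;
  try loc (Ei, ex, ey).
- by apply: (io_comm h) => //; rewrite eq_sym -(inj_eq (inv_inj (@tauK P))) tauK.
- by rewrite (serre0 h) // tti.
- by rewrite (serre0 h).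
- exact: (io_comm h).
Qed.

Lemma pair_legs x : cartan i x = -1 -> cartan i (tau x) = 0 ->
  TB i x * TB i (tau x) - TB i (tau x) * TB i x = (1 / (q - q^-1)) *: (TK i (tau x) - TK i x).
Proof.
move=> c c'; have ex := nbE c c'; have [xi xp tx] := leg_neq c c'.
have txi : tau x != i by rewrite -(inj_eq (inv_inj (@tauK P))) tauK.
have txp : tau x != p by rewrite (inj_eq (inv_inj (@tauK P))).
have d : cartan i (tau (tau x)) = -1 by rewrite tauK.
rewrite !(posFree1E q b k kV ti xi xp c c') !(posFree2E q b k kV ti txi txp c' d).
have ttx : tau (tau x) != tau x by rewrite tauK eq_sym.
have Ex := pairNbE Pg tx.
have pt : cartan p (tau x) = -1 by rewrite ctauL tauK.
have tp : cartan (tau x) p = -1 by rewrite cartanC.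
have xti : cartan i (tau x) = 0 by [].
rewrite (@free_legs_pair L A q q0 q2 (b i) (b p) (kap i) (kap p) _ _ _ _ _ _ (b x) _ _ _ _ _ (b (tau x)) _ _ _ _ _ (kap x) (kap (tau x)));
  try exact: leg_comm; try exact: leg_serre; try exact: leg_serre'; try exact: pair_i;
  try loc (Ei, ex, Ex).
- by rewrite !kkE -!scalerBr scalerA mul1r expr2 mulKf.
- by apply/esym/(io_comm h) => //; rewrite eq_sym.
- by rewrite (serre0 h) // tti.
- by rewrite (serre0 h).
- exact: (pairE h).
Qed.

Lemma pair_self : TB i i * TB i p - TB i p * TB i i = (1 / (q - q^-1)) *: (TK i p - TK i i).
Proof.
rewrite !(posSelfE q b k kV ti) !(posTauE q b k kV ti).
have e1 : kV i * b i = q ^+ 2 *: (b i * kV i) by torus Ei.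
have e2 : kV i * b p = q ^- 2 *: (b p * kV i) by torus Ei.
have e3 : kV p * b i = q ^- 2 *: (b i * kV p) by torus Ei.
have e4 : kV p * b p = q ^+ 2 *: (b p * kV p) by torus Ei.
have e5 := kV_kV h i p.
have -> : - (kV i * b p) * (- q ^+ 2 *: (kV p * b i)) - (- q ^+ 2 *: (kV p * b i)) * - (kV i * b p)
   = - (kV i * (kV p * (b i * b p - b p * b i))).
  NC.nc 2%N 3%N q q0 q2 [:: kV i; kV p; b i; b p] (e1, e2, e3, e4, e5).
rewrite pair_i /kap -scalerBr -!scalerAr mulrBr mulrBr (io_kVk h) mulr1.
by rewrite mulrA e5 -mulrA (io_kVk h) mulr1 mul1r -scalerN opprB.
Qed.

Section Center.
Variable c : I.
Hypotheses (ic : cartan i c = -1) (tc : tau c = c).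
Let ic' : cartan i (tau c) = -1. Proof. by rewrite tc. Qed.
Let ec := nbE ic ic'.
Let ci : cartan c i = -1. Proof. by rewrite cartanC. Qed.
Let pc : cartan p c = -1. Proof. by rewrite ctauL. Qed.
Let cp : cartan c p = -1. Proof. by rewrite cartanC. Qed.
(** T_i(b_c) for a common neighbour c of i and tau i. *)
Definition Phi := - q^-1 *: Br (Br (b c) (b i)) (b p) + (q - q^-1) *: (b c * kap i).

Ltac center lem := apply: (@lem L A q q0 q2 (b i) (b p) (kap i) (kap p) _ _ _ _ _ _ (b c) (zz c));
  try exact: pair_i; try by [rewrite (serre0 h) // ?tti | rewrite (serreE h)]; try loc (Ei, ec).

(** Phi does not change when i and tau i are exchanged, so that each statement about
    one of them gives the one about the other. *)
Lemma Phi_sym : Phi = - q^-1 *: Br (Br (b c) (b p)) (b i) + (q - q^-1) *: (b c * kap p).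
Proof. center free_center_sym. Qed.

Lemma serre_p_Phi : Serre (b p) Phi = 0. Proof. center free_serre_self_center. Qed.
Lemma serre_Phi_p : Serre Phi (b p) = q *: ((q - q^-1) ^+ 2 *: (zz c * kap i * kap p) * b p).
Proof. center free_serre_center_self. Qed.
Lemma Phi_inv : - q^-1 *: Br (b i) (b p * Phi - q *: (Phi * b p)) + (q - q^-1) *: (kap i * Phi) =
  (q - q^-1) ^+ 2 *: (kap i * kap p * b c).
Proof. center free_center_inv. Qed.

Lemma comm_leg_Phi x : cartan i x = -1 -> cartan i (tau x) = 0 -> Br (b x) (b i) * Phi = Phi * Br (b x) (b i).
Proof.
move=> d d'; have ex := nbE d d'; have [xi xp tx] := leg_neq d d'.
have xc : cartan x c = 0.
  case: (cartanP Pg x c) => // e; first by rewrite e tc eqxx in tx.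
  by case: (no_triangle Pg d ic e).
center free_leg_center_comm; try exact: leg_comm; try exact: leg_serre; try exact: leg_serre'; try loc (Ei, ex, ec).
by apply: (io_comm h) => //; rewrite eq_sym -(inj_eq (inv_inj (@tauK P))) tauK tc cartan0_neq.
Qed.

Section CenterFar.
Variable l : I.
Hypotheses (cl : cartan c l = -1) (li : l != i) (lp : l != p) (il : cartan i l = 0) (il' : cartan i (tau l) = 0).
Let F := far_comm q0 h li lp il il'.
Let lc : cartan l c = -1. Proof. by rewrite cartanC. Qed.

Lemma serre_Phi_far : Serre Phi (b l) = q *: ((q - q^-1) ^+ 2 *: (zz c * kap i * kap p) * b l).
Proof. center free_serre_center_far; try exact: (esym (F.1.1.1.1.1.1.2)); try exact: (esym (F.1.1.1.1.1.1.1)); try by rewrite F. Qed.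

Lemma serre_far_Phi : Serre (b l) Phi = q *: (zz l * Phi).
Proof. center free_serre_far_center; try by rewrite F. Qed.
End CenterFar.
End Center.
End FreeI.
End TFree.

(** * The images satisfy the relations *)

Section TAll.
Variables (P : iquiver) (Pg : good_iquiver P).
Local Notation I := (vert P).
Variables (L : fieldType) (q : L).
Hypotheses (q0 : q != 0) (q2 : q + q^-1 != 0) (q1 : q - q^-1 != 0).
Variables (A : algType L) (b k kV : I -> A).
Hypothesis h : iota_data q false (fun _ => 1) b k kV.
Local Notation kap := (kap q k).
Local Notation zz := (zz k).
Local Notation TB := (TB q b k kV).
Local Notation TK := (TK q k kV).
Local Notation TKV := (TKV q k kV).
Local Notation Serre x y := (Serre q x y).
Implicit Types i j l x y : I.

Lemma SerreVl (V u y : A) : V * u = q ^- 2 *: (u * V) -> V * y = y * V ->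
  Serre (V * u) y = q ^+ 2 *: (V * V * Serre u y).
Proof. move=> e1 e2. NC.nc 1%N 3%N q q0 q2 [:: V; u; y] (e1, e2). Qed.

Lemma SerreVr (V u y : A) : V * y = y * V -> Serre y (V * u) = V * Serre y u.
Proof. move=> e1. NC.nc 1%N 3%N q q0 q2 [:: V; u; y] e1. Qed.

Lemma Serre0Z (c d : L) (u w : A) : Serre u w = 0 -> Serre (c *: u) (d *: w) = 0.
Proof. by rewrite SerreZ => ->; rewrite scaler0. Qed.

Lemma Serre0Zl (c : L) (u w : A) : Serre u w = 0 -> Serre (c *: u) w = 0.
Proof. by move=> e; rewrite -[w]scale1r Serre0Z. Qed.

Lemma Serre0Nl (u w : A) : Serre u w = 0 -> Serre (- u) w = 0.
Proof. by move=> e; rewrite -[- u]scaleN1r Serre0Zl. Qed.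

Lemma Serre0Nr (u w : A) : Serre u w = 0 -> Serre u (- w) = 0.
Proof. by move=> e; rewrite -[- w]scaleN1r -[u]scale1r Serre0Z. Qed.

Lemma SerreZr (d : L) (u w z : A) : Serre u w = q *: (z * w) -> Serre u (d *: w) = q *: (z * (d *: w)).
Proof.
by move=> e; rewrite -[X in Serre X _]scale1r SerreZ e expr1n mul1r scalerA -scalerAr scalerA mulrC.
Qed.

Section FreeI.
Variable i : I.
Hypothesis ti : tau i != i.
Local Notation p := (tau i).
Let Ei := pairNbE Pg ti.
Let tp := tti ti.

Lemma kVi_p : kV i * b p = q ^- 2 *: (b p * kV i).
Proof. by rewrite (kV_b q0 h) ?tauK ?Ei. Qed.

Lemma kVp_i : kV p * b i = q ^- 2 *: (b i * kV p).
Proof. by rewrite (kV_b q0 h) !ctauL ?tauK ?Ei. Qed.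

Section Center.
Variable c : I.
Hypotheses (ic : cartan i c = -1) (tc : tau c = c).
Let ic' : cartan i (tau c) = -1. Proof. by rewrite tc. Qed.

Lemma center_neq : c != i /\ c != p.
Proof.
by split; [rewrite eq_sym (adj_neq' ic)|apply: contraNneq ti => e; rewrite -[X in _ == X]tauK -e tc].
Qed.

Lemma TB_center : TB i c = Phi q b k i c.
Proof. by case: center_neq => ci cp; rewrite (posFree12E q1 b k kV ti ci cp ic ic'). Qed.

Lemma TK_center : TK i c = (q - q^-1) ^+ 2 *: (zz c * kap i * kap p).
Proof.
case: center_neq => ci cp; rewrite (posFree12E q1 b k kV ti ci cp ic ic').
by rewrite (kkE q1) -scalerAr mulrA /zz tc eqxx.
Qed.

Lemma Phi_toral t : toral k t -> t * Phi q b k i c = Phi q b k i c * t.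
Proof.
move=> ht; apply: ht => m; rewrite -TB_center (weighted_TB Pg q0 q2 q1 h).
by rewrite /chi tc !subrr mul0r addr0 expr0z scale1r.
Qed.

Lemma serre_self_center : Serre (kV i * b p) (Phi q b k i c) = 0.
Proof.
rewrite SerreVl ?kVi_p ?(serre_p_Phi Pg q0 q2 h) ?mulr0 ?scaler0 //.
exact: (Phi_toral (toral_kV h i)).
Qed.

Lemma serre_center_self : Serre (Phi q b k i c) (kV i * b p) = q *: (TK i c * (kV i * b p)).
Proof.
rewrite SerreVr ?(serre_Phi_p Pg q0 q2 h) //; last exact: (Phi_toral (toral_kV h i)).
rewrite -TK_center -scalerAr [kV i * (_ * _)]mulrA [kV i * TK i c](toral_kV h i) ?mulrA //.
by move=> m; rewrite (TK_toral Pg q1 h) // => m'; apply: (io_kk h).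
Qed.
End Center.
End FreeI.

Lemma Phi_tau i c : tau i != i -> cartan i c = -1 -> tau c = c -> Phi q b k (tau i) c = Phi q b k i c.
Proof. by move=> ti ic tc; rewrite (Phi_sym Pg q0 q2 h ti ic tc) /Phi tauK. Qed.

Lemma serre_tau_center i c : tau i != i -> cartan i c = -1 -> tau c = c ->
  Serre (kV (tau i) * b i) (Phi q b k i c) = 0.
Proof.
move=> ti ic tc; have := @serre_self_center (tau i) (tti ti) c.
by rewrite tauK (Phi_tau ti ic tc) ctauL tc; apply.
Qed.

Lemma serre_center_tau i c : tau i != i -> cartan i c = -1 -> tau c = c ->
  Serre (Phi q b k i c) (kV (tau i) * b i) = q *: (TK i c * (kV (tau i) * b i)).
Proof.
move=> ti ic tc; have := @serre_center_self (tau i) (tti ti) c.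
rewrite tauK (Phi_tau ti ic tc) ctauL tc => /(_ ic erefl) ->.
by rewrite !TK_center ?ctauL ?tc ?tti // tauK -!mulrA (kapC h).
Qed.

(** The analogue of zz for the images under T_i. *)
Definition zzT i j := if tau j == j then TK i j else 0.

Lemma zzT_free i j : tau j != j -> zzT i j = 0.
Proof. by rewrite /zzT => /negPf ->. Qed.

Lemma zzT_nbr i x : tau i = i -> cartan i x = -1 -> zzT i x = - q ^+ 2 *: (zz x * zz i).
Proof.
move=> ti ix; have xi : x != i by rewrite eq_sym (adj_neq' ix).
rewrite /zzT (posFixedE q b k kV ti xi ix) /zz ti eqxx; case: ifP => // _.
by rewrite mul0r scaler0.
Qed.

(** For each pair of positions of j and l relative to i, either one of the
    identities above applies or the pair would close a cycle in the graph. *)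
Lemma T_serre i j l : cartan j l = -1 -> Serre (TB i j) (TB i l) = q *: (zzT i j * TB i l).
Proof.
move=> jl; have lj : cartan l j = -1 by rewrite cartanC.
have [ti|ti] := eqVneq (tau i) i.
  have nT : tau i != i -> False by rewrite ti eqxx.
  case: (positionP Pg i j) => [ej|_ /nT //|_ ji ij|/nT //|/nT //|/nT //|ji jt ij ij'];
  case: (positionP Pg i l) => [el|_ /nT //|_ li il|/nT //|/nT //|/nT //|li lt il il'].
  - by rewrite ej el cartan_ii in jl.
  - by rewrite ej /zzT ti eqxx (serre_self_fixed q0 q2 h ti il).
  - by rewrite ej il in jl.
  - by rewrite el (serre_nbr_self q0 q2 h ti ij) zzT_nbr.
  - by case: (no_triangle Pg ij il jl).
  - rewrite zzT_nbr // (posFixedE q b k kV ti ji ij) !(posFarE q b k kV li lt il il').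
    exact: (serre_nbr_far q0 q2 h ij jl).
  - by rewrite el cartanC ij in jl.
  - rewrite /zzT (posFixedE q b k kV ti li il) !(posFarE q b k kV ji jt ij ij').
    exact: (serre_far_nbr q0 q2 h il lj).
  - rewrite /zzT !(posFarE q b k kV li lt il il') !(posFarE q b k kV ji jt ij ij').
    exact: (serreE h).
have nF : tau i = i -> False by move/eqP; apply/negP.
have zi : zz i = 0 by rewrite /zz (negPf ti).
have zp : zz (tau i) = 0 by rewrite /zz tauK eq_sym (negPf ti).
have N1 (u : A) : - u = -1 *: u by rewrite scaleN1r.
have inj := inj_eq (inv_inj (@tauK P)).
case: (positionP Pg i j) => [ej|ej _|/nF //|_ ji jt ij ij'|_ ji jt ij ij'|_ ji jt ij ij' tj|ji jt ij ij'];
case: (positionP Pg i l) => [el|el _|/nF //|_ li lt il il'|_ li lt il il'|_ li lt il il' tl|li lt il il'].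
- by rewrite ej el cartan_ii in jl.
- by rewrite ej el (cartan_taui Pg ti) in jl.
- rewrite zzT_free ?ej // mul0r scaler0 (posSelfE q b k kV ti) (posFree1E q b k kV ti li lt il il').
  exact/Serre0Nl/(serre_self_leg Pg q0 q2 h ti il il').
- by rewrite ej il in jl.
- rewrite zzT_free ?ej // mul0r scaler0 (posSelfE q b k kV ti) (TB_center ti il tl).
  exact/Serre0Nl/(serre_self_center ti il tl).
- by rewrite ej il in jl.
- by rewrite ej el ctauL (cartan_taui Pg ti) in jl.
- by rewrite ej el cartan_ii in jl.
- by rewrite ej ctauL il' in jl.
- rewrite zzT_free ?ej ?tauK 1?eq_sym // mul0r scaler0 (posTauE q b k kV ti) (posFree2E q b k kV ti li lt il il').
  rewrite free2Br // Serre0Z //.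
  have := @serre_self_leg _ Pg _ _ q0 q2 _ _ _ _ h (tau i) (tti ti) l.
  by rewrite tauK !ctauL tauK; apply.
- rewrite zzT_free ?ej ?tauK 1?eq_sym // mul0r scaler0 (posTauE q b k kV ti) (TB_center ti il tl).
  exact/Serre0Zl/(serre_tau_center ti il tl).
- by rewrite ej ctauL il' in jl.
- have [_ _ tj] := leg_neq ij ij'; rewrite zzT_free // mul0r scaler0 el.
  rewrite (posFree1E q b k kV ti ji jt ij ij') (posSelfE q b k kV ti).
  exact/Serre0Nr/(serre_leg_self Pg q0 q2 h ti ij ij').
- by rewrite el -ctauL cartanC ij' in jl.
- by case: (no_triangle Pg ij il jl).
- by case: (no_hexagon Pg ti ij ij' il il' jl).
- by case: (no_triangle Pg ij il jl).
- have [_ _ tj] := leg_neq ij ij'; rewrite zzT_free // mul0r scaler0.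
  rewrite (posFree1E q b k kV ti ji jt ij ij') !(posFarE q b k kV li lt il il').
  by rewrite (serre_nbr_far q0 q2 h ij jl) // zi mulr0 scaler0 mul0r scaler0.
- by rewrite el cartanC ij in jl.
- have tj : tau j != j by apply: contra_eqN ij' => /eqP ->; rewrite ij.
  rewrite zzT_free // mul0r scaler0 el (posTauE q b k kV ti) (posFree2E q b k kV ti ji jt ij ij').
  rewrite free2Br // Serre0Z //.
  have := @serre_leg_self _ Pg _ _ q0 q2 _ _ _ _ h (tau i) (tti ti) j.
  by rewrite tauK !ctauL tauK; apply.
- by case: (no_hexagon Pg ti il il' ij ij' lj).
- by case: (@no_triangle _ Pg (tau i) j l); rewrite ?ctauL.
- by case: (@no_triangle _ Pg (tau i) j l); rewrite ?ctauL.
- have tj : tau j != j by apply: contra_eqN ij' => /eqP ->; rewrite ij.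
  rewrite zzT_free // mul0r scaler0 (posFree2E q b k kV ti ji jt ij ij') !(posFarE q b k kV li lt il il').
  rewrite free2Br //; apply: Serre0Zl.
  by rewrite (serre_nbr_far q0 q2 h _ jl) ?ctauL ?tauK // zp mulr0 scaler0 mul0r scaler0.
- rewrite el (posSelfE q b k kV ti) /zzT tj eqxx (TB_center ti ij tj) N1.
  exact/SerreZr/(serre_center_self ti ij tj).
- rewrite el (posTauE q b k kV ti) /zzT tj eqxx (TB_center ti ij tj).
  exact/SerreZr/(serre_center_tau ti ij tj).
- by case: (no_triangle Pg ij il jl).
- by case: (@no_triangle _ Pg (tau i) j l); rewrite ?ctauL.
- by case: (no_triangle Pg ij il jl).
- rewrite /zzT tj eqxx (TK_center ti ij tj) (TB_center ti ij tj) !(posFarE q b k kV li lt il il').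
  exact: (serre_Phi_far Pg q0 q2 h ti ij tj).
- by rewrite el cartanC ij in jl.
- by rewrite el cartanC ctauL ij' in jl.
- rewrite /zzT (posFree1E q b k kV ti li lt il il') !(posFarE q b k kV ji jt ij ij').
  exact: (serre_far_nbr q0 q2 h il lj).
- rewrite /zzT (posFree2E q b k kV ti li lt il il') !(posFarE q b k kV ji jt ij ij') free2Br //.
  by apply: SerreZr; apply: (serre_far_nbr q0 q2 h); rewrite ?ctauL ?tauK.
- rewrite /zzT (TB_center ti il tl) !(posFarE q b k kV ji jt ij ij').
  exact: (serre_far_Phi Pg q0 q2 h ti il tl).
- rewrite /zzT !(posFarE q b k kV li lt il il') !(posFarE q b k kV ji jt ij ij').
  exact: (serreE h).
Qed.

Lemma comm_self_leg2 i y : tau i != i -> y != i -> y != tau i -> cartan i y = 0 -> cartan i (tau y) = -1 ->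
  TB i i * TB i y = TB i y * TB i i.
Proof.
move=> ti yi yp c c'; rewrite (posSelfE q b k kV ti) (posFree2E q b k kV ti yi yp c c') free2Br //.
have := @comm_tau_leg _ Pg _ _ q0 q2 _ _ _ _ h (tau i) (tti ti) y.
rewrite tauK !ctauL tauK => /(_ c' c) e.
by rewrite -!scalerAl -!scalerAr mulNr mulrN e.
Qed.

Lemma T_comm i j l : cartan j l = 0 -> l != tau j -> TB i j * TB i l = TB i l * TB i j.
Proof.
move=> jl ltj; have lj : cartan l j = 0 by rewrite cartanC.
have jtl : j != tau l by rewrite eq_sym -(inj_eq (inv_inj (@tauK P))) tauK.
have nb := comm_nbrs q0 q2 h.
have [ti|ti] := eqVneq (tau i) i.
  have nT : tau i != i -> False by rewrite ti eqxx.
  case: (positionP Pg i l) => [el|_ /nT //|_ li il|/nT //|/nT //|/nT //|li lt il il'];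
    last exact: (comm_far Pg q0 q1 h).
  - case: (positionP Pg i j) => [ej|_ /nT //|_ ji ij|/nT //|/nT //|/nT //|ji jt ij ij'].
    + by rewrite ej el.
    + by rewrite el cartanC ij in jl.
    + by apply/esym/(comm_far Pg q0 q1 h).
  - case: (positionP Pg i j) => [ej|_ /nT //|_ ji ij|/nT //|/nT //|/nT //|ji jt ij ij'].
    + by rewrite ej il in jl.
    + by rewrite (posFixedE q b k kV ti ji ij) (posFixedE q b k kV ti li il) nb.
    + by apply/esym/(comm_far Pg q0 q1 h).
have nF : tau i = i -> False by move/eqP; apply/negP.
have leg12 x y : x != i -> x != tau i -> cartan i x = -1 -> cartan i (tau x) = 0 ->
   y != i -> y != tau i -> cartan i y = 0 -> cartan i (tau y) = -1 -> cartan x y = 0 -> y != tau x ->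
   TB i x * TB i y = TB i y * TB i x.
  move=> xi xp ix ix' yi yp iy iy' xy yx.
  rewrite (posFree1E q b k kV ti xi xp ix ix') (posFree2E q b k kV ti yi yp iy iy') free2Br //.
  by rewrite -scalerAl -scalerAr (comm_legs Pg q0 q2 h ti ix ix') ?ctauL ?tauK.
have leg1c x c : x != i -> x != tau i -> cartan i x = -1 -> cartan i (tau x) = 0 ->
   cartan i c = -1 -> tau c = c -> TB i x * TB i c = TB i c * TB i x.
  move=> xi xp ix ix' ic tc.
  by rewrite (posFree1E q b k kV ti xi xp ix ix') (TB_center ti ic tc) (comm_leg_Phi Pg q0 q2 h ti ic tc ix ix').
have leg2c y c : y != i -> y != tau i -> cartan i y = 0 -> cartan i (tau y) = -1 ->
   cartan i c = -1 -> tau c = c -> TB i y * TB i c = TB i c * TB i y.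
  move=> yi yp iy iy' ic tc.
  rewrite (posFree2E q b k kV ti yi yp iy iy') (TB_center ti ic tc) free2Br //.
  have := @comm_leg_Phi _ Pg _ _ q0 q2 _ _ _ _ h (tau i) (tti ti) c.
  rewrite (Phi_tau ti ic tc) ctauL tc => /(_ ic erefl y); rewrite !ctauL tauK => /(_ iy' iy) e.
  by rewrite -scalerAl -scalerAr e.
have tau1 x : x != i -> x != tau i -> cartan i x = -1 -> cartan i (tau x) = 0 ->
   TB i (tau i) * TB i x = TB i x * TB i (tau i).
  move=> xi xp ix ix'; rewrite (posTauE q b k kV ti) (posFree1E q b k kV ti xi xp ix ix').
  by rewrite -scalerAl -scalerAr (comm_tau_leg Pg q0 q2 h ti ix ix').
case: (positionP Pg i l) => [el|el _|/nF //|_ li lt il il'|_ li lt il il'|_ li lt il il' tl|li lt il il'];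
  last exact: (comm_far Pg q0 q1 h);
case: (positionP Pg i j) => [ej|ej _|/nF //|_ ji jt ij ij'|_ ji jt ij ij'|_ ji jt ij ij' tj|ji jt ij ij'];
  try (by apply/esym/(comm_far Pg q0 q1 h)).
- by rewrite ej el.
- by rewrite ej el tauK eqxx in ltj.
- by rewrite el cartanC ij in jl.
- by rewrite el; apply/esym/comm_self_leg2.
- by rewrite el cartanC ij in jl.
- by rewrite ej el eqxx in ltj.
- by rewrite ej el.
- by rewrite el; apply/esym/tau1.
- by rewrite el cartanC ctauL ij' in jl.
- by rewrite el cartanC ctauL ij' in jl.
- by rewrite ej il in jl.
- by rewrite ej; apply: tau1.
- by rewrite (posFree1E q b k kV ti ji jt ij ij') (posFree1E q b k kV ti li lt il il') nb.
- by apply/esym/leg12.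
- by apply/esym/leg1c.
- by rewrite ej; apply: comm_self_leg2.
- by rewrite ej ctauL il' in jl.
- exact: leg12.
- rewrite (posFree2E q b k kV ti ji jt ij ij') (posFree2E q b k kV ti li lt il il') !free2Br //.
  by rewrite -!scalerAl -!scalerAr nb // ctauL.
- by apply/esym/leg2c.
- by rewrite ej il in jl.
- by rewrite ej ctauL il' in jl.
- exact: leg1c.
- exact: leg2c.
(* Two common neighbours of i and tau i would close a square. *)
- have [->//|jl'] := eqVneq j l.
  case: Pg => Pd _; have := no_cycle (s := [:: i; j; tau i; l]) Pd isT.
  have h1 : cartan (tau i) j = -1 by rewrite ctauL.
  have h2 : cartan (tau i) l = -1 by rewrite ctauL.
  rewrite /= !inE !negb_or eq_sym ji (eq_sym i (tau i)) ti eq_sym li jt jl' eq_sym lt /=.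
  by rewrite /adj ij (cartanC j) h1 h2 (cartanC l) il => /(_ isT).
Qed.

Lemma T_pair i j : tau j != j ->
  TB i j * TB i (tau j) - TB i (tau j) * TB i j = (1 / (q - q^-1)) *: (TK i (tau j) - TK i j).
Proof.
have flip x : TB i (tau x) * TB i (tau (tau x)) - TB i (tau (tau x)) * TB i (tau x) =
     (1 / (q - q^-1)) *: (TK i (tau (tau x)) - TK i (tau x)) ->
   TB i x * TB i (tau x) - TB i (tau x) * TB i x = (1 / (q - q^-1)) *: (TK i (tau x) - TK i x).
  by rewrite tauK -opprB => /(congr1 -%R); rewrite opprK -scalerN opprB.
move=> tj; case: (positionP Pg i j) => [ej|ej ti|ti ji ij|ti ji jt ij ij'|ti ji jt ij ij'|_ _ _ _ _ tj'|ji jt ij ij'].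
- by rewrite ej in tj *; apply: (pair_self Pg q0 q2 h tj).
- by apply: flip; rewrite ej tauK; apply: (pair_self Pg q0 q2 h ti).
- exact: (pair_fixed Pg q0 q2 h ti tj ij).
- exact: (pair_legs Pg q0 q2 q1 h ti ij ij').
- by apply: flip; apply: (pair_legs Pg q0 q2 q1 h ti) => //; rewrite tauK.
- by rewrite tj' eqxx in tj.
- have inj := inj_eq (inv_inj (@tauK P)).
  have tji : tau j != i by rewrite -inj tauK.
  have tjt : tau j != tau i by rewrite inj.
  have ij2 : cartan i (tau (tau j)) = 0 by rewrite tauK.
  by rewrite !(posFarE q b k kV ji jt ij ij') !(posFarE q b k kV tji tjt ij' ij2) (io_pair h).
Qed.

(** By this the formulas for T_i define an endomorphism of every algebra that is
    presented by the iota relations. *)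
Theorem T_iota i : iota_data q false (fun _ => 1) (TB i) (TK i) (TKV i).
Proof.
split=> //.
- by move=> j; case: (TKK Pg q0 q1 h i j).
- by move=> j; case: (TKK Pg q0 q1 h i j).
- exact: (TK_comm Pg q1 h).
- exact: (T_kb Pg q0 q2 q1 h).
- exact: T_comm.
- exact: T_pair.
- move=> j l jl; rewrite T_serre // /zzT; case: ifP => _; first by rewrite mulr1.
  by rewrite mul0r scale0r scaler0.
Qed.

End TAll.

(** * The inverse of a braid operator *)

(** The image of TB under the anti-involution b_j -> b_j, k_j -> k_(tau j). *)
Definition sTB (P : iquiver) (L : fieldType) (q : L) (A : algType L) (b k kV : vert P -> A)
   (i j : vert P) : A :=
  let c := cartan i j in
  let c' := cartan (tau i) j in
  if tau i == i then
    if j == i then - q ^- 2 *: (b i * kV i)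
    else if c == -1 then b i * b j - q *: (b j * b i)
    else b j
  else
    if j == i then - (b (tau i) * kV (tau i))
    else if j == tau i then - q ^+ 2 *: (b i * kV i)
    else if (c == -1) && (c' == 0) then b i * b j - q *: (b j * b i)
    else if (c == 0) && (c' == -1) then
      b j * b (tau i) - q^-1 *: (b (tau i) * b j)
    else if (c == -1) && (c' == -1) then
      - q^-1 *: (b (tau i) * (b i * b j - q *: (b j * b i)) - q *: ((b i * b j - q *: (b j * b i)) * b (tau i)))
        + k (tau i) * b j
    else b j.

Section Inverse.
Variables (P : iquiver) (Pg : good_iquiver P).
Local Notation I := (vert P).
Variables (L : fieldType) (q : L).
Hypotheses (q0 : q != 0) (q2 : q + q^-1 != 0) (q1 : q - q^-1 != 0).
Variables (A : algType L) (b k kV : I -> A).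
Hypothesis h : iota_data q false (fun _ => 1) b k kV.
Local Notation zz := (zz k).
Local Notation TB := (TB q b k kV).
Local Notation TK := (TK q k kV).
Local Notation TKV := (TKV q k kV).
Local Notation Br x y := (qcomm q x y).
Implicit Types i j l x y : I.

Lemma inv_fixed i x : tau i = i -> cartan i x = -1 -> TB i i * TB i x - q *: (TB i x * TB i i) = b x.
Proof.
move=> ti ix; have ex := fixedNbE ti ix; have xi : x != i by rewrite eq_sym (adj_neq' ix).
rewrite !(posSelfFixedE q b k kV ti) !(posFixedE q b k kV ti xi ix).
have kVi l : kV i * b l = b l * kV i by rewrite (kV_b q0 h) -ctauL ti subrr expr0z scale1r.
apply: (@fixed_nbr_inv L A q q0 q2 (b i) (b x) (zz i) (zz x) (zz_b h _ _) (zz_b h _ _) (zz_b h _ _) (zz_b h _ _)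
  (zz_zz h _ _) (serreE h ix) (serreE h (ex.1.1.2 : cartan x i = -1))) => //.
by rewrite zzi // (io_kVk h).
Qed.

Section Free.
Variable i : I.
Hypothesis ti : tau i != i.
Local Notation p := (tau i).
Let Ei := pairNbE Pg ti.
Ltac torus E := by rewrite ?(kap_b h) ?(kV_b q0 h) ?ctauL ?tauK ?E ?subrr ?expr0z ?scale1r.

Lemma inv_leg x : cartan i x = -1 -> cartan i (tau x) = 0 ->
  - (kV i * b p) * Br (b x) (b i) - q *: (Br (b x) (b i) * - (kV i * b p)) = b x.
Proof.
move=> c c'; have ex := nbE c c'; have := leg_inv Pg q0 q2 h ti c c'.
have V1 : kV i * b x = q^-1 *: (b x * kV i) by torus (Ei, ex).
have V2 : kV i * b i = q ^+ 2 *: (b i * kV i) by torus (Ei, ex).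
rewrite [(q - q^-1) *: _]scalerAl -(kE q1) => e.
suff -> : - (kV i * b p) * Br (b x) (b i) - q *: (Br (b x) (b i) * - (kV i * b p)) =
    kV i * (Br (b x) (b i) * b p - b p * Br (b x) (b i)).
  by rewrite e mulrA (io_kVk h) mul1r.
NC.nc 1%N 3%N q q0 q2 [:: kV i; b x; b i; b p] (V1, V2).
Qed.

Lemma inv_center c : cartan i c = -1 -> tau c = c ->
  let i' := TB i i in let p' := TB i p in let c' := TB i c in
  - q^-1 *: (p' * (i' * c' - q *: (c' * i')) - q *: ((i' * c' - q *: (c' * i')) * p')) + TK i p * c' = b c.
Proof.
move=> ic tc /=; rewrite !(posSelfE q b k kV ti) !(posTauE q b k kV ti) (TB_center q1 b k kV ti ic tc).
have e := Phi_inv Pg q0 q2 h ti ic tc.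
have V1 : kV i * Phi q b k i c = Phi q b k i c * kV i by apply: (Phi_toral Pg q0 q2 q1 h ti ic tc (toral_kV h i)).
have V2 : kV p * Phi q b k i c = Phi q b k i c * kV p by apply: (Phi_toral Pg q0 q2 q1 h ti ic tc (toral_kV h p)).
have V3 : kV i * b p = q ^- 2 *: (b p * kV i) by torus Ei.
have V4 : kV p * b i = q ^- 2 *: (b i * kV p) by torus Ei.
have V5 : kV i * b i = q ^+ 2 *: (b i * kV i) by torus Ei.
have V6 : kV p * b p = q ^+ 2 *: (b p * kV p) by torus Ei.
have V7 := kV_kV h i p; have V8 := kV_k h i i.
have V9 := io_kVk h i; have V9' := io_kkV h i.
set F := Phi q b k i c in e V1 V2 *.
have {}e : - q^-1 *: Br (b i) (b p * F - q *: (F * b p)) + k i * F = k i * k p * b c.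
  by rewrite (kkE q1) -[RHS]scalerAl -e [(q - q^-1) *: (_ * F)]scalerAl -(kE q1).
have V10 : kV i * kV p * k i = kV p by rewrite -mulrA (kV_k h p i) mulrA V9 mul1r.
have -> : b c = kV i * kV p * (k i * k p * b c).
  by rewrite !mulrA V10 (io_kVk h) mul1r.
rewrite -e.
NC.nc 3%N 4%N q q0 q2 [:: kV i; kV p; k i; b i; b p; F] (V1, V2, V3, V4, V5, V6, V7, V10).
Qed.

End Free.

Lemma inv_leg1 i x : tau i != i -> x != i -> x != tau i -> cartan i x = -1 -> cartan i (tau x) = 0 ->
  TB i i * TB i x - q *: (TB i x * TB i i) = b x.
Proof.
move=> ti xi xp c c'; rewrite (posFree1E q b k kV ti xi xp c c') (posSelfE q b k kV ti).
exact: inv_leg.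
Qed.

Lemma inv_leg2 i y : tau i != i -> y != i -> y != tau i -> cartan i y = 0 -> cartan i (tau y) = -1 ->
  TB i y * TB i (tau i) - q^-1 *: (TB i (tau i) * TB i y) = b y.
Proof.
move=> ti yi yp c c'; rewrite (posFree2E q b k kV ti yi yp c c') (posTauE q b k kV ti) free2Br //.
have := @inv_leg (tau i) (tti ti) y; rewrite tauK !ctauL tauK => /(_ c' c) e.
rewrite -[RHS]e; move: (Br _ _) (kV _ * b i) => u w.
NC.nc 0%N 3%N q q0 q2 [:: u; w] tt.
Qed.

Lemma inv_self i : tau i = i -> - q ^- 2 *: (TB i i * TKV i i) = b i.
Proof.
move=> ti; rewrite !(posSelfFixedE q b k kV ti) -scalerAr -scalerAl !scalerA.
have kVi l : kV i * b l = b l * kV i by rewrite (kV_b q0 h) -ctauL ti subrr expr0z scale1r.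
rewrite kVi -(mulrA (b i)) (io_kVk h) mulr1; have -> : - q ^- 2 * q ^+ 4 * - q ^- 2 = 1 by field.
by rewrite scale1r.
Qed.

Lemma inv_self_free i : tau i != i -> - (TB i (tau i) * TKV i (tau i)) = b i.
Proof.
move=> ti; rewrite !(posTauE q b k kV ti) (kVp_i Pg q0 h ti) scalerA -scalerAl -mulrA (io_kVk h) mulr1.
by rewrite mulNr mulfV ?expf_neq0 // scaleN1r opprK.
Qed.

Lemma inv_tau_free i : tau i != i -> - q ^+ 2 *: (TB i i * TKV i i) = b (tau i).
Proof.
move=> ti; rewrite !(posSelfE q b k kV ti) (kVi_p Pg q0 h ti) mulNr -scalerAl -mulrA (io_kVk h) mulr1.
by rewrite -scaleNr scalerA mulrNN mulfV ?expf_neq0 // scale1r.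
Qed.

(** T_i undoes its transform by the anti-involution: for a vertex adjacent to
    one member of the orbit, the commutator with b_i is undone by the reversed
    commutator with T_i(b_i), which is k_i^-1 b_(tau i) up to a scalar. *)
Theorem T_sT i j : sTB q (TB i) (TK i) (TKV i) i j = b j.
Proof.
rewrite /sTB; have nF : tau i != i -> (tau i == i) = false by move/negPf.
case: (positionP Pg i j) => [->|-> ti|ti ji c|ti ji jt c c'|ti ji jt c c'|ti ji jt c c' tj|ji jt c c'].
- by rewrite eqxx; case: eqP => [/inv_self|/eqP /inv_self_free].
- by rewrite nF // eqxx inv_tau_free.
- by rewrite ti eqxx (negPf ji) c inv_fixed.
- by rewrite nF // (negPf ji) (negPf jt) ctauL c c' inv_leg1.
- by rewrite nF // (negPf ji) (negPf jt) ctauL c c' inv_leg2.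
- by rewrite nF // (negPf ji) (negPf jt) ctauL c c' /= inv_center.
- by rewrite (negPf ji) (negPf jt) ctauL c c' /= !(posFarE q b k kV ji jt c c'); case: ifP.
Qed.

End Inverse.

(** * Braid operators at orthogonal orbits *)

Section AlgHom.
Variables (L : fieldType) (A B : algType L) (f : A -> B).
Hypothesis hf : is_alg_hom f.

Lemma homD x y : f (x + y) = f x + f y.
Proof. by case: hf => lf _ _; have := lf 1 x y; rewrite !scale1r. Qed.
Lemma hom0 : f 0 = 0.
Proof. by have /eqP := homD 0 0; rewrite addr0 -subr_eq0 opprD addrA subrr sub0r oppr_eq0 => /eqP. Qed.
Lemma homZ c x : f (c *: x) = c *: f x.
Proof. by case: hf => lf _ _; have := lf c x 0; rewrite !addr0 hom0 addr0. Qed.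
Lemma homN x : f (- x) = - f x. Proof. by rewrite -scaleN1r homZ scaleN1r. Qed.
Lemma homB x y : f (x - y) = f x - f y. Proof. by rewrite homD homN. Qed.
Lemma homM x y : f (x * y) = f x * f y. Proof. by case: hf. Qed.
Lemma hom1 : f 1 = 1. Proof. by case: hf. Qed.
Definition homE := (homB, homD, homN, homM, homZ, hom1).

Lemma hom_TB (P : iquiver) (q : L) (b k kV : vert P -> A) i j :
  f (TB q b k kV i j) = TB q (f \o b) (f \o k) (f \o kV) i j.
Proof. by rewrite /TB /=; repeat case: ifP => _; rewrite ?homE. Qed.

Lemma hom_sTB (P : iquiver) (q : L) (b k kV : vert P -> A) i j :
  f (sTB q b k kV i j) = sTB q (f \o b) (f \o k) (f \o kV) i j.
Proof. by rewrite /sTB /=; repeat case: ifP => _; rewrite ?homE. Qed.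

Lemma hom_Phi (P : iquiver) (q : L) (b k : vert P -> A) i j :
  f (Phi q b k i j) = Phi q (f \o b) (f \o k) i j.
Proof. by rewrite /Phi /kap /= !homE. Qed.
End AlgHom.

Section Braid.
Variables (P : iquiver) (Pg : good_iquiver P).
Local Notation I := (vert P).
Variables (L : fieldType) (q : L).
Hypotheses (q0 : q != 0) (q2 : q + q^-1 != 0) (q1 : q - q^-1 != 0).
Variables (A : algType L) (b k kV : I -> A).
Hypothesis h : iota_data q false (fun _ => 1) b k kV.
Local Notation kap := (kap q k).
Local Notation TB := (TB q b k kV).
Local Notation TK := (TK q k kV).
Local Notation TKV := (TKV q k kV).
Implicit Types i j l x y : I.

(** f is T_i, seen on the generators; the algebra need not be U~^i itself, so that
    the same lemmas serve for the distinguished parameters. *)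
Record lifts_T i (f : A -> A) : Prop := LiftsT {
  lT_hom : is_alg_hom f;
  lT_b : forall l, f (b l) = TB i l;
  lT_k : forall l, f (k l) = TK i l;
  lT_kV : forall l, f (kV l) = TKV i l
}.

Definition far i l := [/\ l != i, l != tau i, cartan i l = 0 & cartan i (tau l) = 0].

Lemma far_tau i l : far i l -> far i (tau l).
Proof.
case=> li lt c c'; have inj := inj_eq (inv_inj (@tauK P)).
by split; rewrite ?tauK ?inj // -inj tauK.
Qed.

Lemma farC i l : far i l -> far l i.
Proof.
case=> li lt c c'; split; rewrite 1?eq_sym // ?(cartanC l) //.
  by rewrite -(inj_eq (inv_inj (@tauK P))) tauK.
by rewrite ctauL.
Qed.

Lemma lT_far i f l : lifts_T i f -> far i l -> [/\ f (b l) = b l, f (k l) = k l & f (kV l) = kV l].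
Proof.
by move=> hf [li lt c c']; rewrite !(lT_b hf, lT_k hf, lT_kV hf) !(posFarE q b k kV li lt c c').
Qed.

(** T_i(b_l) involves the generators of the orbit of i and b_l only, so a morphism
    that fixes these commutes with its formation. *)
Lemma TB_congr (b' k' kV' : I -> A) i l :
  b' i = b i -> b' (tau i) = b (tau i) -> k' i = k i -> kV' i = kV i -> kV' (tau i) = kV (tau i) ->
  b' l = b l -> TBof q b' k' kV' i l = TB i l.
Proof. by rewrite /TBof => -> -> -> -> -> ->. Qed.

Section Orth.
Variables (i j : I) (f g : A -> A).
Hypotheses (hf : lifts_T i f) (hg : lifts_T j g) (ij : far i j).
Let ji := farC ij.

Lemma orth_far l : far j l \/ l = i \/ l = tau i -> f (g (b l)) = g (f (b l)).
Proof.
move=> hl; have {hl} fl : far j l by case: hl => [//|[->|->]] //; apply: far_tau.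
have [gb _ _] := lT_far hg fl; rewrite gb (lT_b hf) (hom_TB (lT_hom hg)).
have [g1 g2 g3] := lT_far hg ji; have [g4 g5 g6] := lT_far hg (far_tau ji).
by rewrite TB_congr.
Qed.

End Orth.

(** The one case with content is a vertex adjacent to both orbits, where b_l is
    bracketed on the right by two commuting families of letters. *)
Lemma orth_braid i j f g : lifts_T i f -> lifts_T j g -> far i j -> forall l, f (g (b l)) = g (f (b l)).
Proof.
move=> hf hg ij l; have ji := farC ij.
have sym := orth_far hg hf ji; have dir := orth_far hf hg ij.
have [f1 f2 f3] := lT_far hf ij; have [f4 f5 f6] := lT_far hf (far_tau ij).
have [g1 g2 g3] := lT_far hg ji; have [g4 g5 g6] := lT_far hg (far_tau ji).
have kf : f (kap j) = kap j by rewrite (homZ (lT_hom hf)) f2.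
have kg : g (kap i) = kap i by rewrite (homZ (lT_hom hg)) g2.
have E1 := far_comm q0 h (let: And4 a _ _ _ := ij in a) (let: And4 _ a _ _ := ij in a) (let: And4 _ _ a _ := ij in a) (let: And4 _ _ _ a := ij in a).
have ij' := far_tau ij.
have E2 := far_comm q0 h (let: And4 a _ _ _ := ij' in a) (let: And4 _ a _ _ := ij' in a) (let: And4 _ _ a _ := ij' in a) (let: And4 _ _ _ a := ij' in a).
have E3 := far_comm q0 h (let: And4 a _ _ _ := ji in a) (let: And4 _ a _ _ := ji in a) (let: And4 _ _ a _ := ji in a) (let: And4 _ _ _ a := ji in a).
have ji' := far_tau ji.
have E4 := far_comm q0 h (let: And4 a _ _ _ := ji' in a) (let: And4 _ a _ _ := ji' in a) (let: And4 _ _ a _ := ji' in a) (let: And4 _ _ _ a := ji' in a).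
have e1 : b i * b j = b j * b i by rewrite E1.
have e2 : b (tau i) * b j = b j * b (tau i) by rewrite E1.
have e3 : b i * b (tau j) = b (tau j) * b i by rewrite E2.
have e4 : b (tau i) * b (tau j) = b (tau j) * b (tau i) by rewrite E2.
have e5 : kap i * b j = b j * kap i by rewrite E1.
have e6 : kap i * b (tau j) = b (tau j) * kap i by rewrite E2.
have e7 : kap j * b i = b i * kap j by rewrite E3.
have e8 : kap j * b (tau i) = b (tau i) * kap j by rewrite E4.
have e9 := kapC h i j.
rewrite !(lT_b hg, lT_b hf).
case: (positionP Pg i l) => [el|el _|ti li il|ti li lt il il'|ti li lt il il'|ti li lt il il' tl|li lt il il'];
  try (by rewrite -(lT_b hg) -(lT_b hf); apply: dir; auto);
  try (by rewrite -(lT_b hg) -(lT_b hf); apply/esym/sym; left; split);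
case: (positionP Pg j l) => [ej|ej _|tj lj jl|tj lj ljt jl jl'|tj lj ljt jl jl'|tj lj ljt jl jl' tl'|lj ljt jl jl'];
  try (by rewrite -(lT_b hg) -(lT_b hf); apply/esym/sym; auto);
  try (by rewrite -(lT_b hg) -(lT_b hf); apply: dir; left; split);
  rewrite ?(posFixedE q b k kV ti li il) ?(posFree1E q b k kV ti li lt il il')
    ?(posFree2E q b k kV ti li lt il il') ?(posFree12E q1 b k kV ti li lt il il')
    ?(posFixedE q b k kV tj lj jl) ?(posFree1E q b k kV tj lj ljt jl jl')
    ?(posFree2E q b k kV tj lj ljt jl jl') ?(posFree12E q1 b k kV tj lj ljt jl jl')
    ?(homE (lT_hom hf)) ?(homE (lT_hom hg)) ?f1 ?f4 ?f2 ?g1 ?g4 ?g2 -/(kap i) -/(kap j) !(lT_b hf, lT_b hg)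
    ?(posFixedE q b k kV ti li il) ?(posFree1E q b k kV ti li lt il il')
    ?(posFree2E q b k kV ti li lt il il') ?(posFree12E q1 b k kV ti li lt il il')
    ?(posFixedE q b k kV tj lj jl) ?(posFree1E q b k kV tj lj ljt jl jl')
    ?(posFree2E q b k kV tj lj ljt jl jl') ?(posFree12E q1 b k kV tj lj ljt jl jl');
  NC.nc 0%N 3%N q q0 q2 [:: kap i; kap j; b i; b (tau i); b j; b (tau j); b l] (e1, e2, e3, e4, e5, e6, e7, e8, e9).
Qed.

End Braid.

(** * The braid relation of length three *)

Section Braid.
Variables (P : iquiver) (Pg : good_iquiver P).
Local Notation I := (vert P).
Variables (L : fieldType) (q : L).
Hypotheses (q0 : q != 0) (q2 : q + q^-1 != 0) (q1 : q - q^-1 != 0).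
Variables (A : algType L) (b k kV : I -> A).
Hypothesis h : iota_data q false (fun _ => 1) b k kV.
Local Notation kap := (kap q k).
Local Notation TB := (TB q b k kV).
Local Notation TK := (TK q k kV).
Local Notation Br x y := (qcomm q x y).
Local Notation lifts_T := (lifts_T q b k kV).
Implicit Types i j l x y : I.

(** The adjacent pairs of orbits for which the product of reflections has order 3. *)
Definition same_kind i j :=
  cartan i j = -1 /\ ((tau i = i /\ tau j = j) \/ [/\ tau i != i, tau j != j & cartan i (tau j) = 0]).

Lemma same_kindC i j : same_kind i j -> same_kind j i.
Proof.
case=> c d; split; first by rewrite cartanC.
by case: d => [[? ?]|[? ? e]]; [left|right; split=> //; rewrite -ctauL cartanC].
Qed.

(** As s_i s_j sends alpha_i to alpha_j: T_j(b_i) is the commutator of b_i and b_j,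
    which T_i unravels by the formula for its inverse. *)
Lemma same_kind_shift i j f g : same_kind i j -> lifts_T i f -> lifts_T j g ->
  [/\ f (g (b i)) = b j, f (g (b (tau i))) = b (tau j), f (g (k i)) = k j,
      f (g (kV i)) = kV j & f (g (kV (tau i))) = kV (tau j)].
Proof.
case=> ij d hf hg; have ji : cartan j i = -1 by rewrite cartanC.
have nij := adj_neq' ij; have nji : j != i by rewrite eq_sym.
have fh := lT_hom hf; have gh := lT_hom hg.
have kVk := kV_k h; have kk := io_kk h; have k1 := io_kkV h; have k2 := io_kVk h.
have kVkV := kV_kV h.
have a1 : forall l m, kV l * (k m * k l) = k m by move=> l m; rewrite kk mulrA k2 mul1r.
have a2 : forall l m, k l * (kV m * kV l) = kV m by move=> l m; rewrite kVkV mulrA k1 mul1r.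
case: d => [[ti tj]|[ti tj ij']].
  rewrite ti tj !(lT_b hg, lT_k hg, lT_kV hg) !(posFixedE q b k kV tj nij ji).
  have -> : f (Br (b i) (b j)) = b j.
    by rewrite !(homE fh) !(lT_b hf) (inv_fixed q0 q2 h ti ij).
  rewrite !(homE fh) !(lT_k hf, lT_kV hf) !(posFixedE q b k kV ti nji ij) !(posSelfFixedE q b k kV ti).
  have -> : - q ^+ 2 *: (q ^- 4 *: kV i * (- q ^+ 2 *: (k j * k i))) = k j.
    rewrite -scalerAl -scalerAr a1 !scalerA; have -> : - q ^+ 2 * q ^- 4 * - q ^+ 2 = 1 by field.
    exact: scale1r.
  have -> : - q ^- 2 *: (q ^+ 4 *: k i * (- q ^- 2 *: (kV j * kV i))) = kV j.
    rewrite -scalerAl -scalerAr a2 !scalerA; have -> : - q ^- 2 * q ^+ 4 * - q ^- 2 = 1 by field.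
    exact: scale1r.
  by [].
have ji' : cartan j (tau i) = 0 by rewrite -ctauL cartanC.
have nijt : i != tau j by rewrite cartan0_neq.
have njit : j != tau i by rewrite cartan0_neq.
have inj := inj_eq (inv_inj (@tauK P)).
have n1 : tau i != j by rewrite eq_sym.
have n2 : tau i != tau j by rewrite inj.
have n3 : tau j != i by rewrite eq_sym.
have n4 : tau j != tau i by rewrite inj.
have c1 : cartan j (tau (tau i)) = -1 by rewrite tauK.
have c2 : cartan i (tau (tau j)) = -1 by rewrite tauK.
rewrite !(lT_b hg, lT_k hg, lT_kV hg) !(posFree1E q b k kV tj nij nijt ji ji').
rewrite !(posFree2E q b k kV tj n1 n2 ji' c1).
rewrite !(homE fh) !(lT_b hf, lT_k hf, lT_kV hf).
rewrite (inv_leg1 Pg q0 q2 q1 h ti nji njit ij ij') (inv_leg2 Pg q0 q2 q1 h ti n3 n4 ij' c2).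
rewrite !(posFree1E q b k kV ti nji njit ij ij') !(posFree2E q b k kV ti n3 n4 ij' c2).
by rewrite !(posSelfE q b k kV ti) !(posTauE q b k kV ti) a1 !a2.
Qed.

Lemma same_kind_self i j : same_kind i j ->
  forall b' k' kV' : I -> A, b' i = b j -> b' (tau i) = b (tau j) -> kV' i = kV j -> kV' (tau i) = kV (tau j) ->
  (TBof q b' k' kV' i i = TB j j) * (TBof q b' k' kV' i (tau i) = TB j (tau j)).
Proof.
case=> _ d b' k' kV' e1 e2 e3 e4; case: d => [[ti tj]|[ti tj _]].
  by rewrite ti tj !(posSelfFixedE q _ _ _ ti, posSelfFixedE q _ _ _ tj) e1 e3.
by rewrite !(posSelfE q _ _ _ ti, posSelfE q _ _ _ tj, posTauE q _ _ _ ti, posTauE q _ _ _ tj) e1 e2 e3 e4.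
Qed.

(** T_j T_i(b_l) is obtained from T_i(b_l) by replacing b_i with T_j(b_i), and T_i
    sends this letter to b_j.  What is left is a nested commutator of b_l, b_i, b_j
    that reassociates, because b_l and b_j commute. *)
Lemma same_kind_outer i j f g l : same_kind i j -> lifts_T i f -> lifts_T j g ->
  l != i -> l != tau i -> far j l -> f (g (f (b l))) = g (f (b l)).
Proof.
move=> sk hf hg li lt jl; have [s1 s2 s3 s4 s5] := same_kind_shift sk hf hg.
have fh := lT_hom hf; have gh := lT_hom hg.
have [g1 g2 g3] := lT_far hg jl.
have E := far_comm q0 h (let: And4 a _ _ _ := jl in a) (let: And4 _ a _ _ := jl in a) (let: And4 _ _ a _ := jl in a) (let: And4 _ _ _ a := jl in a).
have lj : b l * b j = b j * b l by rewrite E.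
have ltj : b l * b (tau j) = b (tau j) * b l by rewrite E.
case: sk => ij d; have ji : cartan j i = -1 by rewrite cartanC.
have nij := adj_neq' ij; have nji : j != i by rewrite eq_sym.
rewrite (lT_b hf); case: (positionP Pg i l) => [el|el _|ti _ il|ti _ _ il il'|ti _ _ il il'|ti _ _ il il' tl|_ _ il il'].
- by rewrite el eqxx in li.
- by rewrite el eqxx in lt.
- case: d => [[_ tj]|[/eqP //]].
  rewrite (posFixedE q b k kV ti li il) !(homE gh) !(homE fh) s1 g1 !(lT_b hf, lT_b hg).
  by rewrite (posFixedE q b k kV ti li il) (posFixedE q b k kV tj nij ji) (nested_qcomm q0 q2 _ lj).
- case: d => [[/eqP]|[_ tj ij']]; first by rewrite (negPf ti).
  have ji' : cartan j (tau i) = 0 by rewrite -ctauL cartanC.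
  have nijt : i != tau j by rewrite cartan0_neq.
  rewrite (posFree1E q b k kV ti li lt il il') !(homE gh) !(homE fh) s1 g1 !(lT_b hf, lT_b hg).
  by rewrite (posFree1E q b k kV ti li lt il il') (posFree1E q b k kV tj nij nijt ji ji') (nested_qcomm q0 q2 _ lj).
- case: d => [[/eqP]|[_ tj ij']]; first by rewrite (negPf ti).
  have ji' : cartan j (tau i) = 0 by rewrite -ctauL cartanC.
  have n1 : tau i != j by rewrite eq_sym cartan0_neq.
  have n2 : tau i != tau j by rewrite (inj_eq (inv_inj (@tauK P))).
  have c1 : cartan j (tau (tau i)) = -1 by rewrite tauK.
  rewrite (posFree2E q b k kV ti li lt il il') !(homE gh) !(homE fh) s2 g1 !(lT_b hf, lT_b hg).
  by rewrite (posFree2E q b k kV ti li lt il il') (posFree2E q b k kV tj n1 n2 ji' c1) (nested_qcomm_inv q0 q2 _ ltj).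
- case: d => [[/eqP]|[_ tj ij']]; first by rewrite (negPf ti).
  have ji' : cartan j (tau i) = 0 by rewrite -ctauL cartanC.
  have nijt : i != tau j by rewrite cartan0_neq.
  have n1 : tau i != j by rewrite eq_sym cartan0_neq.
  have n2 : tau i != tau j by rewrite (inj_eq (inv_inj (@tauK P))).
  have c1 : cartan j (tau (tau i)) = -1 by rewrite tauK.
  rewrite (posFree12E q1 b k kV ti li lt il il') !(homE gh) g1 (lT_k hg) !(homE fh) !(lT_b hg).
  rewrite (posFree1E q b k kV tj nij nijt ji ji') (posFree2E q b k kV tj n1 n2 ji' c1).
  have -> : f (TK j i) = k j by rewrite -(lT_k hg) s3.
  have -> : f (Br (b i) (b j)) = b j.
    by have := s1; rewrite (lT_b hg) (posFree1E q b k kV tj nij nijt ji ji').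
  have -> : f (qcomm q^-1 (b (tau j)) (b (tau i))) = b (tau j).
    by have := s2; rewrite (lT_b hg) (posFree2E q b k kV tj n1 n2 ji' c1).
  rewrite (lT_b hf) (posFree12E q1 b k kV ti li lt il il') (posFree1E q b k kV tj nij nijt ji ji').
  have Ei := pairNbE Pg ti; have Ej := pairNbE Pg tj; have eij := nbE ij ij'; have eil := nbE il il'.
  have [_ _ jl0 jl0'] := jl; have ejl := nbE jl0 jl0'.
  have ejl2 : (q - q^-1)^-1 *: (k i * k j) = (q - q^-1) *: (kap i * kap j).
    by rewrite (kkE q1) scalerA expr2 mulKf.
  rewrite ejl2 -/(kap j).
  have -> : (q - q^-1) *: (b l * ((q - q^-1) *: (kap i * kap j))) = (q - q^-1) ^+ 2 *: (b l * (kap i * kap j)).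
    by rewrite -scalerAr scalerA -expr2.
  apply: (@same_kind_center L A q q0 q2 (b i) (b (tau i)) (kap i) (kap (tau i)) _ _ _ _ _ _ (b l) _ _ (b j) (b (tau j)) (kap j) (kap (tau j)));
   try exact: (kapC h); try exact: (pairE h); try exact: esym lj; try exact: esym ltj;
   try (by rewrite ?(kap_b h) ?ctauL ?tauK ?(Ei, Ej, eij, eil, ejl) ?subrr ?expr0z ?scale1r).
  + by apply: (io_comm h); rewrite ?ctauL ?tauK ?eij // eq_sym.
  + by apply: (io_comm h) => //; rewrite ?eij // inj_eq // inv_inj.
- by rewrite (posFarE q b k kV li lt il il') g1 (lT_b hf) (posFarE q b k kV li lt il il').
Qed.

(** A vertex adjacent to both orbits would close a triangle or a hexagon. *)
Lemma same_kind_far i j l : same_kind i j -> l != i -> l != tau i -> l != j -> l != tau j ->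
  far i l \/ far j l.
Proof.
move=> sk li lt lj ljt.
have dich x : l != x -> l != tau x -> far x l \/ cartan x l = -1 \/ cartan x (tau l) = -1.
  move=> nx ntx; case: (cartanP Pg x l) => e; [by rewrite e eqxx in nx| |by right; left].
  case: (cartanP Pg x (tau l)) => e'; [by rewrite e' tauK eqxx in ntx|by left|by right; right].
case: (dich i li lt) => [|ci]; first by left.
case: (dich j lj ljt) => [|cj]; first by right.
case: (sk) => ij d; exfalso.
have tri : cartan i l = -1 -> cartan j l = -1 -> False by move=> a1 a2; apply: (no_triangle Pg ij a1 a2).
have tri' : cartan i (tau l) = -1 -> cartan j (tau l) = -1 -> False by move=> a1 a2; apply: (no_triangle Pg ij a1 a2).
case: d => [[ti tj]|[ti tj ij']].
  have ei : cartan i (tau l) = cartan i l by rewrite -ctauL ti.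
  have ej : cartan j (tau l) = cartan j l by rewrite -ctauL tj.
  by rewrite ei in ci; rewrite ej in cj; apply: tri; [case: ci|case: cj].
have c1 : cartan i (tau (tau j)) = -1 by rewrite tauK.
case: ci cj => ci [] cj; [exact: tri| | |exact: tri'].
- have il' : cartan i (tau l) = 0.
    case: (cartanP Pg i (tau l)) => // e; [by rewrite e tauK eqxx in lt|by case: tri'].
  by apply: (no_hexagon Pg ti ci il' ij' c1); rewrite cartanC ctauL.
- have il : cartan i l = 0.
    case: (cartanP Pg i l) => // e; [by rewrite e eqxx in li|by case: tri].
  apply: (@no_hexagon P Pg i (tau l) (tau j)) => //; first by rewrite tauK.
  by rewrite cartan_tau cartanC.
Qed.

(** On the orbit of i, T_j T_i T_j (b_i) = T_j(b_j) and T_i T_j T_i (b_i) is T_i T_j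
    applied to the formula of T_i(b_i), that is the same formula at j.  A further
    vertex is far from i or from j, and then both sides fall under the lemma on
    outer vertices. *)
Theorem same_kind_braid i j f g l : same_kind i j -> lifts_T i f -> lifts_T j g ->
  f (g (f (b l))) = g (f (g (b l))).
Proof.
move=> sk hf hg; have sk' := same_kindC sk.
have [s1 s2 s3 s4 s5] := same_kind_shift sk hf hg.
have [r1 r2 r3 r4 r5] := same_kind_shift sk' hg hf.
have fh := lT_hom hf; have gh := lT_hom hg.
have selfi : f (g (f (b i))) = g (f (g (b i))) /\ f (g (f (b (tau i)))) = g (f (g (b (tau i)))).
  rewrite s1 s2 !(lT_b hf) !(hom_TB gh) !(hom_TB fh) !(lT_b hg).
  by rewrite !(same_kind_self sk).
have selfj : f (g (f (b j))) = g (f (g (b j))) /\ f (g (f (b (tau j)))) = g (f (g (b (tau j)))).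
  rewrite r1 r2 !(lT_b hg) !(hom_TB fh) !(hom_TB gh) !(lT_b hf).
  by rewrite !(same_kind_self sk').
have [->|li] := eqVneq l i; first by case: selfi.
have [->|lt] := eqVneq l (tau i); first by case: selfi.
have [->|lj] := eqVneq l j; first by case: selfj.
have [->|ljt] := eqVneq l (tau j); first by case: selfj.
case: (same_kind_far sk li lt lj ljt) => fl.
- have [f1 _ _] := lT_far hf fl.
  by rewrite f1 (same_kind_outer sk' hg hf).
- have [g1 _ _] := lT_far hg fl.
  by rewrite g1 (same_kind_outer sk hf hg).
Qed.

End Braid.

(** * The braid relation of length four *)

Section Mixed.
Variables (P : iquiver) (Pg : good_iquiver P).
Local Notation I := (vert P).
Variables (L : fieldType) (q : L).
Hypotheses (q0 : q != 0) (q2 : q + q^-1 != 0) (q1 : q - q^-1 != 0).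
Variables (A : algType L) (b k kV : I -> A).
Hypothesis h : iota_data q false (fun _ => 1) b k kV.
Local Notation kap := (kap q k).
Local Notation zz := (zz k).
Local Notation TB := (TB q b k kV).
Local Notation TK := (TK q k kV).
Local Notation TKV := (TKV q k kV).
Local Notation Br x y := (qcomm q x y).
Local Notation lifts_T := (lifts_T q b k kV).
Lemma BrZr (r d : L) (u w : A) : qcomm r u (d *: w) = d *: qcomm r u w.
Proof. by rewrite -scalerAr -scalerAl scalerA mulrC -scalerA -scalerBr. Qed.

Lemma BrZl (r d : L) (u w : A) : qcomm r (d *: u) w = d *: qcomm r u w.
Proof. by rewrite -scalerAr -scalerAl scalerA mulrC -scalerA -scalerBr. Qed.

Section Aux.
Variables (i c : I).
Hypotheses (ti : tau i != i) (tc : tau c = c) (ic : cartan i c = -1).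
Local Notation p := (tau i).
Let ic' : cartan i (tau c) = -1. Proof. by rewrite tc. Qed.
Let Ei := pairNbE Pg ti.
Let ec := nbE ic ic'.
Let ci : cartan c i = -1. Proof. by rewrite cartanC. Qed.
Let pc : cartan p c = -1. Proof. by rewrite ctauL. Qed.
Let cp : cartan c p = -1. Proof. by rewrite cartanC. Qed.
Let nci : c != i. Proof. by case: (center_neq ti ic tc). Qed.
Let ncp : c != p. Proof. by case: (center_neq ti ic tc). Qed.
Let nic : i != c. Proof. by rewrite eq_sym. Qed.
Let npc : p != c. Proof. by rewrite eq_sym. Qed.
Let tp := tti ti.

Ltac center lem := apply: (@lem L A q q0 q2 (b i) (b p) (kap i) (kap p) _ _ _ _ _ _ (b c) (zz c));
  try exact: (kapC h); try exact: (zz_b h); try exact: (zz_kap h); try exact: (zz_zz h); try exact: esym (zz_b h _ _);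
  try exact: (pairE h); try by [rewrite (serre0 h) | rewrite (serreE h)];
  try (by rewrite ?(kap_b h) ?ctauL ?tauK ?(Ei, ec) ?subrr ?expr0z ?scale1r).

Lemma Br_p_Phi : Br (b p) (Phi q b k i c) = q^-1 *: (k i * (b c * b p - q *: (b p * b c))).
Proof.
rewrite (kE q1 k i) -scalerAl scalerA; center mixed_tau_center.
Qed.

End Aux.

Variables (i c : I).
Hypotheses (ti : tau i != i) (tc : tau c = c) (ic : cartan i c = -1).
Local Notation p := (tau i).
Let ic' : cartan i (tau c) = -1. Proof. by rewrite tc. Qed.
Let Ei := pairNbE Pg ti.
Let ec := nbE ic ic'.
Let ci : cartan c i = -1. Proof. by rewrite cartanC. Qed.
Let pc : cartan p c = -1. Proof. by rewrite ctauL. Qed.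
Let cp : cartan c p = -1. Proof. by rewrite cartanC. Qed.
Let nci : c != i. Proof. by case: (center_neq ti ic tc). Qed.
Let ncp : c != p. Proof. by case: (center_neq ti ic tc). Qed.
Let nic : i != c. Proof. by rewrite eq_sym. Qed.
Let npc : p != c. Proof. by rewrite eq_sym. Qed.
Let tp := tti ti.

Ltac center lem := apply: (@lem L A q q0 q2 (b i) (b p) (kap i) (kap p) _ _ _ _ _ _ (b c) (zz c));
  try exact: (kapC h); try exact: (zz_b h); try exact: (zz_kap h); try exact: (zz_zz h); try exact: esym (zz_b h _ _);
  try exact: (pairE h); try by [rewrite (serre0 h) | rewrite (serreE h)];
  try (by rewrite ?(kap_b h) ?ctauL ?tauK ?(Ei, ec) ?subrr ?expr0z ?scale1r).

Lemma Br_i_Phi : Br (b i) (Phi q b k i c) = q^-1 *: (k p * (b c * b i - q *: (b i * b c))).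
Proof.
by have := Br_p_Phi tp tc pc; rewrite (Phi_tau Pg q0 q2 h ti ic tc) tauK.
Qed.

Lemma sTB_center : sTB q b k kV i c = - q^-1 *: (b p * (b i * b c - q *: (b c * b i)) - q *: ((b i * b c - q *: (b c * b i)) * b p)) + (q - q^-1) *: (kap p * b c).
Proof.
rewrite /sTB (negPf ti) (negPf nci) (negPf ncp) ctauL tc ic /=.
by rewrite [(q - q^-1) *: (_ * b c)]scalerAl -(kE q1).
Qed.

Section Homs.
Variables f g : A -> A.
Hypotheses (hf : lifts_T c f) (hg : lifts_T i g).
Let fh := lT_hom hf.
Let gh := lT_hom hg.

Lemma f_i : (f (b i) = Br (b i) (b c)) * (f (k i) = - q ^+ 2 *: (k i * k c)) * (f (kV i) = - q ^- 2 *: (kV i * kV c)).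
Proof. by rewrite (lT_b hf) (lT_k hf) (lT_kV hf) !(posFixedE q b k kV tc nic ci). Qed.
Lemma f_p : (f (b p) = Br (b p) (b c)) * (f (k p) = - q ^+ 2 *: (k p * k c)) * (f (kV p) = - q ^- 2 *: (kV p * kV c)).
Proof. by rewrite (lT_b hf) (lT_k hf) (lT_kV hf) !(posFixedE q b k kV tc npc cp). Qed.
Lemma f_c : (f (b c) = - q ^- 2 *: (kV c * b c)) * (f (k c) = q ^- 4 *: kV c) * (f (kV c) = q ^+ 4 *: k c).
Proof. by rewrite (lT_b hf) (lT_k hf) (lT_kV hf) !(posSelfFixedE q b k kV tc). Qed.
Lemma g_i : (g (b i) = - (kV i * b p)) * (g (k i) = kV i) * (g (kV i) = k i).
Proof. by rewrite (lT_b hg) (lT_k hg) (lT_kV hg) !(posSelfE q b k kV ti). Qed.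
Lemma g_p : (g (b p) = - q ^+ 2 *: (kV p * b i)) * (g (k p) = kV p) * (g (kV p) = k p).
Proof. by rewrite (lT_b hg) (lT_k hg) (lT_kV hg) !(posTauE q b k kV ti). Qed.
Lemma g_c : (g (b c) = Phi q b k i c) * (g (k c) = k c * (k i * k p)) * (g (kV c) = kV c * (kV i * kV p)).
Proof.
by rewrite (lT_b hg) (lT_k hg) (lT_kV hg) (TB_center q1 b k kV ti ic tc) !(posFree12E q1 b k kV ti nci ncp ic ic').
Qed.

Lemma f_inv x : cartan c x = -1 -> f (b c * b x - q *: (b x * b c)) = b x.
Proof. by move=> cx; rewrite !(homE fh) !(lT_b hf) (inv_fixed q0 q2 h tc cx). Qed.

Lemma gf_i : g (f (b i)) = - q^-1 *: (b c * b p - q *: (b p * b c)).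
Proof.
rewrite f_i !(homE gh) !g_i !g_c.
have V := Phi_toral Pg q0 q2 q1 h ti ic tc (toral_kV h i).
transitivity (- (kV i * Br (b p) (Phi q b k i c))).
  move: (Phi q b k i c) V => F V; NC.nc 0%N 3%N q q0 q2 [:: kV i; b p; F] V.
by rewrite (Br_p_Phi ti tc ic) -scalerAr mulrA (io_kVk h) mul1r scaleNr.
Qed.

Lemma gf_p : g (f (b p)) = - q *: (b c * b i - q *: (b i * b c)).
Proof.
rewrite f_p !(homE gh) !g_p !g_c.
have V := Phi_toral Pg q0 q2 q1 h ti ic tc (toral_kV h p).
transitivity (- q ^+ 2 *: (kV p * Br (b i) (Phi q b k i c))).
  move: (Phi q b k i c) V => F V; NC.nc 0%N 3%N q q0 q2 [:: kV p; b i; F] V.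
by rewrite Br_i_Phi -scalerAr mulrA (io_kVk h) mul1r scalerA mulNr expr2 mulfK.
Qed.

(** This is what makes the relation of length four hold at c: T_i undoes its transform
    by the anti-involution, so that T_i T_c T_i fixes b_c. *)
Lemma fg_c : f (g (b c)) = sTB q b k kV i c.
Proof.
rewrite g_c (hom_Phi fh) sTB_center /Phi /kapof /= !f_i !f_p !f_c.
have V l : kV c * b l = b l * kV c by rewrite (kV_b q0 h) -ctauL tc subrr expr0z scale1r.
have V' l : kV c * kap l = kap l * kV c by apply: kV_kap h _ _.
have e1 : kV c * zz c = 1 by rewrite /zz tc eqxx (io_kVk h).
have e2 : zz c * kV c = 1 by rewrite /zz tc eqxx (io_kkV h).
have -> : (q - q^-1)^-1 *: (- q ^+ 2 *: (k i * k c)) = - q ^+ 2 *: (kap i * zz c).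
  by rewrite scalerA mulrC -scalerA scalerAl /zz tc eqxx.
by center mixed_sigma_center.
Qed.

Lemma gfg_c : g (f (g (b c))) = b c.
Proof.
rewrite fg_c (hom_sTB gh).
have -> : g \o b = TB i by apply/funext => l; apply: (lT_b hg).
have -> : g \o k = TK i by apply/funext => l; apply: (lT_k hg).
have -> : g \o kV = TKV i by apply/funext => l; apply: (lT_kV hg).
exact: (T_sT Pg q0 q2 q1 h).
Qed.

(** T_c T_i T_c acts as the diagram automorphism on the orbit of i, up to scalars. *)
Lemma fgf_i : f (g (f (b i))) = - q^-1 *: b p.
Proof. by rewrite gf_i (homZ fh) f_inv. Qed.

Lemma fgf_p : f (g (f (b p))) = - q *: b i.
Proof. by rewrite gf_p (homZ fh) f_inv. Qed.

Lemma fgf_kV : (f (g (f (kV i))) = kV p) * (f (g (f (kV p))) = kV i).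
Proof.
have a : forall u v, kV u * (k v * k u) = k v by move=> u v; rewrite (io_kk h) mulrA (io_kVk h) mul1r.
have a' : forall u v, k u * (kV v * kV u) = kV v by move=> u v; rewrite (kV_kV h) mulrA (io_kkV h) mul1r.
have E1 : g (f (kV i)) = - q ^- 2 *: (kV c * kV p).
  rewrite f_i !(homE gh) !g_i !g_c; congr (_ *: _).
  have e1 := kV_k h c i; have e2 := io_kkV h i.
  NC.nc 0%N 3%N q q0 q2 [:: k i; kV i; kV p; kV c] (e1, e2).
have E2 : g (f (kV p)) = - q ^- 2 *: (kV c * kV i).
  rewrite f_p !(homE gh) !g_p !g_c; congr (_ *: _).
  have e1 := kV_k h c p; have e2 := io_kkV h p; have e3 := kV_kV h i p.
  NC.nc 0%N 3%N q q0 q2 [:: k p; kV p; kV i; kV c] (e1, e2, e3).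
have cc u : - q ^- 2 *: (q ^+ 4 *: k c * (- q ^- 2 *: (kV u * kV c))) = kV u.
  rewrite -scalerAl -scalerAr a' !scalerA; have -> : - q ^- 2 * q ^+ 4 * - q ^- 2 = 1 by field.
  exact: scale1r.
by rewrite E1 E2 !(homE fh) !f_c !f_i !f_p !cc.
Qed.

Lemma gfg_kVc : g (f (g (kV c))) = kV c.
Proof.
rewrite g_c !(homE fh) !f_c !f_i !f_p !(homE gh) !g_c !g_i !g_p.
rewrite -!scalerAl -!scalerAr !scalerA; have -> : q ^+ 4 * (- q ^- 2 * - q ^- 2) = 1 by field.
rewrite scale1r.
have e1 := kV_k h i i; have e2 := kV_k h i p; have e3 := kV_k h p i; have e4 := kV_k h p p.
have e5 := kV_k h c i; have e6 := kV_k h c p; have e7 := kV_k h i c; have e8 := kV_k h p c; have e9 := kV_k h c c.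
have d1 := kV_kV h i p; have d2 := kV_kV h c i; have d3 := kV_kV h c p.
have d4 := io_kk h i p; have d5 := io_kk h c i; have d6 := io_kk h c p.
have v1 := io_kkV h i; have v2 := io_kkV h p; have v3 := io_kkV h c.
NC.nc 0%N 3%N q q0 q2 [:: k i; k p; k c; kV i; kV p; kV c] (e1, e2, e3, e4, e5, e6, e7, e8, e9, d1, d2, d3, d4, d5, d6, v1, v2, v3).
Qed.

Lemma mixed_orbit : [/\ f (g (f (g (b i)))) = g (f (g (f (b i)))),
  f (g (f (g (b p)))) = g (f (g (f (b p)))) & f (g (f (g (b c)))) = g (f (g (f (b c))))].
Proof.
split.
- rewrite fgf_i g_i !(homE fh, homE gh) !fgf_kV fgf_p g_p -scalerAr.
  by rewrite scalerA -scaleNr; congr (_ *: _); field.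
- rewrite fgf_p g_p !(homE fh, homE gh) !fgf_kV fgf_i g_i -scalerAr.
  by rewrite scalerN -scaleNr scalerA; congr (_ *: _); field.
- by rewrite gfg_c f_c !(homE fh, homE gh) gfg_kVc gfg_c.
Qed.

Lemma mixed_far_i l : far i l -> l != c -> f (g (f (g (b l)))) = g (f (g (f (b l)))).
Proof.
move=> il lc; have [g1 _ _] := lT_far hg il; rewrite g1.
case: (positionP Pg c l) => [e|e|_ _ cl|/eqP //|/eqP //|/eqP //|n1 n2 c1 c2].
- by rewrite e eqxx in lc.
- by move=> _; rewrite e tc eqxx in lc.
- have fl : f (b l) = Br (b l) (b c) by rewrite (lT_b hf) (posFixedE q b k kV tc lc cl).
  have [li lp c1 c2] := il.
  have el := nbE c1 c2; have lc' : cartan l c = -1 by rewrite cartanC.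
  have F := far_comm q0 h li lp c1 c2.
  have Y : f (g (f (b l))) = Br (f (b l)) (f (g (b c))) by rewrite {1}fl !(homE gh) !(homE fh) g1.
  rewrite Y !(homE gh) gfg_c fg_c fl !(homE gh) g1 !g_c sTB_center.
  apply: (@mixed_far_center L A q q0 q2 (b i) (b p) (kap i) (kap p) _ _ _ _ _ _ (b c) (zz c) _ _ _ _ _ _ _ _ _ _ _ (b l) (zz l));
    try exact: (kapC h); try exact: (zz_b h); try exact: (zz_kap h); try exact: (zz_zz h);
    try exact: (pairE h); try by [rewrite (serre0 h) | rewrite (serreE h)];
    try by [rewrite F | rewrite ?(kap_b h) ?ctauL ?tauK ?(Ei, ec, el) ?subrr ?expr0z ?scale1r].
- have ff : far c l by split.
  by have [f1 _ _] := lT_far hf ff; rewrite !f1 !g1 !f1.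
Qed.

Lemma mixed_far_c l : far c l -> l != i -> l != p -> f (g (f (g (b l)))) = g (f (g (f (b l)))).
Proof.
move=> cl li lp; have [f1 _ _] := lT_far hf cl; rewrite f1; have [lc _ c1 c2] := cl.
have ecl := nbE c1 c2; have F := far_comm q0 h lc (let: And4 _ a _ _ := cl in a) c1 c2.
have lcc : b l * b c = b c * b l by rewrite F.
have zl : zz c * b l = b l * zz c by apply: (zz_b h).
case: (positionP Pg i l) => [e|e _|/eqP|_ _ _ il il'|_ _ _ il il'|_ _ _ il il' tl|n1 n2 c3 c4].
- by rewrite e eqxx in li.
- by rewrite e eqxx in lp.
- by rewrite (negPf ti).
- have gl : g (b l) = Br (b l) (b i) by rewrite (lT_b hg) (posFree1E q b k kV ti li lp il il').
  have eil := nbE il il'; have [_ _ tl] := leg_neq il il'.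
  have Y : g (f (g (b l))) = Br (g (b l)) (g (f (b i))) by rewrite {1}gl !(homE fh) !(homE gh) f1.
  rewrite Y !(homE fh) fgf_i gf_i gl !(homE fh) f1 !f_i.
  have e : Br (Br (b l) (Br (b i) (b c))) (b p) = Br (Br (b l) (b i)) (b c * b p - q *: (b p * b c)).
    have lpc : b l * b p = b p * b l by apply: (leg_comm h il il').
    apply/esym; center mixed_leg_far; try by rewrite ?(kap_b h) ?ctauL ?tauK ?(Ei, ec, eil) ?subrr ?expr0z ?scale1r.
    by rewrite (serre0 h) ?eil.
  by rewrite !BrZr e.
- have gl : g (b l) = b p * b l - q^-1 *: (b l * b p) by rewrite (lT_b hg) (posFree2E q b k kV ti li lp il il').
  have eil := nbE il il'.
  have tl : tau l != l by apply: contra_eqN il' => /eqP ->; rewrite il.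
  have Y : g (f (g (b l))) = g (f (b p)) * g (b l) - q^-1 *: (g (b l) * g (f (b p))).
    by rewrite {1}gl !(homE fh) !(homE gh) f1.
  rewrite Y !(homE fh) fgf_p gf_p gl !(homE fh) f1 !f_p.
  have pl : cartan p l = -1 by rewrite ctauL.
  have e : qcomm q^-1 (b c * b i - q *: (b i * b c)) (b p * b l - q^-1 *: (b l * b p))
    = qcomm q^-1 (b i) (Br (b p) (b c) * b l - q^-1 *: (b l * Br (b p) (b c))).
    center mixed_tau_leg_far; try by rewrite ?(kap_b h) ?ctauL ?tauK ?(Ei, ec, eil) ?subrr ?expr0z ?scale1r.
    + by apply: (io_comm h); rewrite ?eil // -(inj_eq (inv_inj (@tauK P))) tauK eq_sym.
    + by rewrite (serre0 h) // ?ctauL ?eil.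
  by rewrite !BrZl e.
- have [e|lne] := eqVneq l c; first by rewrite e eqxx in lc.
  case: Pg => Pd _; have := no_cycle (s := [:: i; l; p; c]) Pd isT.
  have h1 : cartan p l = -1 by rewrite ctauL.
  rewrite /= !inE !negb_or eq_sym li (eq_sym i (tau i)) ti nic lp lne npc /=.
  by rewrite /adj il (cartanC l) h1 pc (cartanC c) ic => /(_ isT).
- have il : far i l by split.
  by have [g1 _ _] := lT_far hg il; rewrite !g1 !f1 g1.
Qed.

(** On the orbits of i and c by the computations of T_c T_i T_c and T_i T_c T_i.  Any
    other vertex is far from one of the two orbits, as there is no triangle, and
    there a nested commutator is reassociated. *)
Theorem mixed_braid l : f (g (f (g (b l)))) = g (f (g (f (b l)))).
Proof.
have [o1 o2 o3] := mixed_orbit.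
have [->//|li] := eqVneq l i; have [->//|lp] := eqVneq l p; have [->//|lc] := eqVneq l c.
have [cl|ncl] := boolP (`[< far c l >]); first by apply: mixed_far_c => //; apply/asboolP.
apply: mixed_far_i => //; have {ncl} cl : cartan c l = -1.
  case: (positionP Pg c l) => [e|e _|//|/eqP|/eqP|/eqP|n1 n2 c1 c2] //.
  - by rewrite e eqxx in lc.
  - by rewrite e tc eqxx in lc.
  - by case/asboolP: ncl.
have lc' : cartan l c = -1 by rewrite cartanC.
have tri : cartan i l <> -1 by move=> e; apply: (no_triangle Pg ic e cl).
have tri' : cartan i (tau l) <> -1.
  by move=> e; apply: (@no_triangle P Pg p c l); rewrite ?ctauL // tc.
split=> //.
- by case: (cartanP Pg i l) => // e; rewrite e eqxx in li.
- by case: (cartanP Pg i (tau l)) => // e; rewrite e tauK eqxx in lp.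
Qed.

End Homs.
End Mixed.

(** * Operators, presented algebras and their subalgebras *)

Section Endo.
Variables (L : fieldType) (V : algType L).

(** All linear operators, in any dimension.  V enters as a vector space only; that
    it is an algebra ensures that the identity is not zero. *)
Record endo := Endo { endo_fun :> V -> V; endo_lin : linear endo_fun }.

HB.instance Definition _ := gen_eqMixin endo.
HB.instance Definition _ := gen_choiceMixin endo.

Lemma endoP (f g : endo) : f =1 g -> f = g.
Proof.
case: f g => [f lf] [g lg] /= /funext fg; subst g; congr Endo; exact: Prop_irrelevance.
Qed.

Implicit Types (f g : endo) (c : L).

Lemma endoD f x y : f (x + y) = f x + f y.
Proof. by have := endo_lin f 1 x y; rewrite !scale1r. Qed.
Lemma endo0r f : f 0 = 0.
Proof. by apply: (addrI (f 0)); rewrite -endoD !addr0. Qed.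
Lemma endoZ f c x : f (c *: x) = c *: f x.
Proof. by have := endo_lin f c x 0; rewrite !addr0 endo0r addr0. Qed.

Fact endo_add_lin f g : linear (fun x => f x + g x).
Proof. by move=> c x y; rewrite !endo_lin scalerDr addrACA. Qed.
Fact endo_zero_lin : linear (fun _ : V => 0 : V).
Proof. by move=> c x y; rewrite scaler0 addr0. Qed.
Fact endo_opp_lin f : linear (fun x => - f x).
Proof. by move=> c x y; rewrite endo_lin opprD scalerN. Qed.
Fact endo_one_lin : linear (fun x : V => x). Proof. by []. Qed.
Fact endo_mul_lin f g : linear (fun x => f (g x)).
Proof. by move=> c x y; rewrite !endo_lin. Qed.
Fact endo_scale_lin c f : linear (fun x => c *: f x).
Proof. by move=> d x y; rewrite endo_lin scalerDr !scalerA mulrC. Qed.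

Definition endo_add f g := Endo (endo_add_lin f g).
Definition endo_zero := Endo endo_zero_lin.
Definition endo_opp f := Endo (endo_opp_lin f).
Definition endo_one := Endo endo_one_lin.
Definition endo_mul f g := Endo (endo_mul_lin f g).
Definition endo_scale c f := Endo (endo_scale_lin c f).

Fact endo_addA : associative endo_add.
Proof. by move=> f g e; apply: endoP => x /=; rewrite addrA. Qed.
Fact endo_addC : commutative endo_add.
Proof. by move=> f g; apply: endoP => x /=; rewrite addrC. Qed.
Fact endo_add0 : left_id endo_zero endo_add.
Proof. by move=> f; apply: endoP => x /=; rewrite add0r. Qed.
Fact endo_addN : left_inverse endo_zero endo_opp endo_add.
Proof. by move=> f; apply: endoP => x /=; rewrite addNr. Qed.
HB.instance Definition _ := GRing.isZmodule.Build endo endo_addA endo_addC endo_add0 endo_addN.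

Fact endo_mulA : associative endo_mul. Proof. by move=> f g e; apply: endoP. Qed.
Fact endo_1mul : left_id endo_one endo_mul. Proof. by move=> f; apply: endoP. Qed.
Fact endo_mul1 : right_id endo_one endo_mul. Proof. by move=> f; apply: endoP. Qed.
Fact endo_mulDl : left_distributive endo_mul +%R. Proof. by move=> f g e; apply: endoP. Qed.
Fact endo_mulDr : right_distributive endo_mul +%R.
Proof. by move=> f g e; apply: endoP => x /=; rewrite endoD. Qed.
Fact endo_1neq0 : endo_one != 0.
Proof. by apply/eqP => /(congr1 (fun f : endo => f 1)) /= /eqP; rewrite oner_eq0. Qed.
HB.instance Definition _ := GRing.Zmodule_isNzRing.Build endo
  endo_mulA endo_1mul endo_mul1 endo_mulDl endo_mulDr endo_1neq0.

Fact endo_scaleA c d f : endo_scale c (endo_scale d f) = endo_scale (c * d) f.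
Proof. by apply: endoP => x /=; rewrite scalerA. Qed.
Fact endo_scale1 : left_id 1 endo_scale.
Proof. by move=> f; apply: endoP => x /=; rewrite scale1r. Qed.
Fact endo_scaleDr : right_distributive endo_scale +%R.
Proof. by move=> c f g; apply: endoP => x /=; rewrite scalerDr. Qed.
Fact endo_scaleDl f : {morph endo_scale^~ f : c d / c + d}.
Proof. by move=> c d; apply: endoP => x /=; rewrite scalerDl. Qed.
HB.instance Definition _ := GRing.Zmodule_isLmodule.Build L endo
  endo_scaleA endo_scale1 endo_scaleDr endo_scaleDl.
Fact endo_scaleAl c f g : c *: (f * g) = (c *: f) * g. Proof. exact: endoP. Qed.
HB.instance Definition _ := GRing.Lmodule_isLalgebra.Build L endo endo_scaleAl.
Fact endo_scaleAr c f g : c *: (f * g) = f * (c *: g).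
Proof. by apply: endoP => x /=; rewrite endoZ. Qed.
HB.instance Definition _ := GRing.Lalgebra_isAlgebra.Build L endo endo_scaleAr.

Lemma endo_addE f g x : (f + g) x = f x + g x. Proof. by []. Qed.
Lemma endo_oppE f x : (- f) x = - f x. Proof. by []. Qed.
Lemma endo_mulE f g x : (f * g) x = f (g x). Proof. by []. Qed.
Lemma endo_scaleE c f x : (c *: f) x = c *: f x. Proof. by []. Qed.
Definition endoE := (endo_addE, endo_oppE, endo_mulE, endo_scaleE).

Fact lmul_lin (a : V) : linear (fun x => a * x).
Proof. by move=> c x y; rewrite mulrDr -scalerAr. Qed.
Definition lmul (a : V) : endo := Endo (lmul_lin a).

Lemma lmul_hom : is_alg_hom lmul.
Proof.
by split=> [c x y||x y]; apply: endoP => z /=; rewrite ?mul1r ?mulrA // mulrDl scalerAl.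
Qed.

End Endo.

Section Hom.
Variables (L : fieldType).

Lemma is_alg_hom_comp (A B C : algType L) (f : A -> B) (g : B -> C) :
  is_alg_hom f -> is_alg_hom g -> is_alg_hom (g \o f).
Proof.
by move=> [fl f1 fM] [gl g1 gM]; split=> [c x y||x y]; rewrite /= ?fl ?gl ?f1 ?g1 ?fM ?gM.
Qed.

Lemma hom_aeval (X : Type) (A B : algType L) (f : A -> B) (g : X -> A) t :
  is_alg_hom f -> f (aeval g t) = aeval (f \o g) t.
Proof.
move=> fh; elim: t => [||x|s IHs t IHt|s IHs t IHt|c s IHs] /=; rewrite ?(hom0 fh) ?(hom1 fh) //.
- by rewrite (homD fh) IHs IHt.
- by rewrite (homM fh) IHs IHt.
- by rewrite (homZ fh) IHs.
Qed.

Section Pres.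
Variables (X : Type) (Pr : presentation L X).
Local Notation A := (presAlg Pr).
Local Notation pi := (\pi_(presAlg Pr))%qT.

Lemma aeval_alg_gen t : aeval (alg_gen Pr) t = pi t.
Proof.
elim: t => [||x|s IHs t IHt|s IHs t IHt|c s IHs] //=; rewrite ?IHs ?IHt.
- exact: pa_addE.
- exact: pa_mulE.
- exact: pa_scaleE.
Qed.

Lemma presAlg_ind (Q : A -> Prop) : Q 0 -> Q 1 -> (forall x, Q (alg_gen Pr x)) ->
  (forall a b, Q a -> Q b -> Q (a + b)) -> (forall a b, Q a -> Q b -> Q (a * b)) ->
  (forall c a, Q a -> Q (c *: a)) -> forall a, Q a.
Proof.
move=> Q0 Q1 Qg QD QM QZ; elim/quotW => t; rewrite -aeval_alg_gen.
elim: t => [||x|s IHs t IHt|s IHs t IHt|c s IHs] //=; [exact: QD|exact: QM|exact: QZ].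
Qed.

Lemma presAlg_surj (a : A) : exists t, a = aeval (alg_gen Pr) t.
Proof. by elim/quotW: a => t; exists t; rewrite aeval_alg_gen. Qed.

Lemma presAlg_eq0 t : aeval (alg_gen Pr) t = 0 -> acong (pres_rel Pr) t AZero.
Proof. by rewrite aeval_alg_gen => /apiP. Qed.

Lemma pres_gen_rel s t : pres_rel Pr s t -> aeval (alg_gen Pr) s = aeval (alg_gen Pr) t.
Proof. by move=> st; rewrite !aeval_alg_gen; apply/apiP/acong_rel. Qed.

Section Lift.
Variables (B : algType L) (f : X -> B).
Hypothesis f_rel : forall s t, pres_rel Pr s t -> aeval f s = aeval f t.

Definition pres_lift (a : A) : B := aeval f (repr a).

Lemma pres_liftE t : pres_lift (aeval (alg_gen Pr) t) = aeval f t.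
Proof. by rewrite aeval_alg_gen; apply/(acong_aeval f_rel)/acong_repr. Qed.

Lemma pres_lift_gen x : pres_lift (alg_gen Pr x) = f x.
Proof. exact: (pres_liftE (AGen x)). Qed.

Lemma pres_lift_hom : is_alg_hom pres_lift.
Proof.
split=> [c a b||a b].
- have [[s ->] [t ->]] := (presAlg_surj a, presAlg_surj b).
  by rewrite (pres_liftE (AAdd (AScale c s) t)) !pres_liftE.
- exact: (pres_liftE AOne).
- have [[s ->] [t ->]] := (presAlg_surj a, presAlg_surj b).
  by rewrite (pres_liftE (AMul s t)) !pres_liftE.
Qed.
End Lift.

Lemma pres_hom_eq (B : algType L) (f g : A -> B) : is_alg_hom f -> is_alg_hom g ->
  (forall x, f (alg_gen Pr x) = g (alg_gen Pr x)) -> f =1 g.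
Proof.
move=> fh gh fg; elim/presAlg_ind => [||//|a b ea eb|a b ea eb|c a ea].
- by rewrite !hom0.
- by rewrite !hom1.
- by rewrite !homD // ea eb.
- by rewrite !homM // ea eb.
- by rewrite !homZ // ea.
Qed.

(** Every element of the subalgebra is the value of a word in the generators.  Two
    words with the same value become equal under theta, where only the relations of
    Pr are visible; so any choice of words defines a morphism. *)
Lemma subalg_retract (H Y : algType L) (gen : X -> H) (S : H -> Prop) (theta : H -> Y) :
  (forall y, S y -> exists x, y = gen x) -> is_alg_hom theta ->
  (forall t, aeval (theta \o gen) t = 0 -> acong (pres_rel Pr) t AZero) ->
  exists phi : subalg S -> A, is_alg_hom phi /\
    forall (y : H) (Sy : S y) x, y = gen x -> phi (subalg_of_gen Sy) = alg_gen Pr x.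
Proof.
move=> Sgen th inj.
have surj (u : subalg S) : exists t, subalg_val u = aeval gen t.
  case: u => u /= /asboolP; elim => [x /Sgen [y ->]||x y _ [s ->] _ [t ->]|x y _ [s ->] _ [t ->]|c x _ [s ->]].
  - by exists (AGen y).
  - by exists AOne.
  - by exists (AAdd s t).
  - by exists (AMul s t).
  - by exists (AScale c s).
have [r rP] : {r : subalg S -> aterm L X | forall u, subalg_val u = aeval gen (r u)}.
  by exists (fun u => sval (cid (surj u))) => u; case: cid.
have key s t : aeval gen s = aeval gen t -> aeval (alg_gen Pr) s = aeval (alg_gen Pr) t.
  move=> st; apply/eqP; rewrite -subr_eq0; apply/eqP.
  have : acong (pres_rel Pr) (AAdd s (AOpp t)) AZero.
    apply: inj; rewrite -(hom_aeval _ _ th) /= scaleN1r st subrr; exact: hom0.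
  by move/apiP; rewrite -!aeval_alg_gen /= scaleN1r.
exists (fun u => aeval (alg_gen Pr) (r u)); split; last first.
  by move=> y Sy x e; apply: (key _ (AGen x)); rewrite -rP.
split=> [c u w||u w].
- by apply: (key _ (AAdd (AScale c (r u)) (r w))); rewrite /= -!rP.
- by apply: (key _ AOne); rewrite -rP.
- by apply: (key _ (AMul (r u) (r w))); rewrite /= -!rP.
Qed.

End Pres.

Lemma subalg_hom_eq (H B : algType L) (S : H -> Prop) (f g : subalg S -> B) :
  is_alg_hom f -> is_alg_hom g ->
  (forall y (Sy : S y), f (subalg_of_gen Sy) = g (subalg_of_gen Sy)) -> f =1 g.
Proof.
move=> fh gh fg [u uP]; have /asboolP uS := uP.
suff: forall vP : u \in subalg_pred S, f (SubAlg vP) = g (SubAlg vP) by apply.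
elim: uS {uP} => [x Sx||x y Sx IHx Sy IHy|x y Sx IHx Sy IHy|c x Sx IHx] vP.
- by have := fg x Sx; rewrite (_ : subalg_of_gen Sx = SubAlg vP) //; apply: val_inj.
- by rewrite (_ : SubAlg vP = 1) ?hom1 //; apply: val_inj.
- have [xP yP] : x \in subalg_pred S /\ y \in subalg_pred S by split; apply/asboolP.
  rewrite (_ : SubAlg vP = SubAlg xP + SubAlg yP); last exact: val_inj.
  by rewrite !homD // IHx IHy.
- have [xP yP] : x \in subalg_pred S /\ y \in subalg_pred S by split; apply/asboolP.
  rewrite (_ : SubAlg vP = SubAlg xP * SubAlg yP); last exact: val_inj.
  by rewrite !homM // IHx IHy.
- have xP : x \in subalg_pred S by apply/asboolP.
  rewrite (_ : SubAlg vP = c *: SubAlg xP); last exact: val_inj.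
  by rewrite !homZ // IHx.
Qed.

End Hom.

(** * Quantum group relations imply the iota relations *)

(** Covers both U~ and, with K' = K^-1, the quantum group U. *)
Record qg_data (P : iquiver) (L : fieldType) (q : L) (A : algType L)
    (E F K KV K' KV' : vert P -> A) : Prop := QgData {
  qd_KKV : forall i, K i * KV i = 1;
  qd_KVK : forall i, KV i * K i = 1;
  qd_K'KV' : forall i, K' i * KV' i = 1;
  qd_KV'K' : forall i, KV' i * K' i = 1;
  qd_KK : forall i j, K i * K j = K j * K i;
  qd_KK' : forall i j, K i * K' j = K' j * K i;
  qd_K'K' : forall i j, K' i * K' j = K' j * K' i;
  qd_EF : forall i j, E i * F j - F j * E i =
     (if i == j then (q - q^-1)^-1 else 0) *: (K i - K' i);
  qd_KE : forall i j, K i * E j = q ^ cartan i j *: (E j * K i);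
  qd_KF : forall i j, K i * F j = q ^ (- cartan i j) *: (F j * K i);
  qd_K'E : forall i j, K' i * E j = q ^ (- cartan i j) *: (E j * K' i);
  qd_K'F : forall i j, K' i * F j = q ^ cartan i j *: (F j * K' i);
  qd_EE0 : forall i j, cartan i j = 0 -> E i * E j = E j * E i;
  qd_EE1 : forall i j, cartan i j = -1 -> Serre q (E i) (E j) = 0;
  qd_FF0 : forall i j, cartan i j = 0 -> F i * F j = F j * F i;
  qd_FF1 : forall i j, cartan i j = -1 -> Serre q (F i) (F j) = 0
}.

Section QgIota.
Variables (P : iquiver) (Pg : good_iquiver P) (L : fieldType) (q : L).
Hypotheses (q0 : q != 0) (q2 : q + q^-1 != 0) (q1 : q - q^-1 != 0).
Local Notation I := (vert P).
Variables (A : algType L) (E F K KV K' KV' : I -> A).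
Hypothesis d : qg_data q E F K KV K' KV'.
Variables (s : I -> L).
Hypothesis s_tau : forall i, s (tau i) = s i.
Implicit Types i j : I.

Let e i := s i *: E (tau i).
Let B i := F i + e i * K' i.
Let k i := K i * K' (tau i).
Let kV i := KV i * KV' (tau i).

Lemma inv_comm (u uV y : A) : u * uV = 1 -> uV * u = 1 -> u * y = y * u -> uV * y = y * uV.
Proof.
by move=> e1 e2 uy; rewrite -[LHS]mulr1 -e1 mulrA -(mulrA _ y) -uy mulrA e2 mul1r.
Qed.

Lemma qg_KVV' i j : KV i * KV' j = KV' j * KV i.
Proof.
apply: inv_comm (qd_KKV d i) (qd_KVK d i) _; apply/esym.
by apply: inv_comm (qd_K'KV' d j) (qd_KV'K' d j) _; rewrite (qd_KK' d).
Qed.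

Lemma qg_kkV i : k i * kV i = 1.
Proof. by rewrite /k /kV qg_KVV' mulrA -(mulrA (K i)) (qd_K'KV' d) mulr1 (qd_KKV d). Qed.

Lemma qg_kVk i : kV i * k i = 1.
Proof. by rewrite /k /kV (qd_KK' d) mulrA -(mulrA (KV i)) (qd_KV'K' d) mulr1 (qd_KVK d). Qed.

Lemma qg_kk i j : k i * k j = k j * k i.
Proof.
rewrite /k -mulrA (mulrA (K' _)) -(qd_KK' d) -mulrA (qd_K'K' d) mulrA (qd_KK d).
by rewrite -!mulrA; congr (_ * _); rewrite !mulrA (qd_KK' d).
Qed.

Lemma qg_kF i j : k i * F j = q ^ (cartan (tau i) j - cartan i j) *: (F j * k i).
Proof.
rewrite /k -(mulrA (K i)) (qd_K'F d) -(scalerAr _ (K i)) (mulrA (K i)) (qd_KF d).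
by rewrite -(scalerAl _ _ (K' _)) scalerA -expfzDr // -mulrA.
Qed.

Lemma qg_ke i j : k i * e j = q ^ (cartan (tau i) j - cartan i j) *: (e j * k i).
Proof.
rewrite /e -scalerAr -scalerAl [RHS]scalerA mulrC -scalerA; congr (_ *: _).
rewrite /k -(mulrA (K i)) (qd_K'E d) -(scalerAr _ (K i)) (mulrA (K i)) (qd_KE d).
rewrite -(scalerAl _ _ (K' _)) scalerA -expfzDr // -(mulrA (E _)).
by rewrite cartan_tau ctauL addrC.
Qed.

Lemma qg_kK' i j : k i * K' j = K' j * k i.
Proof. by rewrite /k -mulrA (qd_K'K' d) mulrA (qd_KK' d) mulrA. Qed.

Lemma qg_kB i j : k i * B j = q ^ (cartan (tau i) j - cartan i j) *: (B j * k i).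
Proof.
rewrite /B mulrDr mulrDl scalerDr qg_kF (mulrA (k i)) qg_ke -(scalerAl _ _ (K' j)).
by rewrite -!(mulrA (e j)) qg_kK'.
Qed.

Lemma qg_eF i j : j != tau i -> e i * F j = F j * e i.
Proof.
move=> ji; rewrite /e -scalerAl -scalerAr; congr (_ *: _).
by apply/eqP; rewrite -subr_eq0 (qd_EF d) [tau i == _]eq_sym (negPf ji) scale0r.
Qed.

Lemma qg_K'e i j : K' i * e j = q ^ (- cartan i (tau j)) *: (e j * K' i).
Proof. by rewrite /e -scalerAr (qd_K'E d) -scalerAl !scalerA mulrC. Qed.

Lemma qg_Ke i j : K i * e j = q ^ (cartan i (tau j)) *: (e j * K i).
Proof. by rewrite /e -scalerAr (qd_KE d) -scalerAl !scalerA mulrC. Qed.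

Lemma qg_eF_tau i : e i * F (tau i) - F (tau i) * e i =
  (s i / (q - q^-1)) *: K (tau i) - (s i / (q - q^-1)) *: K' (tau i).
Proof. by rewrite /e -scalerAl -scalerAr -scalerBr (qd_EF d) eqxx -scalerBr scalerA. Qed.

Lemma qg_ee0 i j : cartan i j = 0 -> e i * e j = e j * e i.
Proof.
by move=> c; rewrite /e -!scalerAl -!scalerAr (qd_EE0 d) ?cartan_tau // !scalerA mulrC.
Qed.

Lemma qg_ee1 i j : cartan i j = -1 -> Serre q (e i) (e j) = 0.
Proof. by move=> c; rewrite SerreZ (qd_EE1 d) ?cartan_tau ?scaler0. Qed.

Lemma cartan_tau_cases i j : j != tau i -> cartan i (tau j) = 0 \/ cartan i (tau j) = -1.
Proof.
move=> ji; case: (cartanP Pg i (tau j)) => c; [|by left|by right].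
by rewrite c tauK eqxx in ji.
Qed.

Lemma qg_comm i j : cartan i j = 0 -> j != tau i -> B i * B j = B j * B i.
Proof.
move=> c ji; have cj : cartan j i = 0 by rewrite cartanC.
have ij : i != tau j by rewrite eq_sym -(inj_eq (inv_inj (@tauK P))) tauK.
have h1 := qg_eF ji; have h2 := qg_eF ij.
have h3 : K' i * F j = F j * K' i by rewrite (qd_K'F d) c expr0z scale1r.
have h4 : K' j * F i = F i * K' j by rewrite (qd_K'F d) cj expr0z scale1r.
have h5 := qg_ee0 c; have h6 := qd_K'K' d i j; have h7 := qd_FF0 d c.
have h8 := qg_K'e i j; have h9 := qg_K'e j i.
have cc : cartan j (tau i) = cartan i (tau j) by rewrite -ctauL cartanC.
rewrite cc in h9; rewrite /B; move: (e i) (e j) h1 h2 h5 h8 h9 => ei ej h1 h2 h5 h8 h9.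
case: (cartan_tau_cases ji) => t; rewrite t in h8 h9;
  NC.nc 0%N 4%N q q0 q2 [:: K' i; K' j; F i; F j; ei; ej] (h1, h2, h3, h4, h5, h6, h7, h8, h9).
Qed.

Lemma qg_pair i : tau i != i -> B i * B (tau i) - B (tau i) * B i = (s i / (q - q^-1)) *: (k (tau i) - k i).
Proof.
move=> ti; have t0 : cartan i (tau i) = 0 by apply: cartan_taui.
have t0' : cartan (tau i) i = 0 by rewrite cartanC.
have it : i != tau i by rewrite eq_sym.
have h1 := qg_eF_tau i; have h2 := qg_eF_tau (tau i); rewrite tauK s_tau in h2.
have h3 := qg_eF it; have h4 : e (tau i) * F (tau i) = F (tau i) * e (tau i) by apply: qg_eF; rewrite tauK.
have h5 := qg_ee0 t0; have h6 := qd_FF0 d t0; have h7 := qd_K'K' d i (tau i).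
have h8 : K' i * F i = q ^ 2 *: (F i * K' i) by rewrite (qd_K'F d) cartan_ii.
have h9 : K' i * F (tau i) = F (tau i) * K' i by rewrite (qd_K'F d) t0 expr0z scale1r.
have h10 : K' (tau i) * F i = F i * K' (tau i) by rewrite (qd_K'F d) t0' expr0z scale1r.
have h11 : K' i * e i = e i * K' i by rewrite qg_K'e t0 expr0z scale1r.
have h12 : K' (tau i) * e (tau i) = e (tau i) * K' (tau i) by rewrite qg_K'e tauK t0' expr0z scale1r.
have h13 : K' i * e (tau i) = q ^ (-2) *: (e (tau i) * K' i) by rewrite qg_K'e tauK cartan_ii.
have h14 : K' (tau i) * e i = q ^ (-2) *: (e i * K' (tau i)) by rewrite qg_K'e cartan_ii.
set z := s i / (q - q^-1) in h1 h2 *.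
rewrite scalerBr /k tauK !scalerAl.
have g1 : (z *: K i) * K' (tau i) = K' (tau i) * (z *: K i) by rewrite -scalerAl -scalerAr (qd_KK' d).
have g2 : (z *: K (tau i)) * K' i = K' i * (z *: K (tau i)) by rewrite -scalerAl -scalerAr (qd_KK' d).
have g3 : (z *: K' i) * K' (tau i) = (z *: K' (tau i)) * K' i by rewrite -!scalerAl (qd_K'K' d).
have g4 : (z *: K' i) * K' (tau i) = K' (tau i) * (z *: K' i) by rewrite -scalerAl -scalerAr (qd_K'K' d).
have g5 : (z *: K' (tau i)) * K' i = K' i * (z *: K' (tau i)) by rewrite -scalerAl -scalerAr (qd_K'K' d).
rewrite /B; move: (e i) (e (tau i)) (z *: K i) (z *: K (tau i)) (z *: K' i) (z *: K' (tau i)) h1 h2 h3 h4 h5 h11 h12 h13 h14 g1 g2 g3 g4 g5.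
move=> ei et Xi Xt Yi Yt h1 h2 h3 h4 h5 h11 h12 h13 h14 g1 g2 g3 g4 g5.
NC.nc 6%N 4%N q q0 q2 [:: Xi; Xt; Yi; Yt; K' i; K' (tau i); F i; F (tau i); ei; et] (h1, h2, h3, h4, h5, h6, h7, h8, h9, h10, h11, h12, h13, h14, g1, g2, g3, g4, g5).
Qed.

Lemma qg_serre i j : cartan i j = -1 ->
  Serre q (B i) (B j) = (if tau i == i then q * s i else 0) *: (k i * B j).
Proof.
move=> c; have cj : cartan j i = -1 by rewrite cartanC.
have ji : j != tau i.
  by case: Pg => _ /(_ i); apply: contraNneq => <-; rewrite c.
have ij : i != tau j by rewrite eq_sym -(inj_eq (inv_inj (@tauK P))) tauK.
have h1 := qg_eF ji; have h2 := qg_eF ij; have h3 := qd_FF1 d c; have h4 := qg_ee1 c.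
have h5 : K' i * F i = q ^ 2 *: (F i * K' i) by rewrite (qd_K'F d) cartan_ii.
have h6 : K' i * F j = q ^ (-1) *: (F j * K' i) by rewrite (qd_K'F d) c.
have h7 : K' j * F i = q ^ (-1) *: (F i * K' j) by rewrite (qd_K'F d) cj.
have h8 := qd_K'K' d i j.
have h9 := qg_K'e i j; have h10 := qg_K'e j i; have h11 := qg_K'e i i.
have cc : cartan j (tau i) = cartan i (tau j) by rewrite -ctauL cartanC.
rewrite cc in h10.
(* w is c_(j, tau j); both values have to be completed separately. *)
have [w h13] : exists w, (w = 0 \/ w = 2) /\ K' j * e j = q ^ (- w) *: (e j * K' j).
  exists (cartan j (tau j)); rewrite qg_K'e; split=> //.
  by case: (eqVneq (tau j) j) => [->|tj]; [right; rewrite cartan_ii|left; exact: cartan_taui].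
case: eqP => [ti|/eqP ti]; last first.
  rewrite scale0r; have h12 : e i * F i = F i * e i by apply: qg_eF; rewrite eq_sym.
  rewrite (cartan_taui Pg ti) in h11.
  rewrite /B; move: (e i) (e j) h1 h2 h4 h9 h10 h11 h12 h13 => ei ej h1 h2 h4 h9 h10 h11 h12 h13.
  by case: (cartan_tau_cases ji) => t; rewrite t in h9 h10; case: h13 => -[->|->] h13;
  NC.nc 2%N 5%N q q0 q2 [:: K' i; K' j; F i; F j; ei; ej] (h1, h2, h3, h4, h5, h6, h7, h8, h9, h10, h11, h12, h13).
have t : cartan i (tau j) = -1 by rewrite -ctauL ti.
rewrite t in h9 h10; rewrite ti cartan_ii in h11.
have h12 := qg_eF_tau i; rewrite ti in h12.
(* z is absorbed in the torus letters, so that coefficients stay in Z[q, q^-1]. *)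
set z := s i / (q - q^-1) in h12 *.
have Kz c1 c2 u : K i * u = c1 *: (u * K i) -> K' i * u = c2 *: (u * K' i) ->
    (z *: K i * u = c1 *: (u * (z *: K i))) * (z *: K' i * u = c2 *: (u * (z *: K' i))).
  by move=> e1 e2; rewrite -!scalerAl e1 e2 -!scalerAr !scalerA mulrC [z * c2]mulrC.
have [g1 g2] := Kz _ _ _ (qd_KF d i i) (qd_K'F d i i); rewrite cartan_ii in g1 g2.
have [g3 g4] := Kz _ _ _ (qd_KF d i j) (qd_K'F d i j); rewrite c in g3 g4.
have [g5 g6] := Kz _ _ _ (qg_Ke i i) (qg_K'e i i); rewrite ti cartan_ii in g5 g6.
have [g7 g8] := Kz _ _ _ (qg_Ke i j) (qg_K'e i j); rewrite t in g7 g8.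
have one (u v : A) : u * v = v * u -> u * v = 1 *: (v * u) by rewrite scale1r.
have [g9 g10] := Kz _ _ _ (one _ _ (qd_KK' d i i)) (one _ _ (qd_K'K' d i i)).
have [g11 g12] := Kz _ _ _ (one _ _ (qd_KK' d i j)) (one _ _ (qd_K'K' d i j)).
have -> : (q * s i) *: (k i * B j) = (q * (q - q^-1)) *: ((z *: K i) * K' i * B j).
  have zE : (q - q^-1) * z = s i by rewrite mulrC divfK.
  by rewrite /k ti -!scalerAl [RHS]scalerA -(mulrA q) zE.
rewrite /B; move: (e i) (e j) (z *: K i) (z *: K' i) h1 h2 h4 h9 h10 h11 h12 h13 g1 g2 g3 g4 g5 g6 g7 g8 g9 g10 g11 g12.
move=> ei ej Xi Yi h1 h2 h4 h9 h10 h11 h12 h13 g1 g2 g3 g4 g5 g6 g7 g8 g9 g10 g11 g12.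
by case: h13 => -[->|->] h13; NC.nc 4%N 5%N q q0 q2 [:: Xi; Yi; K' i; K' j; F i; F j; ei; ej] (h1, h2, h3, h4, h5, h6, h7, h8, h9, h10, h11, h12, h13, g1, g2, g3, g4, g5, g6, g7, g8, g9, g10, g11, g12).
Qed.

Theorem qg_iota (red : bool) :
  (red -> forall i, k i * k (tau i) = 1) -> (red -> forall i, tau i = i -> k i = 1) ->
  iota_data q red s (fun i => F i + s i *: (E (tau i) * K' i)) k kV.
Proof.
move=> r1 r2; have BE : (fun i => F i + s i *: (E (tau i) * K' i)) = B.
  by apply/funext => i; rewrite /B /e -scalerAl.
rewrite BE; split=> //; [exact: qg_kkV|exact: qg_kVk|exact: qg_kk|exact: qg_kB|exact: qg_comm|exact: qg_pair|exact: qg_serre].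
Qed.

End QgIota.

(** * The algebra presented by the iota relations *)

Section IotaPresentation.
Variables (P : iquiver) (L : fieldType) (q : L).
Local Notation I := (vert P).

Inductive iota_gen := iB of I | ik of I | ikV of I.

Definition iota_fun (T : Type) (b k kV : I -> T) (x : iota_gen) : T :=
  match x with iB i => b i | ik i => k i | ikV i => kV i end.

Local Notation gb i := (AGen (iB i)).
Local Notation gk i := (AGen (ik i)).
Local Notation gkV i := (AGen (ikV i)).

Inductive iota_rel (red : bool) (s : I -> L) : aterm L iota_gen -> aterm L iota_gen -> Prop :=
| ir_kkV i : iota_rel red s (gk i * gkV i)%AT 1%AT
| ir_kVk i : iota_rel red s (gkV i * gk i)%AT 1%AT
| ir_kk i j : iota_rel red s (gk i * gk j)%AT (gk j * gk i)%AT
| ir_kb i j : iota_rel red s (gk i * gb j)%AT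
    (q ^ (cartan (tau i) j - cartan i j) *: (gb j * gk i))%AT
| ir_comm i j : cartan i j = 0 -> j != tau i -> iota_rel red s (gb i * gb j)%AT (gb j * gb i)%AT
| ir_pair i : tau i != i -> iota_rel red s (gb i * gb (tau i) - gb (tau i) * gb i)%AT
    ((s i / (q - q^-1)) *: (gk (tau i) - gk i))%AT
| ir_serre i j : cartan i j = -1 -> iota_rel red s
    (gb i * gb i * gb j - (q + q^-1) *: (gb i * gb j * gb i) + gb j * gb i * gb i)%AT
    ((if tau i == i then q * s i else 0) *: (gk i * gb j))%AT
| ir_red i : red -> iota_rel red s (gk i * gk (tau i))%AT 1%AT
| ir_red_fixed i : red -> tau i = i -> iota_rel red s (gk i) 1%AT.

Lemma iota_rel_aeval red s (A : algType L) (b k kV : I -> A) :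
  iota_data q red s b k kV ->
  forall x y, iota_rel red s x y -> aeval (iota_fun b k kV) x = aeval (iota_fun b k kV) y.
Proof.
move=> h x y [i|i|i j|i j|i j c ij|i ti|i j c|i r|i r ti] /=; rewrite ?scaleN1r.
- exact: (io_kkV h).
- exact: (io_kVk h).
- exact: (io_kk h).
- exact: (io_kb h).
- exact: (io_comm h).
- exact: (io_pair h).
- exact: (io_serre h).
- exact: (io_red h).
- exact: (io_red_fixed h).
Qed.

Lemma iota_data_aeval red s (A : algType L) (b k kV : I -> A) :
  (forall x y, iota_rel red s x y -> aeval (iota_fun b k kV) x = aeval (iota_fun b k kV) y) ->
  iota_data q red s b k kV.
Proof.
move=> r; have e x y (xy : iota_rel red s x y) := r x y xy.
split=> [i|i|i j|i j|i j c ij|i ti|i j c|rd i|rd i ti].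
- exact: e (ir_kkV _ _ i).
- exact: e (ir_kVk _ _ i).
- exact: e (ir_kk _ _ i j).
- exact: e (ir_kb _ _ i j).
- exact: e (ir_comm _ _ c ij).
- by have := e _ _ (ir_pair _ _ ti); rewrite /= !scaleN1r.
- by have := e _ _ (ir_serre _ _ c); rewrite /= !scaleN1r.
- exact: e (ir_red _ i rd).
- exact: e (ir_red_fixed _ rd ti).
Qed.

Lemma iota_nontrivial red s : ~ acong (iota_rel red s) 1%AT 0%AT.
Proof.
move/(acong_aeval (f := iota_fun (fun _ => 0 : L^o) (fun _ => 1) (fun _ => 1))) => /=.
suff H : forall x y, iota_rel red s x y -> aeval (iota_fun (fun _ => 0 : L^o) (fun _ => 1) (fun _ => 1)) x = aeval (iota_fun (fun _ => 0 : L^o) (fun _ => 1) (fun _ => 1)) y.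
  by move=> /(_ H)/eqP; rewrite oner_eq0.
by move=> x y [] * /=;
  rewrite ?(scaleN1r, mulr1, mulr0, mul0r, scaler0, addr0, oppr0, subrr).
Qed.

Definition iota_pres red s := Presentation (@iota_nontrivial red s).
Definition iotaAlg red s := presAlg (iota_pres red s).

Section Gens.
Variables (red : bool) (s : I -> L).
Local Notation g := (alg_gen (iota_pres red s)).
Definition ia_b i : iotaAlg red s := g (iB i).
Definition ia_k i : iotaAlg red s := g (ik i).
Definition ia_kV i : iotaAlg red s := g (ikV i).

Lemma alg_gen_fun : g = iota_fun ia_b ia_k ia_kV.
Proof. by apply/funext => -[]. Qed.

Lemma iotaAlg_data : iota_data q red s ia_b ia_k ia_kV.
Proof. by apply: iota_data_aeval => x y xy; rewrite -alg_gen_fun; apply: pres_gen_rel. Qed.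

Section Lift.
Variables (A : algType L) (b k kV : I -> A).
Hypothesis h : iota_data q red s b k kV.
Definition iota_lift : iotaAlg red s -> A := @pres_lift L _ (iota_pres red s) A (iota_fun b k kV).
Lemma iota_lift_hom : is_alg_hom iota_lift.
Proof. exact: (pres_lift_hom (Pr := iota_pres red s) (iota_rel_aeval h)). Qed.
Lemma iota_lift_b i : iota_lift (ia_b i) = b i.
Proof. exact: (pres_lift_gen (Pr := iota_pres red s) (iota_rel_aeval h) (iB i)). Qed.
Lemma iota_lift_k i : iota_lift (ia_k i) = k i.
Proof. exact: (pres_lift_gen (Pr := iota_pres red s) (iota_rel_aeval h) (ik i)). Qed.
Lemma iota_lift_kV i : iota_lift (ia_kV i) = kV i.
Proof. exact: (pres_lift_gen (Pr := iota_pres red s) (iota_rel_aeval h) (ikV i)). Qed.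
End Lift.

Lemma iotaAlg_ind (Q : iotaAlg red s -> Prop) : Q 0 -> Q 1 ->
  (forall i, Q (ia_b i)) -> (forall i, Q (ia_k i)) -> (forall i, Q (ia_kV i)) ->
  (forall a b, Q a -> Q b -> Q (a + b)) -> (forall a b, Q a -> Q b -> Q (a * b)) ->
  (forall c a, Q a -> Q (c *: a)) -> forall a, Q a.
Proof. by move=> Q0 Q1 Qb Qk QkV; apply: presAlg_ind => // -[]. Qed.
End Gens.
End IotaPresentation.

Section IotaTransfer.
Variables (P : iquiver) (L : fieldType) (q : L) (red : bool) (s : vert P -> L).
Variables (A B : algType L) (f : A -> B) (fh : is_alg_hom f).
Variables (b k kV : vert P -> A).

Let fE x : f (aeval (iota_fun b k kV) x) =
   aeval (iota_fun (fun i => f (b i)) (fun i => f (k i)) (fun i => f (kV i))) x.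
Proof. by rewrite (hom_aeval _ _ fh); congr (aeval _ x); apply/funext => -[]. Qed.

Lemma iota_data_hom : iota_data q red s b k kV ->
  iota_data q red s (fun i => f (b i)) (fun i => f (k i)) (fun i => f (kV i)).
Proof.
move=> h; apply: iota_data_aeval => x y xy; rewrite -!fE; congr f.
exact: (iota_rel_aeval h).
Qed.

Lemma iota_data_inj : injective f ->
  iota_data q red s (fun i => f (b i)) (fun i => f (k i)) (fun i => f (kV i)) ->
  iota_data q red s b k kV.
Proof.
move=> fi h; apply: iota_data_aeval => x y xy; apply: fi; rewrite !fE.
exact: (iota_rel_aeval h).
Qed.
End IotaTransfer.

(** * A module of Verma type *)

(** A skew derivation of N is the corner of a morphism from N to upper triangular
    2 x 2 matrices of operators, and as such can be defined on the generators of a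
    presentation.  The matrices here are [dbl X], with X twice on the diagonal, the
    nilpotent [up], and [twist], with a scalar in one diagonal entry. *)
Section Double.
Variables (L : fieldType) (V : algType L).
Implicit Types (X Y : endo V) (t : L).

Lemma pair_ext (T : Type) (u w : T * T) : u.1 = w.1 -> u.2 = w.2 -> u = w.
Proof. by case: u w => [u1 u2] [w1 w2] /= -> ->. Qed.

Fact dbl_lin X : linear (fun u : V * V => (X u.1, X u.2) : V * V).
Proof. by move=> c u w; rewrite /= !endo_lin. Qed.
Definition dbl X : endo (V * V)%type := Endo (dbl_lin X).

Fact up_lin : linear (fun u : V * V => (u.2, 0) : V * V).
Proof. by move=> c u w; apply: pair_ext => //=; rewrite scaler0 addr0. Qed.
Definition up : endo (V * V)%type := Endo up_lin.

Fact twist_lin t : linear (fun u : V * V => (t *: u.1, u.2) : V * V).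
Proof.
by move=> c u w; apply: pair_ext => //=; rewrite scalerDr !scalerA mulrC.
Qed.
Definition twist t : endo (V * V)%type := Endo (twist_lin t).

Lemma dbl_hom : is_alg_hom dbl. Proof. by split=> [c X Y||X Y]; apply: endoP => -[]. Qed.
Lemma up_dbl X : up * dbl X = dbl X * up.
Proof. by apply: endoP => u; rewrite !endoE /= endo0r. Qed.
Lemma up_up : up * up = 0. Proof. exact: endoP. Qed.
Lemma twist_dbl t X : twist t * dbl X = dbl X * twist t.
Proof. by apply: endoP => u; rewrite !endoE /= endoZ. Qed.
Lemma twist_up t : twist t * up = t *: (up * twist t).
Proof. by apply: endoP => u; rewrite !endoE; apply: pair_ext => //=; rewrite scaler0. Qed.
Lemma twistM t t' : twist t * twist t' = twist (t * t').
Proof. by apply: endoP => u; rewrite !endoE /= scalerA. Qed.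
Lemma twist1 : twist 1 = 1.
Proof. by apply: endoP => -[u w]; rewrite /= scale1r. Qed.
End Double.

(** The homogeneous relations persist when a multiple of the nilpotent e is added to
    one of the letters: this is the skew Leibniz rule at work. *)
Section Deform.
Variables (L : fieldType) (q : L) (q0 : q != 0) (q2 : q + q^-1 != 0) (A : algType L).
Variables (e X Y x y : A).

Lemma deform_comm : e * y = y * e -> X * y = q ^ (- 0) *: (y * X) -> Y * y = q ^ 0 *: (y * Y) ->
  x * y = y * x -> (x + (X - Y) * e) * y = y * (x + (X - Y) * e).
Proof.
move=> h1 h2 h3 h4.
NC.nc 0%N 4%N q q0 q2 [:: e; X; Y; x; y] (h1, h2, h3, h4).
Qed.

Hypotheses (ee : e * e = 0) (ex : e * x = x * e) (ey : e * y = y * e)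
  (eX : e * X = X * e) (eY : e * Y = Y * e) (xy : Serre q x y = 0).

Lemma deform_serre_l : X * x = q ^ (- 2) *: (x * X) -> Y * x = q ^ 2 *: (x * Y) ->
  X * y = q ^ (- -1) *: (y * X) -> Y * y = q ^ (-1) *: (y * Y) ->
  Serre q (x + (X - Y) * e) y = 0.
Proof.
move=> h1 h2 h3 h4.
NC.nc 1%N 5%N q q0 q2 [:: e; X; Y; x; y] (ee, ex, ey, eX, eY, xy, h1, h2, h3, h4).
Qed.

Lemma deform_serre_r : X * x = q ^ (- -1) *: (x * X) -> Y * x = q ^ (-1) *: (x * Y) ->
  X * y = q ^ (- 2) *: (y * X) -> Y * y = q ^ 2 *: (y * Y) ->
  Serre q x (y + (X - Y) * e) = 0.
Proof.
move=> h1 h2 h3 h4.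
NC.nc 1%N 5%N q q0 q2 [:: e; X; Y; x; y] (ee, ex, ey, eX, eY, xy, h1, h2, h3, h4).
Qed.
End Deform.

(** The Serre expression in the E's commutes, up to a scalar, with whatever its
    letters commute with up to scalars, and with the F's, where the torus elements
    that appear cancel. *)
Section SerreShift.
Variables (L : fieldType) (q : L) (q0 : q != 0) (q2 : q + q^-1 != 0) (A : algType L).

Lemma serre_quasi (u w z : A) (c d : L) : u * z = c *: (z * u) -> w * z = d *: (z * w) ->
  Serre q u w * z = (c * c * d) *: (z * Serre q u w).
Proof.
move=> uz wz.
have tri (x y t : A) (a e f : L) : x * z = a *: (z * x) -> y * z = e *: (z * y) -> t * z = f *: (z * t) ->
    x * y * t * z = (a * e * f) *: (z * (x * y * t)).
  move=> hx hy ht; rewrite -(mulrA (x * y)) ht -scalerAr (mulrA (x * y)) -(mulrA x) hy.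
  rewrite -(scalerAr e) (mulrA x) hx -!scalerAl !scalerA !mulrA.
  by congr (_ *: _); ring.
rewrite mulrDl mulrBl -scalerAl (tri _ _ _ _ _ _ uz uz wz) (tri _ _ _ _ _ _ uz wz uz).
rewrite (tri _ _ _ _ _ _ wz uz uz) mulrDr mulrBr -scalerAr scalerDr scalerBr !scalerA.
by congr (_ *: _ - _ *: _ + _ *: _); ring.
Qed.

Lemma serre_shift_l (X Y u w z : A) :
  u * z = z * u + (X - Y) -> w * z = z * w ->
  X * u = q ^ 2 *: (u * X) -> Y * u = q ^ (- 2) *: (u * Y) ->
  X * w = q ^ (- 1) *: (w * X) -> Y * w = q ^ (- - 1) *: (w * Y) ->
  Serre q u w * z = z * Serre q u w.
Proof.
by move=> h1 h2 h3 h4 h5 h6;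
  NC.nc 0%N 5%N q q0 q2 [:: z; X; Y; u; w] (h1, h2, h3, h4, h5, h6).
Qed.

Lemma serre_shift_r (X Y u w z : A) :
  u * z = z * u -> w * z = z * w + (X - Y) ->
  X * w = q ^ 2 *: (w * X) -> Y * w = q ^ (- 2) *: (w * Y) ->
  X * u = q ^ (- 1) *: (u * X) -> Y * u = q ^ (- - 1) *: (u * Y) ->
  Serre q u w * z = z * Serre q u w.
Proof.
by move=> h1 h2 h3 h4 h5 h6;
  NC.nc 0%N 5%N q q0 q2 [:: z; X; Y; u; w] (h1, h2, h3, h4, h5, h6).
Qed.
End SerreShift.

(** N is the algebra with s = 0: the negative part of the quantum group times the
    torus of the k_i. *)
Section Verma.
Variables (P : iquiver) (Pg : good_iquiver P) (L : fieldType) (q : L) (red : bool).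
Hypotheses (q0 : q != 0) (q2 : q + q^-1 != 0) (q1 : q - q^-1 != 0).
Local Notation I := (vert P).
Local Notation N := (iotaAlg q red (fun _ : I => 0)).
Local Notation b := (ia_b q red (fun _ : I => 0)).
Local Notation k := (ia_k q red (fun _ : I => 0)).
Local Notation kV := (ia_kV q red (fun _ : I => 0)).
Let d := iotaAlg_data q red (fun _ : I => 0).
Implicit Types (i j l : I) (p : I -> int) (x y : N) (X Y : endo N).

Lemma Nbb i j : cartan i j = 0 -> b i * b j = b j * b i.
Proof.
move=> c; case: (eqVneq j (tau i)) => [ji|]; last exact: (io_comm d).
have ti : tau i != i by apply: contraTneq (cartan0_neq c) => e; rewrite ji e eqxx.
by have /eqP := io_pair d ti; rewrite mul0r scale0r subr_eq0 -ji => /eqP.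
Qed.

Lemma Nserre i j : cartan i j = -1 -> Serre q (b i) (b j) = 0.
Proof. by move=> c; rewrite (io_serre d) // mulr0 if_same scale0r. Qed.

Lemma kV_weight i j : kV i * b j = q ^ (cartan i j - cartan (tau i) j) *: (b j * kV i).
Proof.
have := congr1 (fun t => kV i * t * kV i) (io_kb d i j).
rewrite /= mulrA (io_kVk d) mul1r -scalerAr -scalerAl -!mulrA (io_kkV d) mulr1 => ->.
by rewrite scalerA -expfzDr // addrA subrK subrr scale1r.
Qed.

Lemma kVC i x : k i * x = x * k i -> kV i * x = x * kV i.
Proof. exact: inv_comm (io_kkV d i) (io_kVk d i). Qed.

Lemma Nk_kV i j : k i * kV j = kV j * k i. Proof. by rewrite kVC // (io_kk d). Qed.
Lemma NkV_kV i j : kV i * kV j = kV j * kV i. Proof. by rewrite kVC // Nk_kV. Qed.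

Lemma lmulE x y : lmul x y = x * y. Proof. by []. Qed.

(** The relations of N are homogeneous, so a weight function p on the vertices gives
    an automorphism; these are the operators by which the K's act. *)
Lemma om_data p : iota_data q red (fun _ => 0) (fun j => q ^ p j *: b j) k kV.
Proof.
split; [exact: (io_kkV d)|exact: (io_kVk d)|exact: (io_kk d)| | | | |exact: (io_red d)|exact: (io_red_fixed d)].
- by move=> i j; rewrite -scalerAr (io_kb d) -scalerAl !scalerA mulrC.
- by move=> i j c _; rewrite -!scalerAl -!scalerAr Nbb // !scalerA mulrC.
- move=> i ti; rewrite mul0r scale0r -!scalerAl -!scalerAr (Nbb (cartan_taui Pg ti)) !scalerA mulrC.
  exact: subrr.
- by move=> i j c; rewrite mulr0 if_same scale0r SerreZ Nserre ?scaler0.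
Qed.

Definition om_fun p : N -> N := @iota_lift P L q red (fun _ => 0) N (fun j => q ^ p j *: b j) k kV.
Lemma om_hom p : is_alg_hom (om_fun p). Proof. exact: iota_lift_hom (om_data p). Qed.
Fact om_lin p : linear (om_fun p). Proof. by case: (om_hom p). Qed.
Definition om p : endo N := Endo (om_lin p).
Lemma om_b p j : om p (b j) = q ^ p j *: b j. Proof. exact: iota_lift_b (om_data p) _. Qed.
Lemma om_k p j : om p (k j) = k j. Proof. exact: iota_lift_k (om_data p) _. Qed.
Lemma om_kV p j : om p (kV j) = kV j. Proof. exact: iota_lift_kV (om_data p) _. Qed.
Lemma omM p x y : om p (x * y) = om p x * om p y. Proof. exact: homM (om_hom p) x y. Qed.
Lemma om_1 p : om p 1 = 1. Proof. exact: hom1 (om_hom p). Qed.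

Lemma om_om p p' : om p * om p' = om (fun j => p j + p' j).
Proof.
apply: endoP => x; rewrite endoE.
elim/iotaAlg_ind: x => [||j|j|j|x y ex ey|x y ex ey|c x ex];
  rewrite ?endo0r ?om_1 ?om_k ?om_kV ?om_b ?endoZ ?endoD ?omM ?ex ?ey ?om_b //.
by rewrite scalerA -expfzDr // addrC.
Qed.

Lemma om0 p : (forall j, p j = 0) -> om p = 1.
Proof.
move=> p0; apply: endoP => x; rewrite (_ : (1 : endo N) x = x) //.
elim/iotaAlg_ind: x => [||j|j|j|x y ex ey|x y ex ey|c x ex];
  rewrite ?endo0r ?om_1 ?om_k ?om_kV ?om_b ?endoZ ?endoD ?omM ?ex ?ey //.
by rewrite p0 expr0z scale1r.
Qed.

Definition tor x p : endo N := lmul x * om p.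

Lemma torE x p y : tor x p y = x * om p y. Proof. by []. Qed.

Lemma torM x y p p' : (forall p, om p y = y) -> tor x p * tor y p' = tor (x * y) (fun j => p j + p' j).
Proof. by move=> oy; apply: endoP => z; rewrite /tor -om_om !endoE !lmulE omM oy mulrA. Qed.

Lemma tor_b x p j m : x * b j = q ^ m *: (b j * x) ->
  tor x p * lmul (b j) = q ^ (m + p j) *: (lmul (b j) * tor x p).
Proof.
move=> xb; apply: endoP => z; rewrite /tor !endoE !lmulE omM om_b.
by rewrite -scalerAl -scalerAr !mulrA xb -scalerAl scalerA expfzDr // mulrC.
Qed.

Lemma tor_lmul x p y : om p y = y -> x * y = y * x -> tor x p * lmul y = lmul y * tor x p.
Proof. by move=> oy xy; apply: endoP => z; rewrite /tor !endoE !lmulE omM oy !mulrA xy. Qed.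

Definition kx (r : bool) i := if r then k i else 1.
Definition kxV (r : bool) i := if r then kV i else 1.
Definition cc (r : bool) i j := cartan (if r then tau i else i) j.

(** Either choice of r gives K_i the right commutation with multiplication by the
    b_j: k_i itself has weight c_(tau i, j) - c_(i, j), and the automorphism makes up
    for the difference. *)
Definition Kop r i := tor (kx r i) (fun j => - cc r i j).
Definition KVop r i := tor (kxV r i) (fun j => cc r i j).

Lemma om_kx r p i : om p (kx r i) = kx r i. Proof. by case: r; rewrite ?om_k ?om_1. Qed.
Lemma om_kxV r p i : om p (kxV r i) = kxV r i. Proof. by case: r; rewrite ?om_kV ?om_1. Qed.

Lemma tor1 x p : x = 1 -> (forall j, p j = 0) -> tor x p = 1.
Proof. by move=> -> p0; apply: endoP => y; rewrite torE om0 // mul1r. Qed.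

Lemma Kop_KVop r i : Kop r i * KVop r i = 1.
Proof.
rewrite torM; last by move=> p; exact: om_kxV.
by apply: tor1 => [|j]; [case: r; [exact: (io_kkV d)|exact: mul1r]|rewrite addNr].
Qed.
Lemma KVop_Kop r i : KVop r i * Kop r i = 1.
Proof.
rewrite torM; last by move=> p; exact: om_kx.
by apply: tor1 => [|j]; [case: r; [exact: (io_kVk d)|exact: mul1r]|rewrite addrN].
Qed.

Lemma torC x y p p' : (forall p, om p x = x) -> (forall p, om p y = y) -> x * y = y * x ->
  tor x p * tor y p' = tor y p' * tor x p.
Proof. by move=> ox oy xy; rewrite !torM // xy; congr tor; apply/funext => j; rewrite addrC. Qed.

Lemma kx_k r i j : kx r i * k j = k j * kx r i.
Proof. case: r; [exact: (io_kk d)|by rewrite mul1r mulr1]. Qed.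
Lemma kxV_k r i j : kxV r i * k j = k j * kxV r i.
Proof. case: r; [exact: esym (Nk_kV _ _)|by rewrite mul1r mulr1]. Qed.
Lemma kx_kV r i j : kx r i * kV j = kV j * kx r i.
Proof. case: r; [exact: Nk_kV|by rewrite mul1r mulr1]. Qed.
Lemma kxV_kV r i j : kxV r i * kV j = kV j * kxV r i.
Proof. case: r; [exact: NkV_kV|by rewrite mul1r mulr1]. Qed.

Lemma KopC r i r' j : Kop r i * Kop r' j = Kop r' j * Kop r i.
Proof.
apply: torC; [by move=> p; exact: om_kx|by move=> p; exact: om_kx|].
case: r'; [exact: kx_k|by rewrite mul1r mulr1].
Qed.
Lemma KopKVopC r i r' j : Kop r i * KVop r' j = KVop r' j * Kop r i.
Proof.
apply: torC; [by move=> p; exact: om_kx|by move=> p; exact: om_kxV|].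
case: r'; [exact: kx_kV|by rewrite mul1r mulr1].
Qed.
Lemma KVopC r i r' j : KVop r i * KVop r' j = KVop r' j * KVop r i.
Proof.
apply: torC; [by move=> p; exact: om_kxV|by move=> p; exact: om_kxV|].
case: r'; [exact: kxV_kV|by rewrite mul1r mulr1].
Qed.

Lemma Kop_b r i j : Kop r i * lmul (b j) = q ^ (- cartan i j) *: (lmul (b j) * Kop r i).
Proof.
rewrite (tor_b _ (m := if r then cartan (tau i) j - cartan i j else 0)).
  by congr (_ ^ _ *: _); rewrite /cc; case: r; lia.
case: r; [exact: (io_kb d)|by rewrite expr0z scale1r mul1r mulr1].
Qed.
Lemma KVop_b r i j : KVop r i * lmul (b j) = q ^ (cartan i j) *: (lmul (b j) * KVop r i).
Proof.
rewrite (tor_b _ (m := if r then cartan i j - cartan (tau i) j else 0)).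
  by congr (_ ^ _ *: _); rewrite /cc; case: r; lia.
case: r; [exact: kV_weight|by rewrite expr0z scale1r mul1r mulr1].
Qed.

Lemma Kop_k r i j : Kop r i * lmul (k j) = lmul (k j) * Kop r i.
Proof. by apply: tor_lmul; [exact: om_k|exact: kx_k]. Qed.
Lemma KVop_k r i j : KVop r i * lmul (k j) = lmul (k j) * KVop r i.
Proof. by apply: tor_lmul; [exact: om_k|exact: kxV_k]. Qed.
Lemma Kop_kV r i j : Kop r i * lmul (kV j) = lmul (kV j) * Kop r i.
Proof. by apply: tor_lmul; [exact: om_kV|exact: kx_kV]. Qed.
Lemma KVop_kV r i j : KVop r i * lmul (kV j) = lmul (kV j) * KVop r i.
Proof. by apply: tor_lmul; [exact: om_kV|exact: kxV_kV]. Qed.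

(** The product K_i K'_(tau i) has to act as k_i.  If red holds then moreover K'_i is
    the inverse of K_i; this is achieved by giving k_i to one vertex of each orbit
    only, that of smaller rank. *)
Definition rr i := (enum_rank i < enum_rank (tau i))%N.
Definition RK i := ~~ red || rr i.
Definition RK' i := red && rr i.
Definition vK i := Kop (RK i) i.
Definition vKV i := KVop (RK i) i.
Definition vK' i := KVop (RK' i) i.
Definition vKV' i := Kop (RK' i) i.

Lemma RK_red : red -> forall i, RK i = rr i. Proof. by rewrite /RK => ->. Qed.
Lemma RK'_red : red -> forall i, RK' i = rr i. Proof. by rewrite /RK' => ->. Qed.

Lemma RK_nred : ~~ red -> forall i, RK i = true. Proof. by rewrite /RK => ->. Qed.
Lemma RK'_nred : ~~ red -> forall i, RK' i = false. Proof. by rewrite /RK' => /negbTE ->. Qed.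

Lemma vKK' i : vK i * vK' (tau i) = lmul (k i).
Proof.
rewrite /vK /vK' torM; last by move=> p; exact: om_kxV.
have fix_i : rr i = rr (tau i) -> tau i = i.
  rewrite /rr tauK; case: ltngtP => // e _; exact/esym/enum_rank_inj/val_inj.
have asym : rr i -> rr (tau i) = false by rewrite /rr tauK => e; rewrite ltnNge ltnW.
have [er|er] : red \/ ~~ red by case: (red); [left|right].
  2: {
  rewrite RK_nred // RK'_nred //= mulr1 /tor om0 ?mulr1 // => j.
  by rewrite /cc addNr. }
rewrite !RK_red // !RK'_red //; case ri: (rr i).
  rewrite asym //= mulr1 /tor om0 ?mulr1 // => j.
  by rewrite /cc addNr.
case rti: (rr (tau i)) => /=.
  rewrite mul1r (_ : kV (tau i) = k i) /tor ?om0 ?mulr1 // => [j|].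
    by rewrite /cc tauK addNr.
  by rewrite -[LHS]mul1r -(io_red d er i) -mulrA (io_kkV d) mulr1.
have ti : tau i = i by apply: fix_i; rewrite ri rti.
rewrite mul1r (io_red_fixed d er ti) /tor om0 ?mulr1 // => j.
by rewrite /cc ti addNr.
Qed.

Lemma vK'_inv : red -> forall i, vK' i = vKV i.
Proof. by move=> er i; rewrite /vK' /vKV RK_red // RK'_red. Qed.
Lemma vKV'_inv : red -> forall i, vKV' i = vK i.
Proof. by move=> er i; rewrite /vKV' /vK RK_red // RK'_red. Qed.

Definition vH i : endo N := (q - q^-1)^-1 *: (vK i - vK' i).

Lemma vH_k i j : vH i * lmul (k j) = lmul (k j) * vH i.
Proof. by rewrite /vH -scalerAl -scalerAr mulrBl mulrBr Kop_k KVop_k. Qed.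
Section E.
Variable i : I.
Definition wE j : int := cartan (tau j) i - cartan j i.
(** The morphism whose corner is the skew derivation E_i, on generators: the corner is
    the commutator [E_i, F_j] at b_j, and 0 at the torus elements, where the twist
    accounts for the weight of E_i. *)
Definition Psi_b j : endo (N * N)%type :=
  dbl (lmul (b j)) + (if i == j then dbl (vH i) * up N else 0).
Definition Psi_k j : endo (N * N)%type := dbl (lmul (k j)) * twist N (q ^ wE j).
Definition Psi_kV j : endo (N * N)%type := dbl (lmul (kV j)) * twist N (q ^ - wE j).

Let dM (X Y : endo N) : dbl (X * Y) = dbl X * dbl Y. Proof. by case: (dbl_hom N). Qed.
Let dZ c (X : endo N) : dbl (c *: X) = c *: dbl X. Proof. exact: homZ (dbl_hom N) c X. Qed.
Let dB (X Y : endo N) : dbl (X - Y) = dbl X - dbl Y. Proof. exact: homB (dbl_hom N) X Y. Qed.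
Let d1 : dbl (1 : endo N) = 1. Proof. exact: hom1 (dbl_hom N). Qed.
Let d0 : dbl (0 : endo N) = 0. Proof. exact: hom0 (dbl_hom N). Qed.
Let lM x y : lmul (x * y) = lmul x * lmul y. Proof. by case: (lmul_hom N). Qed.
Let lZ c x : lmul (c *: x) = c *: lmul x. Proof. exact: homZ (lmul_hom N) c x. Qed.
Let l1 : lmul (1 : N) = 1. Proof. exact: hom1 (lmul_hom N). Qed.

Let XK j : endo (N * N)%type := (q - q^-1)^-1 *: dbl (vK j).
Let XK' j : endo (N * N)%type := (q - q^-1)^-1 *: dbl (vK' j).
Let dH j : dbl (vH j) = XK j - XK' j. Proof. by rewrite /vH dZ dB scalerBr. Qed.
Let XKb j l : XK j * dbl (lmul (b l)) = q ^ (- cartan j l) *: (dbl (lmul (b l)) * XK j).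
Proof. by rewrite /XK -!scalerAl -dM Kop_b dZ dM -!scalerAr !scalerA mulrC. Qed.
Let XK'b j l : XK' j * dbl (lmul (b l)) = q ^ (cartan j l) *: (dbl (lmul (b l)) * XK' j).
Proof. by rewrite /XK' -!scalerAl -dM KVop_b dZ dM -!scalerAr !scalerA mulrC. Qed.
Let upXK j : up N * XK j = XK j * up N. Proof. by rewrite /XK -scalerAl -scalerAr up_dbl. Qed.
Let upXK' j : up N * XK' j = XK' j * up N. Proof. by rewrite /XK' -scalerAl -scalerAr up_dbl. Qed.

Let tw_dbl t t' X Y : (dbl X * twist N t) * (dbl Y * twist N t') = dbl (X * Y) * twist N (t * t').
Proof. by rewrite -mulrA (mulrA (twist N t)) twist_dbl -(mulrA (dbl Y)) twistM mulrA dM. Qed.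

Lemma wE_tau j : wE j + wE (tau j) = 0.
Proof. by rewrite /wE tauK; lia. Qed.

Lemma Psi_data : iota_data q red (fun _ => 0) Psi_b Psi_k Psi_kV.
Proof.
have kb j l : Psi_k j * Psi_b l = q ^ (cartan (tau j) l - cartan j l) *: (Psi_b l * Psi_k j).
  rewrite /Psi_k /Psi_b mulrDr mulrDl scalerDr; congr (_ + _).
    rewrite -mulrA twist_dbl mulrA -dM -lM (io_kb d) lZ dZ lM dM -!scalerAl.
    by congr (_ *: _); rewrite mulrA.
  case: eqP => [<-|_]; last by rewrite mulr0 mul0r scaler0.
  rewrite -mulrA (mulrA (twist _ _)) twist_dbl -(mulrA (dbl (vH i))) twist_up -!scalerAr.
  congr (_ *: _).
  rewrite -(mulrA (dbl (vH i))) (mulrA (up N)) up_dbl -(mulrA (dbl (lmul _))).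
  by rewrite !(mulrA (dbl _) (dbl _)) -!dM vH_k.
have sw j l : cartan j l = 0 -> Psi_b j * Psi_b l = Psi_b l * Psi_b j.
  move=> c; have cl : cartan l j = 0 by rewrite cartanC.
  have e0 := congr1 (fun t => dbl (lmul t)) (Nbb c); rewrite /= !lM !dM in e0.
  rewrite /Psi_b; case: eqP => [ij|_]; case: eqP => [il|_]; rewrite ?addr0 //.
  - by move: c; rewrite -il ij cartan_ii.
  - rewrite dH; have e1 := XKb i l; have e2 := XK'b i l; rewrite ij c in e1 e2.
    by rewrite ij; apply: deform_comm e1 e2 e0 => //; exact: up_dbl.
  - rewrite dH; have e1 := XKb i j; have e2 := XK'b i j; rewrite il cl in e1 e2.
    by rewrite il; apply/esym/(deform_comm q0 q2 (up_dbl _) e1 e2); rewrite e0.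
split; [ | | |exact: kb|by move=> j l c _; exact: sw| | | | ].
- by move=> j; rewrite tw_dbl -lM (io_kkV d) l1 -expfzDr // subrr twist1 mulr1 d1.
- by move=> j; rewrite tw_dbl -lM (io_kVk d) l1 -expfzDr // addNr twist1 mulr1 d1.
- by move=> j l; rewrite !tw_dbl -!lM (io_kk d) mulrC.
- by move=> j tj; rewrite mul0r scale0r sw ?subrr // (cartan_taui Pg tj).
- move=> j l c; have cl : cartan l j = -1 by rewrite cartanC.
  rewrite mulr0 if_same scale0r.
  have e0 : Serre q (dbl (lmul (b j))) (dbl (lmul (b l))) = 0.
    by rewrite -d0 -(hom0 (lmul_hom N)) -(Nserre c) !(homE (lmul_hom N)) !(homE (dbl_hom N)).
  have u1 := up_dbl (lmul (b l)); have u2 := up_dbl (lmul (b j)); have u0 := up_up N.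
  rewrite /Psi_b; case: eqP => [ij|_]; case: eqP => [il|_]; rewrite ?addr0 //.
  + by move: c; rewrite -il ij cartan_ii.
  + rewrite dH; have e1 := XKb i l; have e2 := XK'b i l; have e3 := XKb i j; have e4 := XK'b i j.
    have e5 := upXK i; have e6 := upXK' i; rewrite ij c cartan_ii in e1 e2 e3 e4 e5 e6; rewrite ij.
    exact: (deform_serre_l q0 q2 u0 u2 u1 e5 e6 e0 e3 e4 e1 e2).
  + rewrite dH; have e1 := XKb i l; have e2 := XK'b i l; have e3 := XKb i j; have e4 := XK'b i j.
    have e5 := upXK i; have e6 := upXK' i; rewrite il cl cartan_ii in e1 e2 e3 e4 e5 e6; rewrite il.
    exact: (deform_serre_r q0 q2 u0 u2 u1 e5 e6 e0 e3 e4 e1 e2).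
- by move=> er j; rewrite tw_dbl -lM (io_red d) // l1 -expfzDr // wE_tau twist1 mulr1 d1.
- move=> er j tj; rewrite /Psi_k (io_red_fixed d) // l1 d1 mul1r.
  by rewrite /wE tj subrr twist1.
Qed.

Definition Psi : N -> endo (N * N)%type :=
  @iota_lift P L q red (fun _ => 0) (endo (N * N)%type) Psi_b Psi_k Psi_kV.
Lemma Psi_hom : is_alg_hom Psi. Proof. exact: iota_lift_hom Psi_data. Qed.

Lemma PsiEb j : Psi (b j) = Psi_b j. Proof. exact: (iota_lift_b Psi_data). Qed.
Lemma PsiEk j : Psi (k j) = Psi_k j. Proof. exact: (iota_lift_k Psi_data). Qed.
Lemma PsiEkV j : Psi (kV j) = Psi_kV j. Proof. exact: (iota_lift_kV Psi_data). Qed.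

Lemma Psi_2 x (u : N * N) : (Psi x u).2 = x * u.2.
Proof.
elim/iotaAlg_ind: x u => [||j|j|j|x y ex ey|x y ex ey|c x ex] u.
- by rewrite (hom0 Psi_hom) mul0r.
- by rewrite (hom1 Psi_hom) mul1r.
- have e : ((if i == j then dbl (vH i) * up N else 0 : endo (N * N)%type) u).2 = 0.
    by case: ifP => _ //; exact: endo0r.
  by rewrite PsiEb -[RHS]addr0 -e.
- by rewrite PsiEk.
- by rewrite PsiEkV.
- by rewrite (homD Psi_hom) endoE /= ex ey mulrDl.
- by rewrite (homM Psi_hom) endoE /= ex ey mulrA.
- by rewrite (homZ Psi_hom) endoE /= ex scalerAl.
Qed.

Fact vE_lin : linear (fun y => (Psi y (0, 1)).1).
Proof. by move=> c x y; case: Psi_hom => -> _ _; rewrite !endoE. Qed.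
(** Applying the matrix to the column (0, 1) reads off its corner at 1. *)
Definition vE : endo N := Endo vE_lin.

Lemma vE_1 : vE 1 = 0. Proof. by rewrite /= (hom1 Psi_hom). Qed.

Lemma vE_b j : vE * lmul (b j) = lmul (b j) * vE + (if i == j then vH i else 0).
Proof.
apply: endoP => y; rewrite !endoE /= (homM Psi_hom) PsiEb endoE.
rewrite /Psi_b endoE /=; case: ifP => _; last by [].
by rewrite [in LHS]endoE /= Psi_2 mulr1.
Qed.

Lemma vE_k j : vE * lmul (k j) = q ^ wE j *: (lmul (k j) * vE).
Proof.
apply: endoP => y; rewrite !endoE /= (homM Psi_hom) PsiEk endoE.
by rewrite /Psi_k endoE /= -scalerAr.
Qed.

Lemma vE_kV j : vE * lmul (kV j) = q ^ (- wE j) *: (lmul (kV j) * vE).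
Proof.
apply: endoP => y; rewrite !endoE /= (homM Psi_hom) PsiEkV endoE.
by rewrite /Psi_kV endoE /= -scalerAr.
Qed.
End E.

(** Words in the generators applied to 1 span N, and such an operator can be moved
    through the words until it reaches 1.  Each relation between the operators K_i
    and E_j is proved by applying this to the difference of its two sides. *)
Lemma quasi_comm_eq0 X : X 1 = 0 ->
  (forall j, exists c : L, X * lmul (b j) = c *: (lmul (b j) * X)) ->
  (forall j, exists c : L, X * lmul (k j) = c *: (lmul (k j) * X)) ->
  (forall j, exists c : L, X * lmul (kV j) = c *: (lmul (kV j) * X)) -> X = 0.
Proof.
move=> X1 Xb Xk XkV; apply: endoP => y; rewrite -[y]mulr1.
suff H : forall z, X z = 0 -> X (y * z) = 0 by rewrite H.
have g x : (exists c : L, X * lmul x = c *: (lmul x * X)) -> forall z, X z = 0 -> X (x * z) = 0.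
  move=> [c e] z Xz; have := congr1 (fun f : endo N => f z) e.
  by rewrite !endoE /= Xz mulr0 scaler0.
elim/iotaAlg_ind: y => [||j|j|j|x y ex ey|x y ex ey|c x ex] z Xz.
- by rewrite mul0r endo0r.
- by rewrite mul1r.
- exact: g (Xb j) _ Xz.
- exact: g (Xk j) _ Xz.
- exact: g (XkV j) _ Xz.
- by rewrite mulrDl endoD ex // ey // addr0.
- by rewrite -mulrA; apply/ex/ey.
- by rewrite -scalerAl endoZ ex // scaler0.
Qed.

Lemma KopH r i j : Kop r i * vH j = vH j * Kop r i.
Proof. by rewrite /vH -scalerAl -scalerAr mulrBl mulrBr KopC KopKVopC. Qed.
Lemma KVopH r i j : KVop r i * vH j = vH j * KVop r i.
Proof. by rewrite /vH -scalerAl -scalerAr mulrBl mulrBr KopKVopC KVopC. Qed.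

Lemma vE_kx i r j : vE i (kx r j) = 0.
Proof.
case: r; last exact: vE_1.
rewrite /kx -[k j]mulr1 -lmulE -endo_mulE vE_k endo_scaleE endo_mulE vE_1.
by rewrite endo0r scaler0.
Qed.
Lemma vE_kxV i r j : vE i (kxV r j) = 0.
Proof.
case: r; last exact: vE_1.
rewrite /kxV -[kV j]mulr1 -lmulE -endo_mulE vE_kV endo_scaleE endo_mulE vE_1.
by rewrite endo0r scaler0.
Qed.

(** The difference of the two sides kills 1 and quasi-commutes with multiplication by
    the generators. *)
Lemma quasi_comm_E (T : endo N) j (c : L) (x : N) (m : I -> L) :
  T 1 = x -> vE j x = 0 -> (forall l, T * lmul (b l) = m l *: (lmul (b l) * T)) ->
  (forall l, T * lmul (k l) = lmul (k l) * T) ->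
  (forall l, T * lmul (kV l) = lmul (kV l) * T) ->
  T * vH j = vH j * T -> c * m j = 1 -> T * vE j = c *: (vE j * T).
Proof.
move=> T1 Ex Tb Tk TkV TH cm; apply/eqP; rewrite -subr_eq0; apply/eqP.
apply: quasi_comm_eq0 => [|l|l|l].
- by rewrite !endoE T1 Ex scaler0 subr0 vE_1 endo0r.
- exists (m l); rewrite mulrBl mulrBr scalerBr.
  rewrite -(mulrA T) vE_b mulrDr (mulrA T) Tb -!scalerAl -(mulrA (vE j)) Tb.
  rewrite -!scalerAr (mulrA (vE j)) vE_b mulrDl !scalerDr !scalerA.
  have -> : T * (if j == l then vH j else 0) = (c * m l) *: ((if j == l then vH j else 0) * T).
    by case: eqP => [<-|_]; rewrite ?cm ?scale1r // mulr0 mul0r scaler0.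
  by rewrite opprD addrACA subrr addr0 -!mulrA [c * _]mulrC.
- exists (q ^ wE j l); rewrite mulrBl mulrBr scalerBr.
  rewrite -(mulrA T) vE_k -!scalerAr (mulrA T) Tk -!scalerAl -(mulrA (vE j)) Tk (mulrA (vE j)) vE_k.
  by rewrite -!scalerAl !scalerA -!mulrA [c * _]mulrC.
- exists (q ^ - wE j l); rewrite mulrBl mulrBr scalerBr.
  rewrite -(mulrA T) vE_kV -!scalerAr (mulrA T) TkV -!scalerAl -(mulrA (vE j)) TkV (mulrA (vE j)) vE_kV.
  by rewrite -!scalerAl !scalerA -!mulrA [c * _]mulrC.
Qed.

Lemma Kop_E r i j : Kop r i * vE j = q ^ cartan i j *: (vE j * Kop r i).
Proof.
apply: (quasi_comm_E (x := kx r i) (m := fun l => q ^ (- cartan i l))) => [|||l|l||].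
- by rewrite /Kop torE om_1 mulr1.
- exact: vE_kx.
- by move=> l; exact: Kop_b.
- exact: Kop_k.
- exact: Kop_kV.
- exact: KopH.
- by rewrite -expfzDr // subrr.
Qed.

Lemma KVop_E r i j : KVop r i * vE j = q ^ (- cartan i j) *: (vE j * KVop r i).
Proof.
apply: (quasi_comm_E (x := kxV r i) (m := fun l => q ^ cartan i l)) => [|||l|l||].
- by rewrite /KVop torE om_1 mulr1.
- exact: vE_kxV.
- by move=> l; exact: KVop_b.
- exact: KVop_k.
- exact: KVop_kV.
- exact: KVopH.
- by rewrite -expfzDr // addNr.
Qed.

Let hK i : endo N := (q - q^-1)^-1 *: vK i.
Let hK' i : endo N := (q - q^-1)^-1 *: vK' i.
Let hKE i j : hK i * vE j = q ^ cartan i j *: (vE j * hK i).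
Proof. by rewrite /hK -scalerAl Kop_E -scalerAr !scalerA mulrC. Qed.
Let hK'E i j : hK' i * vE j = q ^ (- cartan i j) *: (vE j * hK' i).
Proof. by rewrite /hK' -scalerAl KVop_E -scalerAr !scalerA mulrC. Qed.
Let vHE i : vH i = hK i - hK' i. Proof. by rewrite /vH scalerBr. Qed.

Lemma vEE0 i j : cartan i j = 0 -> vE i * vE j = vE j * vE i.
Proof.
move=> c; have cj : cartan j i = 0 by rewrite cartanC.
have HE l m : cartan l m = 0 -> vH l * vE m = vE m * vH l.
  by move=> e; rewrite vHE mulrBl mulrBr hKE hK'E e oppr0 !expr0z !scale1r.
apply/eqP; rewrite -subr_eq0; apply/eqP; apply: quasi_comm_eq0 => [|l|l|l].
- by rewrite !endoE !vE_1 !endo0r subr0.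
- exists 1; rewrite scale1r mulrBl mulrBr -!mulrA !vE_b !mulrDr !mulrA !vE_b !mulrDl.
  set u := (if i == l then vH i else 0); set w := (if j == l then vH j else 0).
  have -> : u * vE j = vE j * u by rewrite /u; case: ifP; rewrite ?mulr0 ?mul0r ?HE.
  have -> : w * vE i = vE i * w by rewrite /w; case: ifP; rewrite ?mulr0 ?mul0r ?HE.
  rewrite -(addrA (_ * vE i * vE j)) -(addrA (_ * vE j * vE i)) [vE j * u + _]addrC.
  by rewrite opprD addrACA subrr addr0.
- exists (q ^ wE i l * q ^ wE j l); rewrite mulrBl mulrBr scalerBr -!mulrA !vE_k.
  rewrite -!scalerAr !(mulrA (vE _)) !vE_k -!scalerAl !scalerA -!mulrA.
  by rewrite [q ^ wE j l * _]mulrC.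
- exists (q ^ (- wE i l) * q ^ (- wE j l)); rewrite mulrBl mulrBr scalerBr -!mulrA !vE_kV.
  rewrite -!scalerAr !(mulrA (vE _)) !vE_kV -!scalerAl !scalerA -!mulrA.
  by rewrite [q ^ (- wE j l) * _]mulrC.
Qed.

Lemma vEE1 i j : cartan i j = -1 -> Serre q (vE i) (vE j) = 0.
Proof.
move=> c; have cj : cartan j i = -1 by rewrite cartanC.
apply: quasi_comm_eq0 => [|l|l|l].
- by rewrite !endoE !vE_1 !endo0r scaler0 subrr addr0.
- exists 1; rewrite scale1r; have Ei := vE_b i l; have Ej := vE_b j l.
  have e1 := hKE i i; have e2 := hK'E i i; have e3 := hKE i j; have e4 := hK'E i j.
  have e5 := hKE j i; have e6 := hK'E j i; have e7 := hKE j j; have e8 := hK'E j j.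
  rewrite !cartan_ii c cj !vHE in e1 e2 e3 e4 e5 e6 e7 e8 Ei Ej.
  case: (eqVneq i l) Ei => [il|il] Ei; case: (eqVneq j l) Ej => [jl|jl] Ej; rewrite ?addr0 in Ei Ej.
  + by have := adj_neq' c; rewrite il jl eqxx.
  + exact: serre_shift_l Ei Ej e1 e2 e3 e4.
  + exact: serre_shift_r Ei Ej e7 e8 e5 e6.
  + by rewrite (@serre_quasi _ q _ (vE i) (vE j) _ 1 1) ?mulr1 scale1r.
- by exists (q ^ wE i l * q ^ wE i l * q ^ wE j l); apply: serre_quasi => //; exact: vE_k.
- by exists (q ^ (- wE i l) * q ^ (- wE i l) * q ^ (- wE j l)); apply: serre_quasi => //; exact: vE_kV.
Qed.

Lemma verma_qg : qg_data q vE (fun i => lmul (b i)) vK vKV vK' vKV'.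
Proof.
split=> [i|i|i|i|i j|i j|i j|i j|i j|i j|i j|i j|i j c|i j c|i j c|i j c].
- exact: Kop_KVop.
- exact: KVop_Kop.
- exact: KVop_Kop.
- exact: Kop_KVop.
- exact: KopC.
- exact: KopKVopC.
- exact: KVopC.
- rewrite vE_b addrAC subrr add0r /vH; case: eqP => [->//|_]; by rewrite scale0r.
- exact: Kop_E.
- exact: Kop_b.
- exact: KVop_E.
- exact: KVop_b.
- exact: vEE0.
- exact: vEE1.
- by rewrite -!(homM (lmul_hom N)) Nbb.
- by rewrite -[RHS](hom0 (lmul_hom N)) -(Nserre c) !(homE (lmul_hom N)).
Qed.
End Verma.

(** * The weights of the Verma module *)

Section Homogeneous.
Variables (P : iquiver) (L : fieldType).

(** The degree that counts the letters b.  The last clause, for a scalar that is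
    zero, makes the right-hand sides of the relations with s = 0 homogeneous. *)
Inductive homog : nat -> aterm L (iota_gen P) -> Prop :=
| homog_0 n : homog n 0%AT
| homog_1 : homog 0 1%AT
| homog_b j : homog 1 (AGen (iB j))
| homog_k j : homog 0 (AGen (ik j))
| homog_kV j : homog 0 (AGen (ikV j))
| homog_add n t u : homog n t -> homog n u -> homog n (t + u)%AT
| homog_mul n m t u : homog n t -> homog m u -> homog (n + m) (t * u)%AT
| homog_scale c n t : homog n t -> homog n (c *: t)%AT
| homog_scale0 c n t : c = 0 -> homog n (c *: t)%AT.
End Homogeneous.

Section Grading.
Variables (P : iquiver) (Pg : good_iquiver P) (L : fieldType) (q : L) (red : bool).
Hypotheses (q0 : q != 0) (q2 : q + q^-1 != 0) (q1 : q - q^-1 != 0).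
Hypothesis q_inf : forall m n : int, m != n -> q ^ m != q ^ n.
Local Notation I := (vert P).
Local Notation N := (iotaAlg q red (fun _ : I => 0)).
Local Notation b := (ia_b q red (fun _ : I => 0)).
Local Notation k := (ia_k q red (fun _ : I => 0)).
Local Notation kV := (ia_kV q red (fun _ : I => 0)).
Variables (s : I -> L).
Local Notation om1 := (om Pg q red (fun _ => 1)).
Local Notation vE := (vE Pg red q0 q2 q1).
Local Notation vK := (vK Pg q red).
Local Notation vK' := (vK' Pg q red).
Implicit Types (m n : int) (x y z : N).

(** The operator by which B_i acts. *)
Definition vB i : endo N := lmul (b i) + s i *: (vE (tau i) * vK' i).
Definition evE : aterm L (iota_gen P) -> endo N :=
  aeval (iota_fun vB (fun i => lmul (k i)) (fun i => lmul (kV i))).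
Definition evN : aterm L (iota_gen P) -> N := aeval (iota_fun b k kV).

(** The grading of N by degree, through the eigenvalues of one weight automorphism:
    q is not a root of unity. *)
Definition eigen m y := om1 y = q ^ m *: y.

Lemma eigenD m x y : eigen m x -> eigen m y -> eigen m (x + y).
Proof. by rewrite /eigen endoD scalerDr => -> ->. Qed.
Lemma eigenZ m c x : eigen m x -> eigen m (c *: x).
Proof. by rewrite /eigen endoZ => ->; rewrite !scalerA mulrC. Qed.
Lemma eigen0 m : eigen m 0.
Proof. by rewrite /eigen endo0r scaler0. Qed.
Lemma eigenM m n x y : eigen m x -> eigen n y -> eigen (m + n) (x * y).
Proof.
rewrite /eigen omM => -> ->.
by rewrite -scalerAl -scalerAr scalerA -expfzDr.
Qed.

Inductive low (n : int) : N -> Prop :=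
| low_0 : low n 0
| low_cons m x y : m < n -> eigen m x -> low n y -> low n (x + y).

Lemma lowW m n y : m <= n -> low m y -> low n y.
Proof.
move=> mn; elim=> [|p x z pm ex _ lz]; first exact: low_0.
by apply: low_cons ex lz; exact: lt_le_trans mn.
Qed.
Lemma lowD n x y : low n x -> low n y -> low n (x + y).
Proof. by elim=> [|p u z pm ex _ lz] ly; rewrite ?add0r // -addrA; apply: low_cons ex (lz ly). Qed.
Lemma lowZ n c x : low n x -> low n (c *: x).
Proof.
elim=> [|p u z pm ex _ lz]; first by rewrite scaler0; exact: low_0.
by rewrite scalerDr; apply: low_cons (eigenZ c ex) lz.
Qed.
Lemma low_eigen m n x : m < n -> eigen m x -> low n x.
Proof. by move=> mn ex; rewrite -[x]addr0; apply: low_cons ex (low_0 n). Qed.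

(** Each eigenvalue q^m with m < n is killed by a factor of a polynomial in the weight
    automorphism that does not vanish at q^n. *)
Lemma eigen_low n y : eigen n y -> low n y -> y = 0.
Proof.
move=> en ly; suff [X [Xo Xy [c c0 Xn]]] : exists X : endo N,
    [/\ X * om1 = om1 * X, X y = 0 & exists2 c : L, c != 0 & forall z, eigen n z -> X z = c *: z].
  by have /eqP := Xn _ en; rewrite Xy eq_sym scaler_eq0 (negbTE c0) => /eqP.
elim: ly => {y en} [|m x y mn ex _ [X [Xo Xy [c c0 Xn]]]].
  by exists 1; split; rewrite ?mul1r ?mulr1 //; exists 1; rewrite ?oner_eq0 // => z _; rewrite scale1r.
exists ((om1 - q ^ m *: 1) * X); split.
- by rewrite mulrBl -scalerAl mul1r mulrBl mulrBr -mulrA Xo -scalerAl -scalerAr Xo.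
- have e : X (om1 x) = om1 (X x) by rewrite -!endo_mulE Xo.
  by rewrite endo_mulE endoD Xy addr0 !endoE -e ex endoZ subrr.
- exists (c * (q ^ n - q ^ m)) => [|z ez].
    by rewrite mulf_neq0 // subr_eq0 q_inf // gt_eqF.
  rewrite endo_mulE (Xn _ ez) endoZ !endoE (_ : om1 z = q ^ n *: z) //.
  by rewrite (_ : (1 : endo N) z = z) // -scalerBl scalerA.
Qed.

Lemma om1_E i : om1 * vE i = q^-1 *: (vE i * om1).
Proof.
have omt p : om Pg q red p = tor Pg 1 p by apply: endoP => x; rewrite torE mul1r.
apply: (quasi_comm_E (x := 1) (m := fun _ => q)) => [|||l|l||].
- exact: om_1.
- exact: vE_1.
- by move=> l; apply: endoP => x; rewrite !endoE !lmulE omM // om_b // -scalerAl.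
- by apply: endoP => x; rewrite !endoE !lmulE omM // om_k.
- by apply: endoP => x; rewrite !endoE !lmulE omM // om_kV.
- rewrite omt /vH -scalerAl -scalerAr mulrBl mulrBr /vK /Kop /vK' /KVop; congr (_ *: (_ - _)).
    by apply: torC; rewrite ?mul1r ?mulr1 // => p; [exact: om_1|exact: om_kx].
  by apply: torC; rewrite ?mul1r ?mulr1 // => p; [exact: om_1|exact: om_kxV].
- by rewrite mulVf.
Qed.

Lemma om1_K' i : om1 * vK' i = vK' i * om1.
Proof.
have omt p : om Pg q red p = tor Pg 1 p by apply: endoP => x; rewrite torE mul1r.
by rewrite omt; apply: torC; rewrite ?mul1r ?mulr1 // => p; [exact: om_1|exact: om_kxV].
Qed.

Lemma eigen_EK' i m y : eigen m y -> eigen (m - 1) (vE (tau i) (vK' i y)).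
Proof.
move=> ey; rewrite /eigen -endo_mulE om1_E endo_scaleE endo_mulE -(endo_mulE om1 (vK' i)).
rewrite om1_K' endo_mulE ey !endoZ.
by rewrite scalerA expfzDr // mulrC.
Qed.

Lemma eigen_evN (n : nat) t : homog n t -> eigen n (evN t).
Proof.
elim=> {n t} /= [n||j|j|j|n t u _ et _ eu|n m t u _ et _ eu|c n t _ et|c n t ->].
- exact: eigen0.
- by rewrite /eigen om_1 // expr0z scale1r.
- exact: om_b.
- by rewrite /eigen om_k // expr0z scale1r.
- by rewrite /eigen om_kV // expr0z scale1r.
- exact: eigenD.
- by rewrite PoszD; exact: eigenM.
- exact: eigenZ.
- by rewrite /evN /= scale0r; exact: eigen0.
Qed.

(** B_j differs from multiplication by b_j by a multiple of E_(tau j) K'_j, which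
    lowers the degree by one. *)
Lemma evE_low (n : nat) t : homog n t -> forall m y, eigen m y ->
  low (n%:Z + m) (evE t y - evN t * y).
Proof.
elim=> {n t} [n||j|j|j|n t u ht et hu eu|n n' t u ht et hu eu|c n t ht et|c n t ->] m y ey.
- by rewrite mul0r subr0; exact: low_0.
- by rewrite mul1r subrr; exact: low_0.
- have -> : evE (AGen (iB j)) y - evN (AGen (iB j)) * y = s j *: vE (tau j) (vK' j y).
    by rewrite /evE /evN /= [LHS]addrC addKr.
  by apply: lowZ; apply: low_eigen (eigen_EK' j ey); lia.
- by rewrite /evE /evN /= subrr; exact: low_0.
- by rewrite /evE /evN /= subrr; exact: low_0.
- rewrite /evE /evN /= mulrDl opprD addrACA; exact: lowD (et _ _ ey) (eu _ _ ey).
- rewrite PoszD /evE /evN /= -/(evE t) -/(evN t) -/(evE u) -/(evN u).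
  have -> : evE t (evE u y) - evN t * evN u * y =
     evE t (evE u y - evN u * y) + (evE t (evN u * y) - evN t * (evN u * y)).
    have e := endoD (evE t) (evE u y - evN u * y) (evN u * y); rewrite subrK in e.
    by rewrite e -addrA mulrA.
  apply: lowD; last by rewrite -addrA; apply/et/eigenM => //; exact: eigen_evN.
  rewrite -addrA; elim: (eu _ _ ey) => [|p x z pl ex _ lz]; first by rewrite endo0r; exact: low_0.
  rewrite endoD; apply: lowD => //; rewrite -[evE t x](subrK (evN t * x)).
  apply: lowD; first by apply: lowW (et _ _ ex); lia.
  by apply: low_eigen (eigenM (eigen_evN ht) ex); lia.
- by rewrite /evE /evN /= -scalerAl -scalerBr; apply/lowZ/et.
- by rewrite /evE /evN /= !scale0r mul0r subr0; exact: low_0.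
Qed.

Lemma evE_1_low (n : nat) (m : int) t : homog n t -> n%:Z < m -> low m (evE t 1).
Proof.
move=> ht nm; have e1 : eigen 0 1 by rewrite /eigen om_1 // expr0z scale1r.
rewrite -[evE t 1](subrK (evN t * 1)); apply: lowD.
  by apply: lowW (evE_low ht e1); lia.
by rewrite mulr1; apply: low_eigen nm (eigen_evN ht).
Qed.

Lemma evE_1_top (n : nat) t : homog n t -> low n (evE t 1) -> evN t = 0.
Proof.
move=> ht lt; have e1 : eigen 0 1 by rewrite /eigen om_1 // expr0z scale1r.
apply: (eigen_low (eigen_evN ht)); have := evE_low ht e1; rewrite addr0 mulr1 => l.
have -> : evN t = evE t 1 + -1 *: (evE t 1 - evN t) by rewrite scaleN1r opprB addrC subrK.
exact: lowD lt (lowZ _ l).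
Qed.
End Grading.

(** * Faithfulness of the Verma module *)

Section Filtration.
Variables (P : iquiver) (Pg : good_iquiver P) (L : fieldType) (q : L) (red : bool).
Local Notation I := (vert P).
Variables (s : I -> L).
Local Notation A := (iotaAlg q red s).
Local Notation b := (ia_b q red s).
Local Notation k := (ia_k q red s).
Local Notation kV := (ia_kV q red s).
Let d := iotaAlg_data q red s.
Implicit Types (m n : nat) (x y z : A) (t u : aterm L (iota_gen P)).

Definition evA : aterm L (iota_gen P) -> A := aeval (iota_fun b k kV).

(** Degree less than n, where n bounds strictly so that Fil 0 is zero. *)
Inductive Fil (n : nat) : A -> Prop :=
| Fil_0 : Fil n 0
| Fil_cons m t x : (m < n)%N -> homog m t -> Fil n x -> Fil n (evA t + x).

Lemma FilW m n x : (m <= n)%N -> Fil m x -> Fil n x.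
Proof.
move=> mn; elim=> [|p t z pm ht _ lz]; first exact: Fil_0.
by apply: Fil_cons ht lz; exact: leq_trans mn.
Qed.
Lemma FilD n x y : Fil n x -> Fil n y -> Fil n (x + y).
Proof. by elim=> [|m t z mn ht _ lz] ly; rewrite ?add0r // -addrA; apply: Fil_cons ht (lz ly). Qed.
Lemma FilZ n c x : Fil n x -> Fil n (c *: x).
Proof.
elim=> [|m t z mn ht _ lz]; first by rewrite scaler0; exact: Fil_0.
by rewrite scalerDr; apply: (@Fil_cons _ m (c *: t)%AT) => //; exact: homog_scale.
Qed.
Lemma FilN n x : Fil n x -> Fil n (- x).
Proof. by rewrite -scaleN1r; exact: FilZ. Qed.
Lemma Fil_homog m n t : (m < n)%N -> homog m t -> Fil n (evA t).
Proof. by move=> mn ht; rewrite -[evA t]addr0; apply: Fil_cons mn ht (Fil_0 n). Qed.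
Lemma FilM m n x y : Fil m x -> Fil n y -> Fil (m + n).-1 (x * y).
Proof.
move=> Fx Fy; elim: Fx => [|p t z pm ht _ IH]; first by rewrite mul0r; exact: Fil_0.
rewrite mulrDl; apply: FilD => //; elim: Fy => [|r u w rn hu _ IH']; first by rewrite mulr0; exact: Fil_0.
rewrite mulrDr; apply: FilD => //; apply: (@Fil_homog (p + r) _ (t * u)%AT); last exact: homog_mul.
by lia.
Qed.
Lemma Fil_sum (J : Type) (r : seq J) (Q : pred J) n (f : J -> A) :
  (forall j, Q j -> Fil n (f j)) -> Fil n (\sum_(j <- r | Q j) f j).
Proof. by move=> h; apply: big_ind => //; [exact: Fil_0|exact: FilD]. Qed.

(** The components of degree n are gathered in a single homogeneous word, the top
    component. *)
Lemma Fil_split n x : Fil n.+1 x -> exists t y, [/\ homog n t, Fil n y & x = evA t + y].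
Proof.
elim=> [|m t z mn ht _ [u [y [hu Fy ->]]]].
  by exists AZero, 0; split; [exact: homog_0|exact: Fil_0|rewrite addr0].
case: (ltngtP m n) mn => [mn _|nm mn|e _]; [ |by rewrite ltnS leqNgt nm in mn|].
  exists u, (evA t + y); split=> //; last by rewrite addrCA.
  by apply: FilD => //; exact: Fil_homog ht.
rewrite e in ht; exists (t + u)%AT, y; split=> //; last by rewrite addrA.
exact: homog_add.
Qed.

Lemma Fil_total x : exists n, Fil n x.
Proof.
elim/iotaAlg_ind: x => [||j|j|j|x y [m Fx] [n Fy]|x y [m Fx] [n Fy]|c x [m Fx]].
- by exists 0%N; exact: Fil_0.
- by exists 1%N; apply: (@Fil_homog 0 1 1%AT) => //; exact: homog_1.
- by exists 2%N; apply: (@Fil_homog 1 2 (AGen (iB j))) => //; exact: homog_b.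
- by exists 1%N; apply: (@Fil_homog 0 1 (AGen (ik j))) => //; exact: homog_k.
- by exists 1%N; apply: (@Fil_homog 0 1 (AGen (ikV j))) => //; exact: homog_kV.
- by exists (m + n)%N; apply: FilD; [apply: FilW Fx|apply: FilW Fy]; lia.
- by exists (m + n).-1; exact: FilM.
- by exists m; exact: FilZ.
Qed.

(** Evaluation in the Rees algebra: the power of 'X records the degree of the word, so
    that congruences of words that are not homogeneous can be followed degree by
    degree. *)
Fixpoint evz t : {poly A} :=
  match t with
  | AZero => 0
  | AOne => 1
  | AGen (iB i) => (b i)%:P * 'X
  | AGen (ik i) => (k i)%:P
  | AGen (ikV i) => (kV i)%:P
  | AAdd t u => evz t + evz u
  | AMul t u => evz t * evz u
  | AScale c t => (c%:A)%:P * evz t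
  end.

Lemma scalar_poly_central (c : L) (p : {poly A}) : (c%:A)%:P * p = p * (c%:A)%:P.
Proof. by apply/polyP => i; rewrite coefCM coefMC -scalerAl -scalerAr mul1r mulr1. Qed.

Lemma evz_homog n t : homog n t -> evz t = (evA t)%:P * 'X^n.
Proof.
elim=> {n t} [n||j|j|j|n t u _ et _ eu|n m t u _ et _ eu|c n t _ et|c n t ->] /=.
- by rewrite mul0r.
- by rewrite mul1r.
- by rewrite expr1.
- by rewrite expr0 mulr1.
- by rewrite expr0 mulr1.
- by rewrite et eu -mulrDl -polyCD.
- rewrite et eu exprD -mulrA (mulrA 'X^n) -commr_polyXn -mulrA mulrA -polyCM.
  by [].
- by rewrite et mulrA -polyCM -scalerAl mul1r.
- by rewrite scale0r polyC0 mul0r /evA /= scale0r polyC0 mul0r.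
Qed.

(** Coefficient n of the evaluation of a word has degree at most n (tame); that it has
    degree less than n (small) says that it vanishes in the associated graded. *)
Definition small (p : {poly A}) := forall n, Fil n p`_n.
Definition tame (p : {poly A}) := forall n, Fil n.+1 p`_n.

Lemma smallD p r : small p -> small r -> small (p + r).
Proof. by move=> hp hr n; rewrite coefD; exact: FilD. Qed.
Lemma smallN p : small p -> small (- p).
Proof. by move=> hp n; rewrite coefN; exact: FilN. Qed.
Lemma small0 : small 0. Proof. by move=> n; rewrite coef0; exact: Fil_0. Qed.
Lemma smallMr p r : small p -> tame r -> small (p * r).
Proof.
move=> hp hr n; rewrite coefM; apply: Fil_sum => j _.
by apply: FilW (FilM (hp j) (hr (n - j)%N)); have := ltn_ord j; lia.
Qed.
Lemma smallMl p r : tame p -> small r -> small (p * r).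
Proof.
move=> hp hr n; rewrite coefM; apply: Fil_sum => j _.
by apply: FilW (FilM (hp j) (hr (n - j)%N)); have := ltn_ord j; lia.
Qed.

Lemma evz_tame t : tame (evz t).
Proof.
have hg n u : homog n u -> tame (evz u).
  move=> hu m; rewrite (evz_homog hu) coefCM coefXn; case: eqP => [->|_]; last by rewrite mulr0; exact: Fil_0.
  by rewrite mulr1; apply: Fil_homog hu.
elim: t => [||[j|j|j]|t et u eu|t et u eu|c t et].
- exact: hg (homog_0 _ _ 0).
- exact: hg (homog_1 _ _).
- exact: hg (homog_b _ j).
- exact: hg (homog_k _ j).
- exact: hg (homog_kV _ j).
- by move=> n; rewrite coefD; exact: FilD.
- move=> n; rewrite coefM; apply: Fil_sum => j _.
  by apply: FilW (FilM (et j) (eu (n - j)%N)); have := ltn_ord j; lia.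
- by move=> n; rewrite coefCM -scalerAl mul1r; exact: FilZ.
Qed.

(** The right-hand sides of the relations that involve s have lower degree than the
    left-hand sides. *)
Lemma small_rel t u : iota_rel q red (fun _ => 0) t u -> small (evz t - evz u).
Proof.
have h n t' u' : homog n t' -> homog n u' -> Fil n (evA t' - evA u') -> small (evz t' - evz u').
  move=> ht hu F m; rewrite (evz_homog ht) (evz_homog hu) -mulrBl -polyCB coefCM coefXn.
  by case: eqP => [->|_]; rewrite ?mulr1 // mulr0; exact: Fil_0.
have h0 n t' u' : homog n t' -> homog n u' -> evA t' = evA u' -> small (evz t' - evz u').
  by move=> ht hu e; apply: (h n) => //; rewrite e subrr; exact: Fil_0.
have hb := @homog_b P L; have hk := @homog_k P L; have hkV := @homog_kV P L.
have h1 := @homog_1 P L; have hM := @homog_mul P L; have hD := @homog_add P L.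
have hZ := @homog_scale P L.
have hN n t' : homog n t' -> homog n (AOpp t') by exact: hZ.
case=> [i|i|i j|i j|i j c ij|i ti|i j c|i r|i r ti].
- by apply: (h0 0%N) => //; [exact: hM (hk i) (hkV i)|exact: (io_kkV d)].
- by apply: (h0 0%N) => //; [exact: hM (hkV i) (hk i)|exact: (io_kVk d)].
- by apply: (h0 0%N) => //; [exact: hM (hk i) (hk j)|exact: hM (hk j) (hk i)|exact: (io_kk d)].
- apply: (h0 1%N) => //; [exact: hM (hk i) (hb j)|exact: hZ (hM _ _ _ _ (hb j) (hk i))|exact: (io_kb d)].
- by apply: (h0 2%N) => //; [exact: hM (hb i) (hb j)|exact: hM (hb j) (hb i)|exact: (io_comm d)].
- apply: (h 2%N).
  + by apply: hD; [exact: hM (hb i) (hb _)|apply: hN; exact: hM (hb _) (hb _)].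
  + by apply: homog_scale0; rewrite mul0r.
  + rewrite /evA /= mul0r scale0r subr0 scaleN1r (io_pair d ti).
    apply: (@Fil_homog 0 2 ((s i / (q - q^-1)) *: (AGen (ik (tau i)) - AGen (ik i)))%AT) => //.
    by apply/hZ/hD => //; exact: hN.
- apply: (h 3%N).
  + have h3 (i1 i2 i3 : I) : homog 3 (AGen (iB i1) * AGen (iB i2) * AGen (iB i3) : aterm L _)%AT.
      exact: hM (hM _ _ _ _ (hb _) (hb _)) (hb _).
    exact: hD (hD _ _ _ (h3 _ _ _) (hN _ _ (hZ _ _ _ (h3 _ _ _)))) (h3 _ _ _).
  + by apply: homog_scale0; rewrite mulr0 if_same.
  + rewrite /evA /= mulr0 if_same scale0r subr0 scaleN1r (io_serre d c).
    apply: (@Fil_homog 1 3 ((if tau i == i then q * s i else 0) *: (AGen (ik i) * AGen (iB j)))%AT) => //.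
    exact: hZ (hM 0%N 1%N _ _ (hk i) (hb j)).
- by apply: (h0 0%N) => //; [exact: hM (hk i) (hk _)|exact: (io_red d)].
- by apply: (h0 0%N) => //; exact: (io_red_fixed d).
Qed.

Lemma small_cong t u : acong (iota_rel q red (fun _ => 0)) t u -> small (evz t - evz u).
Proof.
have eq0 p r : p = r -> small (p - r) by move=> ->; rewrite subrr; exact: small0.
elim=> {t u} /=.
- exact: small_rel.
- by move=> t; exact: eq0.
- by move=> t u _ h; rewrite -opprB; exact: smallN.
- by move=> t u w _ h1 _ h2; rewrite -(subrK (evz u) (evz t)) -addrA; exact: smallD.
- by move=> t t' u u' _ h1 _ h2; rewrite opprD addrACA; exact: smallD.
- move=> t t' u u' _ h1 _ h2.
  have -> : evz t * evz u - evz t' * evz u' = (evz t - evz t') * evz u + evz t' * (evz u - evz u').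
    by rewrite mulrBl mulrBr addrA subrK.
  by apply: smallD; [apply: smallMr => //|apply: smallMl => //]; exact: evz_tame.
- move=> c t u _ h n; rewrite -mulrBr coefCM -scalerAl mul1r; exact: FilZ.
- by move=> *; apply: eq0; rewrite addrA.
- by move=> *; apply: eq0; rewrite addrC.
- by move=> *; apply: eq0; rewrite add0r.
- by move=> t; apply: eq0; rewrite scaleN1r polyCN mulN1r addNr.
- by move=> *; apply: eq0; rewrite mulrA.
- by move=> *; apply: eq0; rewrite mul1r.
- by move=> *; apply: eq0; rewrite mulr1.
- by move=> *; apply: eq0; rewrite mulrDl.
- by move=> *; apply: eq0; rewrite mulrDr.
- by move=> *; apply: eq0; rewrite mulrA -polyCM -scalerAl mul1r scalerA.
- by move=> *; apply: eq0; rewrite scale1r mul1r.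
- by move=> *; apply: eq0; rewrite mulrDr.
- by move=> *; apply: eq0; rewrite scalerDl polyCD mulrDl.
- by move=> *; apply: eq0; rewrite mulrA.
- by move=> *; apply: eq0; rewrite !mulrA scalar_poly_central.
Qed.

(** The associated graded algebra is a quotient of N. *)
Lemma homog_cong0 n t : homog n t -> acong (iota_rel q red (fun _ => 0)) t AZero -> Fil n (evA t).
Proof.
move=> ht /small_cong /(_ n); rewrite /= subr0 (evz_homog ht) coefCM coefXn eqxx mulr1.
by [].
Qed.
End Filtration.

Section Faithful.
Variables (P : iquiver) (Pg : good_iquiver P) (L : fieldType) (q : L) (red : bool).
Hypotheses (q0 : q != 0) (q2 : q + q^-1 != 0) (q1 : q - q^-1 != 0).
Hypothesis q_inf : forall m n : int, m != n -> q ^ m != q ^ n.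
Local Notation I := (vert P).
Variables (s : I -> L).
Hypothesis s_tau : forall i, s (tau i) = s i.
Local Notation N := (iotaAlg q red (fun _ : I => 0)).
Local Notation k := (ia_k q red (fun _ : I => 0)).
Local Notation kV := (ia_kV q red (fun _ : I => 0)).
Let d := verma_qg Pg red q0 q2 q1.
Let d0 := iotaAlg_data q red (fun _ : I => 0).

Local Notation vB := (vB Pg red q0 q2 q1 s).
Local Notation evE := (evE Pg red q0 q2 q1 s).

Lemma vKKV' i : vKV Pg q red i * vKV' Pg q red (tau i) = lmul (kV i).
Proof.
have e1 := qg_kkV d i; rewrite (vKK' Pg red q0) in e1.
have e2 : lmul (kV i) * lmul (k i) = 1.
  by rewrite -(homM (lmul_hom N)) (io_kVk d0) (hom1 (lmul_hom N)).
by rewrite -[LHS]mul1r -e2 -mulrA e1 mulr1.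
Qed.

Lemma verma_iota : iota_data q red s vB (fun i => lmul (k i)) (fun i => lmul (kV i)).
Proof.
have h := qg_iota Pg q0 q2 q1 d s_tau (red := red).
have eK : (fun i => vK Pg q red i * vK' Pg q red (tau i)) = (fun i => lmul (k i)).
  by apply/funext => i; exact: vKK'.
have eV : (fun i => vKV Pg q red i * vKV' Pg q red (tau i)) = (fun i => lmul (kV i)).
  by apply/funext => i; exact: vKKV'.
rewrite eK eV in h; apply: h => r i.
- by rewrite !(vKK' Pg red q0) -(homM (lmul_hom N)) (io_red d0) // (hom1 (lmul_hom N)).
- by move=> ti; rewrite (vKK' Pg red q0) (io_red_fixed d0) // (hom1 (lmul_hom N)).
Qed.

(** Induction on the degree.  If an element acts by 0, apply it to 1: its top
    component has value 0 in N, hence can be rewritten in lower degree. *)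
Lemma verma_faithful t : evE t = 0 -> acong (iota_rel q red s) t AZero.
Proof.
move=> Et; apply: (@presAlg_eq0 L _ (iota_pres q red s)); rewrite alg_gen_fun.
pose A := iotaAlg q red s.
pose Th : A -> endo N := @iota_lift P L q red s (endo N) vB (fun i => lmul (k i)) (fun i => lmul (kV i)).
have Thh : is_alg_hom Th by exact: iota_lift_hom verma_iota.
have ThE u : Th (evA q red s u) = evE u.
  rewrite /evA (hom_aeval _ _ Thh); congr (aeval _ u); apply/funext => -[i|i|i] /=.
  - exact: iota_lift_b verma_iota i.
  - exact: iota_lift_k verma_iota i.
  - exact: iota_lift_kV verma_iota i.
suff H n x : Fil n x -> Th x = 0 -> x = 0.
  have [n Fx] := Fil_total (evA q red s t); apply: H Fx _; by rewrite ThE.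
elim: n x => [|n IH] x; first by case.
move=> /Fil_split [u [y [hu Fy ->]]] Th0.
have ly : low Pg n%:Z (Th y 1).
  rewrite (_ : Th y 1 = 1 *: Th y 1) ?scale1r //.
  elim: Fy => [|m w z mn hw _ lz]; first by rewrite (hom0 Thh); exact: low_0.
  rewrite (homD Thh) endo_addE; apply: lowD => //; rewrite ThE.
  exact: evE_1_low hw _.
have u0 : evN q red u = 0.
  apply: (evE_1_top q_inf (s := s) hu).
  have := congr1 (fun f : endo N => f 1) Th0; rewrite (homD Thh) endo_addE ThE => /eqP.
  by rewrite addr_eq0 -scaleN1r => /eqP ->; exact: lowZ.
have Fu : Fil n (evA q red s u).
  by apply: homog_cong0 hu _; apply: (@presAlg_eq0 L _ (iota_pres q red _)); rewrite alg_gen_fun.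
by apply: IH Th0; exact: FilD.
Qed.
End Faithful.

(** * Presentations of the iota quantum groups *)

Lemma qv0 : qv != 0.
Proof. by rewrite tofrac_eq0 polyX_eq0. Qed.

Lemma qv_exp_neq1 n : (0 < n)%N -> qv ^+ n != 1.
Proof.
move=> n0; rewrite -tofracXn -tofrac1 tofrac_eq; apply: contraTneq n0 => e.
by have := congr1 (@size _ : {poly rat} -> nat) e; rewrite /= size_polyXn size_poly1 => -[->].
Qed.

Lemma qv_inf (m n : int) : m != n -> qv ^ m != qv ^ n.
Proof.
wlog mn : m n / m < n => [H|_].
  by case: (ltgtP m n) => // mn _; [apply: H; rewrite ?lt_eqF|rewrite eq_sym; apply: H; rewrite ?lt_eqF].
have e : n = m + (`|n - m|)%N%:Z by lia.
rewrite e expfzDr ?qv0 // -[X in X != _]mulr1 (inj_eq (mulfI _)) ?expfz_neq0 ?qv0 //.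
by rewrite eq_sym; apply: qv_exp_neq1; lia.
Qed.

Lemma qv1 : qv - qv^-1 != 0.
Proof.
rewrite subr_eq0; apply: contraNneq (qv_exp_neq1 (n := 2) isT) => e.
by rewrite expr2 {1}e mulVf ?qv0.
Qed.

Lemma qv2 : qv + qv^-1 != 0.
Proof.
rewrite addr_eq0; apply: contraNneq (qv_exp_neq1 (n := 4) isT) => e.
have e2 : qv ^+ 2 = -1 by rewrite expr2 {1}e mulNr mulVf ?qv0.
by rewrite (exprM qv 2 2) e2 sqrrN expr1n.
Qed.

Section QgRel.
Variables (P : iquiver) (X : Type) (E F K KV K' KV' : vert P -> aterm Qv X) (A : algType Qv) (f : X -> A).
Local Notation ev g := (fun i => aeval f (g i)).

Lemma qg_rel_aeval : qg_data qv (ev E) (ev F) (ev K) (ev KV) (ev K') (ev KV') ->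
  forall s t, qg_rel E F K KV K' KV' s t -> aeval f s = aeval f t.
Proof.
move=> d s t [i|i|i|i|i j|i j|i j|i j|i j|i j|i j|i j|i j c|i j c|i j c|i j c] /=; rewrite ?scaleN1r.
- exact: (qd_KKV d). - exact: (qd_KVK d). - exact: (qd_K'KV' d). - exact: (qd_KV'K' d).
- exact: (qd_KK d). - exact: (qd_KK' d). - exact: (qd_K'K' d). - exact: (qd_EF d).
- exact: (qd_KE d). - exact: (qd_KF d). - exact: (qd_K'E d). - exact: (qd_K'F d).
- exact: (qd_EE0 d). - exact: (qd_EE1 d). - exact: (qd_FF0 d). - exact: (qd_FF1 d).
Qed.

Lemma qg_data_aeval : (forall s t, qg_rel E F K KV K' KV' s t -> aeval f s = aeval f t) ->
  qg_data qv (ev E) (ev F) (ev K) (ev KV) (ev K') (ev KV').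
Proof.
move=> r; have e s t (st : qg_rel E F K KV K' KV' s t) := r s t st.
split=> [i|i|i|i|i j|i j|i j|i j|i j|i j|i j|i j|i j c|i j c|i j c|i j c].
- exact: e (qg_KKV _ _ _ _ _ _ i).
- exact: e (qg_KVK _ _ _ _ _ _ i).
- exact: e (qg_K'KV' _ _ _ _ _ _ i).
- exact: e (qg_KV'K' _ _ _ _ _ _ i).
- exact: e (qg_KK _ _ _ _ _ _ i j).
- exact: e (qg_KK' _ _ _ _ _ _ i j).
- exact: e (qg_K'K' _ _ _ _ _ _ i j).
- by have := e _ _ (qg_EF _ _ _ _ _ _ i j); rewrite /= !scaleN1r.
- exact: e (qg_KE _ _ _ _ _ _ i j).
- exact: e (qg_KF _ _ _ _ _ _ i j).
- exact: e (qg_K'E _ _ _ _ _ _ i j).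
- exact: e (qg_K'F _ _ _ _ _ _ i j).
- exact: e (qg_EE0 _ _ _ _ _ _ c).
- by have := e _ _ (qg_EE1 _ _ _ _ _ _ c); rewrite /= !scaleN1r.
- exact: e (qg_FF0 _ _ _ _ _ _ c).
- by have := e _ _ (qg_FF1 _ _ _ _ _ _ c); rewrite /= !scaleN1r.
Qed.
End QgRel.

Section SubalgData.
Variables (P : iquiver) (L : fieldType) (A : algType L) (S : A -> Prop).

Lemma subalg_val_hom : is_alg_hom (@subalg_val L A S).
Proof. by split. Qed.
End SubalgData.

Section Universal.
Variables (P : iquiver) (Pg : good_iquiver P).
Local Notation I := (vert P).

Lemma Ut_qg : qg_data qv (fun i => Ut_gen_in (gE i)) (fun i => Ut_gen_in (gF i))
  (fun i => Ut_gen_in (gK i)) (fun i => Ut_gen_in (gKV i))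
  (fun i => Ut_gen_in (gK' i)) (fun i => Ut_gen_in (gKV' i) : Ut P).
Proof. exact: (@qg_data_aeval P _ _ _ _ _ _ _ (Ut P) (alg_gen (Ut_pres P))
   (@pres_gen_rel _ _ (Ut_pres P))). Qed.

Lemma Uti_data : iota_data qv false (fun _ : I => 1) (@Uti_B P) (@Uti_k P) (@Uti_kV P).
Proof.
apply: (iota_data_inj (subalg_val_hom _) val_inj).
have := @qg_iota P Pg Qv qv qv0 qv2 qv1 (Ut P) _ _ _ _ _ _ Ut_qg (fun _ => 1) (fun _ => erefl) false.
rewrite (_ : (fun i => Ut_gen_in (gF i) + 1 *: (Ut_gen_in (gE (tau i)) * Ut_gen_in (gK' i))) = @Ut_B P).
  by apply.
by apply/funext => i; rewrite scale1r.
Qed.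

Lemma U_qg : qg_data qv (fun i => U_gen_in (hE i)) (fun i => U_gen_in (hF i))
  (fun i => U_gen_in (hK i)) (fun i => U_gen_in (hKV i))
  (fun i => U_gen_in (hKV i)) (fun i => U_gen_in (hK i) : U P).
Proof. exact: (@qg_data_aeval P _ _ _ _ _ _ _ (U P) (alg_gen (U_pres P))
   (@pres_gen_rel _ _ (U_pres P))). Qed.

Definition Ui_kV (vs : I -> Qv) (i : I) : Ui vs := subalg_of_gen (Ui_gens_kV vs i).

Lemma Ui_data (vs : I -> Qv) : (forall i, vs (tau i) = vs i) ->
  iota_data qv true vs (Ui_B vs) (Ui_k vs) (Ui_kV vs).
Proof.
move=> vs_tau; apply: (iota_data_inj (subalg_val_hom _) val_inj).
have d := U_qg; have := @qg_iota P Pg Qv qv qv0 qv2 qv1 (U P) _ _ _ _ _ _ d vs vs_tau true.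
apply=> _ i; last by move=> ->; exact: (qd_KKV d).
rewrite tauK mulrA -(mulrA (U_gen_in (hK i))) (qd_KVK d) mulr1; exact: (qd_KKV d).
Qed.

(** The faithfulness of the Verma module says that the generators of S satisfy no
    relations but the iota relations. *)
Lemma iota_subalg_lift (red : bool) (s : I -> Qv) (s_tau : forall i, s (tau i) = s i) (H : algType Qv) (gB gk gkV : I -> H)
    (S : H -> Prop) (SB : forall i, S (gB i)) (Sk : forall i, S (gk i)) (SkV : forall i, S (gkV i))
    (theta : H -> endo (iotaAlg qv red (fun _ : I => 0))) :
  (forall y, S y -> exists x, y = iota_fun gB gk gkV x) -> is_alg_hom theta ->
  (forall i, theta (gB i) = vB Pg red qv0 qv2 qv1 s i) ->
  (forall i, theta (gk i) = lmul (ia_k qv red (fun _ => 0) i)) ->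
  (forall i, theta (gkV i) = lmul (ia_kV qv red (fun _ => 0) i)) ->
  forall (B : algType Qv) (b k kV : I -> B), iota_data qv red s b k kV ->
  exists f : subalg S -> B, [/\ is_alg_hom f, forall i, f (subalg_of_gen (SB i)) = b i,
    forall i, f (subalg_of_gen (Sk i)) = k i & forall i, f (subalg_of_gen (SkV i)) = kV i].
Proof.
move=> Sg th tB tk tkV B b k kV h.
have inj t : aeval (theta \o iota_fun gB gk gkV) t = 0 -> acong (pres_rel (iota_pres qv red s)) t AZero.
  move=> e; apply: (@verma_faithful P Pg Qv qv red qv0 qv2 qv1 qv_inf s s_tau).
  rewrite -[RHS]e; congr (aeval _ t); apply/funext => -[i|i|i] /=.
  - by rewrite tB. - by rewrite tk. - by rewrite tkV.
have [phi [ph phiE]] := subalg_retract Sg th inj.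
exists (iota_lift (q := qv) (red := red) (s := s) b k kV \o phi); split=> [|i|i|i] /=.
- exact: is_alg_hom_comp ph (iota_lift_hom h).
- by rewrite (phiE _ (SB i) (iB i)) // (iota_lift_b h).
- by rewrite (phiE _ (Sk i) (ik i)) // (iota_lift_k h).
- by rewrite (phiE _ (SkV i) (ikV i)) // (iota_lift_kV h).
Qed.

Lemma Uti_lift (B : algType Qv) (b k kV : I -> B) :
  iota_data qv false (fun _ : I => 1) b k kV ->
  exists f : Uti P -> B, [/\ is_alg_hom f, forall i, f (Uti_B i) = b i,
    forall i, f (Uti_k i) = k i & forall i, f (Uti_kV i) = kV i].
Proof.
pose Y := endo (iotaAlg qv false (fun _ : I => 0)).
have vq := verma_qg Pg false qv0 qv2 qv1.
pose g (x : Ut_gen P) : Y := match x with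
  | gE i => vE Pg false qv0 qv2 qv1 i | gF i => lmul (ia_b qv false (fun _ => 0) i)
  | gK i => vK Pg qv false i | gKV i => vKV Pg qv false i
  | gK' i => vK' Pg qv false i | gKV' i => vKV' Pg qv false i end.
have g_rel s t : pres_rel (Ut_pres P) s t -> aeval g s = aeval g t.
  by move: s t; refine (@qg_rel_aeval P _ _ _ _ _ _ _ Y g _); exact: vq.
pose theta := @pres_lift Qv _ (Ut_pres P) Y g.
have th : is_alg_hom theta by exact: (pres_lift_hom g_rel).
have thE x : theta (Ut_gen_in x) = g x by exact: (pres_lift_gen g_rel).
apply: (@iota_subalg_lift false (fun _ => 1) (fun _ => erefl) (Ut P) _ _ _ _ _ _ _ theta _ th).
- by move=> y [i|i|i]; [exists (iB i)|exists (ik i)|exists (ikV i)].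
- by move=> i; rewrite (homD th) (homM th) !thE /vB scale1r.
- by move=> i; rewrite (homM th) !thE -(vKK' Pg false qv0).
- by move=> i; rewrite (homM th) !thE -(vKKV' Pg false qv0 qv2 qv1).
Qed.

Lemma Ui_lift (vs : I -> Qv) (vs_tau : forall i, vs (tau i) = vs i) (B : algType Qv) (b k kV : I -> B) :
  iota_data qv true vs b k kV ->
  exists f : Ui vs -> B, [/\ is_alg_hom f, forall i, f (Ui_B vs i) = b i,
    forall i, f (Ui_k vs i) = k i & forall i, f (Ui_kV vs i) = kV i].
Proof.
pose Y := endo (iotaAlg qv true (fun _ : I => 0)).
have vq := verma_qg Pg true qv0 qv2 qv1.
pose g (x : U_gen P) : Y := match x with
  | hE i => vE Pg true qv0 qv2 qv1 i | hF i => lmul (ia_b qv true (fun _ => 0) i)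
  | hK i => vK Pg qv true i | hKV i => vKV Pg qv true i end.
have eK' : vK' Pg qv true = vKV Pg qv true by apply/funext => i; exact: vK'_inv.
have eKV' : vKV' Pg qv true = vK Pg qv true by apply/funext => i; exact: vKV'_inv.
have g_rel s t : pres_rel (U_pres P) s t -> aeval g s = aeval g t.
  move: s t; refine (@qg_rel_aeval P _ _ _ _ _ _ _ Y g _).
  by rewrite eK' eKV' in vq.
pose theta := @pres_lift Qv _ (U_pres P) Y g.
have th : is_alg_hom theta by exact: (pres_lift_hom g_rel).
have thE x : theta (U_gen_in x) = g x by exact: (pres_lift_gen g_rel).
apply: (@iota_subalg_lift true vs vs_tau (U P) _ _ _ _ _ _ _ theta _ th).
- by move=> y [i|i|i]; [exists (iB i)|exists (ik i)|exists (ikV i)].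
- by move=> i; rewrite (homD th) (homZ th) (homM th) !thE /vB eK'.
- by move=> i; rewrite (homM th) !thE -(vKK' Pg true qv0) eK'.
- by move=> i; rewrite (homM th) !thE -(vKKV' Pg true qv0 qv2 qv1) eKV'.
Qed.
End Universal.

(** * The root lattice *)

Lemma mulz_int (x m : int) : x *~ m = x * m.
Proof. by rewrite -mulrzr intz. Qed.

Section Lattice.
Variables (P : iquiver) (Pg : good_iquiver P).
Local Notation I := (vert P).
Implicit Types (i j l : I) (a c : lattice P) (m n : int).

Definition simple_root j : lattice P := [ffun l => (l == j)%:R].
Local Notation δ := simple_root.

Lemma lattice_ind (Q : lattice P -> Prop) : (forall j, Q (δ j)) ->
  (forall a c, Q a -> Q c -> Q (a + c)) -> (forall a, Q a -> Q (- a)) -> Q 0 -> forall a, Q a.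
Proof.
move=> Qd QD QN Q0 a.
have QM j (n : nat) : Q (δ j *+ n) by elim: n => [//|n IH]; rewrite mulrS; exact: QD.
have -> : a = \sum_j δ j *~ a j.
  apply/ffunP => l; rewrite sum_ffunE (bigD1 l) //= big1 => [|j jl].
    by rewrite addr0 ffunMzE ffunE eqxx mulz_int mul1r.
  by rewrite ffunMzE ffunE eq_sym (negbTE jl) mul0rz.
apply: big_ind => // j _; case: (a j) => n; first exact: QM.
by rewrite NegzE mulrNz; apply/QN/QM.
Qed.

(** The pairing of a with the simple coroot of i. *)
Definition pr i a : int := \sum_j cartan i j * a j.

Lemma prD i a c : pr i (a + c) = pr i a + pr i c.
Proof. by rewrite -big_split; apply: eq_bigr => j _; rewrite /= ffunE mulrDr. Qed.
Lemma pr_delta i j m : pr i (δ j *~ m) = cartan i j * m.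
Proof.
rewrite /pr (bigD1 j) //= big1 => [|l lj].
  by rewrite addr0 ffunMzE ffunE eqxx mulz_int mul1r.
by rewrite ffunMzE ffunE (negbTE lj) mul0rz mulr0.
Qed.

Lemma reflE i a : refl i a = a + δ i *~ - pr i a.
Proof.
apply/ffunP => l; rewrite !ffunE ffunMzE ffunE; case: eqP => [->|_]; last by rewrite mul0rz addr0.
by rewrite mulz_int mul1r.
Qed.

Lemma breflE_fixed i a : tau i = i -> brefl i a = a + δ i *~ - pr i a.
Proof. by move=> ti; rewrite /brefl ti eqxx reflE. Qed.

Lemma breflE_free i a : tau i != i ->
  brefl i a = a + δ i *~ - pr i a + δ (tau i) *~ - pr (tau i) a.
Proof.
move=> ti; rewrite /brefl (negbTE ti) /= !reflE prD pr_delta (cartan_taui Pg ti) mul0r addr0.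
by rewrite addrAC.
Qed.

Lemma breflD i a c : brefl i (a + c) = brefl i a + brefl i c.
Proof.
have [ti|ti] := eqVneq (tau i) i.
  by rewrite !breflE_fixed // prD opprD mulrzDr addrACA.
rewrite !breflE_free //; by rewrite !prD; apply/ffunP => l; rewrite !(ffunE, ffunMzE, mulz_int); ring.
Qed.

Lemma brefl0 i : brefl i 0 = 0.
Proof. by apply: (addrI (brefl i 0)); rewrite -breflD !addr0. Qed.
(** a + u alpha_i + u' alpha_(tau i) + w alpha_j + w' alpha_(tau j).  Words in the two
    reflections only change these four coordinates, linearly, and so the relations
    between them are polynomial identities. *)
Definition span4 a i j (u u' w w' : int) : lattice P :=
  a + δ i *~ u + δ (tau i) *~ u' + δ j *~ w + δ (tau j) *~ w'.

Lemma span4_0 a i j : span4 a i j 0 0 0 0 = a.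
Proof. by rewrite /span4 !mulr0z !addr0. Qed.

Lemma span4C a i j u u' w w' : span4 a i j u u' w w' = span4 a j i w w' u u'.
Proof. by rewrite /span4; apply/ffunP => l; rewrite !(ffunE, ffunMzE, mulz_int); ring. Qed.

Lemma pr_span4 l a i j u u' w w' : pr l (span4 a i j u u' w w') =
  pr l a + cartan l i * u + cartan l (tau i) * u' + cartan l j * w + cartan l (tau j) * w'.
Proof. by rewrite /span4 !prD !pr_delta. Qed.

Lemma brefl_free a i j u u' w w' : tau i != i ->
  brefl i (span4 a i j u u' w w') = span4 a i j
    (- pr i a - u - cartan i j * w - cartan i (tau j) * w')
    (- pr (tau i) a - u' - cartan i (tau j) * w - cartan i j * w') w w'.
Proof.
move=> ti; rewrite breflE_free // !pr_span4 /span4 !ctauL !tauK !cartan_ii !(cartan_taui Pg ti).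
by apply/ffunP => l; rewrite !(ffunE, ffunMzE, mulz_int); ring.
Qed.

Lemma brefl_fixed a i j u w w' : tau i = i ->
  brefl i (span4 a i j u 0 w w') = span4 a i j
    (- pr i a - u - cartan i j * w - cartan i (tau j) * w') 0 w w'.
Proof.
move=> ti; rewrite breflE_fixed // !pr_span4 /span4 !cartan_ii.
by apply/ffunP => l; rewrite !(ffunE, ffunMzE, mulz_int); ring.
Qed.

Lemma breflK i : involutive (brefl i).
Proof.
move=> a; rewrite -{1}(span4_0 a i i); have [ti|ti] := eqVneq (tau i) i.
  rewrite !brefl_fixed // -[RHS](span4_0 a i i); congr span4; ring.
rewrite !brefl_free // -[RHS](span4_0 a i i); congr span4; ring.
Qed.

Lemma brefl_free_r a i j u u' w w' : tau j != j ->
  brefl j (span4 a i j u u' w w') = span4 a i j u u'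
    (- pr j a - w - cartan j i * u - cartan j (tau i) * u')
    (- pr (tau j) a - w' - cartan j (tau i) * u - cartan j i * u').
Proof. by move=> tj; rewrite span4C brefl_free // span4C. Qed.

Lemma brefl_fixed_r a i j u u' w : tau j = j ->
  brefl j (span4 a i j u u' w 0) = span4 a i j u u'
    (- pr j a - w - cartan j i * u - cartan j (tau i) * u') 0.
Proof. by move=> tj; rewrite span4C brefl_fixed // span4C. Qed.

Lemma brefl_far i j a : far i j -> brefl i (brefl j a) = brefl j (brefl i a).
Proof.
case=> ji jti c c'; have cj : cartan j i = 0 by rewrite cartanC.
have cj' : cartan j (tau i) = 0 by rewrite -ctauL cartanC.
rewrite -(span4_0 a i j); have [ti|ti] := eqVneq (tau i) i; have [tj|tj] := eqVneq (tau j) j;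
  [have Ri u w w' := brefl_fixed a j u w w' ti; have Rj u u' w := brefl_fixed_r a i u u' w tj
  |have Ri u w w' := brefl_fixed a j u w w' ti; have Rj u u' w w' := brefl_free_r a i u u' w w' tj
  |have Ri u u' w w' := brefl_free a j u u' w w' ti; have Rj u u' w := brefl_fixed_r a i u u' w tj
  |have Ri u u' w w' := brefl_free a j u u' w w' ti; have Rj u u' w w' := brefl_free_r a i u u' w w' tj];
  rewrite !(Ri, Rj) c cj c' cj'; congr span4; ring.
Qed.

Lemma brefl_same_kind i j a : same_kind i j ->
  brefl i (brefl j (brefl i a)) = brefl j (brefl i (brefl j a)).
Proof.
case=> c kd; have cj : cartan j i = -1 by rewrite cartanC.
rewrite -(span4_0 a i j); case: kd => [[ti tj]|[ti tj c']].
  have Ri u w w' := brefl_fixed a j u w w' ti; have Rj u u' w := brefl_fixed_r a i u u' w tj.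
  by rewrite !(Ri, Rj) c cj; congr span4; ring.
have cj' : cartan j (tau i) = 0 by rewrite -ctauL cartanC.
have Ri u u' w w' := brefl_free a j u u' w w' ti; have Rj u u' w w' := brefl_free_r a i u u' w w' tj.
by rewrite !(Ri, Rj) c cj c' cj'; congr span4; ring.
Qed.

Lemma brefl_mixed i j a : tau i != i -> tau j = j -> cartan i j = -1 ->
  brefl i (brefl j (brefl i (brefl j a))) = brefl j (brefl i (brefl j (brefl i a))).
Proof.
move=> ti tj c; have cj : cartan j i = -1 by rewrite cartanC.
have c' : cartan i (tau j) = -1 by rewrite tj.
have cj' : cartan j (tau i) = -1 by rewrite -ctauL tj.
rewrite -(span4_0 a i j).
have Ri u u' w w' := brefl_free a j u u' w w' ti; have Rj u u' w := brefl_fixed_r a i u u' w tj.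
by rewrite !(Ri, Rj) c cj c' cj'; congr span4; ring.
Qed.
End Lattice.

(** * The restricted Weyl group and the torus *)

(** A braid relation between two involutions bounds the order of their product, and
    the smaller orders are excluded by a point that separates two shorter words. *)
Section Involutions.
Variables (T : Type) (f g : T -> T) (fK : involutive f) (gK : involutive g).
Variable m : nat.
Hypothesis o : has_order m (f \o g).

Lemma order_le n : (0 < n)%N -> iter n (f \o g) =1 id -> (m <= n)%N.
Proof. by case: o => _ _ h n0 e; rewrite leqNgt; apply/negP => nm; apply: (h n); rewrite ?n0 ?nm. Qed.

Let m1 : m = 1%N -> f =1 g.
Proof. by move=> e x; case: o => _; rewrite e => /(_ x) /= h _; rewrite -[RHS]fK h. Qed.

Lemma order2 : (forall a, f (g a) = g (f a)) -> (exists a, f a <> g a) -> m = 2.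
Proof.
move=> e [a ne]; have h : iter 2 (f \o g) =1 id by move=> x; rewrite /= e fK gK.
by have := order_le (isT : (0 < 2)%N) h; case: o m1; case: (m) => [|[|[|]]] // _ _ _ /(_ erefl) /(_ a).
Qed.

Lemma order3 : (forall a, f (g (f a)) = g (f (g a))) -> (exists a, f a <> g a) -> m = 3.
Proof.
move=> e [a ne]; have h : iter 3 (f \o g) =1 id by move=> x; rewrite /= e gK fK gK.
have := order_le (isT : (0 < 3)%N) h; case: o m1; case: (m) => [|[|[|[|]]]] // _ e2 _ k1; first by have := k1 erefl a.
move=> _; case: ne; have := h (g a); have := e2 (g a) => /= ->.
by rewrite gK.
Qed.

Lemma order4 : (forall a, f (g (f (g a))) = g (f (g (f a)))) -> (exists a, f (g a) <> g (f a)) -> m = 4.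
Proof.
move=> e [a ne]; have h : iter 4 (f \o g) =1 id by move=> x; rewrite /= e !(fK, gK).
have fg : f =1 g -> False by move=> fg; apply: ne; rewrite !fg.
have := order_le (isT : (0 < 4)%N) h; case: o m1; case: (m) => [|[|[|[|[|]]]]] // _ e2 _ k1; first by case: fg; exact: k1.
  by move=> _; case: ne; have /= := e2 (g (f a)); rewrite gK fK => ->.
move=> _; case: fg => x; have := h (g x); have /= := e2 (g x) => ->.
by rewrite gK.
Qed.
End Involutions.

Section Orders.
Variables (P : iquiver) (Pg : good_iquiver P).
Local Notation I := (vert P).
Implicit Types (i j l : I) (a c : lattice P).
Local Notation δ := simple_root.

Lemma brefl_off i a l : l != i -> l != tau i -> brefl i a l = a l.
Proof.
move=> /negbTE li /negbTE lt; have [ti|ti] := eqVneq (tau i) i.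
  by rewrite breflE_fixed // !(ffunE, ffunMzE, mulz_int) li mul0r addr0.
by rewrite (breflE_free Pg) // !(ffunE, ffunMzE, mulz_int) li lt !mul0r !addr0.
Qed.

Lemma brefl_on i a : brefl i a i = a i - pr i a.
Proof.
have [ti|ti] := eqVneq (tau i) i.
  by rewrite breflE_fixed // !(ffunE, ffunMzE, mulz_int) eqxx mul1r.
by rewrite (breflE_free Pg) // !(ffunE, ffunMzE, mulz_int) eqxx eq_sym (negbTE ti) mul1r mul0r addr0.
Qed.

Lemma brefl_on_tau i a : tau i != i -> brefl i a (tau i) = a (tau i) - pr (tau i) a.
Proof.
move=> ti; rewrite (breflE_free Pg) // !(ffunE, ffunMzE, mulz_int) eqxx (negbTE ti).
by rewrite mul1r mul0r addr0.
Qed.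

Lemma pr_delta1 i j : pr i (δ j) = cartan i j.
Proof. by have := pr_delta i j 1; rewrite mulr1. Qed.

Lemma brefl_neq i j : j != i -> j != tau i -> exists a, brefl i a <> brefl j a.
Proof.
move=> ji jt; exists (δ j) => /(congr1 (fun a : lattice P => a j)).
by rewrite brefl_off // brefl_on pr_delta1 cartan_ii ffunE eqxx.
Qed.

Lemma same_kind_neq i j : same_kind i j -> j != i /\ j != tau i.
Proof.
case=> c [[ti _]|[ti _ c']]; first by rewrite ti eq_sym (adj_neq' c).
by rewrite eq_sym (adj_neq' c); split=> //; apply: contra_eq_neq c' => ->; rewrite tauK cartan_ii.
Qed.

Lemma order_far i j (m : nat) : far i j -> has_order m (brefl i \o brefl j) -> m = 2%N.
Proof.
move=> f o; apply: (order2 (breflK Pg i) (breflK Pg j) o).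
  by move=> a; exact: brefl_far.
by case: f => ji jt _ _; exact: brefl_neq.
Qed.

Lemma order_same_kind i j (m : nat) : same_kind i j -> has_order m (brefl i \o brefl j) -> m = 3%N.
Proof.
move=> f o; apply: (order3 (breflK Pg i) (breflK Pg j) o).
  by move=> a; exact: brefl_same_kind.
by case: (same_kind_neq f) => ji jt; exact: brefl_neq.
Qed.

Lemma mixed_neq i j : tau i != i -> tau j = j -> cartan i j = -1 ->
  brefl i (brefl j (δ i)) <> brefl j (brefl i (δ i)).
Proof.
move=> ti tj c /(congr1 (fun a : lattice P => a (tau i))).
have tij : tau i != j by apply: contraNneq ti => e; rewrite -{2}(tauK i) e tj.
rewrite brefl_on_tau // [brefl j (δ i) (tau i)]brefl_off ?tj // [RHS]brefl_off ?tj // brefl_on_tau //.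
have c1 : cartan (tau i) i = 0 by rewrite cartanC (cartan_taui Pg ti).
have c2 : cartan (tau i) j = -1 by rewrite ctauL tj.
rewrite breflE_fixed // prD pr_delta !pr_delta1 c1 c2 [cartan j i]cartanC c ffunE.
by rewrite (negbTE ti).
Qed.

Lemma order_mixed i j (m : nat) : tau i != i -> tau j = j -> cartan i j = -1 ->
  has_order m (brefl i \o brefl j) -> m = 4%N.
Proof.
move=> ti tj c o; apply: (order4 (breflK Pg i) (breflK Pg j) o).
  by move=> a; exact: brefl_mixed.
by exists (δ i); exact: mixed_neq.
Qed.

Lemma order_mixed' i j (m : nat) : tau i != i -> tau j = j -> cartan i j = -1 ->
  has_order m (brefl j \o brefl i) -> m = 4%N.
Proof.
move=> ti tj c o; apply: (order4 (breflK Pg j) (breflK Pg i) o).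
  by move=> a; apply/esym/brefl_mixed.
by exists (δ i) => /esym; exact: mixed_neq.
Qed.

(** The action of tau on the root lattice. *)
Definition lat_tau a : lattice P := [ffun l => a (tau l)].

Lemma lat_tauD a c : lat_tau (a + c) = lat_tau a + lat_tau c.
Proof. by apply/ffunP => l; rewrite !ffunE. Qed.

Lemma lat_tau_delta j (m : int) : lat_tau (δ j *~ m) = δ (tau j) *~ m.
Proof.
apply/ffunP => l; rewrite !ffunE !ffunMzE !ffunE.
by rewrite -{1}(tauK j) (inj_eq (inv_inj (@tauK P))).
Qed.

Lemma pr_tau i a : pr i (lat_tau a) = pr (tau i) a.
Proof.
rewrite /pr (reindex_inj (inv_inj (@tauK P))) /=; apply: eq_bigr => j _.
by rewrite -ctauL ffunE tauK.
Qed.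

Lemma brefl_tau i a : brefl i (lat_tau a) = lat_tau (brefl i a).
Proof.
have [ti|ti] := eqVneq (tau i) i.
  by rewrite !breflE_fixed // lat_tauD lat_tau_delta pr_tau ti.
by rewrite !(breflE_free Pg) // !lat_tauD !lat_tau_delta !pr_tau !tauK addrAC.
Qed.
End Orders.

Section Characters.
Variables (P : iquiver) (Pg : good_iquiver P).
Local Notation I := (vert P).
Variables (L : fieldType) (q : L).
Hypotheses (q0 : q != 0) (q2 : q + q^-1 != 0) (q1 : q - q^-1 != 0).
Variables (A : algType L) (b k kV : I -> A).
Hypothesis h : iota_data q false (fun _ => 1) b k kV.
Local Notation TK := (TK q k kV).
Local Notation δ := simple_root.
Implicit Types (i j l : I) (a c : lattice P).

(** The elements k_a and the scalars b_a, for a in the root lattice. *)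
Definition kexp i (m : int) : A :=
  match m with Posz n => k i ^+ n | Negz n => kV i ^+ n.+1 end.
Definition kl a : A := \prod_i kexp i (a i).
Definition bl a : L := \prod_i (if tau i == i then - q ^+ 2 else 1) ^ a i.

Lemma kexp_comm i j (m n : int) : kexp i m * kexp j n = kexp j n * kexp i m.
Proof.
have X (x y : A) (r t : nat) : GRing.comm x y -> x ^+ r * y ^+ t = y ^+ t * x ^+ r.
  by move=> xy; apply: commrX; apply: commr_sym; apply: commrX; apply: commr_sym.
case: m n => m [] n; apply: X.
- exact: (io_kk h). - by apply: commr_sym; exact: (kV_k h).
- exact: (kV_k h). - exact: (kV_kV h).
Qed.

Lemma kexpS i (m : int) : kexp i (1 + m) = k i * kexp i m.
Proof.
case: m => [m|[|m]].
- by rewrite -PoszD /= exprS.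
- by rewrite (_ : 1 + Negz 0 = 0) //= expr1 (io_kkV h).
- by rewrite (_ : 1 + Negz m.+1 = Negz m) ?NegzE; [rewrite -NegzE /= [in RHS]exprS mulrA (io_kkV h) mul1r|lia].
Qed.

Lemma kexpP i (m : int) : kexp i (-1 + m) = kV i * kexp i m.
Proof. by rewrite -{2}[m](addNKr 1) kexpS mulrA (io_kVk h) mul1r. Qed.

Lemma kexpD i (m n : int) : kexp i (m + n) = kexp i m * kexp i n.
Proof.
elim/int_rect: m => [|m IH|m IH]; first by rewrite add0r /= expr0 mul1r.
  by rewrite intS -addrA !kexpS IH mulrA.
by rewrite intS opprD -addrA !kexpP IH mulrA.
Qed.

Lemma klD a c : kl (a + c) = kl a * kl c.
Proof.
rewrite /kl -prodrM_comm => [|i j _ _]; last exact: kexp_comm.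
by apply: eq_bigr => i _; rewrite ffunE kexpD.
Qed.

Lemma kl0 : kl 0 = 1.
Proof. by rewrite /kl big1 // => i _; rewrite ffunE. Qed.

Lemma klC a c : kl a * kl c = kl c * kl a.
Proof. by rewrite -!klD addrC. Qed.

Lemma klNl a : kl (- a) * kl a = 1. Proof. by rewrite -klD addNr kl0. Qed.
Lemma klNr a : kl a * kl (- a) = 1. Proof. by rewrite -klD subrr kl0. Qed.

Lemma kl_delta j : kl (δ j) = k j.
Proof.
have H (r : seq I) : uniq r -> \prod_(i <- r) kexp i (δ j i) = if j \in r then k j else 1.
  elim: r => [|i r IH] /=; first by rewrite big_nil.
  case/andP=> ir ur; rewrite big_cons IH // ffunE inE [j == i]eq_sym.
  case: eqP => [ij|_] /=; last by rewrite mul1r.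
  by rewrite -ij (negbTE ir) mulr1.
by rewrite /kl H ?index_enum_uniq // mem_index_enum.
Qed.

Lemma kl_Ndelta j : kl (- δ j) = kV j.
Proof. by rewrite -[RHS]mulr1 -(klNr (δ j)) kl_delta mulrA (io_kVk h) mul1r. Qed.

Lemma blD a c : bl (a + c) = bl a * bl c.
Proof.
rewrite /bl -big_split; apply: eq_bigr => i _; rewrite /= ffunE expfzDr //.
by case: ifP; rewrite ?oner_eq0 // oppr_eq0 expf_neq0.
Qed.

Lemma bl_neq0 a : bl a != 0.
Proof.
apply/prodf_neq0 => i _; rewrite expfz_neq0 //.
by case: ifP; rewrite ?oner_eq0 // oppr_eq0 expf_neq0.
Qed.

Lemma bl0 : bl 0 = 1.
Proof. by apply: (mulfI (bl_neq0 0)); rewrite -blD addr0 mulr1. Qed.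

Lemma blN a : bl (- a) = (bl a)^-1.
Proof. by apply: (mulfI (bl_neq0 a)); rewrite -blD subrr bl0 mulfV ?bl_neq0. Qed.

Lemma bl_delta j : bl (δ j) = if tau j == j then - q ^+ 2 else 1.
Proof.
rewrite /bl (bigD1 j) //= big1 => [|i ij]; last by rewrite ffunE (negbTE ij) expr0z.
by rewrite ffunE eqxx mulr1 expr1z.
Qed.

(** The scalar in T_i(k_a).  Being a coboundary it telescopes in compositions, so that
    it never obstructs a braid relation. *)
Definition coc i a : L := bl (brefl i a) / bl a.

Lemma cocD i a c : coc i (a + c) = coc i a * coc i c.
Proof. by rewrite /coc (breflD Pg) !blD; field; rewrite !bl_neq0. Qed.

Lemma coc0 i : coc i 0 = 1.
Proof. by rewrite /coc (brefl0 Pg) divff ?bl_neq0. Qed.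

Lemma brefl_delta i j : brefl i (δ j) =
  δ j + δ i *~ - cartan i j + (if tau i == i then 0 else δ (tau i) *~ - cartan (tau i) j).
Proof.
have [ti|ti] := eqVneq (tau i) i; first by rewrite breflE_fixed // pr_delta1 addr0.
by rewrite (breflE_free Pg) // !pr_delta1.
Qed.

Lemma TK_kl i j : TK i j = coc i (δ j) *: kl (brefl i (δ j)).
Proof.
have f0 : - q ^+ 2 != 0 by rewrite oppr_eq0 expf_neq0.
have s0 : brefl i (δ j) = δ j + δ i *~ - cartan i j + (if tau i == i then 0 else δ (tau i) *~ - cartan (tau i) j) by exact: brefl_delta.
have Nd l : δ l + δ l *~ - 2 = - δ l by apply/ffunP => m; rewrite !(ffunE, ffunMzE, mulz_int); ring.
rewrite /coc s0.
case: (positionP Pg i j) => [->|-> ti|ti ji c|ti ji jt c c'|ti ji jt c c'|ti ji jt c c' _|ji jt c c'].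
- have [ti|ti] := eqVneq (tau i) i.
    rewrite !(posSelfFixedE q b k kV ti) cartan_ii addr0 Nd kl_Ndelta blN bl_delta ti eqxx.
    by rewrite invrN mulrNN -invfM -exprD.
  rewrite !(posSelfE q b k kV ti) cartan_ii Nd cartanC (cartan_taui Pg ti) oppr0 mulr0z addr0.
  by rewrite kl_Ndelta blN bl_delta (negbTE ti) invr1 mulr1 scale1r.
- rewrite !(posTauE q b k kV ti) (negbTE ti) cartan_ii (cartan_taui Pg ti) oppr0 mulr0z addr0 Nd.
  by rewrite kl_Ndelta blN bl_delta tauK eq_sym (negbTE ti) invr1 mulr1 scale1r.
- rewrite !(posFixedE q b k kV ti ji c) c opprK mulr1z ti eqxx addr0 klD blD !kl_delta.
  by rewrite mulrAC divff ?bl_neq0 // mul1r bl_delta ti eqxx.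
- rewrite !(posFree1E q b k kV ti ji jt c c') (negbTE ti) ctauL c c' opprK mulr1z oppr0 mulr0z addr0.
  by rewrite klD blD !kl_delta mulrAC divff ?bl_neq0 // mul1r bl_delta (negbTE ti) scale1r.
- rewrite !(posFree2E q b k kV ti ji jt c c') (negbTE ti) ctauL c c' opprK mulr1z oppr0 mulr0z addr0.
  by rewrite klD blD !kl_delta mulrAC divff ?bl_neq0 // mul1r bl_delta tauK eq_sym (negbTE ti) scale1r.
- rewrite !(posFree12E q1 b k kV ti ji jt c c') (negbTE ti) ctauL c c' opprK !mulr1z -addrA.
  rewrite !klD !blD !kl_delta mulrAC divff ?bl_neq0 // mul1r !bl_delta tauK [i == _]eq_sym (negbTE ti).
  by rewrite mulr1 scale1r.
- rewrite !(posFarE q b k kV ji jt c c') ctauL c c' oppr0 !mulr0z !addr0 if_same addr0.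
  by rewrite kl_delta divff ?bl_neq0 // scale1r.
Qed.

(** Both sides are multiplicative in a. *)
Lemma lifts_T_kl i f a : lifts_T q b k kV i f -> f (kl a) = coc i a *: kl (brefl i a).
Proof.
move=> hf; have fh := lT_hom hf; elim/lattice_ind: a => [j|a c ea ec|a ea|].
- by rewrite kl_delta (lT_k hf) TK_kl.
- by rewrite klD (homM fh) ea ec -scalerAl -scalerAr scalerA -klD -(breflD Pg) cocD.
- have e : f (kl (- a)) * f (kl a) = 1 by rewrite -(homM fh) klNl (hom1 fh).
  have e' : f (kl a) * (coc i (- a) *: kl (brefl i (- a))) = 1.
    rewrite ea -scalerAl -scalerAr scalerA -klD -(breflD Pg) subrr (brefl0 Pg) kl0.
    by rewrite -cocD subrr coc0 scale1r.
  by rewrite -[LHS]mulr1 -e' mulrA e mul1r.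
- by rewrite kl0 (hom1 fh) coc0 (brefl0 Pg) kl0 scale1r.
Qed.

Lemma coc_tau i a : coc i (lat_tau a) = coc i a.
Proof.
have bt c : bl (lat_tau c) = bl c.
  rewrite /bl (reindex_inj (inv_inj (@tauK P))) /=; apply: eq_bigr => l _.
  by rewrite ffunE tauK eq_sym.
by rewrite /coc (brefl_tau Pg) !bt.
Qed.

Section Compose.
Variables (i j : I) (f g : A -> A).
Hypotheses (hf : lifts_T q b k kV i f) (hg : lifts_T q b k kV j g).

Let fkl a : f (kl a) = coc i a *: kl (brefl i a). Proof. exact: lifts_T_kl hf. Qed.
Let gkl a : g (kl a) = coc j a *: kl (brefl j a). Proof. exact: lifts_T_kl hg. Qed.
Let fZ (r : L) (x : A) : f (r *: x) = r *: f x. Proof. exact: homZ (lT_hom hf) r x. Qed.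
Let gZ (r : L) (x : A) : g (r *: x) = r *: g x. Proof. exact: homZ (lT_hom hg) r x. Qed.
Let blC (u v w : lattice P) : (bl v / bl u) * (bl w / bl v) = bl w / bl u.
Proof. by rewrite mulrC mulrA divfK ?bl_neq0. Qed.

Lemma orth_kl a : far i j -> f (g (kl a)) = g (f (kl a)).
Proof.
move=> ij; rewrite gkl fkl fZ gZ fkl gkl !scalerA /coc !blC.
by rewrite (brefl_far Pg a ij).
Qed.

Lemma same_kind_kl a : same_kind i j -> f (g (f (kl a))) = g (f (g (kl a))).
Proof.
move=> ij; rewrite !(fkl, gkl, fZ, gZ) !scalerA /coc.
by rewrite !blC (brefl_same_kind Pg a ij).
Qed.

Lemma mixed_kl a : tau i != i -> tau j = j -> cartan i j = -1 ->
  f (g (f (g (kl a)))) = g (f (g (f (kl a)))).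
Proof.
move=> ti tj ij; rewrite !(fkl, gkl, fZ, gZ) !scalerA /coc.
by rewrite !blC (brefl_mixed Pg a ti tj ij).
Qed.
End Compose.
End Characters.

(** * Anti-involution and automorphisms *)

(** An anti-endomorphism of A is a morphism to the opposite algebra, so that it can be
    obtained from a presentation like any other. *)
Section Opposite.
Variables (L : fieldType) (A : algType L).

Definition opp_alg : Type := A.
HB.instance Definition _ := GRing.Lmodule.on opp_alg.

Definition opp_mul (x y : opp_alg) : opp_alg := (y : A) * (x : A).
Fact opp_mulA : associative opp_mul. Proof. by move=> x y z; rewrite /opp_mul mulrA. Qed.
Fact opp_1mul : left_id (1 : A) opp_mul. Proof. by move=> x; rewrite /opp_mul mulr1. Qed.
Fact opp_mul1 : right_id (1 : A) opp_mul. Proof. by move=> x; rewrite /opp_mul mul1r. Qed.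
Fact opp_mulDl : left_distributive opp_mul +%R. Proof. by move=> x y z; exact: mulrDr. Qed.
Fact opp_mulDr : right_distributive opp_mul +%R. Proof. by move=> x y z; exact: mulrDl. Qed.
Fact opp_1neq0 : (1 : A) != 0 :> opp_alg. Proof. exact: oner_neq0. Qed.
HB.instance Definition _ := GRing.Zmodule_isNzRing.Build opp_alg
  opp_mulA opp_1mul opp_mul1 opp_mulDl opp_mulDr opp_1neq0.
Fact opp_scaleAl (c : L) (x y : opp_alg) : c *: (x * y : opp_alg) = (c *: x : opp_alg) * y.
Proof. by change (c *: opp_mul x y = opp_mul (c *: x) y); exact: (@scalerAr L A c y x). Qed.
HB.instance Definition _ := GRing.Lmodule_isLalgebra.Build L opp_alg opp_scaleAl.
Fact opp_scaleAr (c : L) (x y : opp_alg) : c *: (x * y : opp_alg) = x * (c *: y : opp_alg).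
Proof. by change (c *: opp_mul x y = opp_mul x (c *: y)); exact: (@scalerAl L A c y x). Qed.
HB.instance Definition _ := GRing.Lalgebra_isAlgebra.Build L opp_alg opp_scaleAr.

End Opposite.

(** The relations are symmetric under reversing all products and exchanging k_i with
    k_(tau i); the correction term of the Serre relation is unaffected, since it is
    present for tau i = i only, where k_i is central. *)
Lemma iota_opp (P : iquiver) (L : fieldType) (q : L) (red : bool) (s : vert P -> L)
    (s_tau : forall i, s (tau i) = s i) (q0 : q != 0) (A : algType L) (b k kV : vert P -> A) :
  iota_data q red s b k kV ->
  iota_data q red s (b : vert P -> opp_alg A) (fun i => k (tau i)) (fun i => kV (tau i)).
Proof.
move=> h; split=> [i|i|i j|i j|i j c ij|i ti|i j c|r i|r i ti].
- exact: (io_kVk h).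
- exact: (io_kkV h).
- exact: (io_kk h).
- change (b j * k (tau i) = q ^ (cartan (tau i) j - cartan i j) *: (k (tau i) * b j) :> A).
  by rewrite (io_kb h) tauK scalerA -expfzDr // addrA subrK subrr scale1r.
- by apply/esym; exact: (io_comm h).
- change (b (tau i) * b i - b i * b (tau i) =
    (s i / (q - q^-1)) *: (k (tau (tau i)) - k (tau i)) :> A).
  by rewrite tauK -opprB (io_pair h) // -scalerN opprB.
- change (b j * (b i * b i) - (q + q^-1) *: (b i * (b j * b i)) + b i * (b i * b j) =
    (if tau i == i then q * s i else 0) *: (b j * k (tau i)) :> A).
  have -> : (if tau i == i then q * s i else 0) *: (b j * k (tau i)) =
      (if tau i == i then q * s i else 0) *: (k i * b j).
    by case: eqP => [ti|_]; [rewrite (io_kb h) ti subrr expr0z scale1r|rewrite !scale0r].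
  by rewrite -(io_serre h c) !mulrA [RHS]addrC addrA [RHS]addrAC.
- by change (k (tau (tau i)) * k (tau i) = 1 :> A); rewrite tauK (io_red h).
- by rewrite ti (io_red_fixed h).
Qed.

(** Here A is any algebra generated by b, k and kV (this is [uniq]) with an
    anti-involution; both U~^i and U^i with distinguished parameters qualify. *)
Section Automorphisms.
Variables (P : iquiver) (Pg : good_iquiver P).
Local Notation I := (vert P).
Variables (L : fieldType) (q : L).
Hypotheses (q0 : q != 0) (q2 : q + q^-1 != 0) (q1 : q - q^-1 != 0).
Variables (A : algType L) (b k kV : I -> A).
Hypothesis h : iota_data q false (fun _ => 1) b k kV.
Hypothesis uniq : forall (B : algType L) (f g : A -> B), is_alg_hom f -> is_alg_hom g ->
  (forall j, f (b j) = g (b j)) -> (forall j, f (k j) = g (k j)) ->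
  (forall j, f (kV j) = g (kV j)) -> f =1 g.

Variable sg : A -> opp_alg A.
Hypothesis sg_hom : is_alg_hom sg.
Hypothesis sg_b : forall j, sg (b j) = b j.
Hypothesis sg_k : forall j, sg (k j) = k (tau j).
Hypothesis sg_kV : forall j, sg (kV j) = kV (tau j).

Lemma uniq_kl (B : algType L) (f g : A -> B) : is_alg_hom f -> is_alg_hom g ->
  (forall j, f (b j) = g (b j)) -> (forall a, f (kl k kV a) = g (kl k kV a)) -> f =1 g.
Proof.
move=> fh gh fb fk; apply: uniq => // j; first by rewrite -(kl_delta k kV).
by rewrite -(kl_Ndelta q0 q2 q1 h).
Qed.

Let s (x : A) : A := sg x.
Let sD x y : s (x + y) = s x + s y. Proof. exact: (homD sg_hom). Qed.
Let sZ c x : s (c *: x) = c *: s x. Proof. exact: (homZ sg_hom). Qed.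
Let sN x : s (- x) = - s x. Proof. exact: (homN sg_hom). Qed.
Let sM x y : s (x * y) = s y * s x. Proof. exact: (homM sg_hom). Qed.
Let s1 : s 1 = 1. Proof. exact: (hom1 sg_hom). Qed.
Let sb j : s (b j) = b j. Proof. exact: sg_b. Qed.
Let sk j : s (k j) = k (tau j). Proof. exact: sg_k. Qed.
Let skV j : s (kV j) = kV (tau j). Proof. exact: sg_kV. Qed.

Lemma sK x : s (s x) = x.
Proof.
suff: s \o s =1 @id A by apply.
apply: uniq => [||j|j|j] /=; rewrite ?sb ?sk ?skV ?tauK //.
by split=> [c u v||u v]; rewrite /= ?sD ?sZ ?sD ?sZ ?s1 ?sM ?s1 ?sM.
Qed.

Lemma s_TB i j : s (TBof q b k kV i j) = sTB q b k kV i j.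
Proof.
rewrite /TBof /sTB; case: eqP => ti; repeat case: ifP => //; move=> *;
  rewrite !(sD, sN, sZ, sM, sb, sk, skV) ?tauK ?ti //.
Qed.

Lemma s_kl a : s (kl k kV a) = kl k kV (lat_tau a).
Proof.
elim/lattice_ind: a => [j|a c ea ec|a ea|].
- have := lat_tau_delta j 1; rewrite !mulr1z => ->.
  by rewrite !kl_delta sk.
- by rewrite (klD q0 q2 q1 h) sM ea ec lat_tauD (klD q0 q2 q1 h) (klC q0 q2 q1 h).
- have e : lat_tau (- a) = - lat_tau a by apply/ffunP => l; rewrite !ffunE.
  have e1 : s (kl k kV a) * s (kl k kV (- a)) = 1 by rewrite -sM (klNl q0 q2 q1 h) s1.
  by rewrite e -[LHS]mul1r -(klNl q0 q2 q1 h (lat_tau a)) -mulrA -ea e1 mulr1.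
- have e : lat_tau 0 = 0 :> lattice P by apply/ffunP => l; rewrite !ffunE.
  by rewrite (kl0 k kV) s1 e (kl0 k kV).
Qed.

Section OneVertex.
Variables (i : I) (f : A -> A).
Hypothesis hf : lifts_T q b k kV i f.

Let g x := s (f (s x)).

Let g_hom : is_alg_hom g.
Proof.
have fh := lT_hom hf; split=> [c u v||u v]; rewrite /g.
- by rewrite sD sZ (homD fh) (homZ fh) sD sZ.
- by rewrite s1 (hom1 fh) s1.
- by rewrite sM (homM fh) sM.
Qed.

(** On the b_j this is the inverse formula; on the torus it holds because reflections
    are involutions that commute with tau. *)
Lemma conj_left_inverse x : s (f (s (f x))) = x.
Proof.
have fh := lT_hom hf; suff: g \o f =1 @id A by apply.
apply: uniq_kl => // [|j|a]; first exact: is_alg_hom_comp.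
- rewrite /= /g (lT_b hf) s_TB (hom_sTB fh).
  have -> : f \o b = TBof q b k kV i by apply/funext => l; exact: (lT_b hf).
  have -> : f \o k = TK q k kV i by apply/funext => l; exact: (lT_k hf).
  have -> : f \o kV = TKV q k kV i by apply/funext => l; exact: (lT_kV hf).
  by rewrite (T_sT Pg q0 q2 q1 h) sb.
- have fkl c := lifts_T_kl Pg q0 q2 q1 h c hf.
  rewrite /= /g fkl sZ s_kl (homZ fh) fkl !sZ s_kl (brefl_tau Pg) (breflK Pg) coc_tau //.
  have -> : lat_tau (lat_tau a) = a by apply/ffunP => l; rewrite !ffunE tauK.
  rewrite scalerA /coc (breflK Pg) mulrA divfK ?bl_neq0 // divff ?bl_neq0 // scale1r.
  by [].
Qed.

Definition T_aut : algAut A.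
Proof.
apply: (@AlgIso L A A f g (lT_hom hf)) => x; first exact: conj_left_inverse.
by rewrite /g -[RHS]sK -[in RHS](conj_left_inverse (s x)) sK.
Defined.
End OneVertex.

Section TwoVertices.
Variables (i j : I) (f g : A -> A).
Hypotheses (hf : lifts_T q b k kV i f) (hg : lifts_T q b k kV j g).
Let fh := lT_hom hf.
Let gh := lT_hom hg.

Lemma far_relation : far i j -> forall x, f (g x) = g (f x).
Proof.
move=> ij; apply: (@uniq_kl A (f \o g) (g \o f)) => [||l|a]; try exact: is_alg_hom_comp.
- exact: (orth_braid Pg q0 q2 q1 h hf hg ij).
- exact: (orth_kl Pg q0 q2 q1 h hf hg).
Qed.

Lemma same_kind_relation : same_kind i j -> forall x, f (g (f x)) = g (f (g x)).
Proof.
move=> ij; apply: (@uniq_kl A (f \o (g \o f)) (g \o (f \o g)));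
  [exact: is_alg_hom_comp (is_alg_hom_comp fh gh) fh|exact: is_alg_hom_comp (is_alg_hom_comp gh fh) gh| |].
- by move=> l; exact: (same_kind_braid Pg q0 q2 q1 h l ij hf hg).
- by move=> a; exact: (same_kind_kl Pg q0 q2 q1 h hf hg).
Qed.

Lemma mixed_relation : tau i != i -> tau j = j -> cartan i j = -1 ->
  forall x, f (g (f (g x))) = g (f (g (f x))).
Proof.
move=> ti tj ij; apply: (@uniq_kl A (f \o (g \o (f \o g))) (g \o (f \o (g \o f))));
  [exact: is_alg_hom_comp (is_alg_hom_comp (is_alg_hom_comp gh fh) gh) fh
  |exact: is_alg_hom_comp (is_alg_hom_comp (is_alg_hom_comp fh gh) fh) gh| |].
- by move=> l; rewrite /= (mixed_braid Pg q0 q2 q1 h ti tj ij hg hf).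
- by move=> a; exact: (mixed_kl Pg q0 q2 q1 h hf hg).
Qed.
End TwoVertices.
End Automorphisms.

Section PresGroupLift.
Variables (X : Type) (R : gterm X -> gterm X -> Prop) (G : groupType).
Local Open Scope group_scope.

Fixpoint geval (t : X -> G) (s : gterm X) : G :=
  match s with
  | GOne => 1
  | GGen x => t x
  | GMul s1 s2 => geval t s1 * geval t s2
  | GInv s1 => (geval t s1)^-1
  end.

Variable t : X -> G.
Hypothesis tR : forall s u, R s u -> geval t s = geval t u.

Lemma gcong_geval s u : gcong R s u -> geval t s = geval t u.
Proof.
elim=> //=.
- by move=> ? ? ? _ -> _ ->.
- by move=> ? ? ? ? _ -> _ ->.
- by move=> ? ? _ ->.
- by move=> *; rewrite mulgA.
- by move=> *; rewrite mul1g.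
- by move=> *; rewrite mulg1.
- by move=> *; rewrite mulVg.
- by move=> *; rewrite mulgV.
Qed.

Definition presGroup_fun (x : presGroup R) : G := geval t (repr x).

Lemma presGroup_funE s : presGroup_fun (\pi_(presGroup R)%qT s) = geval t s.
Proof. by apply/gcong_geval/gcong_repr. Qed.

Fact presGroup_funM : {morph presGroup_fun : x y / x * y}.
Proof.
elim/quotW=> s; elim/quotW=> u; rewrite -[LHS]/(presGroup_fun (pres_mul _ _)) pres_mulE.
by rewrite !presGroup_funE.
Qed.

Lemma presGroup_lift : exists Phi : {multiplicative presGroup R -> G},
  forall x, Phi (pres_gen R x) = t x.
Proof.
exists (HB.pack_for {multiplicative presGroup R -> G} presGroup_fun
  (isMultiplicative.Build _ _ presGroup_fun presGroup_funM)).
by move=> x; rewrite /= presGroup_funE.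
Qed.
End PresGroupLift.

(** * The action of the braid group *)

Section BraidGroup.
Variables (P : iquiver) (It : {set vert P}) (Pd : dynkin P) (Ir : orbit_reps It).
Local Notation I := (vert P).

Lemma good_orbit_reps : good_iquiver P.
Proof. by split=> // i; exact: not_adj_tau Ir i. Qed.
Let Pg := good_orbit_reps.

(** The relations between two chosen representatives: orders 2, 3, 4 and 4. *)
Inductive It_position (i j : I) : Prop :=
| It_far of far i j
| It_same_kind of same_kind i j
| It_mixed of tau i != i & tau j = j & cartan i j = -1
| It_mixed' of tau j != j & tau i = i & cartan j i = -1.

Lemma It_positionP i j : i \in It -> j \in It -> i != j -> It_position i j.
Proof.
move=> iI jI ij; have ji : j != i by rewrite eq_sym.
have jt : j != tau i.
  apply: contraNneq ij => e; rewrite e in jI; by rewrite e (It_tau Ir iI jI).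
have [c|c] : cartan i j = 0 \/ cartan i j = -1.
  by case: (cartanP Pg i j) => [e|e|e]; [rewrite e eqxx in ij|left|right].
  have [tj|tj] := eqVneq (tau j) j; first by apply: It_far; split; rewrite ?tj.
  have [ti|ti] := eqVneq (tau i) i; first by apply: It_far; split; rewrite // -ctauL ti.
  apply: It_far; split=> //; have := It_not_adj Ir iI jI ti tj.
  by case: (cartanP Pg i (tau j)) => [e|//|->//]; rewrite e tauK eqxx in jt.
have [tj|tj] := eqVneq (tau j) j; have [ti|ti] := eqVneq (tau i) i.
- by apply: It_same_kind; split=> //; left.
- exact: It_mixed.
- by apply: It_mixed'; rewrite // cartanC.
- apply: It_same_kind; split=> //; right; split=> //; have := It_not_adj Ir iI jI ti tj.
  by case: (cartanP Pg i (tau j)) => [e|//|->//]; rewrite e tauK eqxx in jt.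
Qed.

Variables (L : fieldType) (q : L).
Hypotheses (q0 : q != 0) (q2 : q + q^-1 != 0) (q1 : q - q^-1 != 0).
Variables (A : algType L) (b k kV : I -> A).
Hypothesis h : iota_data q false (fun _ => 1) b k kV.
Hypothesis uniq : forall (B : algType L) (f g : A -> B), is_alg_hom f -> is_alg_hom g ->
  (forall j, f (b j) = g (b j)) -> (forall j, f (k j) = g (k j)) ->
  (forall j, f (kV j) = g (kV j)) -> f =1 g.
Variable T : I -> algAut A.
Hypothesis T_lifts : forall i, lifts_T q b k kV i (T i).

(** The order that appears in a relation of the braid group is determined by the
    positions of the two vertices, so each relation is one of those already
    established. *)
Theorem braid_group_action : exists Phi : {multiplicative Br It -> algAut A},
  forall i : {i | i \in It}, Phi (braid_gen i) = T (val i).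
Proof.
apply: presGroup_lift => s t [i j m ij o]; have ne : val i != val j by [].
case: (It_positionP (valP i) (valP j) ne) => [f|f|ti tj c|tj ti c].
- rewrite (order_far Pg f o); apply: algIso_eq => x.
  exact: (far_relation Pg q0 q2 q1 h uniq (T_lifts _) (T_lifts _) f x).
- rewrite (order_same_kind Pg f o); apply: algIso_eq => x.
  exact: (same_kind_relation Pg q0 q2 q1 h uniq (T_lifts _) (T_lifts _) f x).
- rewrite (order_mixed Pg ti tj c o); apply: algIso_eq => x.
  exact: (mixed_relation Pg q0 q2 q1 h uniq (T_lifts _) (T_lifts _) ti tj c x).
- rewrite (order_mixed' Pg tj ti c o); apply: algIso_eq => x; apply/esym.
  exact: (mixed_relation Pg q0 q2 q1 h uniq (T_lifts _) (T_lifts _) tj ti c x).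
Qed.
End BraidGroup.

(** * Braid operators on the iota quantum groups *)

Section HomT.
Variables (P : iquiver) (L : fieldType) (q : L) (A B : algType L) (k kV : vert P -> A).
Variables (f : A -> B) (fh : is_alg_hom f).

Lemma hom_TK i j : f (TK q k kV i j) = TK q (f \o k) (f \o kV) i j.
Proof. by rewrite /TK; repeat case: ifP => _; rewrite ?(homE fh). Qed.
Lemma hom_TKV i j : f (TKV q k kV i j) = TKV q (f \o k) (f \o kV) i j.
Proof. by rewrite /TKV; repeat case: ifP => _; rewrite ?(homE fh). Qed.
End HomT.

Section Normalize.
Variables (P : iquiver) (L : fieldType) (q : L) (s : vert P -> L).
Hypotheses (s_tau : forall i, s (tau i) = s i) (s0 : forall i, s i != 0).
Variables (A : algType L) (b k kV : vert P -> A).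

(** The relations of U^i become those of U~^i when k_i is replaced by s_i k_i: this is
    the quotient map from U~^i to U^i. *)
Lemma iota_rescale_k : iota_data q true s b k kV ->
  iota_data q false (fun _ => 1) b (fun i => s i *: k i) (fun i => (s i)^-1 *: kV i).
Proof.
move=> h; split=> // [i|i|i j|i j|i j c ij|i ti|i j c].
- by rewrite -scalerAl -scalerAr scalerA mulfV // scale1r (io_kkV h).
- by rewrite -scalerAl -scalerAr scalerA mulVf // scale1r (io_kVk h).
- by rewrite -!scalerAl -!scalerAr (io_kk h) !scalerA mulrC.
- by rewrite -scalerAl -scalerAr (io_kb h) !scalerA mulrC.
- exact: (io_comm h).
- by rewrite (io_pair h) // s_tau -scalerBr scalerA mul1r mulrC.
- rewrite (io_serre h) // -scalerAl scalerA; case: ifP => _; first by rewrite mulr1.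
  by rewrite mul0r.
Qed.

Lemma iota_reduce_k : iota_data q false (fun _ => 1) b k kV ->
  (forall i, k i * k (tau i) = (s i ^+ 2)%:A) -> (forall i, tau i = i -> k i = (s i)%:A) ->
  iota_data q true s b (fun i => (s i)^-1 *: k i) (fun i => s i *: kV i).
Proof.
move=> h h1 h2; split=> [i|i|i j|i j|i j c ij|i ti|i j c|_ i|_ i ti].
- by rewrite -scalerAl -scalerAr scalerA mulVf // scale1r (io_kkV h).
- by rewrite -scalerAl -scalerAr scalerA mulfV // scale1r (io_kVk h).
- by rewrite -!scalerAl -!scalerAr (io_kk h) !scalerA mulrC.
- by rewrite -scalerAl -scalerAr (io_kb h) !scalerA mulrC.
- exact: (io_comm h).
- by rewrite (io_pair h) // s_tau -scalerBr scalerA mul1r mulrAC divff // mul1r.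
- rewrite (io_serre h) // -scalerAl scalerA; case: ifP => _; last by rewrite mul0r.
  by rewrite mulr1 mulfK.
- by rewrite -scalerAl -scalerAr h1 !scalerA s_tau -invfM -expr2 mulVf ?scale1r ?expf_neq0.
- by rewrite h2 // scalerA mulVf // scale1r.
Qed.
End Normalize.

Section Diamond.
Variables (P : iquiver) (Pg : good_iquiver P).
Local Notation I := (vert P).
Variables (L : fieldType) (q : L).
Hypotheses (q0 : q != 0) (q2 : q + q^-1 != 0) (q1 : q - q^-1 != 0).
Variables (A : algType L) (b k kV : I -> A).
Hypothesis h : iota_data q false (fun _ => 1) b k kV.
Local Notation TK := (TK q k kV).
Local Notation kl := (kl k kV).
Variable sdia : I -> L.
Hypothesis sdiaE : forall i, sdia i = if tau i == i then - q ^- 2 else 1.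
Hypothesis k_k : forall i, k i * k (tau i) = (sdia i ^+ 2)%:A.
Hypothesis k_fixed : forall i, tau i = i -> k i = (sdia i)%:A.

(** This is what distinguishes these parameters: the scalars of T_i are built from the
    b_j, and k_j takes the value inverse to b_j. *)
Lemma sdia_bl j : sdia j = (bl q (simple_root j))^-1.
Proof. by rewrite bl_delta sdiaE; case: ifP => _; rewrite ?invrN ?invr1. Qed.

Lemma lat_tau_root j : lat_tau (simple_root j) = simple_root (tau j) :> lattice P.
Proof. by have := lat_tau_delta j 1; rewrite !mulr1z. Qed.

(** The additional relations of U^i, extended from simple roots to the lattice, where
    the reflections can be applied to them. *)
Lemma kl_kl_tau (a : lattice P) : kl a * kl (lat_tau a) = (bl q a ^- 2)%:A.
Proof.
have D := klD q0 q2 q1 h.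
elim/lattice_ind: a => [j|a c ea ec|a ea|].
- by rewrite lat_tau_root !kl_delta k_k sdia_bl exprVn.
- rewrite lat_tauD !D -mulrA (mulrA (kl c)) (klC q0 q2 q1 h c) -(mulrA _ (kl c)) ec mulrA ea.
  by rewrite -scalerAl mul1r scalerA blD // exprMn [in RHS]invfM.
- have e : lat_tau (- a) = - lat_tau a by apply/ffunP => l; rewrite !ffunE.
  have e1 : kl (- a) * kl (lat_tau (- a)) * (kl a * kl (lat_tau a)) = 1.
    rewrite e -!D -[X in kl X](_ : 0 = _) ?kl0 //.
    by apply/ffunP => l; rewrite !ffunE; ring.
  have e2 : (bl q a ^- 2)%:A * (bl q a ^+ 2)%:A = 1 :> A.
    by rewrite -scalerAl mul1r scalerA mulVf ?scale1r // expf_neq0 ?bl_neq0.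
  rewrite blN // exprVn invrK; transitivity (kl (- a) * kl (lat_tau (- a)) *
    ((bl q a ^- 2)%:A * (bl q a ^+ 2)%:A)); first by rewrite e2 mulr1.
  by rewrite mulrA -ea e1 mul1r.
- have -> : lat_tau 0 = 0 :> lattice P by apply/ffunP => l; rewrite !ffunE.
  by rewrite kl0 bl0 // expr1n invr1 scale1r mulr1.
Qed.

Lemma TK_k_k i j : TK i j * TK i (tau j) = (sdia j ^+ 2)%:A.
Proof.
rewrite !(TK_kl Pg q0 q2 q1 h) -lat_tau_root coc_tau // (brefl_tau Pg).
rewrite -scalerAl -scalerAr scalerA kl_kl_tau scalerA; congr (_ *: _).
rewrite sdia_bl /coc exprVn expr2 mulf_div -expr2 mulrAC divff ?mul1r ?expr2 //.
by rewrite mulf_neq0 ?bl_neq0.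
Qed.

(** The identity for k_a k_(tau a) gives the square of k_j only when j is fixed, hence
    a case distinction on the position of j. *)
Lemma TK_fixed i j : tau j = j -> TK i j = (sdia j)%:A.
Proof.
move=> tj; have kV_fixed l : tau l = l -> kV l = (sdia l)^-1%:A.
  move=> tl; have l0 : sdia l != 0 by rewrite sdia_bl invr_eq0 bl_neq0.
  have e := io_kVk h l; rewrite (k_fixed tl) -scalerAr mulr1 in e.
  by rewrite -e scalerA mulVf // scale1r.
have kj := k_fixed tj; rewrite sdiaE tj eqxx in kj *.
case: (positionP Pg i j) => [ij|ji ti|ti ji c|ti ji jt c c'|ti ji jt c c'|ti ji jt c c' _|ji jt c c'].
- have ti : tau i = i by rewrite -ij.
  rewrite ij !(posSelfFixedE q b k kV ti) kV_fixed // sdiaE ti eqxx scalerA; congr (_ *: _).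
  have e4 : q ^- 4 = q ^- 2 * q ^- 2 by rewrite -invfM -exprD.
  by rewrite e4 invrN invrK mulrN -mulrA mulVf ?expf_neq0 // mulr1.
- by case/eqP: ti; rewrite -[RHS](tauK i) -ji tj.
- rewrite !(posFixedE q b k kV ti ji c) kj (k_fixed ti) sdiaE ti eqxx -scalerAl mul1r !scalerA.
  by congr (_ *: _); rewrite mulrNN divff ?mul1r // expf_neq0.
- by rewrite tj c in c'.
- by rewrite tj c in c'.
- rewrite !(posFree12E q1 b k kV ti ji jt c c') k_k sdiaE (negbTE ti) expr1n scale1r mulr1.
  by rewrite kj.
- by rewrite !(posFarE q b k kV ji jt c c').
Qed.
End Diamond.

Section DiamondT.
Variables (P : iquiver) (Pg : good_iquiver P).
Local Notation I := (vert P).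
Variables (L : fieldType) (q : L) (s : I -> L).
Hypotheses (q0 : q != 0) (q2 : q + q^-1 != 0) (q1 : q - q^-1 != 0).
Hypothesis sE : forall i, s i = if tau i == i then - q ^- 2 else 1.
Variables (A : algType L) (b k kV : I -> A).
Hypothesis d : iota_data q true s b k kV.
Let K i := s i *: k i.
Let KV i := (s i)^-1 *: kV i.

Lemma diamond_tau i : s (tau i) = s i.
Proof. by rewrite !sE tauK eq_sym. Qed.
Lemma diamond_neq0 i : s i != 0.
Proof. by rewrite sE; case: ifP => _; rewrite ?oner_eq0 // oppr_eq0 invr_eq0 expf_neq0. Qed.

Lemma diamond_data : iota_data q false (fun _ => 1) b K KV.
Proof. exact: iota_rescale_k diamond_tau diamond_neq0 _ _ _ _ d. Qed.

Lemma diamond_T_data i : iota_data q true s (TBof q b K KV i)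
  (fun j => (s j)^-1 *: TK q K KV i j) (fun j => s j *: TKV q K KV i j).
Proof.
have h := diamond_data.
have kk j : K j * K (tau j) = (s j ^+ 2)%:A.
  by rewrite -scalerAl -scalerAr (io_red d) // scalerA diamond_tau -expr2.
have kf j : tau j = j -> K j = (s j)%:A by move=> tj; rewrite /K (io_red_fixed d).
apply: iota_reduce_k (T_iota Pg q0 q2 q1 h i) _ _ => [| |j|j tj].
- exact: diamond_tau.
- exact: diamond_neq0.
- exact: (TK_k_k Pg q0 q2 q1 h sE kk i j).
- exact: (TK_fixed Pg q0 q1 h sE kk kf i tj).
Qed.

Lemma diamond_lifts i (f : A -> A) : is_alg_hom f -> (forall j, f (b j) = TBof q b K KV i j) ->
  (forall j, f (k j) = (s j)^-1 *: TK q K KV i j) ->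
  (forall j, f (kV j) = s j *: TKV q K KV i j) -> lifts_T q b K KV i f.
Proof.
move=> fh fb fk fkV; split=> // j; first by rewrite (homZ fh) fk scalerA mulfV ?scale1r ?diamond_neq0.
by rewrite (homZ fh) fkV scalerA mulVf ?scale1r ?diamond_neq0.
Qed.
End DiamondT.

Section Uti.
Variables (P : iquiver) (Pg : good_iquiver P).
Local Notation I := (vert P).

Lemma Uti_hom_eq (B : algType Qv) (f g : Uti P -> B) : is_alg_hom f -> is_alg_hom g ->
  (forall j, f (Uti_B j) = g (Uti_B j)) -> (forall j, f (Uti_k j) = g (Uti_k j)) ->
  (forall j, f (Uti_kV j) = g (Uti_kV j)) -> f =1 g.
Proof. by move=> fh gh eb ek ekV; apply: subalg_hom_eq => // _ [] j; [exact: eb|exact: ek|exact: ekV]. Qed.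

Lemma Uti_T (i : I) : exists f : algAut (Uti P), lifts_T qv (@Uti_B P) (@Uti_k P) (@Uti_kV P) i f.
Proof.
have h := Uti_data Pg.
have [sg [sh sb sk skV]] := Uti_lift Pg (@iota_opp P Qv qv false (fun _ => 1) (fun _ => erefl) qv0 _ _ _ _ h).
have [f [fh fb fk fkV]] := Uti_lift Pg (T_iota Pg qv0 qv2 qv1 h i).
have hf : lifts_T qv (@Uti_B P) (@Uti_k P) (@Uti_kV P) i f by [].
by exists (T_aut Pg qv0 qv2 qv1 h Uti_hom_eq sh sb sk skV hf).
Qed.

Lemma lifts_is_T i (f : algAut (Uti P)) :
  lifts_T qv (@Uti_B P) (@Uti_k P) (@Uti_kV P) i f -> is_T i f.
Proof.
move=> hf; split=> [a|j].
  exact: (lifts_T_kl Pg qv0 qv2 qv1 (Uti_data Pg) a hf).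
by rewrite (lT_b hf) /T_B /TB invrN.
Qed.
End Uti.

Section Ui.
Variables (P : iquiver) (Pg : good_iquiver P).
Local Notation I := (vert P).

Lemma Ui_hom_eq (vs : I -> Qv) (B : algType Qv) (f g : Ui vs -> B) : is_alg_hom f -> is_alg_hom g ->
  (forall j, f (Ui_B vs j) = g (Ui_B vs j)) -> (forall j, f (Ui_k vs j) = g (Ui_k vs j)) ->
  (forall j, f (Ui_kV vs j) = g (Ui_kV vs j)) -> f =1 g.
Proof. by move=> fh gh eb ek ekV; apply: subalg_hom_eq => // _ [] j; [exact: eb|exact: ek|exact: ekV]. Qed.

Lemma vs_diamond_neq0 (i : I) : vs_diamond i != 0.
Proof. by rewrite /vs_diamond; case: ifP => _; rewrite ?oner_eq0 // oppr_eq0 invr_eq0 expf_neq0 ?qv0. Qed.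
Lemma vs_diamond_tau (i : I) : vs_diamond (tau i) = vs_diamond i.
Proof. by rewrite /vs_diamond tauK eq_sym. Qed.

Local Notation V := (@vs_diamond P).
Local Notation b := (Ui_B V).
Local Notation k := (fun i => V i *: Ui_k V i).
Local Notation kV := (fun i => (V i)^-1 *: Ui_kV V i).

Lemma Ui_diamond_data : iota_data qv false (fun _ => 1) b k kV.
Proof.
exact: (@iota_rescale_k P Qv qv V vs_diamond_tau vs_diamond_neq0 _ _ _ _ (Ui_data Pg vs_diamond_tau)).
Qed.

Lemma Ui_diamond_hom_eq (B : algType Qv) (f g : Ui V -> B) : is_alg_hom f -> is_alg_hom g ->
  (forall j, f (b j) = g (b j)) -> (forall j, f (k j) = g (k j)) ->
  (forall j, f (kV j) = g (kV j)) -> f =1 g.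
Proof.
move=> fh gh eb ek ekV; apply: Ui_hom_eq => // j.
  by apply: (scalerI (vs_diamond_neq0 j)); rewrite -(homZ fh) -(homZ gh).
have v0 : (V j)^-1 != 0 by rewrite invr_eq0 vs_diamond_neq0.
by apply: (scalerI v0); rewrite -(homZ fh) -(homZ gh).
Qed.

Lemma Ui_diamond_T (i : I) : exists g : algAut (Ui V), lifts_T qv b k kV i g.
Proof.
have d := Ui_data Pg vs_diamond_tau; have h := Ui_diamond_data.
have [sg [sh sb sk skV]] := Ui_lift Pg vs_diamond_tau (iota_opp vs_diamond_tau qv0 d).
have VE j : V j = if tau j == j then - qv ^- 2 else 1 by [].
have [f [fh fb fk fkV]] := Ui_lift Pg vs_diamond_tau (diamond_T_data Pg qv0 qv2 qv1 VE d i).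
have hf := diamond_lifts qv0 VE fh fb fk fkV.
have sk' j : sg (k j) = k (tau j) :> opp_alg _ by rewrite (homZ sh) sk vs_diamond_tau.
have skV' j : sg (kV j) = kV (tau j) :> opp_alg _ by rewrite (homZ sh) skV vs_diamond_tau.
by exists (T_aut Pg qv0 qv2 qv1 h Ui_diamond_hom_eq sh sb sk' skV' hf).
Qed.

Lemma lifts_is_T_diamond i (g : algAut (Ui V)) : lifts_T qv b k kV i g -> is_T_diamond i g.
Proof.
move=> hg; have [f hf] := Uti_T Pg i; have h := Ui_diamond_data.
have [r [rh rb rk rkV]] := Uti_lift Pg h.
have eb : r \o @Uti_B P = b by apply/funext.
have ek : r \o @Uti_k P = k by apply/funext.
have ekV : r \o @Uti_kV P = kV by apply/funext.
exists f, r; split=> // [|x]; first exact: lifts_is_T.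
have fh := lT_hom hf; have gh := lT_hom hg.
apply: (@Uti_hom_eq P _ (g \o r) (r \o f)) => [||j|j|j]; try exact: is_alg_hom_comp; rewrite /=.
- by rewrite (lT_b hf) rb (lT_b hg) (hom_TB rh) eb ek ekV.
- by rewrite (lT_k hf) rk (lT_k hg) (hom_TK _ _ _ rh) ek ekV.
- by rewrite (lT_kV hf) rkV (lT_kV hg) (hom_TKV _ _ _ rh) ek ekV.
Qed.
End Ui.

(** * Extension and restriction of scalars *)

(** Restriction of scalars: F-linear morphisms from F (x)_K A to B are K-linear
    morphisms from A to B regarded as a K-algebra. *)
Section Restriction.
Variables (K : fieldType) (F : fieldExtType K) (B : algType F).

Definition restr : Type := B.
HB.instance Definition _ := GRing.NzRing.on restr.

Definition restr_scale (c : K) (x : restr) : restr := (c%:A : F) *: (x : B).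
Fact restr_scaleA c d x : restr_scale c (restr_scale d x) = restr_scale (c * d) x.
Proof. by rewrite /restr_scale scalerA -scalerAl mul1r scalerA. Qed.
Fact restr_scale1 : left_id 1 restr_scale.
Proof. by move=> x; rewrite /restr_scale !scale1r. Qed.
Fact restr_scaleDr : right_distributive restr_scale +%R.
Proof. by move=> c x y; rewrite /restr_scale -scalerDr. Qed.
Fact restr_scaleDl x : {morph restr_scale^~ x : c d / c + d}.
Proof. by move=> c d; rewrite /restr_scale [in LHS]scalerDl scalerDl. Qed.
HB.instance Definition _ := GRing.Zmodule_isLmodule.Build K restr
  restr_scaleA restr_scale1 restr_scaleDr restr_scaleDl.
Fact restr_scaleAl (c : K) (x y : restr) : c *: (x * y : restr) = (c *: x : restr) * y.
Proof. exact: (@scalerAl F B). Qed.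
HB.instance Definition _ := GRing.Lmodule_isLalgebra.Build K restr restr_scaleAl.
Fact restr_scaleAr (c : K) (x y : restr) : c *: (x * y : restr) = x * (c *: y : restr).
Proof. exact: (@scalerAr F B). Qed.
HB.instance Definition _ := GRing.Lalgebra_isAlgebra.Build K restr restr_scaleAr.

Lemma restrE (c : K) (x : restr) : c *: x = (c%:A : F) *: (x : B). Proof. by []. Qed.
End Restriction.

Section ExtScal.
Variables (K : fieldType) (F : fieldExtType K).

Lemma ext_in_hom (A : algType K) : is_alg_hom (@ext_in K F A : A -> restr (extScal F A)).
Proof.
have r s t : ext_rel s t -> aeval (@ext_in K F A) s = aeval (@ext_in K F A) t.
  exact: (@pres_gen_rel F A (Presentation (@ext_nontrivial K F A))).
split=> [c x y||x y].
- have e := r _ _ (ext_add F (c *: x) y); have e' := r _ _ (ext_scale F c x); rewrite /= in e e'.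
  by rewrite e e'.
- exact: (r _ _ (ext_1 F A)).
- exact: (r _ _ (ext_mul F x y)).
Qed.

Section Lift.
Variables (A : algType K) (B : algType F) (g : A -> restr B).
Hypothesis gh : is_alg_hom g.

Lemma ext_lift : exists f : extScal F A -> B, is_alg_hom f /\ forall x, f (ext_in F x) = g x.
Proof.
pose g' : A -> B := g.
have r s t : ext_rel s t -> aeval g' s = aeval g' t.
  case=> [|x y|x y|c x] /=; rewrite /g'.
  - exact: (hom1 gh). - exact: (homM gh). - exact: (homD gh). - exact: (homZ gh).
exists (@pres_lift F A (Presentation (@ext_nontrivial K F A)) B g'); split.
  exact: (pres_lift_hom (Pr := Presentation (@ext_nontrivial K F A)) r).
by move=> x; exact: (pres_lift_gen (Pr := Presentation (@ext_nontrivial K F A)) r x).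
Qed.
End Lift.

Lemma ext_hom_eq (A : algType K) (B : algType F) (f g : extScal F A -> B) :
  is_alg_hom f -> is_alg_hom g -> (forall x, f (ext_in F x) = g (ext_in F x)) -> f =1 g.
Proof. exact: (@pres_hom_eq F A (Presentation (@ext_nontrivial K F A))). Qed.

Lemma restr_hom (B C : algType F) (f : B -> C) : is_alg_hom f ->
  is_alg_hom (f : restr B -> restr C).
Proof.
move=> fh; split=> [c x y||x y]; [|exact: (hom1 fh)|exact: (homM fh)].
by rewrite restrE; exact: (etrans (homD fh _ _) (congr1 (fun z => z + _) (homZ fh _ _))).
Qed.

Lemma ext_aut (A : algType K) (f : algAut A) :
  exists g : algAut (extScal F A), forall x, g (ext_in F x) = ext_in F (f x).
Proof.
have h (u : algAut A) : exists g : extScal F A -> extScal F A,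
    is_alg_hom g /\ forall x, g (ext_in F x) = ext_in F (u x).
  exact: (ext_lift (is_alg_hom_comp (iso_hom u) (ext_in_hom A))).
have [[g [gh gE]] [g' [gh' gE']]] := (h f, h (aut_inv f)).
have gK : cancel g g'.
  apply: (@ext_hom_eq A _ (g' \o g) id) => [||x]; [exact: is_alg_hom_comp|by []|].
  by rewrite /= gE gE' /= iso_funK.
have gK' : cancel g' g.
  apply: (@ext_hom_eq A _ (g \o g') id) => [||x]; [exact: is_alg_hom_comp|by []|].
  by rewrite /= gE' gE /= iso_invK.
by exists (AlgIso gh gK gK').
Qed.
End ExtScal.

Section RescaleB.
Variables (P : iquiver) (L : fieldType) (q : L) (red : bool) (s s' : vert P -> L).
Variables (A : algType L) (b k kV z : vert P -> A).
Hypotheses (zC : forall i x, z i * x = x * z i) (z_tau : forall i, z (tau i) = z i).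
Hypothesis zz : forall i, s i *: (z i * z i) = (s' i)%:A.

Let m2 u v : z u * b u * (z v * b v) = z u * z v * (b u * b v).
Proof. by rewrite -!mulrA (mulrA (b u)) -(zC v (b u)) !mulrA. Qed.
Let m3 u v w : z u * b u * (z v * b v) * (z w * b w) = z u * z v * z w * (b u * b v * b w).
Proof. by rewrite m2 -(mulrA (z u * z v)) (mulrA (b u * b v)) -(zC w (b u * b v)) !mulrA. Qed.

(** In the relations s_i accompanies the replacement of the two letters b_i and
    b_(tau i) by a torus element, so a central square root of s'_i / s_i absorbs a
    change of parameters. *)
Lemma iota_rescale_b : iota_data q red s b k kV ->
  iota_data q red s' (fun i => z i * b i) k kV.
Proof.
move=> h; split=> [i|i|i j|i j|i j c ij|i ti|i j c|r i|r i ti].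
- exact: (io_kkV h).
- exact: (io_kVk h).
- exact: (io_kk h).
- by rewrite mulrA -(zC j (k i)) -!mulrA (io_kb h) -scalerAr.
- by rewrite !m2 (io_comm h) // zC.
- rewrite !m2 z_tau -mulrBr (io_pair h) // -scalerAr scalerAl.
  have -> : (s i / (q - q^-1)) *: (z i * z i) = (s' i / (q - q^-1))%:A.
    by rewrite mulrC -(scalerA _ (s i)) zz scalerA mulrC.
  by rewrite -scalerAl mul1r.
- rewrite !m3; have -> : z i * z j * z i = z i * z i * z j by rewrite -mulrA (zC j) mulrA.
  have -> : z j * z i * z i = z i * z i * z j by rewrite -mulrA zC.
  rewrite scalerAr -mulrBr -mulrDr (io_serre h) //; case: ifP => _; last by rewrite !scale0r mulr0.
  have e : (q * s i) *: (z i * z i) = (q * s' i)%:A by rewrite -(scalerA _ (s i)) zz scalerA.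
  rewrite -scalerAr scalerAl scalerAl e -!scalerAl mul1r mulrA -(zC j (k i)).
  by rewrite -mulrA.
- exact: (io_red h).
- exact: (io_red_fixed h).
Qed.
End RescaleB.

(** * General parameters *)

Section PhiU.
Variables (P : iquiver) (Pg : good_iquiver P) (F : fieldExtType Qv).
Local Notation I := (vert P).

(** The scalars a_i lie in F only, so the presentation of U^i over Q(v) is applied with
    values in F (x) U^i, where they are central. *)
Lemma rescale_hom (s s' : I -> Qv) (a : I -> F) :
  (forall i, s (tau i) = s i) -> (forall i, s' (tau i) = s' i) -> (forall i, s i != 0) ->
  (forall i, a (tau i) = a i) -> (forall i, a i ^+ 2 = (s' i / s i)%:A) ->
  exists f : extScal F (Ui s') -> extScal F (Ui s), [/\ is_alg_hom f,
    forall i, f (ext_in F (Ui_B s' i)) = a i *: ext_in F (Ui_B s i),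
    forall i, f (ext_in F (Ui_k s' i)) = ext_in F (Ui_k s i) &
    forall i, f (ext_in F (Ui_kV s' i)) = ext_in F (Ui_kV s i)].
Proof.
move=> st st' s0 ta a2; pose B := extScal F (Ui s).
have d := iota_data_hom (ext_in_hom F (Ui s)) (Ui_data Pg st).
pose z i : restr B := (a i)%:A.
have zE i (x : B) : z i * x = a i *: x :> B.
  by change (((a i)%:A : B) * x = a i *: x); rewrite -scalerAl mul1r.
have zC i (x : restr B) : z i * x = x * z i.
  by rewrite [LHS]zE; change (a i *: (x : B) = (x : B) * (a i)%:A); rewrite -scalerAr mulr1.
have zt i : z (tau i) = z i by rewrite /z ta.
have zz i : s i *: (z i * z i) = (s' i)%:A :> restr B.
  have -> : z i * z i = a i *: (a i *: 1 : B) by exact: zE.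
  rewrite !restrE !scalerA -mulrA -expr2 a2 -scalerAl mul1r scalerA.
  by rewrite mulrC divfK.
have [g [gh gb gk gkV]] := Ui_lift Pg st' (iota_rescale_b zC zt zz d).
have [f [fh fE]] := ext_lift gh.
exists f; split=> // i; rewrite fE; [rewrite gb; exact: zE|exact: gk|exact: gkV].
Qed.

(** The morphism for the inverse scalars is inverse on the generators. *)
Lemma rescale_iso (s s' : I -> Qv) (a : I -> F) :
  (forall i, s (tau i) = s i) -> (forall i, s' (tau i) = s' i) ->
  (forall i, s i != 0) -> (forall i, s' i != 0) ->
  (forall i, a (tau i) = a i) -> (forall i, a i ^+ 2 = (s' i / s i)%:A) ->
  exists f : algIso (extScal F (Ui s')) (extScal F (Ui s)),
    (forall i, f (ext_in F (Ui_B s' i)) = a i *: ext_in F (Ui_B s i)) /\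
    (forall i, f (ext_in F (Ui_k s' i)) = ext_in F (Ui_k s i)).
Proof.
move=> st st' s0 s0' ta a2.
have a0 i : a i != 0.
  rewrite -sqrf_eq0 a2 scaler_eq0 oner_eq0 orbF mulf_neq0 // invr_eq0; exact: s0.
have aV2 i : (a i)^-1 ^+ 2 = (s i / s' i)%:A.
  apply: (mulfI (x := a i ^+ 2)); first by rewrite expf_neq0.
  rewrite exprVn divff ?expf_neq0 // a2 -scalerAl mul1r scalerA.
  by rewrite mulrA divfK // divff // scale1r.
have taV i : (a (tau i))^-1 = (a i)^-1 by rewrite ta.
have [f [fh fb fk fkV]] := rescale_hom st st' s0 ta a2.
have [g [gh gb gk gkV]] := @rescale_hom s' s (fun i => (a i)^-1) st' st s0' taV aV2.
have K (t : I -> Qv) (u : extScal F (Ui t) -> extScal F (Ui t)) : is_alg_hom u ->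
    (forall i, u (ext_in F (Ui_B t i)) = ext_in F (Ui_B t i)) ->
    (forall i, u (ext_in F (Ui_k t i)) = ext_in F (Ui_k t i)) ->
    (forall i, u (ext_in F (Ui_kV t i)) = ext_in F (Ui_kV t i)) -> u =1 id.
  move=> uh ub uk ukV; apply: ext_hom_eq => //.
  apply: (@Ui_hom_eq P t (restr (extScal F (Ui t))) (u \o @ext_in Qv F (Ui t)) (@ext_in Qv F (Ui t))) => //.
    exact: is_alg_hom_comp (ext_in_hom F (Ui t)) (restr_hom uh).
  exact: ext_in_hom.
have fK : cancel f g.
  apply: K => [|i|i|i] /=; first exact: is_alg_hom_comp fh gh.
  - by rewrite fb (homZ gh) gb scalerA divff // scale1r.
  - by rewrite fk gk.
  - by rewrite fkV gkV.
have gK : cancel g f.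
  apply: K => [|i|i|i] /=; first exact: is_alg_hom_comp gh fh.
  - by rewrite gb (homZ fh) fb scalerA mulVf // scale1r.
  - by rewrite gk fk.
  - by rewrite gkV fkV.
by exists (AlgIso fh fK gK).
Qed.
End PhiU.

Section Conjugation.
Variables (K : pzRingType) (A B : algType K) (phi : algIso A B).

Lemma alg_iso_inv_hom : is_alg_hom (iso_inv phi).
Proof.
case: (iso_hom phi) => [fl f1 fM].
by split=> [k x y||x y]; apply: (can_inj (iso_funK phi)); rewrite ?fl ?f1 ?fM !iso_invK.
Qed.

Fact conj_hom (g : algAut A) : is_alg_hom (fun y => phi (g (iso_inv phi y))).
Proof.
case: (iso_hom phi) (iso_hom g) alg_iso_inv_hom => [fl f1 fM] [gl g1 gM] [hl h1 hM].
by split=> [k x y||x y]; rewrite ?hl ?gl ?fl ?h1 ?g1 ?f1 ?hM ?gM ?fM.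
Qed.
Fact conj_funK (g : algAut A) : cancel (fun y => phi (g (iso_inv phi y))) (fun y => phi (iso_inv g (iso_inv phi y))).
Proof. by move=> y; rewrite !iso_funK iso_invK. Qed.
Fact conj_invK (g : algAut A) : cancel (fun y => phi (iso_inv g (iso_inv phi y))) (fun y => phi (g (iso_inv phi y))).
Proof. by move=> y; rewrite iso_funK !iso_invK. Qed.
Definition conj_aut (g : algAut A) : algAut B := AlgIso (conj_hom g) (conj_funK g) (conj_invK g).
End Conjugation.

Theorem theoremC (P : iquiver) (It : {set vert P})
    (P_dynkin : dynkin P) (It_reps : orbit_reps It) :
  (exists Phi : {multiplicative Br It -> algAut (Uti P)},
     forall i : {i : vert P | i \in It}, is_T (val i) (Phi (braid_gen i)))
  /\
  (forall vs : vert P -> Qv,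
     (forall i, vs i != 0) -> (forall i, vs (tau i) = vs i) ->
   forall (F : fieldExtType Qv) (a : vert P -> F),
     (forall i, a i ^+ 2 = (vs_diamond i / vs i)%:A) ->
     (forall i, a (tau i) = a i) ->
     <<1 & codom a>>%VS = {:F}%VS ->
   exists Psi : {multiplicative Br It -> algAut (extScal F (Ui vs))},
     forall i : {i : vert P | i \in It},
       is_T_param a (val i) (Psi (braid_gen i))).
Proof.
have Pg := good_orbit_reps P_dynkin It_reps; split.
  have T i := cid (Uti_T Pg i).
  have [Phi PhiE] := braid_group_action P_dynkin It_reps qv0 qv2 qv1 (Uti_data Pg) (@Uti_hom_eq P)
    (fun i => svalP (T i)).
  by exists Phi => i; rewrite PhiE; apply: lifts_is_T => //; exact: svalP (T _).
move=> vs vs0 vs_tau F a a2 a_tau _.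
have T i := cid (Ui_diamond_T Pg i).
have [Phi PhiE] := braid_group_action P_dynkin It_reps qv0 qv2 qv1 (Ui_diamond_data Pg)
  (@Ui_diamond_hom_eq P) (fun i => svalP (T i)).
have [phi phiE] := rescale_iso Pg vs_tau (@vs_diamond_tau P) vs0 (@vs_diamond_neq0 P) a_tau a2.
pose E (g : algAut (Ui (@vs_diamond P))) := sval (cid (ext_aut F g)).
have EE (g : algAut (Ui (@vs_diamond P))) x : E g (ext_in F x) = ext_in F (g x) := svalP (cid (ext_aut F g)) x.
pose psi x := conj_aut phi (E (Phi x)).
have psiM : {morph psi : x y / (x * y)%g}.
  move=> x y; apply: algIso_eq => u /=; rewrite iso_funK; congr (phi _).
  move: (iso_inv phi u) => {}u; apply: (@ext_hom_eq Qv F _ _ (E (Phi (x * y)%g)) (E (Phi x) \o E (Phi y))) => [||w].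
  - exact: iso_hom.
  - exact: is_alg_hom_comp (iso_hom _) (iso_hom _).
  - by rewrite /= !EE gmulfM.
exists (HB.pack_for {multiplicative Br It -> algAut (extScal F (Ui vs))} psi
  (isMultiplicative.Build _ _ psi psiM)) => i.
exists (Phi (braid_gen i)), (E (Phi (braid_gen i))), phi; split=> //.
by rewrite PhiE; apply: lifts_is_T_diamond => //; exact: svalP (T _).
Qed.
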